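(* Let $M$ be a smooth paracompact finite-dimensional manifold with Poisson bivector field $\alpha$ and let $\mathcal{G}=\mathcal{C}/H$ be the phase space of the associated Poisson sigma model, with the maps $j:M\to\mathcal{G}$, $l,r:\mathcal{G}\to M$, the composition law $\bullet$ (defined for $g,h\in\mathcal{G}$ with $r(g)=l(h)$) and the map $g\mapsto g^{-1}$ described in the context. Then $\mathcal{G}$ is a groupoid, i.e., with $\mathcal{G}_{x,y}=l^{-1}(x)\cap r^{-1}(y)$: (i) $l\circ j=r\circ j=\mathrm{id}_M$. (ii) If $g\in\mathcal{G}_{x,y}$ and $h\in\mathcal{G}_{y,z}$, then $g\bullet h\in\mathcal{G}_{x,z}$. (iii) $j(x)\bullet g=g\bullet j(y)=g$ if $g\in\mathcal{G}_{x,y}$. (iv) To each $g\in\mathcal{G}_{x,y}$ there exists an inverse $g^{-1}\in\mathcal{G}_{y,x}$ such that $g\bullet g^{-1}=j(x)$. (v) $(g\bullet h)\bullet k=g\bullet(h\bullet k)$ whenever defined.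
   Context: Setting. A Poisson structure on $M$ is a bivector field $\alpha$ such that $\{f,g\}=\alpha(\mathrm{d}f,\mathrm{d}g)$ is a Lie bracket on $C^\infty(M)$. In local coordinates $\alpha=\frac12\alpha^{ij}\partial_i\wedge\partial_j$, and $\alpha(x)$ is also viewed as the linear map $T^*_xM\to T_xM$, $(\alpha\beta)^i=\alpha^{ij}\beta_j$. Let $I=[0,1]$. $\mathcal{C}$ is the Banach manifold of pairs $(X,\eta)$, with $X\in C^1(I,M)$ and $\eta$ a continuous 1-form on $I$ with values in $X^*(T^*M)$, satisfying $\mathrm{d}X+\alpha(X)\eta=0$. Let $P_0\Omega^1(M)$ be the space of continuously differentiable maps $\beta:I\to\Omega^1(M)$ with $\beta(0)=\beta(1)=0$. Each such $\beta$ defines a vector field $\xi_\beta$ on $\mathcal{C}$, in local coordinates (with $\beta_i=\beta_i(X(u),u)$) $$\xi_\beta X^i=-\alpha^{ij}(X)\beta_j,\qquad \xi_\beta\eta_i=\mathrm{d}_u\beta_i+\partial_i\alpha^{jk}(X)\eta_j\beta_k .$$ $H$ is the group generated by the flows of the $\xi_\beta$; two points of $\mathcal{C}$ are in the same $H$-orbit iff they are connected by a finite composition of such flows (where defined). $\mathcal{G}=\mathcal{C}/H$ is the set of orbits. Structure maps: $j(x)$ is the class of the constant solution $X(u)=x$, $\eta=0$; $l([(X,\eta)])=X(0)$, $r([(X,\eta)])=X(1)$. Composition: every class in $\mathcal{G}$ has a representative with $\eta(0)=\eta(1)=0$. If $X_1(1)=X_2(0)$, choose such representatives $(X_1,\eta_1)$,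 $(X_2,\eta_2)$, write $\eta_i(u)=\eta_{iu}(u)\,\mathrm{d}u$, and set $[(X_1,\eta_1)]\bullet[(X_2,\eta_2)]=[(X,\eta)]$, where $X(u)=X_1(2u)$, $\eta(u)=2\eta_{1u}(2u)\,\mathrm{d}u$ for $0\le u\le\frac12$ and $X(u)=X_2(2u-1)$, $\eta(u)=2\eta_{2u}(2u-1)\,\mathrm{d}u$ for $\frac12\le u\le1$. This is independent of the choice of such representatives. Inverse: $[(X,\eta)]^{-1}=[(X\circ\theta,\theta^*\eta)]$ with $\theta(u)=1-u$. *)

(* Defs.v *)
From HB Require Import structures.
From Stdlib Require Import Relation_Operators ClassicalEpsilon.
From mathcomp Require Import all_boot all_order all_algebra.
From mathcomp Require Import all_classical all_reals all_analysis.
Set Implicit Arguments.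
Unset Strict Implicit.
Unset Printing Implicit Defensive.
Import Order.TTheory GRing.Theory Num.Theory numFieldNormedType.Exports.
Local Open Scope classical_set_scope.
Local Open Scope ring_scope.

Section EuclideanCalculus.
Context {R : realType} {n : nat} {W : normedModType R}.

Definition stdvec (i : 'I_n) : 'rV[R]_n := delta_mx 0 i.

Definition dpart (s : seq 'I_n) (f : 'rV[R]_n -> W) : 'rV[R]_n -> W :=
  foldr (fun i g => 'D_(stdvec i) g) f s.

Definition smooth_on (U : set 'rV[R]_n) (f : 'rV[R]_n -> W) : Prop :=
  forall s x, U x ->
    {for x, continuous (dpart s f)} /\
    forall i, derivable (dpart s f) x (stdvec i).

End EuclideanCalculus.

Section OneVariable.
Context {R : realType}.

(** Nonzero increments staying in [D], so that derivatives are one-sided at the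
    ends of an interval. *)
Definition increments (D : set R) (u : R) : set_system R :=
  within [set h | D (u + h)] 0^'.

Definition diffq {W : normedModType R} (f : R -> W) (u h : R) : W :=
  h^-1 *: (f (u + h) - f u).

Definition I01 : set R := [set u | 0 <= u <= 1].

Definition derivableI {W : normedModType R} (f : R -> W) (u : R) : Prop :=
  cvg (diffq f u @ increments I01 u).

Definition dI {W : normedModType R} (f : R -> W) (u : R) : W :=
  lim (diffq f u @ increments I01 u).

Definition clamp (u : R) : R := Num.max 0 (Num.min 1 u).

End OneVariable.

Definition locally_finite_family {T : topologicalType} (V : set (set T)) :=
  forall x : T, exists2 N : set T, nbhs x N &
    finite_set (V `&` [set B | B `&` N !=set0]).

Definition open_cover {T : topologicalType} (V : set (set T)) :=
  (forall B, V B -> open B) /\ (forall x : T, exists2 B, V B & B x).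

Definition paracompact (T : topologicalType) :=
  forall U : set (set T), open_cover U ->
  exists V : set (set T),
    [/\ open_cover V, locally_finite_family V &
        forall B, V B -> exists2 A, U A & B `<=` A].

(** [chart] indexes an arbitrary (not necessarily maximal) atlas; [chart_inv a] is
    the inverse of the chart map [chart_map a] and is irrelevant off its image. *)
Record manifold (R : realType) (n : nat) := Manifold {
  carrier :> topologicalType;
  chart : Type;
  dom : chart -> set carrier;
  chart_map : chart -> carrier -> 'rV[R]_n;
  chart_inv : chart -> 'rV[R]_n -> carrier;
  dom_open : forall a, open (dom a);
  img_open : forall a, open (chart_map a @` dom a);
  coordK : forall a x, dom a x -> chart_inv a (chart_map a x) = x;
  coord_continuous : forall a, {within dom a, continuous (chart_map a)};
  point_continuous : forall a,
    {within chart_map a @` dom a, continuous (chart_inv a)};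
  charts_cover : forall x, exists a, dom a x;
  transition_smooth : forall a b,
    smooth_on (chart_map a @` (dom a `&` dom b)) (chart_map b \o chart_inv a);
  manifold_hausdorff : hausdorff_space carrier;
  manifold_paracompact : paracompact carrier }.

Section TensorFields.
Context {R : realType} {n : nat} (M : manifold R n).
Implicit Types (a b : chart M) (x : M).

Definition chart_image a : set 'rV[R]_n := chart_map a @` dom a.

(** [transJ a b x i j] is the partial derivative of the [j]-th [b]-coordinate
    with respect to the [i]-th [a]-coordinate, at [x]. *)
Definition transJ a b x : 'M[R]_n := 'J (chart_map b \o chart_inv a) (chart_map a x).

Definition smooth_fun (f : M -> R) : Prop :=
  forall a, smooth_on (chart_image a) (f \o chart_inv a : 'rV[R]_n -> R^o).

(** A cotangent vector at [x] is given by its components in all the charts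
    around [x].  Components in the other charts are set to [0], so that equality
    of families of components is equality of cotangent vectors. *)
Definition covector x (w : chart M -> 'rV[R]_n) : Prop :=
  (forall a, ~ dom a x -> w a = 0) /\
  (forall a b, dom a x -> dom b x -> w a = w b *m (transJ a b x)^T).

Definition field_of_comps : Type := M -> chart M -> 'rV[R]_n.

Definition one_form (w : field_of_comps) : Prop :=
  (forall x, covector x (w x)) /\
  (forall a, smooth_on (chart_image a) (fun y => w (chart_inv a y) a)).

(** The components [alpha^{ij}] of an element of the second exterior power of
    the tangent space at [x]. *)
Definition bivector x (w : chart M -> 'M[R]_n) : Prop :=
  (forall a, dom a x -> (w a)^T = - w a) /\
  (forall a b, dom a x -> dom b x ->
     w b = (transJ a b x)^T *m w a *m transJ a b x).

Definition bivector_field (alpha : M -> chart M -> 'M[R]_n) : Prop :=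
  (forall x, bivector x (alpha x)) /\
  (forall a, smooth_on (chart_image a) (fun y => alpha (chart_inv a y) a)).

Definition chart_at x : chart M := projT1 (cid (charts_cover x)).

(** [alpha(df, dg) = alpha^{ij} d_i f d_j g], computed in a chart around [x]. *)
Definition bracket (alpha : M -> chart M -> 'M[R]_n) (f g : M -> R) : M -> R :=
  fun x => let a := chart_at x in
  \sum_(i < n) \sum_(j < n) alpha x a i j
     * ('D_(stdvec i) (f \o chart_inv a : 'rV[R]_n -> R^o) (chart_map a x))
     * ('D_(stdvec j) (g \o chart_inv a : 'rV[R]_n -> R^o) (chart_map a x)).

Definition lie_bracket (br : (M -> R) -> (M -> R) -> M -> R) : Prop :=
  [/\ forall f g, smooth_fun f -> smooth_fun g -> smooth_fun (br f g),
      forall (c : R) f g h, smooth_fun f -> smooth_fun g -> smooth_fun h ->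
        forall x, br (fun y => c * f y + g y) h x = c * br f h x + br g h x,
      forall f g, smooth_fun f -> smooth_fun g ->
        forall x, br f g x = - br g f x &
      forall f g h, smooth_fun f -> smooth_fun g -> smooth_fun h ->
        forall x, br f (br g h) x + br g (br h f) x + br h (br f g) x = 0].

(** Convergence in the Frechet space of smooth 1-forms: locally uniform
    convergence, in charts, of all the partial derivatives. *)
Definition cvg_form (F : set_system R) (w : R -> field_of_comps)
    (l : field_of_comps) : Prop :=
  forall a (K : set 'rV[R]_n) (s : seq 'I_n) (e : R),
    compact K -> K `<=` chart_image a -> 0 < e ->
    \forall h \near F, forall y, K y ->
      `|dpart s (fun z => w h (chart_inv a z) a - l (chart_inv a z) a) y| < e.

Definition C1_forms (beta : R -> field_of_comps) : Prop :=
  (forall u, I01 u -> one_form (beta u)) /\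
  exists beta' : R -> field_of_comps, forall u, I01 u ->
    [/\ one_form (beta' u),
        cvg_form (increments I01 u)
          (fun h x a => diffq (fun v => beta v x a) u h) (beta' u) &
        cvg_form (increments I01 u) (fun h => beta' (u + h)) (beta' u)].

Definition P0_forms (beta : R -> field_of_comps) : Prop :=
  C1_forms beta /\
  forall x a, beta 0 x a = 0 /\ beta 1 x a = 0.

End TensorFields.

Record poisson (R : realType) (n : nat) (M : manifold R n) := Poisson {
  bivec :> M -> chart M -> 'M[R]_n;
  bivec_field : bivector_field bivec;
  bivec_poisson : lie_bracket (bracket bivec) }.

(** [eta c u] is the du-component, a cotangent vector at [Xp c u], of the 1-form
    at [u].  Paths are functions of a real variable which are constant on both
    sides of [0,1] (see [constraint]). *)
Record config (R : realType) (n : nat) (M : manifold R n) := Config {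
  Xp : R -> M;
  eta : R -> chart M -> 'rV[R]_n }.

Section PhaseSpace.
Context {R : realType} {n : nat} {M : manifold R n} (alpha : poisson M).
Implicit Types (c : config M) (a : chart M) (beta : R -> field_of_comps M).

Definition Xcoord c a (u : R) : 'rV[R]_n := chart_map a (Xp c u).

Definition times_in c a : set R := I01 `&` [set u | dom a (Xp c u)].

Definition C1_path c : Prop :=
  {within I01, continuous (Xp c)} /\
  forall a, (forall u, times_in c a u -> derivableI (Xcoord c a) u) /\
            {within times_in c a, continuous (dI (Xcoord c a))}.

Definition continuous_form c : Prop :=
  (forall u, I01 u -> covector (Xp c u) (eta c u)) /\
  forall a, {within times_in c a, continuous (fun u => eta c u a)}.

(** The linear map [(alpha b)^i = alpha^{ij} b_j] in row-vector form. *)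
Definition sharp (x : M) a (b : 'rV[R]_n) : 'rV[R]_n := b *m (alpha x a)^T.

Definition constraint : set (config M) := [set c |
  [/\ forall u, Xp c u = Xp c (clamp u) /\ eta c u = eta c (clamp u),
      C1_path c, continuous_form c &
      forall a u, times_in c a u ->
        dI (Xcoord c a) u + sharp (Xp c u) a (eta c u a) = 0]].

Definition xi_X beta c a (u : R) : 'rV[R]_n :=
  - sharp (Xp c u) a (beta u (Xp c u) a).

(** [dI] differentiates [u |-> beta_i(X(u),u)] totally, i.e. also through X. *)
Definition xi_eta beta c a (u : R) : 'rV[R]_n :=
  dI (fun v => beta v (Xp c v) a) u +
  \row_i \sum_(j < n) \sum_(k < n)
     'D_(stdvec i) (fun y => alpha (chart_inv a y) a j k : R^o) (chart_map a (Xp c u))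
     * eta c u a 0 j * beta u (Xp c u) a 0 k.

(** [gamma : J -> constraint] has velocity [xi_beta] at [s].  The local model of
    the Banach manifold of pairs [(X, eta)], for a chart [a] and a subinterval
    [[p, q]] mapped by [X] into [dom a], is C^1([p,q],R^n) x C^0([p,q],R^n); the
    three estimates are convergence of difference quotients in its norm. *)
Definition has_velocity beta (J : set R) (gamma : R -> config M) (s : R) :=
  let c := gamma s in
  forall a (p q e : R), 0 <= p -> p <= q -> q <= 1 -> 0 < e ->
  (forall u, p <= u <= q -> dom a (Xp c u)) ->
  \forall h \near increments J s, forall u, p <= u <= q ->
    [/\ dom a (Xp (gamma (s + h)) u),
        `|diffq (fun t => Xcoord (gamma t) a u) s h - xi_X beta c a u| < e,
        `|diffq (fun t => dI (Xcoord (gamma t) a) u) s h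
            - dI (xi_X beta c a) u| < e &
        `|diffq (fun t => eta (gamma t) u a) s h - xi_eta beta c a u| < e].

Definition integral_curve beta (J : set R) (gamma : R -> config M) : Prop :=
  forall s, J s -> constraint (gamma s) /\ has_velocity beta J gamma s.

(** [c'] is the image of [c] under the time-[t] flow of some [xi_beta]. *)
Definition flow_step c c' : Prop :=
  exists beta (t : R) (gamma : R -> config M),
    [/\ P0_forms beta,
        integral_curve beta [set s | Num.min 0 t <= s <= Num.max 0 t] gamma,
        gamma 0 = c & gamma t = c'].

Definition H_orbit c : set (config M) := [set c' |
  clos_refl_trans (config M) flow_step c c'].

(** The phase space G = C/H, as the set of orbits. *)
Record phase_space := PhaseSpace {
  members : set (config M);
  membersP : exists2 c, constraint c & members = H_orbit c }.
Implicit Types g h k : phase_space.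

Definition representative g : config M := s2val (cid2 (membersP g)).

Definition lmap g : M := Xp (representative g) 0.
Definition rmap g : M := Xp (representative g) 1.

Definition const_config (x : M) : config M :=
  Config (fun=> x) (fun _ _ => 0).

Definition concat c1 c2 : config M :=
  Config
    (fun u => if u <= 2^-1 then Xp c1 (2 * u) else Xp c2 (2 * u - 1))
    (fun u a => if u <= 2^-1 then 2 *: eta c1 (2 * u) a
                else 2 *: eta c2 (2 * u - 1) a).

(** Pull-back by [u |-> 1 - u]; the sign is the derivative of that map. *)
Definition reverse c : config M :=
  Config (fun u => Xp c (1 - u)) (fun u a => - eta c (1 - u) a).

Definition vanishes_at_ends c : Prop :=
  forall a, eta c 0 a = 0 /\ eta c 1 a = 0.

(** Some representatives of [g] and [h] as required concatenate to an element
    of [k]. *)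
Definition is_composite g h k : Prop :=
  exists c1 c2, [/\ members g c1, members h c2,
    vanishes_at_ends c1 /\ vanishes_at_ends c2, Xp c1 1 = Xp c2 0
    & members k (concat c1 c2)].

Definition is_inverse g k : Prop :=
  exists2 c, members g c & members k (reverse c).

(** [gcomp g h] is the class of the concatenation of some representatives chosen
    as required; it is unspecified for pairs [g], [h] which have none. *)
Definition gcomp g h : phase_space := epsilon (inhabits g) (is_composite g h).

Definition ginv g : phase_space := epsilon (inhabits g) (is_inverse g).

Definition arrows (x y : M) : set phase_space :=
  lmap @^-1` [set x] `&` rmap @^-1` [set y].

End PhaseSpace.

Section ConstantSolutions.
Context {R : realType} {n : nat} {M : manifold R n} (alpha : poisson M).

Lemma increments_proper (u : R) : I01 u -> ProperFilter (increments I01 u).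
Proof.
move=> /andP[u0 u1]; apply: Build_ProperFilter_ex => A.
rewrite /increments /within /= => /nbhs_ballP[e /= e0 eA].
have [u2|u2] := ltP u 2^-1.
- pose h := Num.min (e / 2) 2^-1.
  have h0 : 0 < h by rewrite /h lt_min invr_gt0 ltr0n divr_gt0.
  exists h; apply: eA; last 2 first.
  + exact: lt0r_neq0.
  + apply/andP; split; first by rewrite addr_ge0 // ltW.
    rewrite [leRHS](splitr 1) lerD //; first by rewrite div1r ltW.
    by rewrite div1r /h ge_min lexx orbT.
  + rewrite /ball /= sub0r normrN gtr0_norm // /h.
    by rewrite gt_min gtr_pMr // invf_lt1 ?ltr1n.
- pose h := Num.min (e / 2) 2^-1.
  have h0 : 0 < h by rewrite /h lt_min invr_gt0 ltr0n divr_gt0.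
  exists (- h); apply: eA; last 2 first.
  + by rewrite oppr_eq0; exact: lt0r_neq0.
  + apply/andP; split.
      by rewrite subr_ge0 (le_trans _ u2) // /h ge_min lexx orbT.
    by rewrite (le_trans _ u1) // gerBl ltW.
  + rewrite /ball /= sub0r normrN normrN gtr0_norm // /h.
    by rewrite gt_min gtr_pMr // invf_lt1 ?ltr1n.
Qed.

Lemma diffq_cst {W : normedModType R} (w : W) (u : R) :
  I01 u -> diffq (fun=> w) u @ increments I01 u --> (0 : W).
Proof.
move=> Iu; have PF := increments_proper Iu.
have -> : diffq (fun=> w) u = fun=> 0.
  by apply/funext => h; rewrite /diffq subrr scaler0.
exact: cvg_cst.
Qed.

Lemma dI_cst {W : normedModType R} (w : W) (u : R) :
  I01 u -> dI (fun=> w) u = 0.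
Proof.
move=> Iu; have PF := increments_proper Iu.
by apply: cvg_lim; [exact: norm_hausdorff | exact: diffq_cst].
Qed.

Lemma constraint_cst (x : M) : constraint alpha (const_config x).
Proof.
split => //.
- split; first by move=> u; exact: cst_continuous.
  move=> a; split=> [u [Iu _]|].
    by apply: (cvgP (0 : 'rV[R]_n)); exact: (diffq_cst (chart_map a x) Iu).
  apply: (@subspace_eq_continuous _ _ _ (fun=> 0)).
    by move=> u; rewrite inE => -[Iu _]; rewrite [RHS](dI_cst (chart_map a x) Iu).
  by move=> u; exact: cst_continuous.
- split; last by move=> a u; exact: cst_continuous.
  by move=> u Iu; split => // a b _ _; rewrite mul0mx.
- move=> a u [Iu _]; rewrite /sharp mul0mx addr0; exact: (dI_cst (chart_map a x) Iu).
Qed.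

Definition class_of (c : config M) (hc : constraint alpha c) :
    phase_space alpha :=
  PhaseSpace (ex_intro2 _ (fun c' => H_orbit alpha c = H_orbit alpha c')
    c hc erefl).

Definition jmap (x : M) : phase_space alpha := class_of (constraint_cst x).

End ConstantSolutions.

(* Main.v *)
(** The groupoid laws follow from one fact: if [c] is in [C] and [p, q : I -> I] are
    C^1 with the same end points, the pull-backs of [c] by [p] and [q] are in the
    same [H]-orbit. Both sides of the unit, inverse and associativity laws are, up
    to orbits, pull-backs of one and the same path; for [g g^-1] the map [p] runs
    from 0 to 1 and back to 0, and [q = 0].

    When [p] and [q] are close to a point [t0], everything happens in one chart.
    There a contraction argument gives a C^1 map [B] into the constant 1-forms,
    with [B(t0) = 0], such that the time-1 flow of [B(t)], started at
    [(X(t0), 0)] with inhomogeneous term [B'(t)] for [eta], ends at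
    [(X(t), eta(t))]: only [eta] is prescribed, and [X] follows from the constraint,
    which the flow preserves by the Jacobi identity. The cut-off form [-B(p(u))]
    then retracts the pull-back by [p] to a constant path and [B(q(u))] expands it
    to the pull-back by [q]. The general case is a chain of such local moves along
    the segments joining [p] to [q]. *)
From Stdlib Require Import Relation_Operators ClassicalEpsilon.
From mathcomp Require Import all_boot all_order all_algebra.
From mathcomp Require Import all_classical all_reals all_analysis.
From mathcomp Require Import ring lra.
Require Import Defs.
Set Implicit Arguments.
Unset Strict Implicit.
Unset Printing Implicit Defensive.
Import Order.TTheory GRing.Theory Num.Theory numFieldNormedType.Exports.
Local Open Scope classical_set_scope.
Local Open Scope ring_scope.

(** * Derivatives within a set and differential equations *)

(** Where a form has constant components in one chart, its flow at a path parameter [u] involves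
    only [b(u)], [b'(u)], [X(u)] and [eta(u)]: the flow on the infinite-dimensional space splits
    into one finite-dimensional ODE in the flow time for each [u]. These ODEs are scaled to run over
    [0,1] with Lipschitz constant at most 1/2, so a single contraction and a Gronwall bound without
    exponentials suffice. What remains is regularity in [u], proved by hand from a second-order
    Taylor estimate. The obstacle is that velocities are defined through all charts and all
    subintervals, whereas the construction knows one chart. The components of [xi_eta] do not
    transform linearly; the second derivatives of the transition maps that appear have to be
    computed and cancelled. The cut-off in [u] does no harm where it takes intermediate values:
    there the two parametrizations agree, the two flows use opposite forms, and the second undoes
    the first. *)

Section DerivIn.
Context {R : realType}.

(** Multiplied-out form of differentiability within [D]: no quotient, hence no exclusion of [v = u],
    and the choice of [D] covers one-sided derivatives at the ends of an interval. *)
Definition deriv_in {W : normedModType R} (D : set R) (f : R -> W) (u : R) (l : W) :=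
  forall e : R, 0 < e -> exists2 d : R, 0 < d &
    forall v, D v -> `|v - u| < d -> `|f v - f u - (v - u) *: l| <= e * `|v - u|.

Definition cont_in {W : normedModType R} (D : set R) (f : R -> W) (u : R) :=
  forall e : R, 0 < e -> exists2 d : R, 0 < d &
    forall v, D v -> `|v - u| < d -> `|f v - f u| <= e.

Section Generic.
Context {W : normedModType R}.
Implicit Types (D E : set R) (f g : R -> W) (u : R) (l m : W).

Lemma deriv_inS D E f u l : D `<=` E -> deriv_in E f u l -> deriv_in D f u l.
Proof.
move=> DE H e e0; have [d d0 dP] := H e e0; exists d => // v Dv; apply: dP.
exact: DE.
Qed.

Lemma deriv_inU D E f u l :
  deriv_in D f u l -> deriv_in E f u l -> deriv_in (D `|` E) f u l.
Proof.
move=> H1 H2 e e0; have [d d0 dP] := H1 e e0; have [d' d'0 d'P] := H2 e e0.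
exists (Num.min d d'); first by rewrite lt_min d0.
by move=> v [Dv|Ev]; rewrite lt_min => /andP[? ?]; [apply: dP|apply: d'P].
Qed.

Lemma deriv_in_near D f g u l : (exists2 d : R, 0 < d &
    forall v, D v -> `|v - u| < d -> f v = g v) -> f u = g u ->
  deriv_in D g u l -> deriv_in D f u l.
Proof.
move=> [d' d'0 d'P] fgu H e e0; have [d d0 dP] := H e e0.
exists (Num.min d d'); first by rewrite lt_min d0.
by move=> v Dv; rewrite lt_min => /andP[? ?]; rewrite d'P // fgu; exact: dP.
Qed.

Lemma deriv_in_ext D f g u l : (forall v, D v -> f v = g v) -> D u ->
  deriv_in D g u l -> deriv_in D f u l.
Proof.
move=> fg Du; apply: deriv_in_near; last exact: fg.
by exists 1 => // v Dv _; exact: fg.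
Qed.

Lemma deriv_in_lip D f u l : deriv_in D f u l -> exists2 d : R, 0 < d &
  forall v, D v -> `|v - u| < d -> `|f v - f u| <= (`|l| + 1) * `|v - u|.
Proof.
move=> /(_ 1 ltr01)[d d0 dP]; exists d => // v Dv vd.
rewrite -(subrK ((v - u) *: l) (f v - f u)) (le_trans (ler_normD _ _)) //.
by rewrite mulrDl addrC lerD ?dP // normrZ mulrC.
Qed.

Lemma deriv_in_cont D f u l : deriv_in D f u l -> cont_in D f u.
Proof.
move=> /deriv_in_lip[d d0 dP] e e0.
have l0 : 0 < `|l| + 1 by rewrite ltr_wpDl.
exists (Num.min d (e / (`|l| + 1))); first by rewrite lt_min d0 divr_gt0.
move=> v Dv; rewrite lt_min => /andP[vd ve]; rewrite (le_trans (dP _ Dv vd)) //.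
by rewrite mulrC -ler_pdivlMr // ltW.
Qed.

Lemma deriv_in_cst D (w : W) u : deriv_in D (fun=> w) u 0.
Proof.
by move=> e e0; exists 1 => // v _ _; rewrite subrr sub0r scaler0 oppr0 normr0 mulr_ge0 // ltW.
Qed.

Lemma deriv_inD D f g u l m : deriv_in D f u l -> deriv_in D g u m ->
  deriv_in D (fun v => f v + g v) u (l + m).
Proof.
move=> H1 H2 e e0; have e20 : 0 < e / 2 by rewrite divr_gt0.
have [d d0 dP] := H1 _ e20; have [d' d'0 d'P] := H2 _ e20.
exists (Num.min d d'); first by rewrite lt_min d0.
move=> v Dv; rewrite lt_min => /andP[? ?].
have -> : f v + g v - (f u + g u) - (v - u) *: (l + m) =
  (f v - f u - (v - u) *: l) + (g v - g u - (v - u) *: m).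
  by rewrite scalerDr !opprD (addrACA (f v)) [LHS]addrACA.
rewrite (le_trans (ler_normD _ _)) // [e]splitr mulrDl lerD //.
- exact: dP.
- exact: d'P.
Qed.

Lemma deriv_inZ D (k : R) f u l : deriv_in D f u l ->
  deriv_in D (fun v => k *: f v) u (k *: l).
Proof.
move=> H e e0.
have k0 : 0 < `|k| + 1 by rewrite ltr_wpDl.
have [d d0 dP] := H (e / (`|k| + 1)) (divr_gt0 e0 k0).
exists d => // v Dv vd; rewrite scalerA mulrC -scalerA -!scalerBr normrZ.
rewrite (le_trans (ler_wpM2l _ (dP _ Dv vd))) // mulrA ler_wpM2r // mulrCA.
by rewrite ger_pMr // ler_pdivrMr // mul1r lerDl.
Qed.

Lemma deriv_inN D f u l : deriv_in D f u l -> deriv_in D (fun v => - f v) u (- l).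
Proof.
move=> /(deriv_inZ (-1)); rewrite scaleN1r; congr deriv_in.
by apply/funext => v; rewrite scaleN1r.
Qed.

Lemma deriv_inB D f g u l m : deriv_in D f u l -> deriv_in D g u m ->
  deriv_in D (fun v => f v - g v) u (l - m).
Proof. by move=> H1 /deriv_inN; exact: deriv_inD. Qed.

Lemma deriv_in_sum (I : Type) (r : seq I) (P : pred I) D (F : I -> R -> W) u (l : I -> W) :
  (forall i, P i -> deriv_in D (F i) u (l i)) ->
  deriv_in D (fun v => \sum_(i <- r | P i) F i v) u (\sum_(i <- r | P i) l i).
Proof.
move=> H; elim: r => [|i r IH].
  rewrite big_nil; under [X in deriv_in _ X]eq_fun do rewrite big_nil.
  exact: deriv_in_cst.
rewrite big_cons; under [X in deriv_in _ X]eq_fun do rewrite big_cons.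
by case: ifP => // Pi; apply: deriv_inD => //; exact: H.
Qed.

(** At such a point a derivative within [D] is determined by the function ([deriv_in_uniq]). *)
Definition clusters D u := forall d : R, 0 < d -> exists v, [/\ D v, v != u & `|v - u| < d].

Lemma deriv_in_uniq D f u l m : clusters D u ->
  deriv_in D f u l -> deriv_in D f u m -> l = m.
Proof.
move=> acc H1 H2; apply/eqP; rewrite -subr_eq0 -normr_eq0 eq_le normr_ge0 andbT.
apply/ler_addgt0Pr => e e0; rewrite add0r.
have e20 : 0 < e / 2 by rewrite divr_gt0.
have [d d0 dP] := H1 _ e20; have [d' d'0 d'P] := H2 _ e20.
have [|v [Dv vu]] := acc (Num.min d d'); first by rewrite lt_min d0.
rewrite lt_min => /andP[vd vd'].
have vu0 : 0 < `|v - u| by rewrite normr_gt0 subr_eq0.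
rewrite -(ler_pM2l vu0) -normrZ scalerBr.
have -> : (v - u) *: l - (v - u) *: m =
  (f v - f u - (v - u) *: m) - (f v - f u - (v - u) *: l).
  by rewrite opprB [RHS]addrC addrA subrK.
rewrite (le_trans (ler_normB _ _)) // [e]splitr mulrDr !(mulrC `|v - u|) lerD //.
- exact: d'P.
- exact: dP.
Qed.

End Generic.

Lemma deriv_in_comp {W : normedModType R} (D E : set R) (p : R -> R) (f : R -> W) u (m : R) l :
  (forall v, D v -> E (p v)) -> deriv_in D p u m -> deriv_in E f (p u) l ->
  deriv_in D (f \o p) u (m *: l).
Proof.
move=> DE Hp Hf e e0.
have m0 : 0 < `|m| + 1 by rewrite ltr_wpDl.
have l0 : 0 < `|l| + 1 by rewrite ltr_wpDl.
have e1 : 0 < e / 2 / (`|m| + 1) by rewrite !divr_gt0.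
have e2 : 0 < e / 2 / (`|l| + 1) by rewrite !divr_gt0.
have [d d0 dP] := Hf _ e1.
have [d1 d10 d1P] := deriv_in_lip Hp.
have [d2 d20 d2P] := Hp _ e2.
exists (Num.min (Num.min d1 d2) (d / (`|m| + 1))); first by rewrite !lt_min d10 d20 divr_gt0.
move=> v Dv; rewrite !lt_min -andbA => /and3P[v1 v2 v3] /=.
have pv := d1P _ Dv v1.
have pvd : `|p v - p u| < d.
  by rewrite (le_lt_trans pv) // mulrC -ltr_pdivlMr.
have -> : f (p v) - f (p u) - (v - u) *: (m *: l) =
  (f (p v) - f (p u) - (p v - p u) *: l) + (p v - p u - (v - u) * m) *: l.
  by rewrite [(_ - (v - u) * m) *: l]scalerBl scalerA addrA subrK.
rewrite (le_trans (ler_normD _ _)) // [e]splitr [leRHS]mulrDl lerD //.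
- rewrite (le_trans (dP _ (DE _ Dv) pvd)) //.
  rewrite (le_trans (ler_wpM2l (ltW e1) pv)) // mulrA ler_wpM2r //.
  by rewrite divfK // gt_eqF.
- rewrite normrZ (le_trans (ler_wpM2r _ (d2P _ Dv v2))) //.
  by rewrite mulrAC ler_wpM2r // mulrAC ler_pdivrMr // ler_pM2l ?divr_gt0 // lerDl.
Qed.

Lemma deriv_in_id (D : set R) u : deriv_in D (id : R -> R) u 1.
Proof.
by move=> e e0; exists 1 => // v _ _; rewrite scaler1 subrr normr0 mulr_ge0 // ltW.
Qed.

Lemma mx_entry_le m n (x : 'M[R]_(m, n)) i j : `|x i j| <= `|x|.
Proof.
rewrite [leRHS]/Num.Def.normr /= mx_normrE.
exact: (le_bigmax _ (fun ij : 'I_m * 'I_n => `|x ij.1 ij.2|) (i, j)).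
Qed.

Lemma mx_norm_le m n (x : 'M[R]_(m, n)) e : 0 <= e ->
  (forall i j, `|x i j| <= e) -> `|x| <= e.
Proof.
move=> e0 H; rewrite [leLHS]/Num.Def.normr /= mx_normrE.
by apply/bigmax_leP; split => // -[i j] _; exact: H.
Qed.

Lemma deriv_in_entry m n (D : set R) (f : R -> 'M[R]_(m, n)) u l i j :
  deriv_in D f u l -> deriv_in D (fun v => f v i j : R) u (l i j).
Proof.
move=> H e e0; have [d d0 dP] := H e e0; exists d => // v Dv vd.
have := mx_entry_le (f v - f u - (v - u) *: l) i j; rewrite !mxE => /le_trans; apply.
exact: dP.
Qed.

(** Stands for the argument of taking the smallest of the radii found for the single coordinates;
    [mono] is what makes the smallest one good for all. *)
Lemma finite_radius (I : finType) (P : I -> R -> Prop) :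
  (forall i d d', 0 < d' -> d' <= d -> P i d -> P i d') ->
  (forall i, exists2 d : R, 0 < d & P i d) -> exists2 d : R, 0 < d & forall i, P i d.
Proof.
move=> mono H; have /choice[d dP] : forall i, exists d, 0 < d /\ P i d.
  by move=> i; have [d ? ?] := H i; exists d.
exists (\big[Num.min/1]_i d i).
  by apply/bigmin_gtP; split => // i _; have [] := dP i.
move=> i; apply: (mono _ (d i)); last by have [] := dP i.
  by apply/bigmin_gtP; split => // k _; have [] := dP k.
exact: bigmin_le.
Qed.

Lemma deriv_in_mx m n (D : set R) (f : R -> 'M[R]_(m, n)) u (l : 'M[R]_(m, n)) :
  (forall i j, deriv_in D (fun v => f v i j : R) u (l i j)) -> deriv_in D f u l.
Proof.
move=> H e e0.
have [|d d0 dP] := @finite_radius ('I_m * 'I_n)%type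
  (fun ij d => forall v, D v -> `|v - u| < d ->
    `|f v ij.1 ij.2 - f u ij.1 ij.2 - (v - u) * l ij.1 ij.2| <= e * `|v - u|) _ (fun ij => H ij.1 ij.2 e e0).
  by move=> ij d d' d'0 dd' K v Dv vd; apply: K => //; exact: lt_le_trans dd'.
exists d => // v Dv vd; apply: mx_norm_le; first by rewrite mulr_ge0 // ltW.
by move=> i j; rewrite !mxE; exact: (dP (i, j)).
Qed.

Lemma deriv_in_scale {W : normedModType R} (D : set R) (k : R -> R) (f : R -> W) u (k' : R) l :
  deriv_in D k u k' -> deriv_in D f u l ->
  deriv_in D (fun v => k v *: f v) u (k' *: f u + k u *: l).
Proof.
move=> Hk Hf.
have H1 : deriv_in D (fun v => k v *: f u) u (k' *: f u).
  move=> e e0; have f0 : 0 < `|f u| + 1 by rewrite ltr_wpDl.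
  have [d d0 dP] := Hk _ (divr_gt0 e0 f0); exists d => // v Dv vd.
  rewrite scalerA -!scalerBl normrZ (le_trans (ler_wpM2r _ (dP _ Dv vd))) //.
  rewrite mulrAC ler_wpM2r // -mulrA ger_pMr // mulrC ler_pdivrMr // mul1r.
  by rewrite lerDl.
(* The remainder of the product rule: both factors are O(v - u), so their product is of second
   order. *)
have H2 : deriv_in D (fun v => (k v - k u) *: (f v - f u)) u 0.
  move=> e e0.
  have [d1 d10 d1P] := deriv_in_lip Hk.
  have [d2 d20 d2P] := deriv_in_lip Hf.
  have A0 : 0 < `|k'| + 1 by rewrite ltr_wpDl.
  have B0 : 0 < `|l| + 1 by rewrite ltr_wpDl.
  exists (Num.min (Num.min d1 d2) (e / ((`|k'| + 1) * (`|l| + 1)))).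
    by rewrite !lt_min d10 d20 divr_gt0 // mulr_gt0.
  move=> v Dv; rewrite !lt_min -andbA => /and3P[v1 v2 v3].
  rewrite !subrr !scaler0 !subr0 normrZ.
  rewrite (le_trans (ler_pM _ _ (d1P _ Dv v1) (d2P _ Dv v2))) // mulrACA mulrA.
  by rewrite ler_wpM2r // mulrC -ler_pdivlMr ?ltW // mulr_gt0.
have := deriv_inB (deriv_inD (deriv_inD H1 (deriv_inZ (k u) Hf)) H2) (@deriv_in_cst W D (k u *: f u) u).
rewrite addr0 subr0; congr deriv_in; apply/funext => v.
by rewrite scalerBl !scalerBr opprB addrACA !subrKC addrK.
Qed.

Lemma deriv_inM (D : set R) (f g : R -> R) u (f' g' : R) :
  deriv_in D f u f' -> deriv_in D g u g' ->
  deriv_in D (fun v => f v * g v) u (f' * g u + f u * g').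
Proof. exact: deriv_in_scale. Qed.

Lemma cont_inP {W : normedModType R} (D : set R) (f : R -> W) u :
  cont_in D f u <-> f @ within D (nbhs u) --> f u.
Proof.
split=> [H|/cvgrPdist_le H e e0].
  apply/cvgrPdist_le => e e0; have [d d0 dP] := H e e0.
  rewrite near_withinE; apply/nbhs_ballP; exists d => //= v.
  by rewrite /ball /= distrC => vd Dv; rewrite distrC; exact: dP.
have /nbhs_ballP[d /= d0 dP] := H e e0; exists d => // v Dv vd.
by rewrite distrC; apply: dP => //; rewrite /ball /= distrC.
Qed.

Lemma cont_in_within {W : normedModType R} (D : set R) (f : R -> W) :
  (forall u, D u -> cont_in D f u) <-> {within D, continuous f}.
Proof.
by rewrite subspace_continuousP; split=> H u Du; apply/cont_inP; exact: H.
Qed.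

Lemma deriv_in_is_derive (D : set R) (f : R -> R) u l :
  nbhs u D -> deriv_in D f u l -> is_derive u 1 f l.
Proof.
move=> uD H.
have Hl : (h^-1 *: (f (h *: 1 + u) - f u)) @[h --> 0^'] --> l.
  apply/cvgrPdist_le => e e0; have [d d0 dP] := H e e0.
  have /nbhs_ballP[d' /= d'0 d'D] := uD.
  rewrite near_withinE; apply/nbhs_ballP; exists (Num.min d d') => //=.
    by rewrite lt_min d0.
  move=> h; rewrite /ball /= sub0r normrN lt_min => /andP[hd hd'] h0.
  rewrite scaler1 [h + u]addrC.
  have Duh : D (u + h) by apply: d'D; rewrite /ball /= opprD addrA subrr sub0r normrN.
  have := dP (u + h) Duh; rewrite addrAC subrr add0r => /(_ hd) {}dP.
  have h1 : 0 < `|h| by rewrite normr_gt0.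
  rewrite -(ler_pM2l h1) (mulrC _ e) -normrZ scalerBr scalerA mulfV // scale1r.
  by rewrite distrC.
by apply: DeriveDef; [apply: (cvgP l)|apply: cvg_lim].
Qed.

Lemma mean_value_R (a b K : R) (f f' : R -> R) : a <= b ->
  (forall u, a <= u <= b -> deriv_in [set v | a <= v <= b] f u (f' u)) ->
  (forall u, a <= u <= b -> `|f' u| <= K) -> `|f b - f a| <= K * (b - a).
Proof.
move=> ab df fK.
have [c cab ->] : exists2 c, c \in `[a, b]%R & f b - f a = f' c * (b - a).
  apply: MVT_segment => //.
    move=> x; rewrite in_itv /= => /andP[ax xb].
    apply: (@deriv_in_is_derive [set v | a <= v <= b]).
      apply/nbhs_ballP; exists (Num.min (x - a) (b - x)).
        by rewrite /= lt_min !subr_gt0 ax.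
      move=> y; rewrite /ball /= lt_min => /andP[]; rewrite !ltr_norml => ? ?.
      by apply/andP; split; lra.
    by apply: df; rewrite !ltW.
  have -> : `[a, b]%classic = [set v | a <= v <= b].
    by apply/seteqP; split=> x /=; rewrite in_itv.
  by apply/cont_in_within => u /df; exact: deriv_in_cont.
rewrite normrM (@ger0_norm _ (b - a)) ?subr_ge0 // ler_wpM2r ?subr_ge0 //.
by apply: fK; move: cab; rewrite in_itv.
Qed.

Lemma mean_value m n (a b K : R) (f f' : R -> 'M[R]_(m, n)) : a <= b ->
  (forall u, a <= u <= b -> deriv_in [set v | a <= v <= b] f u (f' u)) ->
  (forall u, a <= u <= b -> `|f' u| <= K) -> `|f b - f a| <= K * (b - a).
Proof.
move=> ab df fK; apply: mx_norm_le.
  by rewrite mulr_ge0 ?subr_ge0 // (le_trans _ (fK a _)) // lexx.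
move=> i j; rewrite !mxE; apply: (@mean_value_R _ _ _ (fun u => f u i j) (fun u => f' u i j)) => //.
  by move=> u /df; exact: deriv_in_entry.
by move=> u /fK; apply: le_trans; exact: mx_entry_le.
Qed.

(** Bridge from the filter derivative of the definitions. That filter omits the increment 0, at
    which the estimate of [deriv_in] is trivial. *)
Lemma diffqP {W : normedModType R} (D : set R) (f : R -> W) u (l : W) :
  diffq f u @ increments D u --> l <-> deriv_in D f u l.
Proof.
split=> [/cvgrPdist_le H e e0|H].
  have := H e e0; rewrite /increments near_withinE => /nbhs_ballP[d /= d0 dP].
  exists d => // v Dv vd.
  have [->|vu] := eqVneq v u; first by rewrite !subrr scale0r subr0 !normr0 mulr0.
  have vu0 : v - u != 0 by rewrite subr_eq0.
  have := dP (v - u); rewrite /ball /= sub0r normrN => /(_ vd vu0).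
  rewrite subrKC /diffq => /(_ Dv) => {}dP.
  have -> : f v - f u - (v - u) *: l = (v - u) *: - (l - (v - u)^-1 *: (f (u + (v - u)) - f u)).
    by rewrite opprB scalerBr scalerA mulfV // scale1r subrKC.
  rewrite normrZ normrN mulrC ler_wpM2r //.
apply/cvgrPdist_le => e e0; have [d d0 dP] := H e e0.
rewrite /increments near_withinE; apply/nbhs_ballP; exists d => //= h.
rewrite /ball /= sub0r normrN => hd h0 Dh.
have := dP (u + h) Dh; rewrite addrAC subrr add0r => /(_ hd) {}dP.
have h1 : 0 < `|h| by rewrite normr_gt0.
rewrite -(ler_pM2l h1) (mulrC _ e) -normrZ /diffq scalerBr scalerA mulfV // scale1r.
by rewrite distrC.
Qed.

Lemma deriv_in_dI {W : normedModType R} (f : R -> W) u l : I01 u ->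
  deriv_in I01 f u l -> derivableI f u /\ dI f u = l.
Proof.
move=> Iu /diffqP H; have PF := increments_proper Iu.
by split; [apply: (cvgP l)|apply: cvg_lim; [exact: norm_hausdorff|]].
Qed.

Lemma derivableI_deriv_in {W : normedModType R} (f : R -> W) u :
  derivableI f u -> deriv_in I01 f u (dI f u).
Proof. by move=> H; apply/diffqP. Qed.

End DerivIn.

(** * Integration, contraction and the Picard theorem *)

Section Integration.
Context {R : realType}.

Lemma derive_deriv_in (D : set R) (f : R -> R) u :
  derivable f u 1 -> deriv_in D f u (derive1 f u).
Proof.
move=> /cvg_ex[l Hl] e e0; have lE : derive1 f u = l.
  by rewrite derive1E; apply: cvg_lim.
move/cvgrPdist_le : Hl => /(_ e e0); rewrite near_withinE => /nbhs_ballP[d /= d0 dP].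
exists d => // v Dv vd; rewrite lE.
have [->|vu] := eqVneq v u; first by rewrite !subrr scale0r subr0 !normr0 mulr0.
have vu0 : v - u != 0 by rewrite subr_eq0.
have := dP (v - u); rewrite /ball /= sub0r normrN => /(_ vd vu0).
rewrite scaler1 subrK => {}dP.
have -> : f v - f u - (v - u) *: l = (v - u) *: - (l - (v - u)^-1 *: (f v - f u)).
  by rewrite opprB scalerBr scalerA mulfV // scale1r.
by rewrite normrZ normrN mulrC ler_wpM2r.
Qed.

(** Two-sided derivatives are available only inside the interval of integration, so callers
    integrate over a larger interval than the one they work on. *)
Lemma antiderivative_R (f : R -> R) (a b : R) : continuous f ->
  exists P : R -> R, forall u, a < u < b -> deriv_in setT P u (f u).
Proof.
move=> cf; exists (fun x => (\int[lebesgue_measure]_(t in `[a, x]) f t)%R).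
move=> u /andP[au ub].
have intf : lebesgue_measure.-integrable `[a, b] (EFin \o f).
  apply: continuous_compact_integrable; first exact: segment_compact.
  exact: continuous_subspaceT.
have [dF <-] := continuous_FTC1_closed ub intf au (cf u).
exact: derive_deriv_in.
Qed.

Lemma antiderivative m n (f : R -> 'M[R]_(m, n)) (a b : R) : continuous f ->
  exists P : R -> 'M[R]_(m, n), forall u, a < u < b -> deriv_in setT P u (f u).
Proof.
move=> cf; have /choice[P HP] : forall ij : 'I_m * 'I_n, exists P : R -> R,
    forall u, a < u < b -> deriv_in setT P u (f u ij.1 ij.2).
  move=> ij; apply: antiderivative_R => u.
  apply/cvgrPdist_le => e e0; have /cvgrPdist_le /(_ e e0) := cf u.
  apply: filterS => v; apply: le_trans.
  by have := mx_entry_le (f u - f v) ij.1 ij.2; rewrite !mxE.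
exists (fun u => \matrix_(i, j) P (i, j) u) => u uab; apply: deriv_in_mx => i j.
under [X in deriv_in _ X]eq_fun do rewrite mxE.
exact: (HP (i, j)).
Qed.

End Integration.

Section FixedPoint.
Context {R : realType} {m0 n0 : nat}.
Local Notation W := 'M[R]_(m0, n0).

(** Banach's fixed point theorem for continuous functions within sup-distance [m] of [w0], with
    factor 1/2. Explicit bounds [d] replace the sup norm, so no function space is set up: the
    iterates are Cauchy at the rate [m / 2 ^+ k], uniformly in [t]. *)
Lemma contraction_fixpoint (K : (R -> W) -> R -> W) (w0 : R -> W) (m : R) :
  0 <= m -> continuous w0 ->
  (forall w : R -> W, continuous w -> (forall t, `|w t - w0 t| <= m) ->
    continuous (K w) /\ forall t, `|K w t - w0 t| <= m) ->
  (forall (w w' : R -> W) (d : R), continuous w -> continuous w' ->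
    (forall t, `|w t - w0 t| <= m) -> (forall t, `|w' t - w0 t| <= m) ->
    (forall t, `|w t - w' t| <= d) -> forall t, `|K w t - K w' t| <= d / 2) ->
  exists w : R -> W, [/\ continuous w, forall t, `|w t - w0 t| <= m & K w = w].
Proof.
move=> m_ge0 cw0 Kinv Kctr; pose v k := iter k K w0.
have vinv k : continuous (v k) /\ forall t, `|v k t - w0 t| <= m.
  elim: k => [|k [IH1 IH2]]; last exact: Kinv.
  by split=> // t; rewrite subrr normr0.
have vdist k j t : `|v (k + j)%N t - v k t| <= m / 2 ^+ k.
  elim: k t => [|k IH] t; first by rewrite expr0 divr1 add0n; apply: (vinv j).2.
  rewrite exprSr invfM mulrA addSn /=.
  by apply: Kctr IH t; apply: (vinv _).1 || apply: (vinv _).2.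
have small e : 0 < e -> exists k, m / 2 ^+ k < e.
  move=> e0.
  have [k kP] : exists k : nat, m / e < k%:R.
    by exists (Num.bound (m / e)); apply: archi_boundP; rewrite divr_ge0 // ltW.
  exists k; rewrite ltr_pdivrMr ?exprn_gt0 // mulrC -ltr_pdivrMr // (lt_trans kP) //.
  by rewrite -natrX ltr_nat ltn_expl.
have vcvg t : cvg (v k t @[k --> \oo]).
  apply/cauchy_cvgP/cauchy_exP => e e0; have [k kP] := small e e0.
  exists (v k t); exists k => // j /= kj.
  by rewrite -ball_normE /= distrC -(subnKC kj); apply: le_lt_trans kP.
pose w t := lim (v k t @[k --> \oo]).
have wv k t : `|w t - v k t| <= m / 2 ^+ k.
  have H : `|v j t - v k t| @[j --> \oo] --> `|w t - v k t|.
    by apply: cvg_norm; apply: cvgB; [exact: vcvg|exact: cvg_cst].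
  apply: (closed_cvg (fun x => x <= m / 2 ^+ k)) H; first exact: closed_le.
  by exists k => // j /= kj; rewrite -(subnKC kj).
have cw : continuous w.
  move=> t; apply/cvgrPdist_le => e e0.
  have e30 : 0 < e / 3 by rewrite divr_gt0.
  have [k kP] := small _ e30.
  have /cvgrPdist_le /(_ _ e30) := (vinv k).1 t.
  apply: filterS => s sP.
  have -> : w t - w s = (w t - v k t) + (v k t - v k s) - (w s - v k s).
    by rewrite opprB !subrKA.
  rewrite (le_trans (ler_normB _ _)) //.
  have H1 := ler_normD (w t - v k t) (v k t - v k s).
  have H2 := wv k t; have H3 := wv k s; lra.
have wm t : `|w t - w0 t| <= m by have := wv 0%N t; rewrite expr0 divr1.
exists w; split => //; apply/funext => t; apply/eqP.
rewrite -subr_eq0 -normr_eq0 eq_le normr_ge0 andbT.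
apply/ler_addgt0Pr => e e0; rewrite add0r.
have e20 : 0 < e / 2 by rewrite divr_gt0.
have [k kP] := small _ e20.
have -> : K w t - w t = (K w t - v k.+1 t) - (w t - v k.+1 t).
  by rewrite opprB addrA subrK.
rewrite (le_trans (ler_normB _ _)) //.
have H1 := Kctr _ _ _ cw (vinv k).1 wm (vinv k).2 (wv k) t.
have H2 := wv k.+1 t.
have H3 : m / 2 ^+ k.+1 <= m / 2 ^+ k.
  by rewrite ler_wpM2l // lef_pV2 ?posrE ?exprn_gt0 // exprS ler_peMl ?exprn_ge0 // ler1n.
move: H1 H2 H3 kP; rewrite /=; set x := m / 2 ^+ k.
have x0 : 0 <= x by rewrite divr_ge0 // exprn_ge0.
by lra.
Qed.

End FixedPoint.

Section ODE.
Context {R : realType}.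

Lemma I01_0 : I01 (0 : R).
Proof. by rewrite /I01 /= lexx ler01. Qed.

Lemma I01_1 : I01 (1 : R).
Proof. by rewrite /I01 /= lexx ler01. Qed.

Lemma clamp_I01 (u : R) : I01 (clamp u).
Proof. by rewrite /I01 /clamp /= le_max lexx ge_max ler01 ge_min lexx. Qed.

Lemma clamp_id (u : R) : I01 u -> clamp u = u.
Proof. by move=> /andP[u0 u1]; rewrite /clamp min_r // max_r. Qed.

Lemma clamp_cases (x : R) :
  [\/ x <= 0 /\ clamp x = 0, 0 <= x <= 1 /\ clamp x = x | 1 <= x /\ clamp x = 1].
Proof.
rewrite /clamp; have [x1|x1] := leP 1 x; first by apply: Or33; split=> //; rewrite max_r.
have [x0|x0] := leP 0 x; first by apply: Or32; split=> //; rewrite ltW.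
by apply: Or31; split=> //; rewrite ltW.
Qed.

Lemma clamp_lip (u v : R) : `|clamp u - clamp v| <= `|u - v|.
Proof.
have := ler_norm (u - v); have := ler_norm (v - u); rewrite (distrC v u).
by case: (clamp_cases u) => -[+ ->]; case: (clamp_cases v) => -[+ ->]; rewrite ler_norml => *; apply/andP; split; lra.
Qed.

Lemma cont_in_clamp {W : normedModType R} (f : R -> W) :
  (forall u, I01 u -> cont_in I01 f u) -> continuous (f \o clamp).
Proof.
move=> cf u; apply/cvgrPdist_le => e e0.
have [d d0 dP] := cf _ (clamp_I01 u) e e0.
apply/nbhs_ballP; exists d => //= v; rewrite /ball /= => uv.
rewrite distrC; apply: dP; first exact: clamp_I01.
by rewrite distrC; apply: le_lt_trans uv; exact: clamp_lip.
Qed.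

Lemma cont_in_bounded {W : normedModType R} (f : R -> W) :
  (forall u, I01 u -> cont_in I01 f u) ->
  exists2 K : R, 0 <= K & forall u, I01 u -> `|f u| <= K.
Proof.
move=> cf.
have [|c c01 cP] := @EVT_max R (fun u => `|f (clamp u)|) 0 1 ler01.
  apply: continuous_subspaceT => u; apply: cvg_norm.
  exact: (cont_in_clamp cf).
exists `|f (clamp c)| => // u Iu; rewrite -{1}(clamp_id Iu); apply: cP.
by rewrite in_itv.
Qed.

Lemma mean_value_I01 m n (K : R) (f f' : R -> 'M[R]_(m, n)) (a b : R) :
  I01 a -> I01 b ->
  (forall u, I01 u -> deriv_in I01 f u (f' u)) ->
  (forall u, I01 u -> `|f' u| <= K) -> `|f b - f a| <= K * `|b - a|.
Proof.
wlog ab : a b / a <= b.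
  move=> H Ia Ib df fK; have [|ba] := leP a b; first by move=> ?; exact: H.
  by rewrite distrC (distrC b) H // ltW.
move=> /andP[a0 a1] /andP[b0 b1] df fK; rewrite ger0_norm ?subr_ge0 //.
have sub u : a <= u <= b -> I01 u by move=> /andP[? ?]; apply/andP; split; lra.
apply: (@mean_value _ _ _ _ _ _ _ f') => // u uab; last exact/fK/sub.
by apply: deriv_inS (df _ (sub _ uab)) => v; exact: sub.
Qed.

(** With constant 1/2 on an interval of length 1 no exponential appears: at a maximum point [c] of
    the norm the mean value inequality gives [|f c| <= |f 0| + |f c| / 2 + e]. All later estimates
    are normalized to this constant. *)
Lemma small_gronwall m n (e : R) (f f' : R -> 'M[R]_(m, n)) : 0 <= e ->
  (forall u, I01 u -> deriv_in I01 f u (f' u)) ->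
  (forall u, I01 u -> `|f' u| <= 2^-1 * `|f u| + e) ->
  forall u, I01 u -> `|f u| <= 2 * (`|f 0| + e).
Proof.
move=> e0 df fe.
have I0 := I01_0.
have [|c c01 cP] := @EVT_max R (fun u => `|f (clamp u)|) 0 1 ler01.
  apply: continuous_subspaceT => u; apply: cvg_norm.
  by apply: cont_in_clamp => v /df; exact: deriv_in_cont.
have Ic : I01 c by move: c01; rewrite in_itv.
have fc u : I01 u -> `|f u| <= `|f c|.
  by move=> Iu; have := cP u; rewrite !clamp_id // in_itv; apply.
have : `|f c - f 0| <= (2^-1 * `|f c| + e) * `|c - 0|.
  apply: mean_value_I01 df _ => // u Iu; rewrite (le_trans (fe _ Iu)) //.
  by rewrite lerD2r ler_wpM2l ?fc // invr_ge0.
have c1 : `|c - 0| <= 1 by move/andP: Ic => [? ?]; rewrite subr0 ger0_norm.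
have K0 : 0 <= 2^-1 * `|f c| + e by rewrite addr_ge0 // mulr_ge0 ?invr_ge0.
move=> /le_trans /(_ (ler_piMr K0 c1)) H u Iu.
have := fc u Iu; have := lerB_dist (f c) (f 0); lra.
Qed.

(** The global Lipschitz constant 1/2 makes the integral operator a contraction over all of [0,1],
    so no continuation over short intervals is needed. A field that is controlled only on a cube is
    first composed with a projection to the cube. *)
Lemma picard m n (F : R -> 'M[R]_(m, n) -> 'M[R]_(m, n)) (z0 : 'M[R]_(m, n)) :
  (forall s z z', I01 s -> `|F s z - F s z'| <= 2^-1 * `|z - z'|) ->
  (forall s z, I01 s -> cont_in I01 (F^~ z) s) ->
  exists z : R -> 'M[R]_(m, n), z 0 = z0 /\
    forall s, I01 s -> deriv_in I01 z s (F s (z s)).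
Proof.
move=> Flip Fcont.
have I0 := I01_0.
(* One operator selects all antiderivatives, with a junk value on discontinuous functions. The
   interval (-1,2) makes 0 and 1 interior points. *)
have /choice[P HP] : forall f : R -> 'M[R]_(m, n), exists P : R -> 'M[R]_(m, n),
    continuous f -> forall u, I01 u -> deriv_in I01 P u (f u).
  move=> f; have [cf|ncf] := pselect (continuous f); last by exists f.
  have [P HP] := antiderivative (-1) 2 cf; exists P => _ u /andP[u0 u1].
  by apply: (deriv_inS (@subsetT _ _)); apply: HP; apply/andP; split; lra.
pose G (z : R -> 'M[R]_(m, n)) s := F (clamp s) (z (clamp s)).
have Gc z : continuous z -> continuous (G z).
  move=> cz; apply: (@cont_in_clamp _ (fun s => F s (z s))) => s Is e e0.
  have e20 : 0 < e / 2 by rewrite divr_gt0.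
  have [d d0 dP] := Fcont s (z s) Is _ e20.
  have /cvgrPdist_le /(_ _ e0)/nbhs_ballP[d' /= d'0 d'P] := cz s.
  exists (Num.min d d'); first by rewrite lt_min d0.
  move=> v Iv; rewrite lt_min => /andP[vd vd'].
  have := dP v Iv vd; have := d'P v; rewrite /ball /= distrC => /(_ vd').
  rewrite distrC => H1 H2; have H3 := Flip v (z v) (z s) Iv.
  have -> : F v (z v) - F s (z s) = (F v (z v) - F v (z s)) + (F v (z s) - F s (z s)).
    by rewrite addrA subrK.
  by rewrite (le_trans (ler_normD _ _)) //; lra.
have [M M0 MP] := cont_in_bounded (fun s Is => Fcont s z0 Is).
pose K z s := z0 + (P (G z) (clamp s) - P (G z) 0).
have dK z s : continuous z -> I01 s -> deriv_in I01 (K z) s (F s (z s)).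
  move=> cz Is; apply: (@deriv_in_ext _ _ _ _ (fun s => z0 + (P (G z) s - P (G z) 0))) => //.
    by move=> v Iv; rewrite /K clamp_id.
  have -> : F s (z s) = 0 + (G z s - 0) by rewrite add0r subr0 /G clamp_id.
  apply: deriv_inD; first exact: deriv_in_cst.
  by apply: deriv_inB; [apply: HP => //; exact: Gc|exact: deriv_in_cst].
have Kc z : continuous z -> continuous (K z).
  move=> cz; have -> : K z = K z \o clamp.
    by apply/funext => s; rewrite /K /= (clamp_id (clamp_I01 s)).
  by apply: cont_in_clamp => s Is; exact: deriv_in_cont (dK _ _ cz Is).
have K0 z : K z 0 = z0 by rewrite /K clamp_id // subrr addr0.
have KE z s : K z s = K z (clamp s) by rewrite /K (clamp_id (clamp_I01 s)).
have c01 s : `|clamp s - 0| <= 1 :> R.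
  by have /andP[? ?] := clamp_I01 s; rewrite subr0 ger0_norm.
(* Radius [2 * M]: within it the field is at most [(2 * M) / 2 + M], which is the radius again. *)
have [|||w w' d cw cw' _ _ ww' t|w [cw _ wK]] := @contraction_fixpoint R m n K (fun=> z0) (2 * M).
- by rewrite mulr_ge0.
- by move=> ?; exact: cvg_cst.
- move=> w cw wM; split; first exact: Kc.
  move=> t; rewrite KE -[X in _ - X](K0 w).
  rewrite (le_trans (@mean_value_I01 _ _ (2 * M) _ (fun s => F s (w s)) _ _ I0 (clamp_I01 t) (fun s Is => dK _ _ cw Is) _)) //.
    move=> u Iu; have := Flip u (w u) z0 Iu; have := MP u Iu; have := wM u.
    have := ler_normD (F u (w u) - F u z0) (F u z0); rewrite subrK; lra.
  by rewrite ler_piMr // mulr_ge0.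
- have d0 : 0 <= d by rewrite (le_trans _ (ww' 0)).
  rewrite KE (KE w').
  have := @mean_value_I01 _ _ (d / 2) (fun s => K w s - K w' s) (fun s => F s (w s) - F s (w' s)) _ _ I0 (clamp_I01 t).
  rewrite /= !K0 subrr subr0 => H; rewrite (le_trans (H _ _)) //.
  + by move=> u Iu; apply: deriv_inB; exact: dK.
  + by move=> u Iu; rewrite (le_trans (Flip _ _ _ Iu)) // mulrC ler_wpM2r ?invr_ge0.
  + by rewrite ler_piMr // divr_ge0.
- exists w; split; first by rewrite -wK K0.
  by move=> s Is; rewrite -{1}wK; exact: dK.
Qed.

End ODE.

(** * Functions of several variables *)

Section DirectionalDerivatives.
Context {R : realType}.

Lemma derivable_deriv_in {V W : normedModType R} (f : V -> W) (x v : V) (l : W) :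
  (derivable f x v /\ 'D_v f x = l) <->
  deriv_in setT (fun t : R => f (x + t *: v)) 0 l.
Proof.
split=> [[/cvg_ex[m Hm] Dl] e e0|H].
  have lm : l = m by rewrite -Dl; apply: cvg_lim.
  move/cvgrPdist_le : Hm => /(_ e e0); rewrite near_withinE => /nbhs_ballP[d /= d0 dP].
  exists d => // t _; rewrite subr0 scale0r addr0 => td.
  have [->|t0] := eqVneq t 0.
    by rewrite !scale0r addr0 subrr subr0 !normr0 mulr0.
  have := dP t; rewrite /ball /= sub0r normrN => /(_ td t0).
  rewrite lm [t *: v + x]addrC => {}dP.
  have -> : f (x + t *: v) - f x - t *: m =
      t *: - (m - t^-1 *: (f (x + t *: v) - f x)).
    by rewrite opprB scalerBr scalerA mulfV // scale1r.
  by rewrite normrZ normrN mulrC ler_wpM2r.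
have Hl : (h^-1 *: (f (h *: v + x) - f x)) @[h --> 0^'] --> l.
  apply/cvgrPdist_le => e e0; have [d d0 dP] := H e e0.
  rewrite near_withinE; apply/nbhs_ballP; exists d => //= h.
  rewrite /ball /= sub0r normrN => hd h0.
  have := dP h I; rewrite subr0 scale0r addr0 => /(_ hd) {}dP.
  have h1 : 0 < `|h| by rewrite normr_gt0.
  rewrite -(ler_pM2l h1) (mulrC _ e) -normrZ scalerBr scalerA mulfV // scale1r.
  by rewrite distrC [h *: v + x]addrC.
by split; [apply: (cvgP l)|apply: cvg_lim].
Qed.

Lemma derivable_line {V W : normedModType R} (f : V -> W) (D : set R) (x v : V) (t : R) :
  derivable f (x + t *: v) v ->
  deriv_in D (fun t : R => f (x + t *: v)) t ('D_v f (x + t *: v)).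
Proof.
move=> H; have /derivable_deriv_in {}H := conj H (erefl ('D_v f (x + t *: v))).
move=> e e0; have [d d0 dP] := H e e0; exists d => // s _ st.
have := dP (s - t) I; rewrite subr0 scale0r addr0 => /(_ st).
by rewrite -[x + _ + _]addrA -scalerDl subrKC.
Qed.

Lemma continuous_atP {V W : normedModType R} (f : V -> W) x :
  {for x, continuous f} <-> forall e : R, 0 < e -> exists2 d : R, 0 < d &
    forall y, `|y - x| < d -> `|f y - f x| <= e.
Proof.
split=> [/cvgrPdist_le H e e0|H].
  have /nbhs_ballP[d /= d0 dP] := H e e0; exists d => // y yd.
  by rewrite distrC; apply: dP; rewrite -ball_normE /= distrC.
apply/cvgrPdist_le => e e0; have [d d0 dP] := H e e0.
apply/nbhs_ballP; exists d => //= y; rewrite -ball_normE /= distrC => yd.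
by rewrite distrC; exact: dP.
Qed.

Lemma open_normP {V : normedModType R} (U : set V) x : open U -> U x ->
  exists2 d : R, 0 < d & forall y, `|y - x| < d -> U y.
Proof.
move=> oU Ux; have /nbhs_ballP[d /= d0 dP] := open_nbhs_nbhs (conj oU Ux).
by exists d => // y yd; apply: dP; rewrite -ball_normE /= distrC.
Qed.

End DirectionalDerivatives.

Section Partials.
Context {R : realType} {n : nat}.
Local Notation vec := 'rV[R]_n.
Implicit Types (f g : vec -> R^o) (x y z : vec) (U : set vec).

Definition pd (i : 'I_n) f : vec -> R^o := 'D_(stdvec i) f.

Lemma pd_line (D : set R) f x i : derivable f x (stdvec i) ->
  deriv_in D (fun t : R => f (x + t *: stdvec i)) 0 (pd i f x).
Proof.
move=> df; apply: (deriv_inS (@subsetT _ _)).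
exact: (derivable_deriv_in f x (stdvec i) _).1 (conj df erefl).
Qed.

Lemma pd_intro f x i (l : R) :
  deriv_in setT (fun t : R => f (x + t *: stdvec i)) 0 (l : R^o) ->
  derivable f x (stdvec i) /\ pd i f x = l.
Proof. exact: (derivable_deriv_in f x (stdvec i) l).2. Qed.

Lemma stdvec_norm (i : 'I_n) : `|stdvec i : vec| <= 1.
Proof.
apply: mx_norm_le => // a b; rewrite mxE.
by case: (_ && _); rewrite ?normr0 ?normr1 // ler01.
Qed.

(** One coordinate is changed at a time; in the max norm the intermediate points stay within
    [|y - x|] of [x]. The free slopes [c] let one statement yield differentiability (slopes at [x],
    small [e]), Lipschitz bounds (slopes 0) and the second-order Taylor estimate (slopes at [x], [e]
    proportional to [|y - x|]). *)
Lemma coordinate_mean_value f (c : 'I_n -> R) (e : R) x y :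
  (forall z, `|z - x| <= `|y - x| -> forall i,
     derivable f z (stdvec i) /\ `|pd i f z - c i| <= e) ->
  `|f y - f x - \sum_i (y - x) 0 i * c i| <= n%:R * e * `|y - x|.
Proof.
move=> H.
pose z (k : nat) : vec := \row_i (if (i < k)%N then y 0 i else x 0 i).
have zx k : `|z k - x| <= `|y - x|.
  apply: mx_norm_le => // a b; rewrite !mxE !ord1.
  case: ifP => _; last by rewrite subrr normr0.
  by have := mx_entry_le (y - x) 0 b; rewrite !mxE.
have z0 : z 0%N = x by apply/rowP => i; rewrite mxE ltn0.
have zn : z n = y by apply/rowP => i; rewrite mxE ltn_ord.
have zS (k : 'I_n) : z k.+1 = z k + (y - x) 0 k *: stdvec k.
  apply/rowP => i; rewrite !mxE eqxx /= ltnS leq_eqVlt -val_eqE.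
  case: eqVneq => [/val_inj ->|ik]; last by rewrite mulr0 addr0.
  by rewrite ltnn mulr1 subrKC.
have seg (k : 'I_n) t : `|t| <= `|(y - x) 0 k| -> `|z k + t *: stdvec k - x| <= `|y - x|.
  move=> tk; apply: mx_norm_le => // a b; rewrite !mxE !ord1 eqxx /=.
  case: (eqVneq b k) => [->|bk].
    by rewrite ltnn mulr1 addrAC subrr add0r (le_trans tk) // mx_entry_le.
  by rewrite mulr0 addr0; have := mx_entry_le (z k - x) 0 b; rewrite !mxE => /le_trans; apply.
have step (k : 'I_n) : `|f (z k.+1) - f (z k) - (y - x) 0 k * c k| <= e * `|y - x|.
  set h := (y - x) 0 k.
  have e0 : 0 <= e by have [_ /(le_trans (normr_ge0 _))] := H _ (zx 0%N) k.
  pose G t : R := f (z k + t *: stdvec k) - t * c k.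
  have dG (D : set R) t : `|t| <= `|h| -> deriv_in D G t (pd k f (z k + t *: stdvec k) - c k).
    move=> th; apply: deriv_inB.
      by apply: derivable_line; have [] := H _ (seg _ _ th) k.
    by have := deriv_in_scale (@deriv_in_id R D t) (@deriv_in_cst R R D (c k) t);
      rewrite scaler0 addr0 /GRing.scale /= mul1r.
  have bG t : `|t| <= `|h| -> `|pd k f (z k + t *: stdvec k) - c k| <= e.
    by move=> th; have [] := H _ (seg _ _ th) k.
  have -> : f (z k.+1) - f (z k) - h * c k = G h - G 0.
    by rewrite /G zS -/h scale0r addr0 mul0r subr0 addrAC.
  have hn : `|G h - G 0| <= e * `|h|.
    have [h0|h0] := leP 0 h.
      have uh u : 0 <= u <= h -> `|u| <= `|h|.
        by move=> /andP[u0 uh]; rewrite !ger0_norm.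
      rewrite (ger0_norm h0) -[X in _ <= e * X]subr0.
      exact: (@mean_value_R _ 0 h e G _ h0 (fun u Iu => dG _ u (uh u Iu)) (fun u Iu => bG u (uh u Iu))).
    have uh u : h <= u <= 0 -> `|u| <= `|h|.
      by move=> /andP[hu u0]; rewrite !ler0_norm ?lerN2 // ltW.
    rewrite distrC (ltr0_norm h0) -[X in _ <= e * X]sub0r.
    exact: (@mean_value_R _ h 0 e G _ (ltW h0) (fun u Iu => dG _ u (uh u Iu)) (fun u Iu => bG u (uh u Iu))).
  by rewrite (le_trans hn) // ler_wpM2l // mx_entry_le.
have -> : f y - f x - \sum_i (y - x) 0 i * c i =
    \sum_(k < n) (f (z k.+1) - f (z k) - (y - x) 0 k * c k).
  rewrite sumrB; congr (_ - _).
  by rewrite -{1}zn -{1}z0 -(big_mkord xpredT (fun k => f (z k.+1) - f (z k))) telescope_sumr.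
rewrite (le_trans (ler_norm_sum _ _ _)) // (le_trans (ler_sum _ (fun k _ => step k))) //.
by rewrite sumr_const card_ord -mulrA mulr_natl.
Qed.

(** Products and compositions are treated by induction on a finite order of differentiability;
    smoothness is recovered as [Ck] for every [k] ([smooth_onP]). *)
Fixpoint Ck (k : nat) U f : Prop :=
  (forall x, U x -> {for x, continuous f}) /\
  if k is k'.+1 then forall i, (forall x, U x -> derivable f x (stdvec i)) /\ Ck k' U (pd i f)
  else True.

Lemma Ck_cont k U f : Ck k U f -> forall x, U x -> {for x, continuous f}.
Proof. by case: k => [|k] []. Qed.

Lemma CkW k U f : Ck k.+1 U f -> Ck k U f.
Proof.
elim: k f => [|k IH] f [cf Hf]; split => // i.
by have [? ?] := Hf i; split => //; exact: IH.
Qed.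

Lemma smooth_onP U f : smooth_on U f <-> forall k, Ck k U f.
Proof.
split=> [H k|H].
  elim: k f H => [|k IH] f H; first by split=> // x Ux; have [] := H [::] x Ux.
  split=> [x Ux|i]; first by have [] := H [::] x Ux.
  split=> [x Ux|]; first by have [_ /(_ i)] := H [::] x Ux.
  apply: IH => s x Ux; have := H (rcons s i) x Ux.
  by rewrite /dpart foldr_rcons.
move=> s; elim/last_ind: s f H => [|s i IH] f H x Ux.
  by have [cf Hf] := H 1%N; split; [exact: cf|move=> i; have [+ _] := Hf i; exact].
rewrite /dpart foldr_rcons -/(dpart _ _); apply: IH => // k.
by have [_ /(_ i)[]] := H k.+1.
Qed.

Lemma CkS U k l f : (l <= k)%N -> Ck k U f -> Ck l U f.
Proof.
move=> /subnK <-; elim: (k - l)%N => [|j IH] //; rewrite addSn => /CkW; exact: IH.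
Qed.

Lemma Ck_sub U V k f : V `<=` U -> Ck k U f -> Ck k V f.
Proof.
move=> VU; elim: k f => [|k IH] f [cf Hf]; split => //; try by move=> x /VU; exact: cf.
by move=> i; have [d /IH] := Hf i; split=> // x /VU; exact: d.
Qed.

Lemma near_eq_pd f g x i : (exists2 d : R, 0 < d & forall y, `|y - x| < d -> f y = g y) ->
  derivable f x (stdvec i) -> derivable g x (stdvec i) /\ pd i g x = pd i f x.
Proof.
move=> [d d0 dP] df; apply: pd_intro; have := pd_line setT df.
apply: deriv_in_near.
  exists d => // t _; rewrite subr0 => td; apply/esym/dP.
  rewrite addrAC subrr add0r normrZ.
  by apply: le_lt_trans td; rewrite ler_piMr // stdvec_norm.
by rewrite scale0r addr0; apply/esym/dP; rewrite subrr normr0.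
Qed.

Lemma Ck_eq U k f g : open U -> (forall x, U x -> f x = g x) -> Ck k U f -> Ck k U g.
Proof.
move=> oU; have near x : U x -> forall f g, (forall x, U x -> f x = g x) ->
    exists2 d : R, 0 < d & forall y, `|y - x| < d -> f y = g y.
  move=> Ux f' g' fg; have [d d0 dP] := open_normP oU Ux.
  by exists d => // y /dP /fg.
have cont f' g' : (forall x, U x -> f' x = g' x) -> (forall x, U x -> {for x, continuous f'}) ->
    forall x, U x -> {for x, continuous g'}.
  move=> fg cf x Ux; apply/continuous_atP => e e0.
  have /continuous_atP /(_ e e0)[d d0 dP] := cf x Ux.
  have [d' d'0 d'P] := near x Ux _ _ fg.
  exists (Num.min d d'); first by rewrite lt_min d0.
  by move=> y; rewrite lt_min => /andP[yd yd']; rewrite -d'P // -fg //; exact: dP.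
elim: k f g => [|k IH] f g fg [cf Hf]; first by split=> //; exact: cont cf.
split; first exact: cont cf.
move=> i; have [df Hd] := Hf i; split=> [x Ux|].
  by have [] := near_eq_pd (near _ Ux _ _ fg) (df x Ux).
apply: IH Hd => x Ux.
by have [_ ->] := near_eq_pd (near _ Ux _ _ fg) (df x Ux).
Qed.

Lemma Ck_cst U k (c : R) : Ck k U (fun=> c).
Proof.
have D0 i x : derivable (fun=> c : R^o) x (stdvec i) /\ pd i (fun=> c) x = 0.
  by apply: pd_intro; exact: deriv_in_cst.
elim: k c D0 => [|k IH] c D0; first by split=> // x _; exact: cst_continuous.
split; first by move=> x _; exact: cst_continuous.
move=> i; split=> [x _|]; first by have [] := D0 i x.
have -> : pd i (fun=> c) = fun=> 0 by apply/funext => x; have [] := D0 i x.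
by apply: IH => j x; apply: pd_intro; exact: deriv_in_cst.
Qed.

Lemma Ck_add U k f g : open U -> Ck k U f -> Ck k U g -> Ck k U (fun x => f x + g x).
Proof.
move=> oU Cf Cg.
have cfg : forall x, U x -> {for x, continuous (fun x => f x + g x : R^o)}.
  by move=> x Ux; exact: (continuousD (Ck_cont Cf Ux) (Ck_cont Cg Ux)).
elim: k f g Cf Cg cfg => [|k IH] f g [cf Hf] [cg Hg] cfg; first by split.
split=> // i; have [df Df] := Hf i; have [dg Dg] := Hg i.
have E x : U x -> derivable (fun x => f x + g x : R^o) x (stdvec i) /\
    pd i (fun x => f x + g x) x = pd i f x + pd i g x.
  by move=> Ux; apply: pd_intro; exact: (deriv_inD (pd_line _ (df _ Ux)) (pd_line _ (dg _ Ux))).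
split=> [x /E[]//|].
have cD : forall x, U x -> {for x, continuous (fun x => pd i f x + pd i g x : R^o)}.
  by move=> x Ux; exact: (continuousD (Ck_cont Df Ux) (Ck_cont Dg Ux)).
apply: (Ck_eq oU _ (IH _ _ Df Dg cD)) => x Ux.
by have [_ ->] := E x Ux.
Qed.

Lemma Ck_mul U k f g : open U -> Ck k U f -> Ck k U g -> Ck k U (fun x => f x * g x).
Proof.
move=> oU.
have cM f' g' x : {for x, continuous f'} -> {for x, continuous g'} ->
  {for x, continuous (fun x => f' x * g' x : R^o)} by move=> ? ?; exact: continuousM.
elim: k f g => [|k IH] f g Cf Cg; case: (Cf) => cf Hf; case: (Cg) => cg Hg.
  by split=> // x Ux; apply: cM; [exact: cf|exact: cg].
split; first by move=> x Ux; apply: cM; [exact: cf|exact: cg].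
move=> i; have [df Df] := Hf i; have [dg Dg] := Hg i.
have E x : U x -> derivable (fun x => f x * g x : R^o) x (stdvec i) /\
    pd i (fun x => f x * g x) x = pd i f x * g x + f x * pd i g x.
  move=> Ux; apply: pd_intro.
  by have := deriv_inM (pd_line setT (df _ Ux)) (pd_line setT (dg _ Ux)); rewrite scale0r addr0.
split=> [x /E[]//|]; apply: (Ck_eq oU _ (Ck_add oU (IH _ _ Df (CkW Cg)) (IH _ _ (CkW Cf) Dg))) => x Ux.
by have [_ ->] := E x Ux.
Qed.

Lemma Ck_sum U k (I : Type) (r : seq I) (P : pred I) (F : I -> vec -> R^o) : open U ->
  (forall i, P i -> Ck k U (F i)) -> Ck k U (fun x => \sum_(i <- r | P i) F i x).
Proof.
move=> oU H; elim: r => [|i r IH].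
  by under eq_fun do rewrite big_nil; exact: Ck_cst.
have [Pi|/negbTE nPi] := boolP (P i); last by under eq_fun do rewrite big_cons nPi.
under eq_fun do rewrite big_cons Pi.
by apply: Ck_add => //; exact: H.
Qed.

Lemma Ck_prod U k (I : Type) (r : seq I) (P : pred I) (F : I -> vec -> R^o) : open U ->
  (forall i, P i -> Ck k U (F i)) -> Ck k U (fun x => \prod_(i <- r | P i) F i x).
Proof.
move=> oU H; elim: r => [|i r IH].
  by under eq_fun do rewrite big_nil; exact: Ck_cst.
have [Pi|/negbTE nPi] := boolP (P i); last by under eq_fun do rewrite big_cons nPi.
under eq_fun do rewrite big_cons Pi.
by apply: Ck_mul => //; exact: H.
Qed.

Lemma Ck_coord U k (j : 'I_n) : Ck k U (fun x => x 0 j).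
Proof.
have D0 i x : derivable (fun x : vec => x 0 j : R^o) x (stdvec i) /\ pd i (fun x => x 0 j) x = (j == i)%:R.
  apply: pd_intro.
  have -> : (j == i)%:R = (stdvec i : vec) 0 j by rewrite mxE eqxx.
  move=> e e0; exists 1 => // t _ _; rewrite !mxE subr0 mul0r addr0.
  by rewrite [x 0 j + _]addrC addrK /GRing.scale /= subrr normr0 mulr_ge0 // ltW.
have cc x : {for x, continuous (fun x : vec => x 0 j : R^o)} by
  apply/continuous_atP => e e0; exists e => // y /ltW; apply: le_trans;
  have := mx_entry_le (y - x) 0 j; rewrite !mxE.
case: k => [|k]; split => //.
move=> i; split=> [x _|]; first by have [] := D0 i x.
have -> : pd i (fun x => x 0 j) = fun=> (j == i)%:R by apply/funext => x; have [] := D0 i x.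
exact: Ck_cst.
Qed.

Lemma C1_frechet U f x : open U -> Ck 1 U f -> U x -> forall e : R, 0 < e ->
  exists2 d : R, 0 < d & forall y, `|y - x| < d ->
    `|f y - f x - \sum_i (y - x) 0 i * pd i f x| <= e * `|y - x|.
Proof.
move=> oU [cf Hf] Ux e e0.
have n0 : 0 < n%:R + 1 :> R by rewrite ltr_wpDl.
have e1 : 0 < e / (n%:R + 1) by rewrite divr_gt0.
have [d0 d00 d0P] := open_normP oU Ux.
have [|i|d d_gt0 dP] := @finite_radius R 'I_n (fun i d => forall z, `|z - x| < d -> `|pd i f z - pd i f x| <= e / (n%:R + 1)).
- by move=> i d d' _ dd' H z zd; apply: H; exact: lt_le_trans dd'.
- have [_ [/(_ x Ux) /continuous_atP /(_ _ e1) [d d_gt0 dP] _]] := Hf i.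
  by exists d.
exists (Num.min d d0); first by rewrite lt_min d_gt0.
move=> y; rewrite lt_min => /andP[yd yd0].
rewrite (le_trans (@coordinate_mean_value f _ (e / (n%:R + 1)) x y _)) //.
  move=> z zy i; split; last by apply: dP; exact: le_lt_trans yd.
  have [+ _] := Hf i; apply; apply: d0P; exact: le_lt_trans yd0.
by rewrite ler_wpM2r // mulrCA ger_pMr // ler_pdivrMr // mul1r lerDl.
Qed.

Lemma chain_deriv_in U f (D : set R) (c : R -> vec) (u : R) (l : vec) : open U ->
  Ck 1 U f -> U (c u) -> deriv_in D c u l ->
  deriv_in D (fun t => f (c t) : R) u (\sum_i l 0 i * pd i f (c u)).
Proof.
move=> oU Cf Ucu dc e e0.
have l0 : 0 < `|l| + 1 by rewrite ltr_wpDl.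
have e1 : 0 < e / 2 / (`|l| + 1) by rewrite !divr_gt0.
pose B := \sum_i `|pd i f (c u)| + 1.
have B0 : 0 < B by rewrite ltr_wpDl // sumr_ge0.
have e2 : 0 < e / 2 / B by rewrite !divr_gt0.
have [d1 d10 d1P] := C1_frechet oU Cf Ucu e1.
have [d2 d20 d2P] := deriv_in_lip dc.
have [d3 d30 d3P] := dc _ e2.
exists (Num.min (Num.min d2 d3) (d1 / (`|l| + 1))).
  by rewrite !lt_min d20 d30 divr_gt0.
move=> t Dt; rewrite !lt_min -andbA => /and3P[t2 t3 t1].
have ct := d2P t Dt t2.
have ctd : `|c t - c u| < d1 by rewrite (le_lt_trans ct) // mulrC -ltr_pdivlMr.
have -> : f (c t) - f (c u) - (t - u) *: \sum_i l 0 i * pd i f (c u) =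
  (f (c t) - f (c u) - \sum_i (c t - c u) 0 i * pd i f (c u)) +
  \sum_i (c t - c u - (t - u) *: l) 0 i * pd i f (c u).
  rewrite -[(t - u) *: _]/((t - u) * _) mulr_sumr -[RHS]addrA; congr (_ + _).
  rewrite [RHS]addrC -sumrB -sumrN.
  by apply: eq_bigr => i _; rewrite !mxE /GRing.scale /=; ring.
rewrite (le_trans (ler_normD _ _)) // [e]splitr [leRHS]mulrDl lerD //.
  rewrite (le_trans (d1P _ ctd)) // (le_trans (ler_wpM2l (ltW e1) ct)) // mulrA.
  by rewrite divfK // gt_eqF.
rewrite (le_trans (ler_norm_sum _ _ _)) //.
rewrite (@le_trans _ _ (\sum_i (e / 2 / B * `|t - u|) * `|pd i f (c u)|)) //.
  apply: ler_sum => i _; rewrite normrM ler_wpM2r //.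
  by rewrite (le_trans (mx_entry_le _ _ _)) // d3P.
rewrite -mulr_sumr mulrAC ler_wpM2r // mulrAC ler_pdivrMr // ler_pM2l ?divr_gt0 //.
by rewrite lerDl.
Qed.

(** The arithmetic of Schwarz's theorem: one second difference is compared with [h * h] times each
    of the two mixed derivatives. *)
Lemma second_difference_le (A B C D p q h e : R) :
  `|A - B - (C - D) - h * (h * p)| <= e / 2 * h * h ->
  `|A - C - (B - D) - h * (h * q)| <= e / 2 * h * h ->
  `|h * h * (q - p)| <= h * h * e.
Proof.
move=> H1 H2.
have -> : h * h * (q - p) = (A - B - (C - D) - h * (h * p)) - (A - C - (B - D) - h * (h * q)) by ring.
rewrite (le_trans (ler_normB _ _)) // (le_trans (lerD H1 H2)) //.
have -> : e / 2 * h * h + e / 2 * h * h = h * h * e by field.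
exact: lexx.
Qed.

(** Schwarz's theorem. The second difference over a square of side [h] is symmetric in the two
    directions, and [key] shows that it is [h * h] times the mixed derivative in either order, up to
    a small multiple of [h * h]. *)
Lemma pd_swap U f x i j : open U -> Ck 2 U f -> U x -> pd i (pd j f) x = pd j (pd i f) x.
Proof.
move=> oU Cf Ux.
have key (a b : 'I_n) (e : R) : 0 < e -> exists2 d : R, 0 < d & forall h, 0 < h -> h < d ->
  `|f (x + h *: stdvec a + h *: stdvec b) - f (x + h *: stdvec a) -
    (f (x + h *: stdvec b) - f x) - h * (h * pd b (pd a f) x)| <= e * h * h.
  move=> e0; have [cf Hf] := Cf; have [da [ca Ha]] := Hf a; have [dba [cba _]] := Ha b.
  have /continuous_atP /(_ _ e0) [d1 d10 d1P] := cba x Ux.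
  have [d0 d00 d0P] := open_normP oU Ux.
  exists (Num.min d1 d0 / 2); first by rewrite divr_gt0 // lt_min d10.
  move=> h h0; rewrite ltr_pdivlMr // lt_min => /andP[h1 h2].
  set c := pd b (pd a f) x.
  have near s t : 0 <= s <= h -> 0 <= t <= h -> `|x + s *: stdvec a + t *: stdvec b - x| <= h * 2.
    move=> /andP[s0 sh] /andP[t0 th].
    have -> : x + s *: stdvec a + t *: stdvec b - x = s *: stdvec a + t *: stdvec b.
      by rewrite -[x + _ + _]addrA [x + _]addrC addrK.
    rewrite (le_trans (ler_normD _ _)) // !normrZ !ger0_norm //.
    have := stdvec_norm a; have := stdvec_norm b.
    move=> /(ler_wpM2l t0) H1 /(ler_wpM2l s0) H2; lra.
  have inU s t : 0 <= s <= h -> 0 <= t <= h -> U (x + s *: stdvec a + t *: stdvec b).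
    by move=> sh th; apply: d0P; exact: le_lt_trans (near _ _ sh th) h2.
  have c0 : 0 <= 0 :> R by [].
  (* The mean value inequality is used twice: for [G] in direction [a], and for [K] in direction [b]
     in order to bound [G']. *)
  pose G t : R := f (x + t *: stdvec a + h *: stdvec b) - f (x + t *: stdvec a) - t * (h * c).
  pose G' t : R := pd a f (x + t *: stdvec a + h *: stdvec b) - pd a f (x + t *: stdvec a) - h * c.
  have hh : 0 <= h <= h by rewrite lexx ltW.
  have h00 : 0 <= (0 : R) <= h by rewrite lexx ltW.
  have dlin (D : set R) (k t : R) : deriv_in D (fun t => t * k : R) t k.
    by have := deriv_inM (@deriv_in_id R D t) (@deriv_in_cst R R D k t); rewrite mul1r mulr0 addr0.
  have dG t : 0 <= t <= h -> deriv_in [set s | 0 <= s <= h] G t (G' t).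
    move=> th; apply: deriv_inB; last exact: dlin.
    apply: deriv_inB; last first.
      by apply: derivable_line; apply: da; have := inU t 0 th h00; rewrite scale0r addr0.
    have -> : (fun v => f (x + v *: stdvec a + h *: stdvec b)) =
        (fun v => f (x + h *: stdvec b + v *: stdvec a)).
      by apply/funext => v; rewrite addrAC.
    rewrite [x + t *: _ + _]addrAC; apply: derivable_line; apply: da; rewrite addrAC; exact: inU.
  have bG' t : 0 <= t <= h -> `|G' t| <= e * h.
    move=> th.
    pose K s : R := pd a f (x + t *: stdvec a + s *: stdvec b) - s * c.
    have -> : G' t = K h - K 0 by rewrite /G' /K scale0r addr0 mul0r subr0 addrAC.
    rewrite -[X in _ <= e * X]subr0.
    apply: (@mean_value_R _ 0 h e K (fun s => pd b (pd a f) (x + t *: stdvec a + s *: stdvec b) - c) (ltW h0)).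
      move=> s sh; apply: deriv_inB; last exact: dlin.
      by apply: derivable_line; apply: dba; exact: inU.
    by move=> s sh; apply: d1P; exact: le_lt_trans (near _ _ th sh) h1.
  have := @mean_value_R _ 0 h (e * h) G G' (ltW h0) dG bG'.
  rewrite /G scale0r addr0 mul0r !subr0; congr (`|_| <= _).
  by rewrite addrAC.
apply/eqP; rewrite -subr_eq0 -normr_eq0 eq_le normr_ge0 andbT.
apply/ler_addgt0Pr => e e0; rewrite add0r.
have e20 : 0 < e / 2 by rewrite divr_gt0.
have [d d0 dP] := key i j _ e20; have [d' d'0 d'P] := key j i _ e20.
set m := Num.min d d'; have m0 : 0 < m by rewrite lt_min d0.
have [md md'] : m <= d /\ m <= d' by rewrite /m !ge_min !lexx orbT.
have h0 : 0 < m / 2 by rewrite divr_gt0.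
have hm : m / 2 < m by rewrite ltr_pdivrMr // ltr_pMr // ltr1n.
have {dP}H1 := dP _ h0 (lt_le_trans hm md); have {d'P}H2 := d'P _ h0 (lt_le_trans hm md').
move: H1 H2; set h := m / 2 in h0 *; rewrite [x + h *: stdvec j + _]addrAC.
set A := f _; set B := f _; set C := f _; set D := f _.
set p := pd j (pd i f) x; set q := pd i (pd j f) x => H1 H2.
have hh : 0 < h * h by rewrite mulr_gt0.
rewrite -(ler_pM2l hh).
have -> : h * h * `|q - p| = `|h * h * (q - p)| by rewrite normrM (gtr0_norm hh).
exact: second_difference_le H1 H2.
Qed.

End Partials.

Section Composition.
Context {R : realType} {n m : nat}.

Lemma continuous_at_row (F : 'I_m -> 'rV[R]_n -> R^o) x :
  (forall j, {for x, continuous (F j)}) ->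
  {for x, continuous (fun y => \row_j F j y : 'rV[R]_m)}.
Proof.
move=> cF; apply/continuous_atP => e e0.
have [|j|d d0 dP] := @finite_radius R 'I_m (fun j d => forall y, `|y - x| < d -> `|F j y - F j x| <= e).
- by move=> j d d' _ dd' H y yd; apply: H; exact: lt_le_trans dd'.
- by have /continuous_atP /(_ e e0) := cF j.
- exists d => // y yd; apply: mx_norm_le; first exact: ltW.
  by move=> i j; rewrite !mxE; exact: dP.
Qed.

Lemma pd_comp U V (F : 'I_m -> 'rV[R]_n -> R^o) (g : 'rV[R]_m -> R^o) x i :
  open U -> open V -> U x -> V (\row_j F j x) ->
  (forall j, Ck 1 U (F j)) -> Ck 1 V g ->
  derivable (fun y => g (\row_j F j y)) x (stdvec i) /\
  pd i (fun y => g (\row_j F j y)) x = \sum_j pd i (F j) x * pd j g (\row_j F j x).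
Proof.
move=> oU oV Ux Vx CF Cg; apply: pd_intro.
have := @chain_deriv_in R m V g setT (fun t : R => \row_j F j (x + t *: stdvec i)) 0
  (\row_j pd i (F j) x) oV Cg.
rewrite scale0r addr0 => /(_ Vx).
have H : deriv_in setT (fun t : R => \row_j F j (x + t *: stdvec i)) 0 (\row_j pd i (F j) x).
  apply: deriv_in_mx => a j; rewrite mxE; under [X in deriv_in _ X]eq_fun do rewrite mxE.
  by apply: pd_line; have [_ /(_ i)[+ _]] := CF j; apply.
move=> /(_ H); congr deriv_in.
by apply: eq_bigr => j _; rewrite mxE.
Qed.

End Composition.

Lemma Ck_comp {R : realType} {n m : nat} k U V (F : 'I_m -> 'rV[R]_n -> R^o) (g : 'rV[R]_m -> R^o) :
  open U -> open V -> (forall x, U x -> V (\row_j F j x)) ->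
  (forall j, Ck k U (F j)) -> Ck k V g -> Ck k U (fun x => g (\row_j F j x)).
Proof.
move=> oU oV UV.
have cont (F' : 'I_m -> 'rV[R]_n -> R^o) (g' : 'rV[R]_m -> R^o) x : U x -> V (\row_j F' j x) ->
    (forall j, {for x, continuous (F' j)}) ->
    {for (\row_j F' j x), continuous g'} -> {for x, continuous (fun x => g' (\row_j F' j x))}.
  move=> Ux Vx cF /continuous_atP cg; apply/continuous_atP => e e0.
  have [d d0 dP] := cg e e0.
  have d20 : 0 < d / 2 by rewrite divr_gt0.
  have /continuous_atP /(_ _ d20)[d' d'0 d'P] := continuous_at_row cF.
  exists d' => // y yd; apply: dP; rewrite (le_lt_trans (d'P _ yd)) //.
  by rewrite ltr_pdivrMr // ltr_pMr // ltr1n.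
elim: k g => [|k IH] g CF Cg.
  by split=> // x Ux; apply: cont => //; [exact: UV|move=> j; exact: (CF j).1|exact/Cg.1/UV].
split=> [x Ux|i].
  by apply: cont => //; [exact: UV|move=> j; exact: (CF j).1|exact/Cg.1/UV].
have C1F j : Ck 1 U (F j) by apply: CkS (CF j).
have C1g : Ck 1 V g by apply: CkS Cg.
split=> [x Ux|]; first by have [] := pd_comp i oU oV Ux (UV _ Ux) C1F C1g.
apply: (@Ck_eq _ _ _ _ (fun x => \sum_j pd i (F j) x * pd j g (\row_j F j x))) => //.
  by move=> x Ux; have [_ ->] := pd_comp i oU oV Ux (UV _ Ux) C1F C1g.
apply: Ck_sum => // j _; apply: Ck_mul => //.
  by have [_ /(_ i)[]] := CF j.
apply: IH; first by move=> l; exact: CkW (CF l).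
by have [_ /(_ j)[]] := Cg.
Qed.

Lemma mulmx_norm {R : realType} p q r (A : 'M[R]_(p, q)) (B : 'M[R]_(q, r)) :
  `|A *m B| <= q%:R * `|A| * `|B|.
Proof.
apply: mx_norm_le => [|i j]; first by rewrite !mulr_ge0.
rewrite mxE (le_trans (ler_norm_sum _ _ _)) //.
rewrite (@le_trans _ _ (\sum_(k < q) `|A| * `|B|)) //.
  by apply: ler_sum => k _; rewrite normrM ler_pM // mx_entry_le.
by rewrite sumr_const card_ord -mulrA mulr_natl.
Qed.

Section Entries.
Context {R : realType} {n : nat}.

Lemma smooth_on_entry p q U (F : 'rV[R]_n -> 'M[R]_(p, q)) k a b : open U ->
  smooth_on U F -> Ck k U (fun y => F y a b : R^o).
Proof.
move=> oU; elim: k F => [|k IH] F sF.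
  split=> // x Ux; have [cF _] := sF [::] x Ux.
  apply/continuous_atP => e e0; have /continuous_atP /(_ e e0)[d d0 dP] := cF.
  exists d => // y yd; apply: le_trans (dP _ yd).
  by have := mx_entry_le (F y - F x) a b; rewrite !mxE.
split=> [x Ux|i].
  have [cF _] := sF [::] x Ux.
  apply/continuous_atP => e e0; have /continuous_atP /(_ e e0)[d d0 dP] := cF.
  exists d => // y yd; apply: le_trans (dP _ yd).
  by have := mx_entry_le (F y - F x) a b; rewrite !mxE.
have dF x : U x -> derivable F x (stdvec i) by move=> Ux; have [_ /(_ i)] := sF [::] x Ux.
split=> [x /dF /derivable_mxP|]; first exact.
have sD : smooth_on U ('D_(stdvec i) F).
  by move=> s x Ux; have := sF (rcons s i) x Ux; rewrite /dpart foldr_rcons.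
apply: (Ck_eq oU _ (IH _ sD)) => x /dF Hd.
by rewrite derive_mx // mxE.
Qed.

Lemma smooth_on_mx p q U (F : 'rV[R]_n -> 'M[R]_(p, q)) : open U ->
  (forall a b k, Ck k U (fun y => F y a b : R^o)) -> smooth_on U F.
Proof.
move=> oU H s; elim/last_ind: s F H => [|s i IH] F H x Ux.
  split=> [|i].
    apply/continuous_atP => e e0.
    have [|ab|d d0 dP] := @finite_radius R ('I_p * 'I_q)%type (fun ab d => forall y, `|y - x| < d ->
        `|F y ab.1 ab.2 - F x ab.1 ab.2| <= e).
    - by move=> ab d d' _ dd' K y yd; apply: K; exact: lt_le_trans dd'.
    - by have /continuous_atP /(_ e e0) := (H ab.1 ab.2 0%N).1 x Ux.
    - exists d => // y yd; apply: mx_norm_le; first exact: ltW.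
      by move=> a b; rewrite !mxE; exact: (dP (a, b)).
  by apply/derivable_mxP => a b; have [_ /(_ i)[+ _]] := H a b 1%N; apply.
have dF y : U y -> derivable F y (stdvec i).
  by move=> Uy; apply/derivable_mxP => a b; have [_ /(_ i)[+ _]] := H a b 1%N; apply.
rewrite /dpart foldr_rcons -/(dpart _ _); apply: IH => // a b k.
have [_ /(_ i)[_]] := H a b k.+1; apply: Ck_eq => // y Uy.
by rewrite derive_mx ?mxE //; exact: dF.
Qed.

Lemma differentiable_frechet {V W : normedModType R} (F : V -> W) (L : {linear V -> W}) x :
  continuous L ->
  (forall e : R, 0 < e -> exists2 d : R, 0 < d & forall y, `|y - x| < d ->
     `|F y - F x - L (y - x)| <= e * `|y - x|) ->
  differentiable F x /\ 'd F x = L :> (V -> W).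
Proof.
move=> cL H; have oL : F \o shift x = cst (F x) + L +o_ (0 : V) id.
  apply/eqaddoP => e e0; have [d d0 dP] := H e e0.
  apply/nbhs_ballP; exists d => //= h; rewrite -ball_normE /= sub0r normrN => hd.
  have := dP (h + x); rewrite addrK => /(_ hd); congr (`|_| <= _).
  by rewrite /cst /= -addrA -opprD.
have dE : 'd F x = L :> (V -> W) by exact: diff_unique.
by split=> //; apply/diff_locallyP; rewrite dE.
Qed.

(** [transJ] is defined by the Jacobian ['J]; this computes it by partial derivatives. C^1
    regularity gives the Frechet derivative, and uniqueness of the differential identifies it. *)
Lemma differentiable_C1 m U (F : 'rV[R]_n -> 'rV[R]_m) x : open U -> U x ->
  (forall j, Ck 1 U (fun y => F y 0 j : R^o)) ->
  differentiable F x /\ forall i j, 'J F x i j = pd i (fun y => F y 0 j) x.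
Proof.
move=> oU Ux CF.
pose J : 'M[R]_(n, m) := \matrix_(i, j) pd i (fun y => F y 0 j) x.
pose L : {linear 'rV[R]_n -> 'rV[R]_m} := mulmxr J.
have cL : continuous L.
  move=> y; apply/continuous_atP => e e0.
  have C0 : 0 < n%:R * `|J| + 1 by rewrite ltr_wpDl // mulr_ge0.
  exists (e / (n%:R * `|J| + 1)); first by rewrite divr_gt0.
  move=> z zy; rewrite -linearB /= (le_trans (mulmx_norm _ _)) // mulrAC.
  rewrite (@le_trans _ _ ((n%:R * `|J| + 1) * `|z - y|)) //.
    by rewrite ler_wpM2r // lerDl.
  by rewrite mulrC -ler_pdivlMr // ltW.
have [|dF dE] := @differentiable_frechet _ _ F L x cL.
  move=> e e0.
  have [|j|d d0 dP] := @finite_radius R 'I_m (fun j d => forall y, `|y - x| < d ->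
    `|F y 0 j - F x 0 j - \sum_i (y - x) 0 i * pd i (fun y => F y 0 j) x| <= e * `|y - x|).
  - by move=> j d d' _ dd' K y yd; apply: K; exact: lt_le_trans dd'.
  - exact: (C1_frechet oU (CF j) Ux e0).
  exists d => // y yd; apply: mx_norm_le; first by rewrite mulr_ge0 // ltW.
  move=> a j; rewrite !ord1 {a} /=.
  have := dP j y yd; congr (`|_| <= _); rewrite !mxE; congr (_ - _).
  by apply: eq_bigr => i _; rewrite !mxE.
split=> // i j.
by rewrite /jacobian /lin1_mx mxE dE /= -rowE !mxE.
Qed.

End Entries.

(** * Bounds, Lipschitz and Taylor estimates on cubes *)

Section Boxes.
Context {R : realType} {n : nat}.

(** A cube, since the norm is the max norm: it is compact, and truncating coordinates projects onto
    it. *)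
Definition cball (x0 : 'rV[R]_n) (r : R) : set 'rV[R]_n := [set y | `|y - x0| <= r].

Lemma cball_compact x0 r : compact (cball x0 r).
Proof.
apply: bounded_closed_compact.
  exists (`|x0| + r); split; first by rewrite num_real.
  move=> M rM y /= yr; rewrite (le_trans _ (ltW rM)) //.
  by rewrite -(subrK x0 y) addrC (le_trans (ler_normD _ _)) // lerD2l.
have -> : cball x0 r = (fun y => `|y - x0|) @^-1` [set x | x <= r] by [].
apply: closed_comp; last exact: closed_le.
move=> y _; apply/continuous_atP => e e0; exists e => // z /ltW; apply: le_trans.
by rewrite (le_trans (ler_dist_dist _ _)) // opprB subrKA.
Qed.

Lemma Ck_bounded U (f : 'rV[R]_n -> R^o) x0 r : cball x0 r `<=` U -> Ck 0 U f ->
  exists2 K : R, 0 <= K & forall y, cball x0 r y -> `|f y| <= K.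
Proof.
move=> sub [cf _].
have /compact_bounded [M [_ MP]] : compact (f @` cball x0 r).
  apply: continuous_compact; last exact: cball_compact.
  apply: continuous_in_subspaceT => y; rewrite inE => /sub; exact: cf.
exists (`|M| + 1); first by rewrite addr_ge0.
move=> y yr; apply: MP; last by exists y.
by rewrite (le_lt_trans (ler_norm _)) // ltrDl.
Qed.

(** The factor 3: the points visited by [coordinate_mean_value] are within [|y - x| <= 2 * r] of
    [x], hence within [3 * r] of [x0]. *)
Lemma C1_lipschitz U (f : 'rV[R]_n -> R^o) x0 r : cball x0 (3 * r) `<=` U -> Ck 1 U f ->
  exists2 K : R, 0 <= K & forall x y, cball x0 r x -> cball x0 r y -> `|f y - f x| <= K * `|y - x|.
Proof.
move=> sub [_ Cf].
have /choice[K KP] : forall i, exists K : R, 0 <= K /\ forall y, cball x0 (3 * r) y -> `|pd i f y| <= K.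
  move=> i; have [_ Ci] := Cf i.
  by have [K ? ?] := Ck_bounded sub Ci; exists K.
have SK i : K i <= \sum_i K i.
  by rewrite (bigD1 i) //= lerDl sumr_ge0 // => j _; have [] := KP j.
exists (n%:R * \sum_i K i); first by rewrite mulr_ge0 // sumr_ge0 // => i _; have [] := KP i.
move=> x y xr yr.
have := @coordinate_mean_value R n f (fun=> 0) (\sum_i K i) x y.
have -> : \sum_i (y - x) 0 i * 0 = 0 by rewrite big1 // => i _; rewrite mulr0.
rewrite subr0; apply.
move=> z zxy i; have zr : cball x0 (3 * r) z.
  have yx : `|y - x| <= 2 * r.
    have -> : y - x = (y - x0) - (x - x0) by rewrite opprB subrKA.
    rewrite (le_trans (ler_normB _ _)) //.
    by move: xr yr; rewrite /cball /=; lra.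
  rewrite /cball /= -(subrKA x) (le_trans (ler_normD _ _)) //.
  by move: xr; rewrite /cball /=; lra.
split; first by have [+ _] := Cf i; apply; exact: sub.
by rewrite subr0 (le_trans _ (SK i)) //; have [_] := KP i; apply.
Qed.

(** The partial derivatives have to be Lipschitz on radius [3 * r], for which [C1_lipschitz] asks
    for control on radius [9 * r]. *)
Lemma C2_taylor U (f : 'rV[R]_n -> R^o) x0 r : 0 <= r -> cball x0 (9 * r) `<=` U -> Ck 2 U f ->
  exists2 K : R, 0 <= K & forall x y, cball x0 r x -> cball x0 r y ->
    `|f y - f x - \sum_i (y - x) 0 i * pd i f x| <= K * `|y - x| ^+ 2.
Proof.
move=> r0 sub [_ Cf].
have sub3 : cball x0 (3 * (3 * r)) `<=` U by rewrite mulrA; have -> : 3 * 3 = 9 :> R by lra.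
have /choice[K KP] : forall i, exists K : R, 0 <= K /\ forall x y, cball x0 (3 * r) x ->
    cball x0 (3 * r) y -> `|pd i f y - pd i f x| <= K * `|y - x|.
  move=> i; have [_ Ci] := Cf i.
  by have [K ? ?] := C1_lipschitz sub3 Ci; exists K.
have SK i : K i <= \sum_i K i.
  by rewrite (bigD1 i) //= lerDl sumr_ge0 // => j _; have [] := KP j.
exists (n%:R * \sum_i K i); first by rewrite mulr_ge0 // sumr_ge0 // => i _; have [] := KP i.
move=> x y xr yr.
rewrite expr2 mulrA -(mulrA n%:R); apply: coordinate_mean_value => z zxy i.
have yx : `|y - x| <= 2 * r.
  have -> : y - x = (y - x0) - (x - x0) by rewrite opprB subrKA.
  rewrite (le_trans (ler_normB _ _)) //.
  by move: xr yr; rewrite /cball /=; lra.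
have zr : cball x0 (3 * r) z.
  rewrite /cball /= -(subrKA x) (le_trans (ler_normD _ _)) //.
  by move: xr; rewrite /cball /=; lra.
have xr3 : cball x0 (3 * r) x by move: xr; rewrite /cball /=; lra.
split; first by have [+ _] := Cf i; apply; apply: sub; move: zr; rewrite /cball /=; lra.
have [Ki0 H] := KP i; rewrite (le_trans (H _ _ xr3 zr)) // ler_pM //.
Qed.

End Boxes.

(** * Bump functions *)

Section FlatFunction.
Context {R : realType}.

Lemma is_derive_deriv_in (f : R -> R) (u l : R) :
  is_derive u (1 : R) f l -> deriv_in setT f u l.
Proof.
by move=> [df dl]; have := derive_deriv_in setT df; rewrite derive1E dl.
Qed.

(** The family [p(1/x) exp(-1/x)] is closed under differentiation. *)
Definition flat (p : {poly R}) (x : R) : R :=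
  if x <= 0 then 0 else p.[x^-1] * expR (- x^-1).

Lemma flat_posE (p : {poly R}) x : 0 < x -> flat p x = p.[x^-1] * expR (- x^-1).
Proof. by move=> x0; rewrite /flat leNgt x0. Qed.

(** The factor [x ^+ 2] makes the derivative at 0 vanish. It comes from [(y / k) ^+ k <= expR y]
    with [y = 1/x] and [k] equal to the size of [p] plus two. *)
Lemma flat_bound (p : {poly R}) :
  exists2 C : R, 0 <= C & forall x, 0 < x -> x <= 1 -> `|flat p x| <= C * x ^+ 2.
Proof.
pose N := size p.
pose C0 := \sum_(i < N) `|p`_i|.
have C00 : 0 <= C0 by apply: sumr_ge0.
pose k := N.+2.
have k0 : 0 < k%:R :> R by rewrite ltr0n.
exists (C0 * k%:R ^+ k); first by rewrite mulr_ge0 // exprn_ge0 // ltW.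
move=> x x0 x1; rewrite flat_posE //.
set y := x^-1.
have y0 : 0 < y by rewrite invr_gt0.
have y1 : 1 <= y by rewrite -invr1 lef_pV2 ?posrE.
have py : `|p.[y]| <= C0 * y ^+ N.
  rewrite horner_coef (le_trans (ler_norm_sum _ _ _)) // mulr_suml ler_sum // => i _.
  rewrite normrM ler_wpM2l // ger0_norm; last by rewrite exprn_ge0 // ltW.
  by rewrite ler_weXn2l //; exact: ltnW (ltn_ord i).
have ey : (y / k%:R) ^+ k <= expR y.
  rewrite [X in expR X](_ : y = k%:R * (y / k%:R)); last by rewrite mulrC divfK // gt_eqF.
  rewrite expRM_natl lerXn2r ?nnegrE ?expR_ge0 //.
    by rewrite divr_ge0 // ltW.
  by rewrite (le_trans _ (expR_ge1Dx _)) // lerDr.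
rewrite normrM (ger0_norm (expR_ge0 _)) expRN ler_pdivrMr ?expR_gt0 //.
rewrite (le_trans py) //.
have -> : C0 * k%:R ^+ k * x ^+ 2 * expR y = C0 * (k%:R ^+ k * x ^+ 2 * expR y) by ring.
rewrite ler_wpM2l //.
rewrite (@le_trans _ _ (k%:R ^+ k * x ^+ 2 * (y / k%:R) ^+ k)) //; last first.
  by rewrite ler_wpM2l // mulr_ge0 // exprn_ge0 // ltW.
have -> : k%:R ^+ k * x ^+ 2 * (y / k%:R) ^+ k = y ^+ N.
  rewrite mulrAC -exprMn [k%:R * _]mulrC divfK ?gt_eqF // /k -addn2 exprD -mulrA.
  by rewrite -exprMn /y mulVf ?gt_eqF // expr1n mulr1.
exact: lexx.
Qed.

(** With [y = 1/x], the [x]-derivative of [p(y) exp(-y)] is [y^2 (p(y) - p'(y)) exp(-y)]. *)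
Definition flat_step (p : {poly R}) : {poly R} := 'X^2 * (p - p^`()).

Lemma flat_deriv (p : {poly R}) x : deriv_in setT (flat p) x (flat (flat_step p) x).
Proof.
have [x0|x0|->] := ltgtP x 0.
- have -> : flat (flat_step p) x = 0 by rewrite /flat ltW.
  apply: (@deriv_in_near _ _ _ _ (fun=> 0)); last exact: deriv_in_cst.
    exists (- x); first by rewrite oppr_gt0.
    move=> v _ vx; rewrite /flat; case: leP => // v0.
    by move: vx; rewrite gtr0_norm; lra.
  by rewrite /flat ltW.
- apply: (@deriv_in_near _ _ _ _ (fun x => p.[x^-1] * expR (- x^-1))).
  + exists x => // v _ vx; rewrite /flat; case: leP => // v0.
    by move: vx; rewrite ler0_norm; lra.
  + by rewrite flat_posE.
  + have xn : x != 0 by rewrite gt_eqF.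
    have dV : deriv_in setT (fun x : R => x^-1) x (- x ^- 2).
      apply: is_derive_deriv_in; have := @is_deriveV R (@idfun R) x 1 1 xn (is_derive_id _ _).
      by rewrite /GRing.scale /= mulr1.
    have dp : deriv_in setT (fun x : R => p.[x^-1]) x (- x ^- 2 * p^`().[x^-1]).
      exact: (deriv_in_comp (fun _ _ => I) dV (is_derive_deriv_in (is_derive_poly p _))).
    have de : deriv_in setT (fun x : R => expR (- x^-1)) x (- (- x ^- 2) * expR (- x^-1)).
      exact: (deriv_in_comp (fun _ _ => I) (deriv_inN dV) (is_derive_deriv_in (is_derive_expR _))).
    have := deriv_inM dp de; congr deriv_in.
    rewrite flat_posE // /flat_step hornerM hornerXn hornerD hornerN exprVn; ring.
- have -> : flat (flat_step p) 0 = 0 by rewrite /flat lexx.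
  have [C C0 CP] := flat_bound p.
  move=> e e0; exists (Num.min 1 (e / (C + 1))); first by rewrite lt_min ltr01 divr_gt0 // ltr_wpDl.
  move=> v _; rewrite subr0 lt_min => /andP[v1 v2].
  rewrite scaler0 subr0 {2}/flat lexx subr0.
  have [v0|v0] := leP v 0; first by rewrite /flat v0 normr0 mulr_ge0 // ltW.
  move: v1 v2; rewrite gtr0_norm // => v1 v2.
  rewrite (le_trans (CP v v0 (ltW v1))) // expr2 mulrA ler_wpM2r ?(ltW v0) //.
  have C1 : 0 < C + 1 by rewrite ltr_wpDl.
  rewrite (@le_trans _ _ ((C + 1) * v)) //.
    by rewrite ler_wpM2r ?(ltW v0) // lerDl.
  by rewrite mulrC -ler_pdivlMr // ltW.
Qed.

(** Closure under differentiation gives all orders by induction on [k]. Rows of length 1 stand for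
    real numbers because [Ck] speaks of functions of row vectors. *)
Lemma Ck_of_family (T : Type) (F : T -> R -> R) (next : T -> T) :
  (forall t x, deriv_in setT (F t) x (F (next t) x)) ->
  forall k t (U : set 'rV[R]_1), Ck k U (fun y : 'rV[R]_1 => F t (y 0 0)).
Proof.
move=> HF; have C0 t (U : set 'rV[R]_1) x : U x -> {for x, continuous (fun y : 'rV[R]_1 => F t (y 0 0) : R^o)}.
  move=> _; apply/continuous_atP => e e0.
  have [d d0 dP] := deriv_in_cont (HF t (x 0 0)) e0.
  exists d => // y yd; apply: dP => //; apply: le_lt_trans yd.
  by have := mx_entry_le (y - x) 0 0; rewrite !mxE.
have D t i (x : 'rV[R]_1) : derivable (fun y : 'rV[R]_1 => F t (y 0 0) : R^o) x (stdvec i) /\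
    pd i (fun y : 'rV[R]_1 => F t (y 0 0)) x = F (next t) (x 0 0).
  apply: pd_intro; rewrite ord1.
  have -> : (fun s : R => F t ((x + s *: stdvec 0) 0 0)) = F t \o (fun s => x 0 0 + s).
    by apply/funext => s; rewrite /= !mxE eqxx mulr1.
  have ds : deriv_in setT (fun s : R => x 0 0 + s) 0 (0 + 1).
    by apply: deriv_inD; [exact: deriv_in_cst|exact: deriv_in_id].
  have := @deriv_in_comp R R setT setT _ (F t) _ _ (F (next t) (x 0 0)) (fun _ _ => I) ds.
  by rewrite add0r scale1r; apply; rewrite addr0; exact: HF.
elim=> [|k IH] t U; first by split=> //; exact: C0.
split; first exact: C0.
move=> i; split=> [x _|]; first by have [] := D t i x.
have -> : pd i (fun y : 'rV[R]_1 => F t (y 0 0)) = fun y => F (next t) (y 0 0).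
  by apply/funext => x; have [] := D t i x.
exact: IH.
Qed.

Definition flat0 : R -> R := flat 1.

Lemma flat0_gt0 x : 0 < x -> 0 < flat0 x.
Proof. by move=> x0; rewrite /flat0 flat_posE // hornerC mul1r expR_gt0. Qed.

Lemma flat0_le0 x : x <= 0 -> flat0 x = 0.
Proof. by move=> x0; rewrite /flat0 /flat x0. Qed.

Lemma flat0_mono x y : 0 < x -> x <= y -> flat0 x <= flat0 y.
Proof.
move=> x0 xy; have y0 : 0 < y by exact: lt_le_trans xy.
rewrite /flat0 !flat_posE // !hornerC !mul1r ler_expR lerN2.
by rewrite lef_pV2.
Qed.

End FlatFunction.

Section Bump.
Context {R : realType} {n : nat}.

Lemma Ck_comp1 k U (f : 'rV[R]_n -> R^o) (h : R -> R) : open U ->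
  (forall V : set 'rV[R]_1, Ck k V (fun y : 'rV[R]_1 => h (y 0 0))) ->
  Ck k U f -> Ck k U (fun x => h (f x)).
Proof.
move=> oU Ch Cf.
have := @Ck_comp R n 1 k U setT (fun=> f) (fun y => h (y 0 0)) oU openT (fun _ _ => I) (fun=> Cf) (Ch setT).
by under eq_fun do rewrite mxE.
Qed.

(** Composing the flat function with itself produces a plateau without division
    by a non-constant function. *)
Definition plateau (x : R) : R := flat0 (flat0 1 - flat0 x) / flat0 (flat0 1).

Lemma plateau1 x : x <= 0 -> plateau x = 1.
Proof.
move=> x0; rewrite /plateau (flat0_le0 x0) subr0 divff // gt_eqF //.
by do 2! apply: flat0_gt0.
Qed.

Lemma plateau0 x : 1 <= x -> plateau x = 0.
Proof.
move=> x1; rewrite /plateau [flat0 (_ - _)]flat0_le0 ?mul0r //.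
by rewrite subr_le0 flat0_mono.
Qed.

Lemma Ck_plateau k U (f : 'rV[R]_n -> R^o) : open U -> Ck k U f -> Ck k U (fun x => plateau (f x)).
Proof.
move=> oU Cf.
have Cflat (g : 'rV[R]_n -> R^o) : Ck k U g -> Ck k U (fun x => flat0 (g x)).
  by apply: Ck_comp1 => // W; exact: (Ck_of_family (@flat_deriv R)).
rewrite /plateau; apply: Ck_mul => //; last exact: Ck_cst.
have Cm : Ck k U (fun x => -1 * flat0 (f x)) by apply: Ck_mul => //; [exact: Ck_cst|exact: Cflat].
apply: (Ck_eq oU _ (Cflat _ (Ck_add oU (@Ck_cst R n U k (flat0 1)) Cm))) => x _.
by rewrite mulN1r.
Qed.

(** Squares keep the argument smooth where absolute values would not. All arguments are at most 0 on
    the cube of radius [r], and beyond radius [2 * r] one of them is at least 3, where [plateau] is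
    0. *)
Definition bump (y0 : 'rV[R]_n) (r : R) (y : 'rV[R]_n) : R :=
  \prod_i plateau (((y - y0) 0 i / r) ^+ 2 - 1).

Lemma bump1 y0 r y : `|y - y0| <= r -> bump y0 r y = 1.
Proof.
move=> yr; rewrite /bump big1 // => i _; apply: plateau1.
have r0 : 0 <= r by exact: le_trans yr.
rewrite subr_le0 -real_normK ?num_real // exprn_ile1 // normrM normfV (ger0_norm r0).
have [->|rn] := eqVneq r 0; first by rewrite invr0 mulr0 ler01.
rewrite ler_pdivrMr ?lt_def ?rn // mul1r.
exact: le_trans (mx_entry_le _ _ _) yr.
Qed.

Lemma bump0 y0 r y : 0 < r -> 2 * r < `|y - y0| -> bump y0 r y = 0.
Proof.
move=> r0 yr.
have [i yi] : exists i, 2 * r < `|(y - y0) 0 i|.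
  apply: contrapT => H; move: yr; rewrite ltNge => /negP; apply.
  apply: mx_norm_le; first by rewrite mulr_ge0 // ltW.
  by move=> a i; rewrite ord1 leNgt; apply/negP => H'; apply: H; exists i.
rewrite /bump (bigD1 i) //= plateau0 ?mul0r //.
rewrite lerBrDr -[1 + 1]/(2 : R).
have : 2 < `|(y - y0) 0 i / r| by rewrite normrM normfV (gtr0_norm r0) ltr_pdivlMr.
move=> h; rewrite -real_normK ?num_real // expr2.
have : 2 * 2 <= `|(y - y0) 0 i / r| * `|(y - y0) 0 i / r| by rewrite ler_pM // ltW.
by lra.
Qed.

Lemma Ck_bump k U y0 r : open U -> Ck k U (bump y0 r).
Proof.
move=> oU; apply: Ck_prod => // i _; apply: Ck_plateau => //.
have Cl : Ck k U (fun y : 'rV[R]_n => r^-1 * (y 0 i + - y0 0 i)).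
  by apply: Ck_mul => //; [exact: Ck_cst|apply: Ck_add => //; [exact: Ck_coord|exact: Ck_cst]].
apply: (Ck_eq oU _ (Ck_add oU (Ck_mul oU Cl Cl) (@Ck_cst R n U k (-1)))) => y _.
by rewrite !mxE expr2 (mulrC r^-1).
Qed.

End Bump.

(** * Charts, forms and configurations *)

Section CkLocal.
Context {R : realType} {n : nat}.

(** [Ck] asks only for pointwise properties of iterated partial derivatives, so it can be checked
    one singleton at a time, with a set [O'] that depends on the point. *)
Lemma Ck_pointwise k (U : set 'rV[R]_n) (f : 'rV[R]_n -> R^o) :
  (forall x, U x -> exists2 O' : set 'rV[R]_n, O' x & Ck k O' f) -> Ck k U f.
Proof.
move=> H; have {}H x : U x -> Ck k [set x] f.
  by move=> /H[V' Vx]; apply: Ck_sub => y /= ->.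
elim: k f H => [|k IH] f H; first by split=> // x /H[+ _]; exact.
split; first by move=> x /H[+ _]; exact.
move=> i; split; first by move=> x /H[_ /(_ i)[+ _]]; exact.
by apply: IH => x /H[_ /(_ i)[]].
Qed.

End CkLocal.

Section Charts.
Context {R : realType} {n : nat} (M : manifold R n).
Implicit Types (a b c : chart M) (x : M) (y z : 'rV[R]_n).

Definition overlap a b : set 'rV[R]_n := chart_map a @` (dom a `&` dom b).

Definition trans a b : 'rV[R]_n -> 'rV[R]_n := chart_map b \o chart_inv a.

Lemma chart_image_open a : open (chart_image a).
Proof. exact: img_open. Qed.

Lemma chart_invP a y : chart_image a y ->
  dom a (chart_inv a y) /\ chart_map a (chart_inv a y) = y.
Proof. by move=> [x ax <-]; rewrite coordK. Qed.

Lemma chart_map_image a x : dom a x -> chart_image a (chart_map a x).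
Proof. by exists x. Qed.

Lemma open_chart_image a (W : set M) : open W -> open (chart_map a @` (dom a `&` W)).
Proof.
move=> oW; have oV := @chart_image_open a.
have -> : chart_map a @` (dom a `&` W) = chart_image a `&` chart_inv a @^-1` W.
  apply/seteqP; split=> [y [x [ax Wx] <-]|y [/chart_invP[ay ya] Wy]].
    by split; [exact: chart_map_image|rewrite /preimage /= coordK].
  by exists (chart_inv a y).
have cinv := @point_continuous _ _ M a.
rewrite openE => y [Vy Wy]; rewrite /interior.
have cy : {for y, continuous (chart_inv a)}.
  by move: cinv; rewrite continuous_open_subspace // => /(_ y); apply; rewrite inE.
apply: filterI; first exact: open_nbhs_nbhs.
by apply: cy; exact: open_nbhs_nbhs.
Qed.

Lemma overlap_open a b : open (overlap a b).
Proof. by apply: open_chart_image; exact: dom_open. Qed.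

Lemma overlapP a b x : dom a x -> dom b x -> overlap a b (chart_map a x).
Proof. by exists x. Qed.

Lemma overlap_inv a b y : overlap a b y ->
  [/\ dom a (chart_inv a y), dom b (chart_inv a y) & chart_map a (chart_inv a y) = y].
Proof. by move=> [x [ax bx] <-]; rewrite coordK. Qed.

Lemma transE a b x : dom a x -> trans a b (chart_map a x) = chart_map b x.
Proof. by move=> ax; rewrite /trans /= coordK. Qed.

Lemma trans_Ck a b k j : Ck k (overlap a b) (fun y => trans a b y 0 j : R^o).
Proof. by apply: smooth_on_entry; [exact: overlap_open|exact: transition_smooth]. Qed.

Lemma trans_row a b y : \row_j trans a b y 0 j = trans a b y.
Proof. by apply/rowP => j; rewrite mxE. Qed.

Lemma transJE a b x i j : dom a x -> dom b x ->
  transJ a b x i j = pd i (fun y => trans a b y 0 j) (chart_map a x).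
Proof.
move=> ax bx.
have [_ ->] := @differentiable_C1 _ _ _ (overlap a b) (trans a b) (chart_map a x)
  (@overlap_open a b) (overlapP ax bx) (@trans_Ck a b 1).
by [].
Qed.

Lemma pd_chart_change a b (V : set 'rV[R]_n) (f : M -> R) x i : dom a x -> dom b x ->
  open V -> V (chart_map b x) -> Ck 1 V (f \o chart_inv b : 'rV[R]_n -> R^o) ->
  pd i (f \o chart_inv a : 'rV[R]_n -> R^o) (chart_map a x) =
  \sum_j transJ a b x i j * pd j (f \o chart_inv b : 'rV[R]_n -> R^o) (chart_map b x).
Proof.
move=> ax bx oV Vb Cf.
have [] := @pd_comp R n n (overlap a b) V (fun j y => trans a b y 0 j)
  (f \o chart_inv b) (chart_map a x) i (@overlap_open a b) oV (overlapP ax bx).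
- by rewrite trans_row transE.
- by move=> j; exact: trans_Ck.
- exact: Cf.
rewrite trans_row transE // => dc pE.
under eq_bigr do rewrite transJE //.
rewrite -pE.
have [d d0 dP] := open_normP (@overlap_open a b) (overlapP ax bx).
have [|_ -> //] := @near_eq_pd R n (fun y => (f \o chart_inv b) (\row_j trans a b y 0 j))
  (f \o chart_inv a) _ i _ dc.
exists d => // y /dP /overlap_inv[ay by' _].
by rewrite trans_row /trans /= coordK.
Qed.

Lemma transJ_cocycle a b c x : dom a x -> dom b x -> dom c x ->
  transJ a c x = transJ a b x *m transJ b c x.
Proof.
move=> ax bx cx; apply/matrixP => i j; rewrite (transJE i j ax cx) mxE.
have := @pd_chart_change a b (overlap b c) (fun x => chart_map c x 0 j) x i ax bx
  (@overlap_open b c) (overlapP bx cx) (@trans_Ck b c 1 j).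
rewrite -[X in pd i X]/(fun y => trans a c y 0 j) => ->.
apply: eq_bigr => k _; congr (_ * _).
by rewrite (transJE k j bx cx).
Qed.

Lemma transJ_id a x : dom a x -> transJ a a x = 1%:M.
Proof.
move=> ax; apply/matrixP => i j; rewrite transJE // !mxE.
have [d d0 dP] := open_normP (@chart_image_open a) (chart_map_image ax).
have D0 : derivable (fun y : 'rV[R]_n => y 0 j : R^o) (chart_map a x) (stdvec i) /\
    pd i (fun y : 'rV[R]_n => y 0 j) (chart_map a x) = (i == j)%:R.
  apply: pd_intro.
  have -> : (i == j)%:R = (stdvec i : 'rV[R]_n) 0 j by rewrite mxE eqxx eq_sym.
  apply: deriv_in_entry.
  have := deriv_in_scale (@deriv_in_id R setT 0) (@deriv_in_cst R _ setT (stdvec i : 'rV[R]_n) 0).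
  rewrite scale1r scaler0 addr0 => H.
  by have := deriv_inD (@deriv_in_cst R _ setT (chart_map a x) 0) H; rewrite add0r.
have [|_ ->] := @near_eq_pd R n _ (fun y => trans a a y 0 j) _ i _ D0.1; last exact: D0.2.
by exists d => // y /dP /chart_invP[_]; rewrite /trans /= => ->.
Qed.

(** Here the Hausdorff property enters: the support of a cut-off is closed in the manifold and not
    merely in the chart. *)
Lemma compact_in_chart a y0 r : cball y0 r `<=` chart_image a ->
  closed (chart_inv a @` cball y0 r).
Proof.
move=> sub; apply: compact_closed; first exact: manifold_hausdorff.
apply: continuous_compact; last exact: cball_compact.
exact: continuous_subspaceW sub (@point_continuous _ _ M a).
Qed.

(** Extension by zero. A point of the chart [b] either lies in the overlap with [a], where [F] is
    [G], or has an open neighbourhood that misses the compact support, where [F] is 0. *)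
Lemma Ck_extension k a b y0 r (G F : 'rV[R]_n -> R^o) :
  cball y0 r `<=` chart_image a -> Ck k (overlap b a) G ->
  (forall y, overlap b a y -> F y = G y) ->
  (forall y, chart_image b y ->
     ~ (dom a (chart_inv b y) /\ cball y0 r (chart_map a (chart_inv b y))) -> F y = 0) ->
  Ck k (chart_image b) F.
Proof.
move=> sub CG FG F0; apply: Ck_pointwise => y by'.
have [iny|niny] := pselect (overlap b a y).
  by exists (overlap b a) => //; apply: Ck_eq CG => [|z /FG]; [exact: overlap_open|].
pose W : set M := ~` (chart_inv a @` cball y0 r).
have oW : open W by apply: closed_openC; exact: compact_in_chart.
exists (chart_map b @` (dom b `&` W)).
  have [dy my] := chart_invP by'; exists (chart_inv b y) => //; split => //.
  move=> [z zr zy]; apply: niny; exists (chart_inv b y) => //; split => //.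
  by rewrite -zy; have [] := chart_invP (sub _ zr).
apply: (Ck_eq _ _ (Ck_cst _ k 0)); first exact: open_chart_image.
move=> _ [x [bx Wx] <-]; rewrite F0 //; first exact: chart_map_image.
rewrite coordK // => -[ax xr]; apply: Wx; exists (chart_map a x) => //.
exact: coordK.
Qed.

Definition extend a (g : 'rV[R]_n -> R) : M -> R :=
  fun x => if `[<dom a x>] then g (chart_map a x) else 0.

Lemma extend_in a g x : dom a x -> extend a g x = g (chart_map a x).
Proof. by move=> ax; rewrite /extend; case: asboolP. Qed.

Lemma smooth_extend a y0 r (g : 'rV[R]_n -> R^o) :
  cball y0 r `<=` chart_image a -> (forall k, Ck k setT g) ->
  (forall y, ~ cball y0 r y -> g y = 0) -> smooth_fun (extend a g).
Proof.
move=> sub Cg g0 b; apply/smooth_onP => k.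
apply: (@Ck_extension _ a b y0 r (fun y => g ( \row_j trans b a y 0 j))) => //.
- apply: (@Ck_comp R n n k (overlap b a) setT (fun j y => trans b a y 0 j)) => //.
  + exact: overlap_open.
  + exact: openT.
  + by move=> j; exact: trans_Ck.
- move=> y /overlap_inv[by' ay _]; rewrite trans_row /= /extend.
  by case: asboolP.
- move=> y by' H; rewrite /= /extend; case: asboolP => // ay.
  by apply: g0 => yr; apply: H.
Qed.

End Charts.

(** * The Jacobi identity in coordinates *)

Section Poisson.
Context {R : realType} {n : nat} {M : manifold R n} (alpha : poisson M).
Implicit Types (a b c : chart M) (x : M) (y z : 'rV[R]_n).

Definition Acoef a (i j : 'I_n) : 'rV[R]_n -> R^o := fun y => alpha (chart_inv a y) a i j.

Lemma Acoef_Ck k a i j : Ck k (chart_image a) (Acoef a i j).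
Proof.
by apply: smooth_on_entry; [exact: chart_image_open|have [_] := bivec_field alpha; apply].
Qed.

Lemma alpha_anti a x i j : dom a x -> alpha x a j i = - alpha x a i j.
Proof.
move=> ax; have [/(_ x)[/(_ a ax) H _] _] := bivec_field alpha.
by have := congr1 (fun A : 'M[R]_n => A i j) H; rewrite !mxE.
Qed.

Lemma alpha_change a b x : dom a x -> dom b x ->
  alpha x b = (transJ a b x)^T *m alpha x a *m transJ a b x.
Proof. by move=> ax bx; have [/(_ x)[_ +] _] := bivec_field alpha; apply. Qed.

Definition grad a (f : M -> R) x : 'rV[R]_n :=
  \row_i pd i (f \o chart_inv a : 'rV[R]_n -> R^o) (chart_map a x).

Lemma grad_change a b f x : smooth_fun f -> dom a x -> dom b x ->
  grad a f x = grad b f x *m (transJ a b x)^T.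
Proof.
move=> sf ax bx; apply/rowP => i; rewrite !mxE.
rewrite (pd_chart_change _ ax bx (@chart_image_open _ _ _ b) (chart_map_image bx)).
  by apply: eq_bigr => j _; rewrite !mxE mulrC.
by have /smooth_onP := sf b.
Qed.

(** The bracket is defined through an arbitrarily selected chart. Gradients and bivector transform
    in opposite ways, so every chart gives the same value. *)
Lemma bracketE a (f g : M -> R) x : smooth_fun f -> smooth_fun g -> dom a x ->
  bracket alpha f g x = (grad a f x *m alpha x a *m (grad a g x)^T) 0 0.
Proof.
move=> sf sg ax.
have cx : dom (chart_at x) x by exact: (projT2 (cid (charts_cover x))).
have -> : bracket alpha f g x =
    (grad (chart_at x) f x *m alpha x (chart_at x) *m (grad (chart_at x) g x)^T) 0 0.
  rewrite /bracket mxE exchange_big; apply: eq_bigr => j _ /=.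
  rewrite !mxE mulr_suml; apply: eq_bigr => i _.
  by rewrite !mxE mulrAC [_ * pd _ _ _]mulrC !mulrA [X in X * _]mulrC.
rewrite (grad_change sf cx ax) (grad_change sg cx ax) (alpha_change cx ax).
by rewrite trmx_mul trmxK !mulmxA.
Qed.

(** The Jacobi identity for functions is applied to cut-off coordinate functions. Near [x] their
    brackets are the coefficients of the bivector, and the outer bracket differentiates these
    coefficients. *)
Theorem jacobi_chart a x (i j k : 'I_n) : dom a x ->
  \sum_m (alpha x a i m * pd m (Acoef a j k) (chart_map a x) +
          alpha x a j m * pd m (Acoef a k i) (chart_map a x) +
          alpha x a k m * pd m (Acoef a i j) (chart_map a x)) = 0.
Proof.
move=> ax.
have [d d0 dP] := open_normP (@chart_image_open _ _ _ a) (chart_map_image ax).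
(* The bump lives on radius [2 * r], which has to stay inside the chart. *)
pose y0 := chart_map a x; pose r := d / 3.
have r0 : 0 < r by rewrite divr_gt0.
have sub : cball y0 (2 * r) `<=` chart_image a.
  by move=> y; rewrite /cball /= => yr; apply: dP; apply: le_lt_trans yr _; rewrite /r; lra.
pose F (p : 'I_n) := extend a (fun y => bump y0 r y * y 0 p).
have sF p : smooth_fun (F p).
  apply: (smooth_extend sub) => [l|y yr].
    by apply: Ck_mul; [exact: openT|apply: Ck_bump; exact: openT|exact: Ck_coord].
  rewrite bump0 ?mul0r // ltNge; apply/negP; exact: yr.
pose N : set M := [set x' | dom a x' /\ `|chart_map a x' - y0| < r].
have gradF p x' : N x' -> grad a (F p) x' = stdvec p.
  move=> [ax' xr]; apply/rowP => q; rewrite mxE.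
  have D0 : derivable (fun y : 'rV[R]_n => y 0 p : R^o) (chart_map a x') (stdvec q) /\
      pd q (fun y : 'rV[R]_n => y 0 p) (chart_map a x') = (stdvec p : 'rV[R]_n) 0 q.
    apply: pd_intro.
    have -> : (stdvec p : 'rV[R]_n) 0 q = (stdvec q : 'rV[R]_n) 0 p by rewrite !mxE !eqxx eq_sym.
    apply: deriv_in_entry.
    have := deriv_in_scale (@deriv_in_id R setT 0) (@deriv_in_cst R _ setT (stdvec q : 'rV[R]_n) 0).
    rewrite scale1r scaler0 addr0 => H.
    by have := deriv_inD (@deriv_in_cst R _ setT (chart_map a x') 0) H; rewrite add0r.
  have [|_ ->] := @near_eq_pd R n _ (F p \o chart_inv a) _ q _ D0.1; last exact: D0.2.
  exists (r - `|chart_map a x' - y0|); first by rewrite subr_gt0.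
  move=> y yx; have yr : `|y - y0| < r.
    rewrite -(subrKA (chart_map a x')) (le_lt_trans (ler_normD _ _)) //.
    by rewrite -ltrBrDr.
  have /chart_invP[ay ya] : chart_image a y by apply: sub; rewrite /cball /=; lra.
  by rewrite /= /F extend_in // ya bump1 ?mul1r // ltW.
have brF p q x' : N x' -> bracket alpha (F p) (F q) x' = alpha x' a p q.
  move=> Nx; rewrite (@bracketE a) //; last by case: Nx.
  by rewrite !gradF // -rowE trmx_delta -colE !mxE.
have Nx : N x by split=> //; rewrite subrr normr0.
have [sbr _ _ jac] := bivec_poisson alpha.
have brbr p q s : bracket alpha (F p) (bracket alpha (F q) (F s)) x =
    \sum_m alpha x a p m * pd m (Acoef a q s) (chart_map a x).
  rewrite (@bracketE a) //; last exact: sbr.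
  rewrite gradF // -rowE mxE; apply: eq_bigr => m _; rewrite !mxE; congr (_ * _).
  have [_ /(_ m)[da _]] := @Acoef_Ck 1 a q s.
  have [|_ ->] := @near_eq_pd R n _ (bracket alpha (F q) (F s) \o chart_inv a) _ m _ (da _ (chart_map_image ax)) => //.
  exists r => // y yr.
  have /chart_invP[ay ya] : chart_image a y.
    by apply: sub; rewrite /cball /=; move: yr; rewrite -/y0; lra.
  by rewrite /= brF //; split=> //; rewrite ya.
have := jac _ _ _ (sF i) (sF j) (sF k) x.
by rewrite !brbr -!big_split.
Qed.

End Poisson.

(** * Smooth linear combinations and cut-off one-forms *)

Section LinearCombinations.
Context {R : realType} {n : nat} {W : normedModType R}.
Implicit Types (f g : 'rV[R]_n -> W) (U : set 'rV[R]_n).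

Lemma derive_line_near f g x v (l : W) : (exists2 d : R, 0 < d & forall y, `|y - x| < d -> f y = g y) ->
  deriv_in setT (fun t : R => g (x + t *: v)) 0 l -> derivable f x v /\ 'D_v f x = l.
Proof.
move=> [d d0 dP] H; apply/derivable_deriv_in; apply: deriv_in_near H; last first.
  by apply: dP; rewrite scale0r addr0 subrr normr0.
have v0 : 0 < `|v| + 1 by rewrite ltr_wpDl.
exists (d / (`|v| + 1)); first by rewrite divr_gt0.
move=> t _; rewrite subr0 => td; apply: dP; rewrite addrAC subrr add0r normrZ.
rewrite (le_lt_trans (y := `|t| * (`|v| + 1))) ?ler_wpM2l ?lerDl //.
by rewrite -ltr_pdivlMr.
Qed.

(** The formula for all iterated partial derivatives is kept along with smoothness, since
    convergence of forms is stated through [dpart]. *)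
Lemma smooth_on_lin U (c : R) f g : open U -> smooth_on U f -> smooth_on U g ->
  smooth_on U (fun y => c *: f y + g y) /\
  forall s y, U y -> dpart s (fun y => c *: f y + g y) y = c *: dpart s f y + dpart s g y.
Proof.
move=> oU sf sg.
have step s : (forall y, U y -> dpart s (fun y => c *: f y + g y) y = c *: dpart s f y + dpart s g y) ->
    forall i y, U y -> derivable (dpart s (fun y => c *: f y + g y)) y (stdvec i) /\
      'D_(stdvec i) (dpart s (fun y => c *: f y + g y)) y =
      c *: 'D_(stdvec i) (dpart s f) y + 'D_(stdvec i) (dpart s g) y.
  move=> H i y Uy; apply: (derive_line_near (g := fun y => c *: dpart s f y + dpart s g y)).
    by have [d d0 dP] := open_normP oU Uy; exists d => // z /dP /H.
  apply: deriv_inD; [apply: deriv_inZ|]; apply/derivable_deriv_in; split=> //.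
    by have [_] := sf s y Uy; apply.
  by have [_] := sg s y Uy; apply.
have E s : forall y, U y -> dpart s (fun y => c *: f y + g y) y = c *: dpart s f y + dpart s g y.
  elim: s => [|i s IH] y Uy //=.
  by have [] := step s IH i y Uy.
split=> // s y Uy; split; last by move=> i; have [] := step s (E s) i y Uy.
have [d d0 dP] := open_normP oU Uy.
have cfg : {for y, continuous (fun y => c *: dpart s f y + dpart s g y)}.
  have [cf _] := sf s y Uy; have [cg _] := sg s y Uy.
  by apply: continuousD => //; apply: continuousZr.
apply/continuous_atP => e e0; have /continuous_atP /(_ e e0)[d' d'0 d'P] := cfg.
exists (Num.min d d'); first by rewrite lt_min d0.
by move=> z; rewrite lt_min => /andP[/dP Uz /d'P]; rewrite !E.
Qed.

Lemma smooth_on_cst U (w : W) : smooth_on U (fun=> w).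
Proof.
have D0 (w' : W) (x v : 'rV[R]_n) : derivable (fun=> w') x v /\ 'D_v (fun=> w' : W) x = 0 :> W.
  by apply/derivable_deriv_in; exact: deriv_in_cst.
have H (s : seq 'I_n) : exists w', dpart s (fun=> w : W) = fun=> w'.
  elim: s => [|i s [w' IH]] /=; first by exists w.
  by exists 0; apply/funext => x; rewrite IH; have [] := D0 w' x (stdvec i).
move=> s x _; have [w' ->] := H s; split; first exact: cst_continuous.
by move=> i; have [] := D0 w' x (stdvec i).
Qed.

Lemma smooth_on_sum U (I : Type) (r : seq I) (c : I -> R) (F : I -> 'rV[R]_n -> W) : open U ->
  (forall i, smooth_on U (F i)) ->
  smooth_on U (fun y => \sum_(i <- r) c i *: F i y) /\
  forall s y, U y -> dpart s (fun y => \sum_(i <- r) c i *: F i y) y = \sum_(i <- r) c i *: dpart s (F i) y.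
Proof.
move=> oU sF; elim: r => [|i r [IH1 IH2]].
  have -> : (fun y => \sum_(i <- [::]) c i *: F i y) = fun=> 0 by apply/funext => y; rewrite big_nil.
  split=> [|s y Uy]; first exact: smooth_on_cst.
  rewrite big_nil; elim: s y Uy => [|j s IH] y Uy //=.
  have [|_ ->] := @derive_line_near (dpart s (fun=> 0)) (fun=> 0) y (stdvec j) 0 _ (@deriv_in_cst _ _ _ _ _) => //.
  by have [d d0 dP] := open_normP oU Uy; exists d => // z /dP /IH.
have -> : (fun y => \sum_(k <- i :: r) c k *: F k y) =
    (fun y => c i *: F i y + \sum_(k <- r) c k *: F k y) by apply/funext => y; rewrite big_cons.
have [H1 H2] := smooth_on_lin (c i) oU (sF i) IH1; split=> // s y Uy.
by rewrite H2 // IH2 // big_cons.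
Qed.

Lemma smooth_on_bounded U (K : set 'rV[R]_n) f s : compact K -> K `<=` U -> smooth_on U f ->
  exists2 C : R, 0 <= C & forall y, K y -> `|dpart s f y| <= C.
Proof.
move=> cK KU sf.
have /compact_bounded [m [_ mP]] : compact (dpart s f @` K).
  apply: continuous_compact => //; apply: continuous_in_subspaceT => y; rewrite inE => /KU Uy.
  by have [] := sf s y Uy.
exists (`|m| + 1); first by rewrite addr_ge0.
move=> y Ky; apply: mP; last by exists y.
by rewrite (le_lt_trans (ler_norm _)) // ltrDl.
Qed.

End LinearCombinations.

Section Forms.
Context {R : realType} {n : nat} {M : manifold R n}.
Implicit Types (a b c : chart M) (x : M).

(** A covector given by its components in one chart and 0 outside it, so that one formula defines a
    cut-off form on all of [M]. *)
Definition covector_from a x (w : 'rV[R]_n) : chart M -> 'rV[R]_n :=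
  fun b => if `[<dom a x /\ dom b x>] then w *m (transJ b a x)^T else 0.

Lemma covector_from_in a b x w : dom a x -> dom b x ->
  covector_from a x w b = w *m (transJ b a x)^T.
Proof. by move=> ax bx; rewrite /covector_from asboolT. Qed.

Lemma covector_from_out a b x w : ~ (dom a x /\ dom b x) -> covector_from a x w b = 0.
Proof. by move=> H; rewrite /covector_from asboolF. Qed.

Lemma covector_fromP a x w : covector x (covector_from a x w).
Proof.
split=> [b nb|b c bx cx]; first by rewrite covector_from_out // => -[].
have [ax|nax] := pselect (dom a x); last first.
  by rewrite !covector_from_out ?mul0mx // => -[].
rewrite (covector_from_in w ax bx) (covector_from_in w ax cx) -mulmxA -trmx_mul.
by rewrite (transJ_cocycle bx cx ax).
Qed.

Lemma covector_from_id a x w : dom a x -> covector_from a x w a = w.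
Proof.
by move=> ax; rewrite covector_from_in // transJ_id // trmx1 mulmx1.
Qed.

Lemma covector_determined x (v w : chart M -> 'rV[R]_n) a :
  covector x v -> covector x w -> dom a x -> v a = w a -> v = w.
Proof.
move=> [v0 vE] [w0 wE] ax vw; apply/funext => b.
have [bx|bx] := pselect (dom b x); last by rewrite v0 // w0.
by rewrite (vE b a) // (wE b a) // vw.
Qed.

Section Cutoff.
Variables (a : chart M) (y0 : 'rV[R]_n) (r : R).
Hypothesis (r0 : 0 < r) (sub : cball y0 (2 * r) `<=` chart_image a).

Definition cutoff_dx (i : 'I_n) : field_of_comps M :=
  fun x => covector_from a x (bump y0 r (chart_map a x) *: stdvec i).

Lemma one_form_cutoff i : one_form (cutoff_dx i).
Proof.
split=> [x|b]; first exact: covector_fromP.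
apply: smooth_on_mx; first exact: chart_image_open.
move=> p j k; rewrite ord1.
pose G y : R^o := bump y0 r (\row_l trans b a y 0 l) * pd j (fun y => trans b a y 0 i) y.
apply: (@Ck_extension _ _ _ k a b y0 (2 * r) G) => //.
- apply: Ck_mul; first exact: overlap_open.
    apply: (@Ck_comp R n n k (overlap b a) setT (fun j y => trans b a y 0 j)) => //.
    + exact: overlap_open.
    + exact: openT.
    + by move=> l; exact: trans_Ck.
    + by apply: Ck_bump; exact: openT.
  by have [_ /(_ j)[]] := @trans_Ck _ _ M b a k.+1 i.
- move=> y /overlap_inv[by' ay my]; rewrite /cutoff_dx covector_from_in //.
  rewrite -scalemxAl mxE /G trans_row; congr (_ * _).
  by rewrite -rowE mxE mxE (transJE j i by' ay) my.
- move=> y by' H; rewrite /cutoff_dx.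
  have [[ay _]|nay] := pselect (dom a (chart_inv b y) /\ dom b (chart_inv b y)).
    rewrite covector_from_in //; last exact: (chart_invP by').1.
    rewrite bump0 ?scale0r ?mul0mx ?mxE //.
    by rewrite ltNge; apply/negP => yr; apply: H.
  by rewrite covector_from_out // mxE.
Qed.

(** The form [sum_i f_i(u) dx^i] on the cube of radius [r], cut off outside. It is linear in
    finitely many coefficients, so convergence in the Frechet space reduces to convergence of row
    vectors ([cutoff_form_small]). *)
Definition cutoff_form (f : R -> 'rV[R]_n) : R -> field_of_comps M :=
  fun u x c => \sum_i f u 0 i *: cutoff_dx i x c.

Lemma cutoff_formE (f : R -> 'rV[R]_n) u x :
  cutoff_form f u x = covector_from a x (bump y0 r (chart_map a x) *: f u).
Proof.
apply/funext => c; rewrite /cutoff_form /cutoff_dx.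
have [[ax cx]|H] := pselect (dom a x /\ dom c x); last first.
  by rewrite covector_from_out // big1 // => i _; rewrite covector_from_out // scaler0.
rewrite covector_from_in //; under eq_bigr do rewrite covector_from_in //.
rewrite [in RHS](row_sum_delta (f u)) scaler_sumr mulmx_suml; apply: eq_bigr => i _.
by rewrite -!scalemxAl !scalerA mulrC.
Qed.

Lemma one_form_cutoff_form (f : R -> 'rV[R]_n) u : one_form (cutoff_form f u).
Proof.
split=> [x|c]; first by rewrite cutoff_formE; exact: covector_fromP.
have sm i : smooth_on (chart_image c) (fun z => cutoff_dx i (chart_inv c z) c).
  by have [_] := one_form_cutoff i; apply.
exact: (smooth_on_sum (index_enum _) (fun i => f u 0 i) (@chart_image_open _ _ _ c) sm).1.
Qed.

Lemma cutoff_form_small (c : chart M) (K : set 'rV[R]_n) s (e : R) : compact K -> K `<=` chart_image c -> 0 < e ->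
  exists2 d : R, 0 < d & forall w : 'rV[R]_n, `|w| < d -> forall y, K y ->
    `|dpart s (fun z => \sum_i w 0 i *: cutoff_dx i (chart_inv c z) c) y| < e.
Proof.
move=> cK KV e0.
have sm i : smooth_on (chart_image c) (fun z => cutoff_dx i (chart_inv c z) c).
  by have [_] := one_form_cutoff i; apply.
have /choice[C CP] : forall i, exists C : R, 0 <= C /\
    forall y, K y -> `|dpart s (fun z => cutoff_dx i (chart_inv c z) c) y| <= C.
  by move=> i; have [C ? ?] := smooth_on_bounded s cK KV (sm i); exists C.
have S0 : 0 < \sum_i C i + 1 by rewrite ltr_wpDl // sumr_ge0 // => i _; have [] := CP i.
exists (e / (\sum_i C i + 1)); first by rewrite divr_gt0.
move=> w wd y Ky.
rewrite (smooth_on_sum (index_enum _) (fun i => w 0 i) (@chart_image_open _ _ _ c) sm).2; last exact: KV.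
rewrite (le_lt_trans (ler_norm_sum _ _ _)) //.
rewrite (@le_lt_trans _ _ (`|w| * (\sum_i C i + 1))) -?ltr_pdivlMr //.
rewrite (@le_trans _ _ (`|w| * \sum_i C i)) ?ler_wpM2l ?lerDl // mulr_sumr.
by apply: ler_sum => i _; rewrite normrZ ler_pM // ?mx_entry_le //; have [_] := CP i; apply.
Qed.

Lemma C1_cutoff_form (b b' : R -> 'rV[R]_n) :
  (forall u, I01 u -> deriv_in I01 b u (b' u)) -> (forall u, I01 u -> cont_in I01 b' u) ->
  C1_forms (cutoff_form b).
Proof.
move=> db cb'; split; first by move=> u _; exact: one_form_cutoff_form.
exists (cutoff_form b') => u Iu; split; first exact: one_form_cutoff_form.
- move=> c K s e cK KV e0.
  have [d d0 dP] := cutoff_form_small s cK KV e0.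
  have /diffqP /cvgrPdist_lt /(_ _ d0) := db u Iu.
  apply: filterS => h; rewrite distrC => /dP {}dP y /dP.
  congr (`|dpart _ _ _| < _); apply/funext => z; rewrite /cutoff_form /diffq.
  rewrite -sumrB scaler_sumr -sumrB; apply: eq_bigr => i _.
  by rewrite !mxE -scalerBl scalerA -scalerBl.
- move=> c K s e cK KV e0.
  have [d d0 dP] := cutoff_form_small s cK KV e0.
  have d20 : 0 < d / 2 by rewrite divr_gt0.
  have [d' d'0 d'P] := cb' u Iu _ d20.
  rewrite /increments near_withinE; apply/nbhs_ballP; exists d' => //= h.
  rewrite /ball /= sub0r normrN => hd' _ Ih y Ky.
  have := d'P (u + h) Ih; rewrite addrAC subrr add0r => /(_ hd') H.
  have dd : d / 2 < d by rewrite ltr_pdivrMr // ltr_pMr // ltr1n.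
  have := dP _ (le_lt_trans H dd) y Ky; congr (`|dpart _ _ _| < _); apply/funext => z; rewrite /cutoff_form.
  by rewrite -sumrB; apply: eq_bigr => i _; rewrite !mxE -scalerBl.
Qed.

Lemma cutoff_form0 (f : R -> 'rV[R]_n) u x : f u = 0 -> cutoff_form f u x = fun=> 0.
Proof.
move=> fu; apply/funext => c; rewrite /cutoff_form big1 // => i _.
by rewrite fu mxE scale0r.
Qed.

Lemma P0_cutoff_form (b b' : R -> 'rV[R]_n) :
  (forall u, I01 u -> deriv_in I01 b u (b' u)) -> (forall u, I01 u -> cont_in I01 b' u) ->
  b 0 = 0 -> b 1 = 0 -> P0_forms (cutoff_form b).
Proof.
move=> db cb' b0 b1; split; first exact: C1_cutoff_form db cb'.
by move=> x c; rewrite !cutoff_form0.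
Qed.

Lemma cutoff_form_near (f : R -> 'rV[R]_n) u x : dom a x -> cball y0 r (chart_map a x) ->
  cutoff_form f u x a = f u.
Proof.
by move=> ax xr; rewrite cutoff_formE covector_from_id // bump1 // scale1r.
Qed.

End Cutoff.

End Forms.

Section MatrixConvergence.
Context {R : realType}.

Lemma cvg_mx_entry (T : Type) (F : set_system T) {FF : Filter F} p q (f : T -> 'M[R]_(p, q)) (l : 'M[R]_(p, q)) i j :
  f @ F --> l -> (fun t => f t i j) @ F --> l i j.
Proof.
move=> /cvgrPdist_le H; apply/cvgrPdist_le => e e0; apply: filterS (H e e0) => t.
by apply: le_trans; have := mx_entry_le (l - f t) i j; rewrite !mxE.
Qed.

Lemma cvg_mx_intro (T : Type) (F : set_system T) {FF : Filter F} p q (f : T -> 'M[R]_(p, q)) (l : 'M[R]_(p, q)) :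
  (forall i j, (fun t => f t i j) @ F --> l i j) -> f @ F --> l.
Proof.
move=> H; apply/cvgrPdist_le => e e0.
have : \forall t \near F, forall ij : 'I_p * 'I_q, `|l ij.1 ij.2 - f t ij.1 ij.2| <= e.
  by apply: filter_forall => -[i j]; have /cvgrPdist_le := H i j; apply.
apply: filterS => t Ht; apply: mx_norm_le; first exact: ltW.
by move=> i j; rewrite !mxE; exact: (Ht (i, j)).
Qed.

Lemma cvg_bigsum (T : Type) (F : set_system T) {FF : Filter F} (I : Type) (r : seq I) (f : I -> T -> R) (l : I -> R) :
  (forall i, f i @ F --> l i) -> (fun t => \sum_(i <- r) f i t) @ F --> \sum_(i <- r) l i.
Proof.
move=> H; elim: r => [|i r IH].
  by under eq_fun do rewrite big_nil; rewrite big_nil; exact: cvg_cst.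
by under eq_fun do rewrite big_cons; rewrite big_cons; exact: cvgD.
Qed.

Lemma cvg_Ck n (T : Type) (F : set_system T) {FF : Filter F} (U : set 'rV[R]_n) (g : 'rV[R]_n -> R^o) (x : T -> 'rV[R]_n) y :
  Ck 0 U g -> U y -> x @ F --> y -> (fun t => g (x t)) @ F --> g y.
Proof.
move=> [cg _] Uy /cvgrPdist_lt xy; apply/cvgrPdist_le => e e0.
have /continuous_atP /(_ e e0)[d d0 dP] := cg y Uy.
by apply: filterS (xy d d0) => t ty; rewrite distrC; apply: dP; rewrite distrC.
Qed.

End MatrixConvergence.

(** * Coordinate expressions of the flow and their transformation laws *)

Section Coordinates.
Context {R : realType} {n : nat} {M : manifold R n} (alpha : poisson M).
Implicit Types (a b c : chart M) (x : M) (y v w e : 'rV[R]_n).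
Local Notation A a i j := (Acoef alpha a i j).

(** The sign makes two equations alike: the constraint reads [X' = fA X eta], and the flow of [beta]
    moves [X] with velocity [fA X beta]. *)
Definition fA a y w : 'rV[R]_n := - (w *m (alpha (chart_inv a y) a)^T).

(** Derivative of [fA] in the base point, along [v] and at fixed [w]. *)
Definition dfA a y v w : 'rV[R]_n := \row_i - \sum_j w 0 j * \sum_m v 0 m * pd m (A a i j) y.

(** The term [d_i alpha^{jk} eta_j beta_k] of [xi_eta]. *)
Definition Qf a y e w : 'rV[R]_n := \row_i \sum_j \sum_k pd i (A a j k) y * e 0 j * w 0 k.

Lemma fA_entry a y w i : fA a y w 0 i = - \sum_j w 0 j * A a i j y.
Proof. by rewrite !mxE; congr (- _); apply: eq_bigr => j _; rewrite mxE. Qed.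

Lemma fAE a x w : dom a x -> fA a (chart_map a x) w = - sharp alpha x a w.
Proof. by move=> ax; rewrite /fA /sharp coordK. Qed.

Lemma A_anti a y i j : chart_image a y -> A a j i y = - A a i j y.
Proof. by move=> /chart_invP[ay _]; exact: alpha_anti. Qed.

Lemma A_deriv a y m i j : chart_image a y -> derivable (A a i j) y (stdvec m).
Proof. by move=> Vy; have [_ /(_ m)[+ _]] := Acoef_Ck alpha 1 a i j; apply. Qed.

Lemma dA_anti a y m i j : chart_image a y -> pd m (A a j i) y = - pd m (A a i j) y.
Proof.
move=> Vy; have [d1 D1] := @pd_intro R n (fun y => - A a i j y) y m _
  (deriv_inN (pd_line setT (@A_deriv a y m i j Vy))).
have [|_ ->] := @near_eq_pd R n (fun y => - A a i j y) (A a j i) y m _ d1; last by rewrite D1.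
have [d d0 dP] := open_normP (@chart_image_open _ _ _ a) Vy.
by exists d => // z /dP Vz; rewrite (A_anti i j Vz).
Qed.

(** [jacobi_chart] rewritten by antisymmetry into the index pattern that arises in [tangency]. *)
Lemma jacobi_contracted a y i k l : chart_image a y ->
  \sum_m (A a m k y * pd m (A a i l) y - A a m l y * pd m (A a i k) y + A a i m y * pd m (A a k l) y) = 0.
Proof.
move=> Vy; have [ay my] := chart_invP Vy.
have := jacobi_chart alpha i k l ay; rewrite my => H; rewrite -[RHS]H.
apply: eq_bigr => m _; rewrite (A_anti k m Vy) (A_anti l m Vy) (dA_anti m l i Vy) /Acoef; ring.
Qed.

(** Closedness of the constraint surface under the flow of [beta], i.e. the
    Jacobi identity. *)
Lemma tangency a y e w : chart_image a y ->
  dfA a y (fA a y e) w - dfA a y (fA a y w) e = fA a y (Qf a y e w).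
Proof.
move=> Vy; apply/rowP => i; rewrite fA_entry !mxE.
(* All terms are brought to triple sums; the coefficient of each product [e 0 k * w 0 l] is then a
   contracted Jacobi identity. *)
have E1 (p q : 'rV[R]_n) : \sum_j p 0 j * (\sum_m (fA a y q) 0 m * pd m (A a i j) y) =
    - \sum_k \sum_l \sum_m q 0 k * p 0 l * (A a m k y * pd m (A a i l) y).
  rewrite exchange_big -sumrN; apply: eq_bigr => l _; rewrite exchange_big mulr_sumr -sumrN.
  apply: eq_bigr => m _; rewrite fA_entry mulNr mulrN; congr (- _).
  rewrite mulr_suml mulr_sumr; apply: eq_bigr => k _; ring.
have E2 : \sum_j (Qf a y e w) 0 j * A a i j y =
    \sum_k \sum_l \sum_m e 0 k * w 0 l * (A a i m y * pd m (A a k l) y).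
  under eq_bigr => j _ do rewrite mxE mulr_suml.
  rewrite exchange_big; apply: eq_bigr => k _.
  under eq_bigr => j _ do rewrite mulr_suml.
  rewrite exchange_big; apply: eq_bigr => l _; apply: eq_bigr => j _; ring.
rewrite !E1 E2 !opprK.
rewrite [X in _ - X = _]exchange_big -sumrB -sumrN; apply: eq_bigr => k _.
rewrite -sumrB -sumrN; apply: eq_bigr => l _.
rewrite -sumrB -sumrN; apply/eqP; rewrite -subr_eq0 -sumrB; apply/eqP.
have := jacobi_contracted i k l Vy => /(congr1 (fun z => e 0 k * w 0 l * z)).
rewrite mulr0 mulr_sumr => H; rewrite -[RHS]H; apply: eq_bigr => m _; ring.
Qed.

Lemma fA_linear_w a y : linear (fA a y).
Proof. by move=> k v w; rewrite /fA mulmxDl -scalemxAl opprD scalerN. Qed.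

Lemma deriv_in_fA (D : set R) a (X W : R -> 'rV[R]_n) u X' W' : chart_image a (X u) ->
  deriv_in D X u X' -> deriv_in D W u W' ->
  deriv_in D (fun t => fA a (X t) (W t)) u (dfA a (X u) X' (W u) + fA a (X u) W').
Proof.
move=> VX dX dW; apply: deriv_in_mx => p i; rewrite ord1.
have -> : (fun t => fA a (X t) (W t) 0 i) = fun t => - \sum_j W t 0 j * A a i j (X t).
  by apply/funext => t; rewrite fA_entry.
have -> : (dfA a (X u) X' (W u) + fA a (X u) W') 0 i =
    - \sum_j (W' 0 j * A a i j (X u) + W u 0 j * \sum_m X' 0 m * pd m (A a i j) (X u)).
  by rewrite mxE fA_entry mxE big_split /= opprD addrC.
apply: deriv_inN; apply: deriv_in_sum => j _.
apply: deriv_inM; first exact: deriv_in_entry.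
exact: (chain_deriv_in (@chart_image_open _ _ _ a) (Acoef_Ck alpha 1 a i j) VX dX).
Qed.

Section Convergence.
Variables (T : Type) (F : set_system T).
Context {FF : Filter F}.
Variables (a : chart M) (X W E V : T -> 'rV[R]_n) (x0 w0 e0 v0 : 'rV[R]_n).
Hypotheses (Vx : chart_image a x0) (cX : X @ F --> x0) (cW : W @ F --> w0)
  (cE : E @ F --> e0) (cV : V @ F --> v0).

Lemma cvg_fA : (fun t => fA a (X t) (W t)) @ F --> fA a x0 w0.
Proof.
apply: cvg_mx_intro => p i; rewrite ord1 fA_entry.
under eq_fun do rewrite fA_entry.
apply: cvgN; apply: cvg_bigsum => j; apply: cvgM; first exact: cvg_mx_entry.
exact: cvg_Ck (Acoef_Ck alpha 0 a i j) Vx cX.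
Qed.

Lemma cvg_dfA : (fun t => dfA a (X t) (V t) (W t)) @ F --> dfA a x0 v0 w0.
Proof.
apply: cvg_mx_intro => p i; rewrite ord1 mxE.
under eq_fun do rewrite mxE.
apply: cvgN; apply: cvg_bigsum => j; apply: cvgM; first exact: cvg_mx_entry.
apply: cvg_bigsum => m; apply: cvgM; first exact: cvg_mx_entry.
have [_ /(_ m)[_ C1]] := Acoef_Ck alpha 1 a i j.
exact: cvg_Ck C1 Vx cX.
Qed.

Lemma cvg_Qf : (fun t => Qf a (X t) (E t) (W t)) @ F --> Qf a x0 e0 w0.
Proof.
apply: cvg_mx_intro => p i; rewrite ord1 mxE.
under eq_fun do rewrite mxE.
apply: cvg_bigsum => j; apply: cvg_bigsum => k; apply: cvgM; last exact: cvg_mx_entry.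
apply: cvgM; last exact: cvg_mx_entry.
have [_ /(_ i)[_ C1]] := Acoef_Ck alpha 1 a j k.
exact: cvg_Ck C1 Vx cX.
Qed.

End Convergence.

Lemma fA_change a b x (w : chart M -> 'rV[R]_n) : dom a x -> dom b x -> covector x w ->
  fA b (chart_map b x) (w b) = fA a (chart_map a x) (w a) *m transJ a b x.
Proof.
move=> ax bx [_ wE]; rewrite !fAE // /sharp mulNmx (alpha_change alpha ax bx) (wE a b ax bx).
by rewrite !trmx_mul trmxK !mulmxA.
Qed.

(** Second derivatives of the transition map: they are what keeps [Qf] from transforming like a
    covector. *)
Definition hess a b (j i k : 'I_n) y : R := pd j (pd i (fun z => trans a b z 0 k)) y.

Lemma hess_sym a b j i k y : overlap a b y -> hess a b j i k y = hess a b i j k y.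
Proof. by move=> oy; apply: (pd_swap j i (@overlap_open _ _ _ a b) (@trans_Ck _ _ M a b 2 k) oy). Qed.

(** [a] are the old coordinates, [b] the new ones; [transJ b a] is the Jacobian. *)
Lemma Qf_change a b x (e w : chart M -> 'rV[R]_n) i : dom a x -> dom b x ->
  covector x e -> covector x w ->
  let z := chart_map b x in
  Qf b z (e b) (w b) 0 i = \sum_p transJ b a x i p * Qf a (chart_map a x) (e a) (w a) 0 p
    + \sum_j \sum_l hess b a j i l z * (fA b z (w b) 0 j * e a 0 l - fA b z (e b) 0 j * w a 0 l).
Proof.
move=> ax bx [_ eE] [_ wE] z.
pose J p q := pd p (fun y => trans b a y 0 q).
have JE p q : transJ b a x p q = J p q z by rewrite transJE.
have eb p : e b 0 p = \sum_l e a 0 l * J p l z.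
  by rewrite (eE b a bx ax) mxE; apply: eq_bigr => l _; rewrite mxE JE.
have wb p : w b 0 p = \sum_l w a 0 l * J p l z.
  by rewrite (wE b a bx ax) mxE; apply: eq_bigr => l _; rewrite mxE JE.
have oz : overlap b a z by exists x.
have Vz : chart_image b z by exact: chart_map_image.
have Va : chart_image a (chart_map a x) by exact: chart_map_image.
have dJ p q : derivable (J p q) z (stdvec i).
  by have [_ /(_ p)[_ [_ /(_ i)[+ _]]]] := @trans_Ck _ _ M b a 2 q; apply.
(* The derivative of the law [alpha_a = J^T alpha_b J] along the [i]-th new coordinate: one term
   with the derivative of the bivector and two with second derivatives of the transition map. *)
have key l m : \sum_p J i p z * pd p (A a l m) (chart_map a x) =
    \sum_j \sum_k (hess b a i j l z * A b j k z * J k m z + J j l z * pd i (A b j k) z * J k m z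
      + J j l z * A b j k z * hess b a i k m z).
  have [] := @pd_comp R n n (overlap b a) (chart_image a) (fun j y => trans b a y 0 j)
    (A a l m) z i (@overlap_open _ _ _ b a) (@chart_image_open _ _ _ a) oz.
  - by rewrite trans_row transE.
  - by move=> j; exact: trans_Ck.
  - exact: Acoef_Ck.
  move=> _ pE; under eq_bigr => p _ do rewrite /J.
  have -> : \sum_p J i p z * pd p (A a l m) (chart_map a x) =
    pd i (fun y => A a l m (\row_j trans b a y 0 j)) z.
    by rewrite pE trans_row transE.
  have H : deriv_in setT (fun t : R => \sum_j \sum_k J j l (z + t *: stdvec i) * A b j k (z + t *: stdvec i) * J k m (z + t *: stdvec i)) 0
     (\sum_j \sum_k (hess b a i j l z * A b j k z * J k m z + J j l z * pd i (A b j k) z * J k m z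
      + J j l z * A b j k z * hess b a i k m z)).
    apply: deriv_in_sum => j _; apply: deriv_in_sum => k _.
    have := deriv_inM (deriv_inM (pd_line setT (dJ j l)) (pd_line setT (@A_deriv b z i j k Vz))) (pd_line setT (dJ k m)).
    by rewrite scale0r addr0 mulrDl.
  have [dH EH] := @pd_intro R n (fun y => \sum_j \sum_k J j l y * A b j k y * J k m y) z i _ H.
  rewrite -EH.
  have [|_ ->//] := @near_eq_pd R n (fun y => \sum_j \sum_k J j l y * A b j k y * J k m y)
    (fun y => A a l m (\row_j trans b a y 0 j)) z i _ dH.
  have [d d0 dP] := open_normP (@overlap_open _ _ _ b a) oz.
  exists d => // y /dP /overlap_inv[by' ay my].
  rewrite trans_row; have -> : A a l m (trans b a y) = alpha (chart_inv b y) a l m.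
    by rewrite /trans /= /Acoef coordK.
  rewrite (alpha_change alpha by' ay) !mxE.
  under [RHS]eq_bigr => k _ do rewrite mxE mulr_suml.
  rewrite exchange_big; apply: eq_bigr => j _; apply: eq_bigr => k _.
  by rewrite mxE !transJE // my /Acoef.
have step1 : \sum_p transJ b a x i p * Qf a (chart_map a x) (e a) (w a) 0 p =
    \sum_l \sum_m e a 0 l * w a 0 m * \sum_p J i p z * pd p (A a l m) (chart_map a x).
  under eq_bigr => p _ do rewrite [Qf _ _ _ _ _ _]mxE mulr_sumr.
  rewrite exchange_big; apply: eq_bigr => l _.
  under eq_bigr => p _ do rewrite mulr_sumr.
  rewrite exchange_big; apply: eq_bigr => m _; rewrite mulr_sumr.
  by apply: eq_bigr => p _; rewrite JE; ring.
have split3 : \sum_l \sum_m e a 0 l * w a 0 m * \sum_p J i p z * pd p (A a l m) (chart_map a x) =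
    \sum_j \sum_k ((\sum_l e a 0 l * hess b a i j l z) * A b j k z * w b 0 k
      + e b 0 j * pd i (A b j k) z * w b 0 k
      + e b 0 j * A b j k z * (\sum_m w a 0 m * hess b a i k m z)).
  under eq_bigr => l _ do under eq_bigr => m _ do rewrite key mulr_sumr.
  under eq_bigr => l _ do rewrite exchange_big.
  rewrite exchange_big; apply: eq_bigr => j _.
  under eq_bigr => l _ do under eq_bigr => m _ do rewrite mulr_sumr.
  under eq_bigr => l _ do rewrite exchange_big.
  rewrite exchange_big; apply: eq_bigr => k _.
  rewrite eb wb.
  have expand3 (p q h A1 J1 D1 J2 h' : R) : p * q * (h * A1 * J1 + J2 * D1 * J1 + J2 * A1 * h') =
      p * h * A1 * (q * J1) + p * J2 * D1 * (q * J1) + p * J2 * A1 * (q * h') by ring.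
  have mul3 (f g : 'I_n -> R) (q : R) : (\sum_l f l) * q * (\sum_m g m) = \sum_l \sum_m f l * q * g m.
    by rewrite !mulr_suml; apply: eq_bigr => l _; rewrite mulr_sumr.
  rewrite !mul3 -!big_split; apply: eq_bigr => l _ /=.
  by rewrite -!big_split; apply: eq_bigr => m _ /=; exact: expand3.
rewrite step1 split3 mxE.
(* Symmetry of the second derivatives turns the two extra sums into Hessians contracted with
   [fA]. *)
have term1 : \sum_j \sum_k (\sum_l e a 0 l * hess b a i j l z) * A b j k z * w b 0 k =
    - \sum_j \sum_l hess b a j i l z * (fA b z (w b) 0 j * e a 0 l).
  rewrite -sumrN; apply: eq_bigr => j _.
  have -> : \sum_k (\sum_l e a 0 l * hess b a i j l z) * A b j k z * w b 0 k =
      (\sum_l e a 0 l * hess b a i j l z) * - fA b z (w b) 0 j.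
    by rewrite fA_entry opprK mulr_sumr; apply: eq_bigr => k _; ring.
  rewrite mulrN mulr_suml; congr (- _); apply: eq_bigr => l _.
  by rewrite (hess_sym i j l oz); ring.
have term3 : \sum_j \sum_k e b 0 j * A b j k z * (\sum_m w a 0 m * hess b a i k m z) =
    \sum_j \sum_l hess b a j i l z * (fA b z (e b) 0 j * w a 0 l).
  rewrite exchange_big; apply: eq_bigr => k _.
  have -> : \sum_j e b 0 j * A b j k z * (\sum_m w a 0 m * hess b a i k m z) =
      fA b z (e b) 0 k * (\sum_m w a 0 m * hess b a i k m z).
    rewrite fA_entry -mulr_suml; congr (_ * _); rewrite -sumrN; apply: eq_bigr => j _.
    by rewrite (A_anti k j Vz) mulrN.
  by rewrite mulr_sumr; apply: eq_bigr => l _; rewrite (hess_sym i k l oz); ring.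
have -> : \sum_j \sum_l hess b a j i l z * (fA b z (w b) 0 j * e a 0 l - fA b z (e b) 0 j * w a 0 l) =
    \sum_j \sum_l hess b a j i l z * (fA b z (w b) 0 j * e a 0 l) -
    \sum_j \sum_l hess b a j i l z * (fA b z (e b) 0 j * w a 0 l).
  rewrite -sumrB; apply: eq_bigr => j _; rewrite -sumrB; apply: eq_bigr => l _.
  by rewrite mulrBr.
rewrite -term3.
have -> : \sum_j \sum_l hess b a j i l z * (fA b z (w b) 0 j * e a 0 l) =
  - \sum_j \sum_k (\sum_l e a 0 l * hess b a i j l z) * A b j k z * w b 0 k by rewrite term1 opprK.
have -> : \sum_j \sum_k ((\sum_l e a 0 l * hess b a i j l z) * A b j k z * w b 0 k
      + e b 0 j * pd i (A b j k) z * w b 0 k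
      + e b 0 j * A b j k z * (\sum_m w a 0 m * hess b a i k m z)) =
   \sum_j \sum_k (\sum_l e a 0 l * hess b a i j l z) * A b j k z * w b 0 k
   + \sum_j \sum_k e b 0 j * pd i (A b j k) z * w b 0 k
   + \sum_j \sum_k e b 0 j * A b j k z * (\sum_m w a 0 m * hess b a i k m z).
  by rewrite -!big_split; apply: eq_bigr => j _; rewrite -!big_split.
have -> : \sum_j \sum_k pd i (A b j k) z * e b 0 j * w b 0 k =
    \sum_j \sum_k e b 0 j * pd i (A b j k) z * w b 0 k.
  by apply: eq_bigr => j _; apply: eq_bigr => k _; rewrite [pd _ _ _ * _]mulrC.
ring.
Qed.

End Coordinates.

(** * Uniformity in the path parameter *)

Section CompactUniform.
Context {R : realType}.

(** Compactness in near-covering form along the filter of small positive [d]; by [anti] the property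
    holds eventually along this filter. *)
Lemma segment_uniform (p q : R) (P : R -> R -> Prop) :
  (forall d d' u, 0 < d' -> d' <= d -> P d u -> P d' u) ->
  (forall u0, p <= u0 <= q -> exists2 d : R, 0 < d & forall u, p <= u <= q -> `|u - u0| < d -> P d u) ->
  exists2 d : R, 0 < d & forall u, p <= u <= q -> P d u.
Proof.
move=> anti H.
have /compact_near_coveringP cov := @segment_compact R p q.
have := cov R (0 : R)^'+ (fun d u => p <= u <= q -> P d u) _ _.
case.
  move=> u0 /=; rewrite in_itv /= => /H[d d0 dP].
  exists ([set u | `|u - u0| < d], [set d' | 0 < d' /\ d' <= d]).
    split=> /=; first by apply/nbhs_ballP; exists d => // u; rewrite /ball /= distrC.
    by near=> d'; split; near: d'; [exact: nbhs_right_gt|exact: nbhs_right_le].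
  by move=> [u d'] [/= ud [d'0 d'd]] uI; apply: (anti d) => //; exact: dP.
move=> e /= e0 eP; exists (e / 2); first by rewrite divr_gt0.
move=> u uI; apply: (eP (e / 2)) => //.
- by rewrite /ball_ /= sub0r normrN gtr0_norm ?divr_gt0 // ltr_pdivrMr // ltr_pMr // ltr1n.
- by rewrite divr_gt0.
Unshelve. all: by end_near. Qed.

Definition I2 : set (R * R) := I01 `*` I01.

(** Neighbourhoods in the square of flow time and path parameter. Joint continuity in both is the
    source of all estimates uniform in [u]. *)
Definition near2 (p : R * R) : set_system (R * R) := within I2 (nbhs p).

#[global] Instance near2_filter p : Filter (near2 p).
Proof. exact: within_filter. Qed.

Lemma near2P (s0 u0 : R) (P : R * R -> Prop) :
  (\forall p \near near2 (s0, u0), P p) <->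
  exists2 d : R, 0 < d & forall s u, I01 s -> I01 u -> `|s - s0| < d -> `|u - u0| < d -> P (s, u).
Proof.
rewrite /near2 near_withinE; split=> [/nbhs_ballP[d /= d0 dP]|[d d0 dP]].
  exists d => // s u Is Iu sd ud; apply: dP => //.
  by split; rewrite /ball /= distrC.
apply/nbhs_ballP; exists d => //= -[s u] [/= sd ud] [/= Is Iu].
by apply: dP => //; rewrite distrC.
Qed.

(** The mean value inequality is applied to [f t u - t *: g s0 u], whose derivative [g t u - g s0 u]
    is small by joint continuity of [g]. *)
Lemma uniform_increment m n (f g : R -> R -> 'M[R]_(m, n)) s0 u0 : I01 s0 -> I01 u0 ->
  (\forall p \near near2 (s0, u0), deriv_in I01 (f^~ p.2) p.1 (g p.1 p.2)) ->
  (fun p : R * R => g p.1 p.2) @ near2 (s0, u0) --> g s0 u0 ->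
  forall e : R, 0 < e -> exists2 d : R, 0 < d & forall u h, I01 u -> `|u - u0| < d ->
    I01 (s0 + h) -> `|h| < d -> `|f (s0 + h) u - f s0 u - h *: g s0 u| <= e * `|h|.
Proof.
move=> Is Iu /near2P[d1 d10 d1P] /cvgrPdist_le cg e e0.
have e20 : 0 < e / 2 by rewrite divr_gt0.
have /near2P[d2 d20 d2P] := cg _ e20.
exists (Num.min d1 d2); first by rewrite lt_min d10.
move=> u h Iu'; rewrite !lt_min => /andP[u1 u2] Ish /andP[h1 h2].
have s00 : `|s0 - s0| < d2 by rewrite subrr normr0.
pose F t := f t u - t *: g s0 u.
have dlin (D : set R) (w : 'M[R]_(m, n)) t : deriv_in D (fun t => t *: w) t w.
  by have := deriv_in_scale (@deriv_in_id R D t) (@deriv_in_cst R _ D w t); rewrite scale1r scaler0 addr0.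
have seg a b : I01 a -> I01 b -> a <= b -> (forall t, a <= t <= b -> `|t - s0| <= `|h|) ->
    `|F b - F a| <= e * (b - a).
  move=> /andP[a0 a1] /andP[b0 b1] ab near.
  have inI t : a <= t <= b -> I01 t by move=> /andP[? ?]; apply/andP; split; lra.
  apply: (@mean_value R _ _ a b e F (fun t => g t u - g s0 u)) => // t tab.
    apply: deriv_inB; last exact: dlin.
    apply: deriv_inS (d1P t u (inI _ tab) Iu' _ u1); first by move=> v /= /inI.
    by apply: le_lt_trans h1; exact: near.
  have t2 : `|t - s0| < d2 by apply: le_lt_trans h2; exact: near.
  have H1 := d2P t u (inI _ tab) Iu' t2 u2.
  have H2 := d2P s0 u Is Iu' s00 u2.
  have -> : g t u - g s0 u = (g s0 u0 - g s0 u) - (g s0 u0 - g t u) by rewrite opprB [RHS]addrC subrKA.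
  by rewrite (le_trans (ler_normB _ _)) //; move: H1 H2 => /=; lra.
have -> : f (s0 + h) u - f s0 u - h *: g s0 u = F (s0 + h) - F s0.
  by apply/matrixP => i j; rewrite /F !mxE; ring.
have [h0|h0] := leP 0 h.
  have := seg s0 (s0 + h) Is Ish; rewrite lerDl [s0 + h - s0]addrAC subrr add0r ger0_norm //; apply => //.
  by move=> t /andP[t1 t2]; rewrite !ger0_norm ?subr_ge0 // lerBlDl.
have -> : `|h| = s0 - (s0 + h) by rewrite ltr0_norm //; ring.
rewrite distrC; apply: seg => //; first by rewrite gerDl ltW.
rewrite ltr0_norm //.
by move=> t /andP[t1 t2]; rewrite ler0_norm ?subr_le0 // lerN2 lerBrDl.
Qed.

End CompactUniform.

(** * Configurations, forms along paths and change of chart *)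

Section Configurations.
Context {R : realType} {n : nat} {M : manifold R n} (alpha : poisson M).
Implicit Types (a b : chart M) (c : config M) (x : M).

Lemma path_open_near (X : R -> M) (U : set M) u : {within I01, continuous X} ->
  I01 u -> open U -> U (X u) ->
  exists2 d : R, 0 < d & forall v, I01 v -> `|v - u| < d -> U (X v).
Proof.
move=> /subspace_continuousP cX Iu oU UX.
have : (X @ within I01 (nbhs u)) U by apply: (cX u Iu); exact: open_nbhs_nbhs.
rewrite /fmap /= near_simpl near_withinE => /nbhs_ballP[d /= d0 dP].
by exists d => // v Iv vu; apply: dP => //; rewrite /ball /= distrC.
Qed.

Section Constraint.
Variable c : config M.
Hypothesis hc : constraint alpha c.

Lemma config_near (U : set M) u : I01 u -> open U -> U (Xp c u) ->
  exists2 d : R, 0 < d & forall v, I01 v -> `|v - u| < d -> U (Xp c v).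
Proof. by move=> Iu; apply: path_open_near => //; have [_ []] := hc. Qed.

Lemma config_deriv a u : I01 u -> dom a (Xp c u) ->
  deriv_in I01 (Xcoord c a) u (fA alpha a (Xcoord c a u) (eta c u a)).
Proof.
move=> Iu au; have [_ [_ /(_ a)[H _]] _ E] := hc.
have := derivableI_deriv_in (H u (conj Iu au)).
have := E a u (conj Iu au) => /eqP; rewrite addr_eq0 => /eqP ->.
by rewrite /Xcoord fAE.
Qed.

Lemma config_covector u : I01 u -> covector (Xp c u) (eta c u).
Proof. by have [_ _ [+ _] _] := hc; apply. Qed.

Lemma config_eta_cont a u : I01 u -> dom a (Xp c u) -> cont_in I01 (fun v => eta c v a) u.
Proof.
move=> Iu au e e0; have [_ _ [_ /(_ a)/cont_in_within/(_ u (conj Iu au) e e0)[d d0 dP]] _] := hc.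
have [d' d'0 d'P] := config_near Iu (@dom_open _ _ M a) au.
exists (Num.min d d'); first by rewrite lt_min d0.
move=> v Iv; rewrite lt_min => /andP[vd vd']; apply: dP => //; split => //=.
exact: d'P.
Qed.

(** [dspace] moves the point with the form frozen, [dtime] moves the form. The latter needs
    difference quotients that converge uniformly on a ball, as the point of evaluation moves too. *)
Lemma form_along (beta : R -> field_of_comps M) a u : C1_forms beta -> I01 u -> dom a (Xp c u) ->
  derivableI (fun v => beta v (Xp c v) a) u.
Proof.
move=> [obeta [beta' Hb]] Iu au.
pose F v y := beta v (chart_inv a y) a; pose F' v y := beta' v (chart_inv a y) a.
set x0 := Xcoord c a u.
have Vx : chart_image a x0 by exact: chart_map_image.
have [r r0 rP] := open_normP (@chart_image_open _ _ _ a) Vx.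
have Ksub : cball x0 (r / 2) `<=` chart_image a.
  by move=> y; rewrite /cball /= => yr; apply: rP; apply: le_lt_trans yr _; lra.
have sF v : I01 v -> smooth_on (chart_image a) (F v).
  by move=> /obeta[_]; apply.
have [[_ /(_ a) sF'] cvg1 _] := Hb u Iu.
have dX := config_deriv Iu au.
have [d0 d00 d0P] := config_near Iu (@dom_open _ _ M a) au.
have dspace : deriv_in I01 (fun v => F u (Xcoord c a v)) u
    (\row_j \sum_i (fA alpha a x0 (eta c u a)) 0 i * pd i (fun y => F u y 0 j) x0).
  apply: deriv_in_mx => p j; rewrite ord1 mxE.
  apply: (chain_deriv_in (@chart_image_open _ _ _ a)) Vx dX.
  by apply: smooth_on_entry; [exact: chart_image_open|exact: sF].
set l2 := \row_j _ in dspace.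
suff H : deriv_in I01 (fun v => beta v (Xp c v) a) u (F' u x0 + l2) by have [] := deriv_in_dI Iu H.
apply: (@deriv_in_near _ _ _ _ (fun v => F v (Xcoord c a v))).
- by exists d0 => // v Iv vd; rewrite /F /Xcoord coordK //; exact: d0P.
- by rewrite /F /Xcoord coordK.
have dtime : deriv_in I01 (fun v => F v (Xcoord c a v) - F u (Xcoord c a v)) u (F' u x0).
  move=> e e0; have e20 : 0 < e / 2 by rewrite divr_gt0.
  have r20 : 0 < r / 2 by rewrite divr_gt0.
  have := cvg1 a (cball x0 (r / 2)) [::] (e / 2) (@cball_compact _ _ _ _) Ksub e20.
  rewrite /increments near_withinE => /nbhs_ballP[d1 /= d10 d1P].
  have [d2 d20 d2P] := deriv_in_cont dX r20.
  have cF' : {for x0, continuous (F' u)} by have [] := sF' [::] x0 Vx.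
  have /continuous_atP /(_ _ e20)[d3 d30 d3P] := cF'.
  have d320 : 0 < d3 / 2 by rewrite divr_gt0.
  have [d4 d40 d4P] := deriv_in_cont dX d320.
  exists (Num.min (Num.min d1 d2) d4); first by rewrite !lt_min d10 d20.
  move=> v Iv; rewrite !lt_min -andbA => /and3P[v1 v2 v4].
  rewrite subrr subr0.
  have [->|vu] := eqVneq v u; first by rewrite !subrr scale0r subrr !normr0 mulr0.
  have vu0 : v - u != 0 by rewrite subr_eq0.
  have := d1P (v - u); rewrite /ball /= sub0r normrN subrKC => /(_ v1 vu0 Iv (Xcoord c a v)).
  rewrite /= => /(_ (d2P v Iv v2)) H1.
  have H3 : `|F' u (Xcoord c a v) - F' u x0| <= e / 2.
    by apply: d3P; apply: le_lt_trans (d4P v Iv v4) _; lra.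
  have -> : F v (Xcoord c a v) - F u (Xcoord c a v) - (v - u) *: F' u x0 =
     (v - u) *: ((diffq (fun w => beta w (chart_inv a (Xcoord c a v)) a) u (v - u) - F' u (Xcoord c a v))
       + (F' u (Xcoord c a v) - F' u x0)).
    by rewrite subrKA /diffq subrKC scalerBr scalerA mulfV // scale1r.
  rewrite normrZ mulrC ler_wpM2r // (le_trans (ler_normD _ _)) //.
  by move: H1 H3; rewrite /F'; lra.
apply: (@deriv_in_ext _ _ _ _ (fun v => (F v (Xcoord c a v) - F u (Xcoord c a v)) + F u (Xcoord c a v))) => //.
  by move=> v _; rewrite subrK.
exact: deriv_inD.
Qed.

End Constraint.

Section ChangeOfChart.
Variables (a b : chart M).

Lemma cvg_chart_change (T : Type) (F : set_system T) {FF : Filter F} (X : T -> M) x0 :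
  dom a x0 -> dom b x0 -> (\forall t \near F, dom a (X t)) ->
  (fun t => chart_map a (X t)) @ F --> chart_map a x0 ->
  (\forall t \near F, dom b (X t)) /\ (fun t => chart_map b (X t)) @ F --> chart_map b x0.
Proof.
move=> ax bx aX cX.
have o0 := overlapP ax bx.
have [d d0 dP] := open_normP (@overlap_open _ _ _ a b) o0.
have near_o : \forall t \near F, overlap a b (chart_map a (X t)).
  by move/cvgrPdist_lt : cX => /(_ d d0); apply: filterS => t; rewrite distrC => /dP.
split; first by apply: filterS2 aX near_o => t at_ /overlap_inv[_]; rewrite coordK.
have -> : chart_map b x0 = trans a b (chart_map a x0) by rewrite transE.
apply: (cvg_trans (G := (fun t => trans a b (chart_map a (X t))) @ F)).
  apply: near_eq_cvg; apply: filterS aX => t at_; by rewrite transE.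
apply: cvg_mx_intro => p j; rewrite ord1.
exact: (cvg_Ck (@trans_Ck _ _ M a b 0 j) o0 cX).
Qed.

Lemma cvg_covector_change (T : Type) (F : set_system T) {FF : Filter F} (X : T -> M)
    (w : T -> chart M -> 'rV[R]_n) x0 w0 :
  dom a x0 -> dom b x0 -> covector x0 w0 ->
  (\forall t \near F, [/\ dom a (X t), dom b (X t) & covector (X t) (w t)]) ->
  (fun t => chart_map b (X t)) @ F --> chart_map b x0 ->
  (fun t => w t a) @ F --> w0 a -> (fun t => w t b) @ F --> w0 b.
Proof.
move=> ax bx [_ w0E] H cX cw.
have o0 := overlapP bx ax.
apply: (cvg_trans (G := (fun t => \row_i \sum_k w t a 0 k * pd i (fun z => trans b a z 0 k) (chart_map b (X t))) @ F)).
  apply: near_eq_cvg; apply: filterS H => t [at_ bt [_ wE]].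
  rewrite (wE b a bt at_); apply/rowP => i; rewrite [LHS]mxE [RHS]mxE; apply: eq_bigr => k _.
  by rewrite mxE transJE.
have -> : w0 b = \row_i \sum_k w0 a 0 k * pd i (fun z => trans b a z 0 k) (chart_map b x0).
  rewrite (w0E b a bx ax); apply/rowP => i; rewrite [LHS]mxE [RHS]mxE; apply: eq_bigr => k _.
  by rewrite mxE transJE.
apply: cvg_mx_intro => p i; rewrite mxE; under eq_fun do rewrite mxE.
apply: cvg_bigsum => k; apply: cvgM; first exact: cvg_mx_entry.
have [_ /(_ i)[_ C0]] := @trans_Ck _ _ M b a 1 k.
exact: (cvg_Ck C0 o0 cX).
Qed.

Lemma deriv_chart_change (D : set R) (X : R -> M) u X' : dom a (X u) -> dom b (X u) ->
  (exists2 d : R, 0 < d & forall v, D v -> `|v - u| < d -> dom a (X v)) ->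
  deriv_in D (fun t => chart_map a (X t)) u X' ->
  deriv_in D (fun t => chart_map b (X t)) u (X' *m transJ a b (X u)).
Proof.
move=> ax bx [d d0 dP] dX.
apply: (@deriv_in_near _ _ _ _ (fun t => trans a b (chart_map a (X t)))).
- by exists d => // v Dv vd; rewrite transE //; exact: dP.
- by rewrite transE.
apply: deriv_in_mx => p j; rewrite ord1.
have := chain_deriv_in (@overlap_open _ _ _ a b) (@trans_Ck _ _ M a b 1 j) (overlapP ax bx) dX.
by congr deriv_in; rewrite mxE; apply: eq_bigr => k _; rewrite transJE.
Qed.

(** Product rule for [w_b = w_a J^T] along a curve: the derivative of the Jacobian contributes the
    Hessian contracted with the velocity. *)
Lemma deriv_covector_change (D : set R) (X : R -> M) (w : R -> chart M -> 'rV[R]_n) u X' w' :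
  dom a (X u) -> dom b (X u) -> covector (X u) (w u) ->
  (exists2 d : R, 0 < d & forall v, D v -> `|v - u| < d ->
     [/\ dom a (X v), dom b (X v) & covector (X v) (w v)]) ->
  deriv_in D (fun t => chart_map b (X t)) u X' ->
  deriv_in D (fun t => w t a) u w' ->
  deriv_in D (fun t => w t b) u (\row_i \sum_k (w' 0 k * transJ b a (X u) i k +
     w u a 0 k * \sum_j X' 0 j * hess b a j i k (chart_map b (X u)))).
Proof.
move=> ax bx wu [d d0 dP] dX dw.
have E v : dom a (X v) -> dom b (X v) -> covector (X v) (w v) ->
    w v b = \row_i \sum_k w v a 0 k * pd i (fun z => trans b a z 0 k) (chart_map b (X v)).
  move=> av bv [_ wE]; rewrite (wE b a bv av); apply/rowP => i; rewrite [LHS]mxE [RHS]mxE.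
  by apply: eq_bigr => k _; rewrite mxE transJE.
apply: (@deriv_in_near _ _ _ _ (fun v => \row_i \sum_k w v a 0 k * pd i (fun z => trans b a z 0 k) (chart_map b (X v)))).
- by exists d => // v Dv vd; have [? ? ?] := dP v Dv vd; exact: E.
- exact: E.
apply: deriv_in_mx => p i; rewrite mxE; under [X in deriv_in _ X]eq_fun do rewrite mxE.
apply: deriv_in_sum => k _; rewrite transJE //.
apply: deriv_inM; first exact: deriv_in_entry.
have [_ /(_ i)[_ C1]] := @trans_Ck _ _ M b a 2 k.
exact: (chain_deriv_in (@overlap_open _ _ _ b a) C1 (overlapP bx ax) dX).
Qed.

End ChangeOfChart.

End Configurations.

Lemma cvg_row {R : realType} n (T : Type) (F : set_system T) {FF : Filter F} (f : 'I_n -> T -> R) (l : 'I_n -> R) :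
  (forall i, f i @ F --> l i) -> (fun t => \row_i f i t) @ F --> \row_i l i.
Proof.
move=> H; apply: cvg_mx_intro => p i; rewrite mxE.
by have -> : (fun t => (\row_i f i t) p i) = f i by apply/funext => t; rewrite mxE.
Qed.

(** * From one chart per point to configurations and velocities *)

Section LocalData.
Context {R : realType} {n : nat} {M : manifold R n} (alpha : poisson M).
Implicit Types (a b : chart M) (c : config M).

(** The constraint at one parameter in one chart. It passes to other charts ([solves_change]), so a
    single chart around each point is enough to recognize a configuration ([constraint_intro]). *)
Definition solves_at c a u :=
  [/\ exists2 d : R, 0 < d & forall v, I01 v -> `|v - u| < d -> dom a (Xp c v),
      deriv_in I01 (Xcoord c a) u (fA alpha a (Xcoord c a u) (eta c u a)) &
      cont_in I01 (fun v => eta c v a) u].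

Lemma constraint_solves c a u : constraint alpha c -> I01 u -> dom a (Xp c u) -> solves_at c a u.
Proof.
move=> hc Iu au; split.
- exact: (config_near hc Iu (@dom_open _ _ M a) au).
- exact: (config_deriv hc).
- exact: (config_eta_cont hc).
Qed.

Lemma cont_in_cvg {W : normedModType R} (f : R -> W) u : I01 u ->
  cont_in I01 f u <-> f @ within I01 (nbhs u) --> f u.
Proof.
move=> Iu; split=> [H|/cvgrPdist_le H].
  apply/cvgrPdist_le => e e0; have [d d0 dP] := H e e0.
  rewrite near_withinE; apply/nbhs_ballP; exists d => // v /=.
  by rewrite /ball /= distrC => vd Iv; rewrite distrC; exact: dP.
move=> e /H; rewrite near_withinE => /nbhs_ballP[d /= d0 dP].
by exists d => // v Iv vd; rewrite distrC; apply: dP => //; rewrite /ball /= distrC.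
Qed.

Lemma within_I01P u (P : R -> Prop) :
  (exists2 d : R, 0 < d & forall v, I01 v -> `|v - u| < d -> P v) <->
  \forall v \near within I01 (nbhs u), P v.
Proof.
rewrite near_withinE; split=> [[d d0 dP]|/nbhs_ballP[d /= d0 dP]].
  by apply/nbhs_ballP; exists d => // v; rewrite /ball /= distrC => vd Iv; exact: dP.
by exists d => // v Iv vd; apply: dP => //; rewrite /ball /= distrC.
Qed.

Lemma solves_change c a b u : (forall v, I01 v -> covector (Xp c v) (eta c v)) -> I01 u ->
  dom b (Xp c u) -> solves_at c a u -> solves_at c b u.
Proof.
move=> cov Iu bu [na dX ce].
have au : dom a (Xp c u) by have [d d0 dP] := na; apply: dP => //; rewrite subrr normr0.
have nea := (within_I01P u (fun v => dom a (Xp c v))).1 na.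
have cX := (cont_in_cvg (Xcoord c a) Iu).1 (deriv_in_cont dX).
have [neb cXb] := cvg_chart_change au bu nea cX.
split.
- exact/within_I01P.
- rewrite /Xcoord (fA_change alpha au bu (cov u Iu)).
  exact: deriv_chart_change.
- apply/(cont_in_cvg _ Iu).
  apply: (cvg_covector_change au bu (cov u Iu) _ cXb); last exact/(cont_in_cvg (fun v => eta c v a) Iu).
  have nI : \forall v \near within I01 (nbhs u), I01 v by rewrite near_withinE; near=> v.
  by apply: filterS3 nea neb nI => v ? ? /cov.
Unshelve. all: by end_near. Qed.

Lemma constraint_intro c : (forall u, Xp c u = Xp c (clamp u) /\ eta c u = eta c (clamp u)) ->
  (forall u, I01 u -> covector (Xp c u) (eta c u)) ->
  (forall u, I01 u -> exists a, solves_at c a u) -> constraint alpha c.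
Proof.
move=> cl cov H.
have S b u : I01 u -> dom b (Xp c u) -> solves_at c b u.
  by move=> Iu bu; have [a /(solves_change cov Iu bu)] := H u Iu.
have dE b u : I01 u -> dom b (Xp c u) -> derivableI (Xcoord c b) u /\
    dI (Xcoord c b) u = fA alpha b (Xcoord c b u) (eta c u b).
  by move=> Iu bu; have [_ dX _] := S b u Iu bu; have := deriv_in_dI Iu dX.
split=> //; last by move=> a u [Iu au]; rewrite (dE a u Iu au).2 /Xcoord fAE // addNr.
- split.
    apply/subspace_continuousP => u Iu.
    have [a [[d d0 dP] dX _]] := H u Iu.
    have au : dom a (Xp c u) by apply: dP => //; rewrite subrr normr0.
    move=> W; rewrite nbhsE /= => -[V [oV Vu] VW].
    (* Continuity into the manifold follows from that of the coordinates because charts send open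
       sets to open sets. *)
    have V0 : (chart_map a @` (dom a `&` V)) (Xcoord c a u) by exists (Xp c u).
    have [e e0 eP] := open_normP (open_chart_image oV) V0.
    have [d' d'0 d'P] : exists2 d : R, 0 < d & forall v, I01 v -> `|v - u| < d -> `|Xcoord c a v - Xcoord c a u| < e.
      have e20 : 0 < e / 2 by rewrite divr_gt0.
      have [d' d'0 d'P] := deriv_in_cont dX e20; exists d' => // v Iv vd.
      by apply: le_lt_trans (d'P v Iv vd) _; lra.
    apply: ((within_I01P u (fun v => W (Xp c v))).1 _).
    exists (Num.min d d') => /=; first by rewrite lt_min d0.
    move=> v Iv; rewrite lt_min => /andP[vd vd']; apply: VW.
    have [x [ax Vx] E] := eP _ (d'P v Iv vd').
    by rewrite -(coordK (dP v Iv vd)) -[chart_map _ _]E coordK.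
  move=> a; split=> [u [Iu au]|]; first by have [] := dE a u Iu au.
  apply: (@subspace_eq_continuous _ _ _ (fun u => fA alpha a (Xcoord c a u) (eta c u a))).
    by move=> u; rewrite inE => -[Iu au]; rewrite [RHS](dE a u Iu au).2.
  apply/cont_in_within => u [Iu au].
  suff : cont_in I01 (fun u => fA alpha a (Xcoord c a u) (eta c u a)) u.
    by move=> K e /K[d d0 dP]; exists d => // v [Iv _]; exact: dP.
  have [_ dX ce] := S a u Iu au.
  apply/(cont_in_cvg _ Iu); apply: cvg_fA; first exact: chart_map_image.
    by apply/(cont_in_cvg (Xcoord c a) Iu); exact: deriv_in_cont dX.
  exact/(cont_in_cvg (fun v => eta c v a) Iu).
- split=> // a; apply/cont_in_within => u [Iu au].
  have [_ _ ce] := S a u Iu au.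
  by move=> e /ce[d d0 dP]; exists d => // v [Iv _]; exact: dP.
Qed.

Lemma xi_etaE (beta : R -> field_of_comps M) c a u :
  xi_eta alpha beta c a u = dI (fun v => beta v (Xp c v) a) u +
    Qf alpha a (Xcoord c a u) (eta c u a) (beta u (Xp c u) a).
Proof. by []. Qed.

(** Differentiating [beta] along [X] gives a Hessian term along the velocity of the path, which
    cancels against one in [Qf_change]. The surviving Hessian term is contracted with the flow
    velocity of [X], as the flow-time derivative of the transformation law of [eta] demands. *)
Lemma xi_eta_change (beta : R -> field_of_comps M) c a b u : C1_forms beta -> constraint alpha c ->
  I01 u -> dom a (Xp c u) -> dom b (Xp c u) ->
  xi_eta alpha beta c b u = \row_i \sum_k (xi_eta alpha beta c a u 0 k * transJ b a (Xp c u) i k +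
    eta c u a 0 k * \sum_j fA alpha b (Xcoord c b u) (beta u (Xp c u) b) 0 j * hess b a j i k (Xcoord c b u)).
Proof.
move=> hb hc Iu au bu.
have bcov v : I01 v -> covector (Xp c v) (beta v (Xp c v)).
  by move=> /(hb.1 v)[+ _]; apply.
have ecov := config_covector hc Iu.
have [da da0 daP] := config_near hc Iu (@dom_open _ _ M a) au.
have [db db0 dbP] := config_near hc Iu (@dom_open _ _ M b) bu.
have dbeta := @deriv_covector_change _ _ M a b I01 (Xp c) (fun v => beta v (Xp c v)) u _ _ au bu (bcov u Iu) _
  (config_deriv hc Iu bu) (derivableI_deriv_in (form_along hc hb Iu au)).
rewrite !xi_etaE (deriv_in_dI Iu (dbeta _)).2; last first.
  exists (Num.min da db); first by rewrite lt_min da0.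
  move=> v Iv; rewrite lt_min => /andP[va vb]; split; [exact: daP|exact: dbP|exact: bcov].
apply/rowP => i; rewrite mxE [X in X + _]mxE (Qf_change alpha i au bu ecov (bcov u Iu)) [RHS]mxE.
set J := transJ b a _; set D := dI _ _; set Q := Qf _ _ _ _ _; set z := chart_map b _.
set fb := fA _ _ _ (beta _ _ _); set fe := fA _ _ _ (eta _ _ _).
have -> : \sum_j \sum_l hess b a j i l z * (fb 0 j * eta c u a 0 l - fe 0 j * beta u (Xp c u) a 0 l) =
    \sum_l (eta c u a 0 l * (\sum_j fb 0 j * hess b a j i l z) - beta u (Xp c u) a 0 l * (\sum_j fe 0 j * hess b a j i l z)).
  rewrite exchange_big; apply: eq_bigr => l _; rewrite !mulr_sumr -sumrB; apply: eq_bigr => j _; ring.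
rewrite -!big_split; apply: eq_bigr => k _ /=.
rewrite [(D + Q) 0 k]mxE -/z /Xcoord -/z -/fe; ring.
Qed.

Section Curves.
Variables (beta : R -> field_of_comps M) (gamma : R -> config M).
Hypotheses (hb : C1_forms beta) (hg : forall s, I01 s -> constraint alpha (gamma s)).

(** A one-chart substitute for [has_velocity]: the flow equations hold near a point of the square,
    and the quantities in them are jointly continuous at it. *)
Definition regular_at a s0 u0 :=
  [/\ \forall p \near near2 (s0, u0), dom a (Xp (gamma p.1) p.2),
      \forall p \near near2 (s0, u0), deriv_in I01 (fun t => Xcoord (gamma t) a p.2) p.1
         (fA alpha a (Xcoord (gamma p.1) a p.2) (beta p.2 (Xp (gamma p.1) p.2) a)),
      \forall p \near near2 (s0, u0), deriv_in I01 (fun t => eta (gamma t) p.2 a) p.1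
         (xi_eta alpha beta (gamma p.1) a p.2) &
      [/\ (fun p : R * R => Xcoord (gamma p.1) a p.2) @ near2 (s0, u0) --> Xcoord (gamma s0) a u0,
          (fun p : R * R => eta (gamma p.1) p.2 a) @ near2 (s0, u0) --> eta (gamma s0) u0 a,
          (fun p : R * R => beta p.2 (Xp (gamma p.1) p.2) a) @ near2 (s0, u0) --> beta u0 (Xp (gamma s0) u0) a &
          (fun p : R * R => xi_eta alpha beta (gamma p.1) a p.2) @ near2 (s0, u0) --> xi_eta alpha beta (gamma s0) a u0]].

Lemma near2I (q : R * R) (P Q : R * R -> Prop) : (\forall p \near near2 q, P p) ->
  (\forall p \near near2 q, Q p) -> \forall p \near near2 q, P p /\ Q p.
Proof. exact: filterI. Qed.

Lemma near2_open s0 u0 (P : R * R -> Prop) : (\forall p \near near2 (s0, u0), P p) ->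
  \forall p \near near2 (s0, u0), exists2 d : R, 0 < d & forall v, I01 v -> `|v - p.1| < d -> P (v, p.2).
Proof.
move=> /near2P[d d0 dP]; apply/near2P; exists (d / 2); first by rewrite divr_gt0.
move=> s u Is Iu sd ud /=; exists (d / 2); first by rewrite divr_gt0.
move=> v Iv vs; apply: dP => //; last by apply: lt_le_trans ud _; lra.
by have := ler_distD s v s0; lra.
Qed.

Lemma near2_I2 (s0 u0 : R) : \forall p \near near2 (s0, u0), I01 p.1 /\ I01 p.2.
Proof. by apply/near2P; exists 1. Qed.

Lemma bcov s u : I01 u -> covector (Xp (gamma s) u) (beta u (Xp (gamma s) u)).
Proof. by move=> /(hb.1 u)[+ _]; apply. Qed.

(** A curve is built in one chart but its velocity is tested in all of them; this closes the gap. *)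
Lemma regular_change a b s0 u0 : I01 s0 -> I01 u0 -> dom b (Xp (gamma s0) u0) ->
  regular_at a s0 u0 -> regular_at b s0 u0.
Proof.
move=> Is Iu bs [na dX de [cX ce cb cxi]].
have ecov s u : I01 s -> I01 u -> covector (Xp (gamma s) u) (eta (gamma s) u).
  by move=> /hg hc; exact: (config_covector hc).
have as_ : dom a (Xp (gamma s0) u0).
  have /near2P[d d0 dP] := na; have := dP s0 u0 Is Iu; rewrite !subrr normr0 /=; exact.
have [nb cXb] := cvg_chart_change (X := fun p : R * R => Xp (gamma p.1) p.2) as_ bs na cX.
have nI := near2_I2 s0 u0.
have ceb : (fun p : R * R => eta (gamma p.1) p.2 b) @ near2 (s0, u0) --> eta (gamma s0) u0 b.
  apply: (cvg_covector_change (X := fun p : R * R => Xp (gamma p.1) p.2) (w := fun p : R * R => eta (gamma p.1) p.2)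
    as_ bs (ecov s0 u0 Is Iu) _ cXb ce).
  by apply: filterS3 na nb nI => p ? ? [? ?]; split=> //; exact: ecov.
have cbb : (fun p : R * R => beta p.2 (Xp (gamma p.1) p.2) b) @ near2 (s0, u0) --> beta u0 (Xp (gamma s0) u0) b.
  apply: (cvg_covector_change (X := fun p : R * R => Xp (gamma p.1) p.2) (w := fun p : R * R => beta p.2 (Xp (gamma p.1) p.2))
    as_ bs (bcov s0 Iu) _ cXb cb).
  by apply: filterS3 na nb nI => p ? ? [? ?]; split=> //; exact: bcov.
have oz := overlapP bs as_.
split; [exact: nb| | |split; [exact: cXb|exact: ceb|exact: cbb|]].
- have na' := near2_open na; have nn := near2I na nI.
  apply: filterS (near2I (near2I nb dX) (near2I na' nn)) => p [[bp dXp] [nap [ap [I1 I2']]]].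
  rewrite /Xcoord (fA_change alpha ap bp (bcov p.1 I2')).
  exact: (deriv_chart_change (X := fun t => Xp (gamma t) p.2)).
- have nab' := near2_open (near2I na nb); have nn := near2I (near2I na nb) nI.
  apply: filterS (near2I (near2I dX de) (near2I nab' nn)) => p [[dXp dep] [[d d0 dP] [[ap bp] [I1 I2']]]].
  rewrite (xi_eta_change hb (hg I1) I2' ap bp).
  apply: (deriv_covector_change (X := fun t => Xp (gamma t) p.2) (w := fun t => eta (gamma t) p.2) ap bp) => //.
  + exact: ecov.
  + by exists d => // v Iv vd; have [? ?] := dP v Iv vd; split=> //; exact: ecov.
  + rewrite [X in deriv_in _ _ _ X](fA_change alpha ap bp (bcov p.1 I2')).
    apply: (deriv_chart_change (X := fun t => Xp (gamma t) p.2)) => //.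
    by exists d => // v Iv vd; have [] := dP v Iv vd.
- rewrite (xi_eta_change hb (hg Is) Iu as_ bs).
  apply: (cvg_trans (G := (fun p : R * R => \row_i \sum_k (xi_eta alpha beta (gamma p.1) a p.2 0 k *
      pd i (fun z => trans b a z 0 k) (Xcoord (gamma p.1) b p.2) +
      eta (gamma p.1) p.2 a 0 k * \sum_j fA alpha b (Xcoord (gamma p.1) b p.2) (beta p.2 (Xp (gamma p.1) p.2) b) 0 j
        * hess b a j i k (Xcoord (gamma p.1) b p.2))) @ near2 (s0, u0))).
    apply: near_eq_cvg; apply: filterS3 na nb nI => p ap bp [I1 I2'].
    rewrite (xi_eta_change hb (hg I1) I2' ap bp); apply/rowP => i; rewrite [LHS]mxE [RHS]mxE.
    by apply: eq_bigr => k _; rewrite transJE.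
  apply: cvg_row => i; apply: cvg_bigsum => k; apply: cvgD; apply: cvgM; try exact: cvg_mx_entry.
    rewrite transJE //.
    have [_ /(_ i)[_ C0]] := @trans_Ck _ _ M b a 1 k.
    exact: (cvg_Ck C0 oz cXb).
  apply: cvg_bigsum => j; apply: cvgM.
    by apply: cvg_mx_entry; apply: cvg_fA => //; exact: chart_map_image.
  have [_ /(_ i)[_ [_ /(_ j)[_ C0]]]] := @trans_Ck _ _ M b a 2 k.
  exact: (cvg_Ck C0 oz cXb).
Qed.

(** By [tangency] the [u]-derivative of the velocity of [X] is the flow-time derivative of
    [fA X eta]. The mixed derivatives of [X] thus agree through the Jacobi identity. *)
Lemma deriv_xi_X a s u : I01 s -> I01 u -> dom a (Xp (gamma s) u) ->
  deriv_in I01 (xi_X alpha beta (gamma s) a) u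
    (dfA alpha a (Xcoord (gamma s) a u) (fA alpha a (Xcoord (gamma s) a u) (beta u (Xp (gamma s) u) a)) (eta (gamma s) u a)
     + fA alpha a (Xcoord (gamma s) a u) (xi_eta alpha beta (gamma s) a u)).
Proof.
move=> Is Iu au; have hc := hg Is.
have Vz := chart_map_image au.
have H := deriv_in_fA alpha Vz (config_deriv hc Iu au) (derivableI_deriv_in (form_along hc hb Iu au)).
have -> : dfA alpha a (Xcoord (gamma s) a u) (fA alpha a (Xcoord (gamma s) a u) (beta u (Xp (gamma s) u) a)) (eta (gamma s) u a)
     + fA alpha a (Xcoord (gamma s) a u) (xi_eta alpha beta (gamma s) a u) =
  dfA alpha a (Xcoord (gamma s) a u) (fA alpha a (Xcoord (gamma s) a u) (eta (gamma s) u a)) (beta u (Xp (gamma s) u) a)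
     + fA alpha a (Xcoord (gamma s) a u) (dI (fun v => beta v (Xp (gamma s) v) a) u).
  have L (v w : 'rV[R]_n) : fA alpha a (Xcoord (gamma s) a u) (v + w) =
      fA alpha a (Xcoord (gamma s) a u) v + fA alpha a (Xcoord (gamma s) a u) w.
    by have := fA_linear_w alpha a (Xcoord (gamma s) a u) 1 v w; rewrite !scale1r.
  by rewrite xi_etaE L -(tangency alpha (eta (gamma s) u a) _ Vz) addrCA [X in _ + X]addrC subrK addrC.
apply: deriv_in_near H; last by rewrite /xi_X -fAE.
have [d d0 dP] := config_near hc Iu (@dom_open _ _ M a) au.
by exists d => // v Iv vd; rewrite /xi_X -fAE //; exact: dP.
Qed.

Lemma diffq_small {W : normedModType R} (f : R -> W) s h (g : W) (e : R) : h != 0 ->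
  `|f (s + h) - f s - h *: g| <= e * `|h| -> `|diffq f s h - g| <= e.
Proof.
move=> h0; have -> : diffq f s h - g = h^-1 *: (f (s + h) - f s - h *: g).
  by rewrite /diffq [RHS]scalerBr scalerA mulVf // scale1r.
by rewrite normrZ normfV [_^-1 * _]mulrC ler_pdivrMr // normr_gt0.
Qed.

(** The estimates are three instances of [uniform_increment]. For the middle one the constraint
    replaces [dI X] by [fA X eta], and compactness of [[p, q]] makes the radius independent of
    [u]. *)
Lemma regular_velocity s : I01 s -> (forall u, I01 u -> exists a, regular_at a s u) ->
  has_velocity alpha beta I01 gamma s.
Proof.
move=> Is reg c a p q e p0 pq q1 e0 dpq.
pose P d u := forall h, I01 (s + h) -> `|h| < d -> h != 0 ->
    [/\ dom a (Xp (gamma (s + h)) u),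
        `|diffq (fun t => Xcoord (gamma t) a u) s h - xi_X alpha beta (gamma s) a u| < e,
        `|diffq (fun t => dI (Xcoord (gamma t) a) u) s h - dI (xi_X alpha beta (gamma s) a) u| < e &
        `|diffq (fun t => eta (gamma t) u a) s h - xi_eta alpha beta (gamma s) a u| < e].
have inI u : p <= u <= q -> I01 u by move=> /andP[? ?]; apply/andP; split; lra.
have [d d0 dP] : exists2 d : R, 0 < d & forall u, p <= u <= q -> P d u; last first.
  rewrite /increments near_withinE; apply/nbhs_ballP; exists d => //= h.
  by rewrite /ball /= sub0r normrN => hd h0 Ih u upq; apply: dP.
apply: segment_uniform => [d d' u d'0 dd' H h Ih hd|u0 u0pq].
  by apply: H => //; exact: lt_le_trans dd'.
have Iu := inI u0 u0pq; have au := dpq u0 u0pq.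
have [b /(regular_change Is Iu au)[na dX de [cX ce cb cxi]]] := reg u0 Iu.
have Vz := chart_map_image au.
have nI := near2_I2 s u0.
have e20 : 0 < e / 2 by rewrite divr_gt0.
have [d1 d10 d1P] := @uniform_increment R 1 n (fun t u => Xcoord (gamma t) a u)
  (fun t u => fA alpha a (Xcoord (gamma t) a u) (beta u (Xp (gamma t) u) a)) s u0 Is Iu dX (cvg_fA Vz cX cb) _ e20.
have [d2 d20 d2P] := @uniform_increment R 1 n (fun t u => eta (gamma t) u a)
  (fun t u => xi_eta alpha beta (gamma t) a u) s u0 Is Iu de cxi _ e20.
pose g3 s u := dfA alpha a (Xcoord (gamma s) a u) (fA alpha a (Xcoord (gamma s) a u) (beta u (Xp (gamma s) u) a)) (eta (gamma s) u a)
     + fA alpha a (Xcoord (gamma s) a u) (xi_eta alpha beta (gamma s) a u).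
have dE t u : I01 t -> I01 u -> dom a (Xp (gamma t) u) ->
    dI (Xcoord (gamma t) a) u = fA alpha a (Xcoord (gamma t) a u) (eta (gamma t) u a).
  by move=> /hg hc I2' at_; rewrite (deriv_in_dI I2' (config_deriv hc I2' at_)).2.
have d3 : \forall p \near near2 (s, u0), deriv_in I01 (fun t => dI (Xcoord (gamma t) a) p.2) p.1 (g3 p.1 p.2).
  apply: filterS (near2I (near2I dX de) (near2I (near2_open na) (near2I na nI))) => t [[dXt det] [[d d0 dP] [at_ [I1 I2']]]].
  apply: (deriv_in_near _ _ (deriv_in_fA alpha (chart_map_image at_) dXt det)).
    by exists d => // v Iv vd; rewrite dE //; exact: dP.
  by rewrite dE.
have c3 : (fun p : R * R => g3 p.1 p.2) @ near2 (s, u0) --> g3 s u0.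
  apply: cvgD; last exact: cvg_fA.
  by apply: cvg_dfA => //; exact: cvg_fA.
have [d4 d40 d4P] := @uniform_increment R 1 n (fun t u => dI (Xcoord (gamma t) a) u) g3 s u0 Is Iu d3 c3 _ e20.
have /near2P[d5 d50 d5P] := na.
exists (Num.min (Num.min d1 d2) (Num.min d4 d5)); first by rewrite !lt_min d10 d20 d40.
move=> u upq; rewrite !lt_min => /andP[/andP[u1 u2] /andP[u4 u5]] h Ih.
rewrite !lt_min => /andP[/andP[h1 h2] /andP[h4 h5]] h0.
have Iu' := inI u upq; have au' := dpq u upq.
have e2e : e / 2 < e by lra.
split.
- by apply: (d5P (s + h) u) => //; rewrite addrAC subrr add0r.
- apply: le_lt_trans e2e; apply: (diffq_small h0).
  by rewrite /xi_X -fAE //; exact: d1P.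
- apply: le_lt_trans e2e; apply: (diffq_small h0).
  by rewrite (deriv_in_dI Iu' (deriv_xi_X Is Iu' au')).2; exact: d4P.
- by apply: le_lt_trans e2e; apply: (diffq_small h0); exact: d2P.
Qed.

End Curves.

End LocalData.

(** * The flow of a constant form in a chart *)

Section Window.
Context {R : realType}.
Variables (t0 r : R).
Hypothesis r0 : 0 < r.

(** The 1-Lipschitz retraction onto [[t0 - r, t0 + r]]; composing with it extends functions from
    this interval to the line. *)
Definition window (t : R) : R := t0 - r + 2 * r * clamp ((t - t0 + r) / (2 * r)).

Lemma window_in t : `|window t - t0| <= r.
Proof.
have /andP[c0 c1] := clamp_I01 ((t - t0 + r) / (2 * r)); rewrite /window.
move: (clamp _) c0 c1 => k k0 k1; rewrite ler_norml; apply/andP; split.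
  by have := mulr_ge0 (ltW r0) k0; lra.
by have := ler_wpM2l (ltW r0) k1; lra.
Qed.

Lemma window_id t : `|t - t0| <= r -> window t = t.
Proof.
have r1 : r != 0 by rewrite gt_eqF.
rewrite ler_norml => /andP[t1 t2]; rewrite /window clamp_id; first by field.
apply/andP; split; first by rewrite divr_ge0 //; lra.
by rewrite ler_pdivrMr ?mulr_gt0 //; lra.
Qed.

Lemma window_lip t t' : `|window t - window t'| <= `|t - t'|.
Proof.
have := clamp_lip ((t - t0 + r) / (2 * r)) ((t' - t0 + r) / (2 * r)).
rewrite -mulrBl normrM normfV (gtr0_norm (x := 2 * r)) ?mulr_gt0 // ler_pdivlMr ?mulr_gt0 //.
have -> : t - t0 + r - (t' - t0 + r) = t - t' by ring.
rewrite /window; move: (clamp _) (clamp _) => k k' H.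
have -> : t0 - r + 2 * r * k' - (t0 - r + 2 * r * k) = (k' - k) * (2 * r) by ring.
by rewrite normrM (gtr0_norm (x := 2 * r)) ?mulr_gt0.
Qed.

Lemma window_continuous : continuous window.
Proof.
move=> u; apply/cvgrPdist_le => e e0; apply/nbhs_ballP; exists e => //= v.
by rewrite /ball /= => /ltW; apply: le_trans; exact: window_lip.
Qed.

End Window.

Section FiniteBounds.
Context {R : realType}.

Lemma finite_bound (I : finType) (P : I -> R -> Prop) :
  (forall i K K', K <= K' -> P i K -> P i K') ->
  (forall i, exists2 K : R, 0 <= K & P i K) -> exists2 K : R, 0 <= K & forall i, P i K.
Proof.
move=> mono H; have /choice[K KP] : forall i, exists K, 0 <= K /\ P i K.
  by move=> i; have [K ? ?] := H i; exists K.
exists (\sum_i K i); first by rewrite sumr_ge0 // => i _; have [] := KP i.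
move=> i; apply: mono (KP i).2.
by rewrite (bigD1 i) //= lerDl sumr_ge0 // => j _; have [] := KP j.
Qed.

Lemma sum_ord_bound n (f : 'I_n -> R) (K : R) : (forall i, `|f i| <= K) -> `|\sum_i f i| <= n%:R * K.
Proof.
move=> H; rewrite (le_trans (ler_norm_sum _ _ _)) //.
have -> : n%:R * K = \sum_(i < n) K by rewrite sumr_const card_ord mulr_natl.
by apply: ler_sum.
Qed.

End FiniteBounds.

(** * Flow boxes and the pointwise flow *)

Section FlowBox.
Context {R : realType} {n : nat} {M : manifold R n} (alpha : poisson M).
Implicit Types (a : chart M) (y v w e b : 'rV[R]_n).
Local Notation A a i j := (Acoef alpha a i j).
Lemma fAB a y v w : fA alpha a y (v - w) = fA alpha a y v - fA alpha a y w.
Proof. by rewrite /fA mulmxBl opprB opprK addrC. Qed.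

Lemma fAZ a y (k : R) w : fA alpha a y (k *: w) = k *: fA alpha a y w.
Proof. by rewrite /fA -scalemxAl scalerN. Qed.

Lemma fA0 a y : fA alpha a y 0 = 0.
Proof. by rewrite /fA mul0mx oppr0. Qed.

Local Notation fA := (fA alpha).
Local Notation dfA := (dfA alpha).
Local Notation Qf := (Qf alpha).

Lemma dfAB a y v v' w : dfA a y (v - v') w = dfA a y v w - dfA a y v' w.
Proof.
apply/rowP => i; rewrite !mxE -opprD; congr (- _); rewrite -sumrB; apply: eq_bigr => j _.
rewrite -mulrBr -sumrB; congr (_ * _); apply: eq_bigr => m _; by rewrite !mxE mulrBl.
Qed.

Lemma dfAZ a y (k : R) v w : dfA a y (k *: v) w = k *: dfA a y v w.
Proof.
apply/rowP => i; rewrite !mxE mulrN mulr_sumr; congr (- _); apply: eq_bigr => j _.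
by rewrite mulrCA; congr (_ * _); rewrite mulr_sumr; apply: eq_bigr => m _; rewrite !mxE mulrA.
Qed.

Lemma QfB a y e e' w : Qf a y (e - e') w = Qf a y e w - Qf a y e' w.
Proof.
apply/rowP => i; rewrite !mxE -sumrB; apply: eq_bigr => j _; rewrite -sumrB.
by apply: eq_bigr => k _; rewrite !mxE mulrBr mulrBl.
Qed.

Lemma QfBr a y e w w' : Qf a y e (w - w') = Qf a y e w - Qf a y e w'.
Proof.
apply/rowP => i; rewrite !mxE -sumrB; apply: eq_bigr => j _; rewrite -sumrB.
by apply: eq_bigr => k _; rewrite !mxE mulrBr.
Qed.

Lemma QfZ a y (k : R) e w : Qf a y (k *: e) w = k *: Qf a y e w.
Proof.
apply/rowP => i; rewrite !mxE mulr_sumr; apply: eq_bigr => j _; rewrite mulr_sumr.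
by apply: eq_bigr => l _; rewrite !mxE; ring.
Qed.

Lemma Qf0r a y e : Qf a y e 0 = 0.
Proof. by have := QfBr a y e 0 0; rewrite !subrr. Qed.

(** All analytic information on the bivector near [y0]. [kappa] bounds the admissible forms:
    [box_half] normalizes the equations for [picard] and [small_gronwall], [box_exit] keeps a flow
    that starts in the half cube inside the cube. The chart contains radius [2 * rho], the support
    of the bump of radius [rho]. *)
Record flow_box a y0 (rho C kappa : R) : Prop := FlowBox {
  box_rho : 0 < rho;
  box_C : 0 <= C;
  box_kappa : 0 < kappa;
  box_half : C * kappa <= 2^-1;
  box_exit : C * kappa <= rho / 2;
  box_sub : cball y0 (2 * rho) `<=` chart_image a;
  box_fA : forall y w, cball y0 rho y -> `|fA a y w| <= C * `|w|;
  box_fA_lip : forall y z w, cball y0 rho y -> cball y0 rho z ->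
    `|fA a z w - fA a y w| <= C * `|z - y| * `|w|;
  box_taylor : forall y z w, cball y0 rho y -> cball y0 rho z ->
    `|fA a z w - fA a y w - dfA a y (z - y) w| <= C * `|z - y| ^+ 2 * `|w|;
  box_dfA : forall y v w, cball y0 rho y -> `|dfA a y v w| <= C * `|v| * `|w|;
  box_Qf : forall y e w, cball y0 rho y -> `|Qf a y e w| <= C * `|e| * `|w|;
  box_Qf_lip : forall y z e w, cball y0 rho y -> cball y0 rho z ->
    `|Qf a z e w - Qf a y e w| <= C * `|z - y| * `|e| * `|w| }.

Lemma flow_box_exists a y0 : chart_image a y0 -> exists rho C kappa, flow_box a y0 rho C kappa.
Proof.
move=> Vy0; have [r r0 rP] := open_normP (@chart_image_open _ _ _ a) Vy0.
(* Gives [9 * rho = r / 2 < r], as [C2_taylor] requires. *)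
pose rho := r / 18.
have rho0 : 0 < rho by rewrite divr_gt0.
have sub k : k <= 9 -> cball y0 (k * rho) `<=` chart_image a.
  move=> k9 y /= yk; apply: rP; apply: le_lt_trans yk _.
  have : k * rho <= 9 * rho by rewrite ler_wpM2r // ltW.
  by rewrite /rho; lra.
have sub1 : cball y0 rho `<=` chart_image a by rewrite -[rho]mul1r; apply: sub; lra.
have sub3 : cball y0 (3 * rho) `<=` chart_image a by apply: sub; lra.
have sub9 : cball y0 (9 * rho) `<=` chart_image a by apply: sub.
have [K0 K00 K0P] : exists2 K : R, 0 <= K & forall ij : 'I_n * 'I_n, forall y, cball y0 rho y ->
    `|A a ij.1 ij.2 y| <= K.
  apply: finite_bound => [ij K K' KK' H y /H|[i j]]; first by move=> /le_trans; exact.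
  by have [K ? ?] := Ck_bounded sub1 (Acoef_Ck alpha 0 a i j); exists K.
have [K1 K10 K1P] : exists2 K : R, 0 <= K & forall ij : 'I_n * 'I_n, forall y z, cball y0 rho y -> cball y0 rho z ->
    `|A a ij.1 ij.2 z - A a ij.1 ij.2 y| <= K * `|z - y|.
  apply: finite_bound => [ij K K' KK' H y z yr zr|[i j]].
    by rewrite (le_trans (H _ _ yr zr)) // ler_wpM2r.
  by have [K ? ?] := C1_lipschitz sub3 (Acoef_Ck alpha 1 a i j); exists K.
have [K2 K20 K2P] : exists2 K : R, 0 <= K & forall ij : 'I_n * 'I_n, forall y z, cball y0 rho y -> cball y0 rho z ->
    `|A a ij.1 ij.2 z - A a ij.1 ij.2 y - \sum_m (z - y) 0 m * pd m (A a ij.1 ij.2) y| <= K * `|z - y| ^+ 2.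
  apply: finite_bound => [ij K K' KK' H y z yr zr|[i j]].
    by rewrite (le_trans (H _ _ yr zr)) // ler_wpM2r // exprn_ge0.
  by have [K ? ?] := C2_taylor (ltW rho0) sub9 (Acoef_Ck alpha 2 a i j); exists K.
have CdA m i j k : Ck k (chart_image a) (pd m (A a i j)).
  by have [_ /(_ m)[]] := Acoef_Ck alpha k.+1 a i j.
have [K3 K30 K3P] : exists2 K : R, 0 <= K & forall ijm : 'I_n * 'I_n * 'I_n, forall y, cball y0 rho y ->
    `|pd ijm.2 (A a ijm.1.1 ijm.1.2) y| <= K.
  apply: finite_bound => [ij K K' KK' H y /H|[[i j] m]]; first by move=> /le_trans; exact.
  by have [K ? ?] := Ck_bounded sub1 (CdA m i j 0%N); exists K.
have [K4 K40 K4P] : exists2 K : R, 0 <= K & forall ijm : 'I_n * 'I_n * 'I_n, forall y z, cball y0 rho y -> cball y0 rho z ->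
    `|pd ijm.2 (A a ijm.1.1 ijm.1.2) z - pd ijm.2 (A a ijm.1.1 ijm.1.2) y| <= K * `|z - y|.
  apply: finite_bound => [ij K K' KK' H y z yr zr|[[i j] m]].
    by rewrite (le_trans (H _ _ yr zr)) // ler_wpM2r.
  by have [K ? ?] := C1_lipschitz sub3 (CdA m i j 1%N); exists K.
pose K := K0 + K1 + K2 + K3 + K4.
pose N : R := n%:R.
(* The first summand serves estimates with one sum over indices, the second those with two. *)
pose C := N * K + N * (N * K).
have N0 : 0 <= N by [].
have Kge : 0 <= K by rewrite !addr_ge0.
have C0 : 0 <= C by rewrite addr_ge0 ?mulr_ge0.
have C1 x : 0 <= x -> N * (K * x) <= C * x.
  by move=> x0; rewrite /C [leRHS]mulrDl mulrA lerDl !mulr_ge0.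
have C2 x : 0 <= x -> N * (N * (K * x)) <= C * x.
  by move=> x0; rewrite /C [leRHS]mulrDl !mulrA lerDr !mulr_ge0.
have C10 : 0 < C + 1 by rewrite ltr_wpDl.
(* Division by [C + 1], as [C] may be 0. *)
pose kappa := Num.min 2^-1 (rho / 2) / (C + 1).
have kappa0 : 0 < kappa by rewrite divr_gt0 // lt_min invr_gt0 ltr0n divr_gt0.
have Ck_ : C * kappa <= Num.min 2^-1 (rho / 2).
  rewrite mulrA ler_pdivrMr // mulrC ler_wpM2l ?lerDl //.
  by rewrite le_min invr_ge0 ler0n divr_ge0 // ltW.
exists rho, C, kappa; split=> //.
- by rewrite (le_trans Ck_) // ge_min lexx.
- by rewrite (le_trans Ck_) // ge_min lexx orbT.
- by apply: sub; lra.
- move=> y w yr; apply: le_trans (C1 _ (normr_ge0 w)).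
  apply: mx_norm_le => [|i j]; first by rewrite !mulr_ge0.
  rewrite ord1 fA_entry normrN; apply: sum_ord_bound => k.
  rewrite normrM mulrC ler_pM ?mx_entry_le // (le_trans (K0P (j, k) _ yr)) //.
  by rewrite /K -!addrA lerDl !addr_ge0.
- move=> y z w yr zr; rewrite -mulrA; apply: le_trans (C1 _ _); last by rewrite mulr_ge0.
  apply: mx_norm_le => [|i j]; first by rewrite !mulr_ge0.
  have -> : (fA a z w - fA a y w) i j = - \sum_k w 0 k * (A a j k z - A a j k y).
    rewrite ord1 mxE [X in _ + X]mxE !fA_entry opprK addrC -sumrB -sumrN.
    by apply: eq_bigr => k _; rewrite -mulrBr -mulrN opprB.
  rewrite normrN; apply: sum_ord_bound => k.
  rewrite normrM mulrC mulrA ler_pM ?mx_entry_le // (le_trans (K1P (j, k) _ _ yr zr)) //.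
  by rewrite ler_wpM2r // /K; lra.
- move=> y z w yr zr; rewrite -mulrA; apply: le_trans (C1 _ _); last by rewrite mulr_ge0 // exprn_ge0.
  apply: mx_norm_le => [|i j]; first by rewrite !mulr_ge0 // exprn_ge0.
  have -> : (fA a z w - fA a y w - dfA a y (z - y) w) i j = - \sum_k w 0 k * (A a j k z - A a j k y -
      \sum_m (z - y) 0 m * pd m (A a j k) y).
    rewrite ord1 mxE [X in X + _]mxE [X in _ + X + _]mxE [X in _ + X]mxE !fA_entry [X in _ - X]mxE !opprK addrAC addrC addrA.
    rewrite -sumrN -big_split -big_split -sumrN /=; apply: eq_bigr => k _.
    by move: (\sum_m _) => S; ring.
  rewrite normrN; apply: sum_ord_bound => k.
  rewrite normrM mulrC mulrA ler_pM ?mx_entry_le // (le_trans (K2P (j, k) _ _ yr zr)) //.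
  by rewrite ler_wpM2r ?exprn_ge0 // /K; lra.
- move=> y v w yr; rewrite -mulrA; apply: le_trans (C2 _ _); last by rewrite mulr_ge0.
  apply: mx_norm_le => [|i j]; first by rewrite !mulr_ge0.
  rewrite ord1 mxE normrN; apply: sum_ord_bound => k.
  rewrite mulr_sumr; apply: sum_ord_bound => m.
  have -> : `|w 0 k * (v 0 m * pd m (A a j k) y)| = `|pd m (A a j k) y| * `|v 0 m| * `|w 0 k|.
    by rewrite !normrM; ring.
  rewrite [leRHS]mulrA ler_pM ?mulr_ge0 ?mx_entry_le //.
  rewrite ler_pM ?mx_entry_le // (le_trans (K3P (j, k, m) _ yr)) //.
  by rewrite /K; lra.
- move=> y e w yr; rewrite -mulrA; apply: le_trans (C2 _ _); last by rewrite mulr_ge0.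
  apply: mx_norm_le => [|i j]; first by rewrite !mulr_ge0.
  rewrite ord1 mxE; apply: sum_ord_bound => k; apply: sum_ord_bound => m.
  rewrite !normrM mulrA ler_pM ?mulr_ge0 ?mx_entry_le // ler_pM ?mx_entry_le //.
  by rewrite (le_trans (K3P (k, m, j) _ yr)) // /K; lra.
- move=> y z e w yr zr; rewrite -!mulrA; apply: le_trans (C2 _ _); last by rewrite !mulr_ge0.
  apply: mx_norm_le => [|i j]; first by rewrite !mulr_ge0.
  have -> : (Qf a z e w - Qf a y e w) i j = \sum_k \sum_l (pd j (A a k l) z - pd j (A a k l) y) * e 0 k * w 0 l.
    rewrite ord1 !mxE -sumrB; apply: eq_bigr => k _; rewrite -sumrB; apply: eq_bigr => l _.
    by rewrite !mulrBl.
  apply: sum_ord_bound => k; apply: sum_ord_bound => m.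
  rewrite !normrM !mulrA ler_pM ?mulr_ge0 ?mx_entry_le // ler_pM ?mx_entry_le //.
  rewrite (le_trans (K4P (k, m, j) _ _ yr zr)) // ler_wpM2r // /K; lra.
Qed.

Section Flow.
Variables (a : chart M) (y0 : 'rV[R]_n) (rho C kappa : R).
Hypothesis box : flow_box a y0 rho C kappa.

(** The flow at one fixed path parameter: [b] and [e] are the value and the [u]-derivative of the
    form there, and [X], [E] are the point and the 1-form as functions of the flow time. The time is
    always [0,1]; the size of the flow is carried by [b]. *)
Record local_flow b e x0 e0 (X E : R -> 'rV[R]_n) : Prop := LocalFlow {
  flow_small : `|b| <= kappa;
  flow_X0 : X 0 = x0;
  flow_E0 : E 0 = e0;
  flow_in : forall s, I01 s -> cball y0 rho (X s);
  flow_dX : forall s, I01 s -> deriv_in I01 X s (fA a (X s) b);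
  flow_dE : forall s, I01 s -> deriv_in I01 E s (e + Qf a (X s) (E s) b) }.

(** Makes the field globally Lipschitz for [picard]; the exit bound shows afterwards that the
    solution never left the cube. *)
Definition box_proj y : 'rV[R]_n := \row_i window (y0 0 i) rho (y 0 i).

Lemma box_proj_in y : cball y0 rho (box_proj y).
Proof.
apply: mx_norm_le => [|i j]; first exact: ltW (box_rho box).
by rewrite !mxE ord1; apply: window_in; exact: box_rho box.
Qed.

Lemma box_proj_lip y z : `|box_proj y - box_proj z| <= `|y - z|.
Proof.
apply: mx_norm_le => // i j; rewrite !mxE (le_trans (window_lip _ (box_rho box) _ _)) //.
by have := mx_entry_le (y - z) 0 j; rewrite !mxE.
Qed.

Lemma box_proj_id y : cball y0 rho y -> box_proj y = y.
Proof.
move=> yr; apply/rowP => i; rewrite !mxE window_id //; first exact: box_rho box.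
by have := mx_entry_le (y - y0) 0 i; rewrite !mxE => /le_trans; apply.
Qed.

Lemma C_small b : `|b| <= kappa -> C * `|b| <= 2^-1.
Proof. by move=> bk; rewrite (le_trans _ (box_half box)) // ler_wpM2l // (box_C box). Qed.

Lemma flow_exists b e x0 e0 : `|b| <= kappa -> cball y0 (rho / 2) x0 ->
  exists X E, local_flow b e x0 e0 X E.
Proof.
move=> bk x0r; have rho0 := box_rho box; have C0 := box_C box.
have Cb := C_small bk.
have [X [X0 dX]] : exists z : R -> 'rV[R]_n, z 0 = x0 /\ forall s, I01 s -> deriv_in I01 z s (fA a (box_proj (z s)) b).
  apply: (@picard _ _ _ (fun _ z => fA a (box_proj z) b)) => [s z z' _|s z _ d d0].
    rewrite (le_trans (box_fA_lip box b (box_proj_in z') (box_proj_in z))) // mulrAC.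
    by rewrite ler_pM ?mulr_ge0 // box_proj_lip.
  by exists 1 => // v _ _; rewrite subrr normr0 ltW.
have speed s : I01 s -> `|fA a (box_proj (X s)) b| <= rho / 2.
  move=> _; rewrite (le_trans (box_fA box _ (box_proj_in _))) // (le_trans _ (box_exit box)) //.
  by rewrite ler_wpM2l.
have I0 := @I01_0 R.
have Xlip s t : I01 s -> I01 t -> `|X t - X s| <= rho / 2 * `|t - s|.
  by move=> Is It; apply: (mean_value_I01 Is It dX).
have Xin s : I01 s -> cball y0 rho (X s).
  move=> Is; rewrite /cball /= -(subrKA x0) (le_trans (ler_normD _ _)) //.
  have s1 : `|s - 0| <= 1 by move/andP: Is => [? ?]; rewrite subr0 ger0_norm.
  have := Xlip 0 s I0 Is; rewrite X0 => /le_trans /(_ (ler_piMr _ s1)).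
  have r2 : 0 <= rho / 2 by lra.
  by move=> /(_ r2); move: x0r; rewrite /cball /=; lra.
(* Along the known [X] the equation is affine in [E], hence globally Lipschitz without
   projection. *)
have [E [E0 dE]] : exists z : R -> 'rV[R]_n, z 0 = e0 /\ forall s, I01 s -> deriv_in I01 z s (e + Qf a (X s) (z s) b).
  apply: (@picard _ _ _ (fun s z => e + Qf a (X s) z b)) => [s z z' Is|s z Is d d0].
    rewrite opprD addrACA subrr add0r -QfB (le_trans (box_Qf box _ _ (Xin s Is))) // mulrAC.
    by rewrite ler_wpM2r.
  pose K := C * rho * `|z| * `|b| + 1.
  have K0 : 0 < K by rewrite ltr_wpDl // !mulr_ge0 // ltW.
  exists (d / K); first by rewrite divr_gt0.
  move=> t It; rewrite ltr_pdivlMr // => ts.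
  rewrite opprD addrACA subrr add0r (le_trans (box_Qf_lip box _ _ (Xin s Is) (Xin t It))) //.
  rewrite (le_trans _ (ltW ts)) // /K mulrDr mulr1 -[leLHS]addr0 lerD //.
  rewrite [leRHS]mulrCA -!mulrA ler_wpM2l // !mulrA ler_wpM2r // [leRHS]mulrC mulrA ler_wpM2r //.
  by rewrite (le_trans (Xlip _ _ Is It)) //; have := normr_ge0 (t - s); nra.
exists X, E; split=> // s Is.
by have := dX s Is; rewrite box_proj_id //; exact: Xin.
Qed.

Section Dependence.
Variables (b e x0 e0 : 'rV[R]_n) (X E : R -> 'rV[R]_n).
Variables (b' e' x0' e0' : 'rV[R]_n) (X' E' : R -> 'rV[R]_n).
Hypotheses (H : local_flow b e x0 e0 X E) (H' : local_flow b' e' x0' e0' X' E').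

Lemma flow_E_bound s : I01 s -> `|E s| <= 2 * (`|e0| + `|e|).
Proof.
move=> Is; rewrite -(flow_E0 H).
apply: (small_gronwall _ (flow_dE H)) => // t It.
rewrite (le_trans (ler_normD _ _)) // addrC lerD2r.
rewrite (le_trans (box_Qf box _ _ (flow_in H It))) // mulrAC ler_wpM2r //.
exact: C_small (flow_small H).
Qed.

Lemma flow_X_dep s : I01 s -> `|X s - X' s| <= 2 * (`|x0 - x0'| + C * `|b - b'|).
Proof.
move=> Is; rewrite -(flow_X0 H) -(flow_X0 H').
have C0 := box_C box.
have dW t : I01 t -> deriv_in I01 (fun s => X s - X' s) t (fA a (X t) b - fA a (X' t) b').
  by move=> It; apply: deriv_inB; [exact: (flow_dX H)|exact: (flow_dX H')].
apply: (small_gronwall _ dW) => // [|t It]; first by rewrite mulr_ge0.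
have -> : fA a (X t) b - fA a (X' t) b' = (fA a (X t) b - fA a (X' t) b) + fA a (X' t) (b - b').
  by rewrite fAB subrKA.
rewrite (le_trans (ler_normD _ _)) // lerD //; last exact: (box_fA box _ (flow_in H' It)).
rewrite (le_trans (box_fA_lip box _ (flow_in H' It) (flow_in H It))) // mulrAC ler_wpM2r //.
exact: C_small (flow_small H).
Qed.

(** Asymmetric: the coefficient involves [e0'] and [e'] of the second flow only, so it stays fixed
    while the first flow varies. *)
Lemma flow_E_dep s : I01 s -> `|E s - E' s| <= 2 * (`|e0 - e0'| + (`|e - e'| +
  C * (2 * (`|e0'| + `|e'|)) * (`|b - b'| + kappa * (2 * (`|x0 - x0'| + C * `|b - b'|))))).
Proof.
move=> Is; rewrite -{1}(flow_E0 H) -{1}(flow_E0 H').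
have C0 := box_C box; have k0 := ltW (box_kappa box).
have dW t : I01 t -> deriv_in I01 (fun s => E s - E' s) t (e + Qf a (X t) (E t) b - (e' + Qf a (X' t) (E' t) b')).
  by move=> It; apply: deriv_inB; [exact: (flow_dE H)|exact: (flow_dE H')].
have bound_ge0 : 0 <= C * (2 * (`|e0'| + `|e'|)) * (`|b - b'| + kappa * (2 * (`|x0 - x0'| + C * `|b - b'|))).
  by do ![apply: mulr_ge0 || apply: addr_ge0].
apply: (small_gronwall _ dW) => // [|t It]; first by rewrite addr_ge0.
have -> : e + Qf a (X t) (E t) b - (e' + Qf a (X' t) (E' t) b') =
   Qf a (X t) (E t - E' t) b + ((e - e') + (Qf a (X t) (E' t) (b - b') + (Qf a (X t) (E' t) b' - Qf a (X' t) (E' t) b'))).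
  rewrite QfB QfBr; move: (Qf _ _ _ _) (Qf _ _ _ _) (Qf _ _ _ _) (Qf _ _ _ _) => q1 q2 q3 q4.
  by apply/rowP => i; rewrite !mxE; ring.
rewrite (le_trans (ler_normD _ _)) // lerD //.
  rewrite (le_trans (box_Qf box _ _ (flow_in H It))) // mulrAC ler_wpM2r //.
  exact: C_small (flow_small H).
rewrite (le_trans (ler_normD _ _)) // lerD2l.
have HE : `|E' t| <= 2 * (`|e0'| + `|e'|).
  rewrite -(flow_E0 H'); apply: (small_gronwall _ (flow_dE H')) => // u Iu.
  rewrite (le_trans (ler_normD _ _)) // addrC lerD2r.
  rewrite (le_trans (box_Qf box _ _ (flow_in H' Iu))) // mulrAC ler_wpM2r //.
  exact: C_small (flow_small H').
rewrite mulrDr (le_trans (ler_normD _ _)) // lerD //.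
  rewrite (le_trans (box_Qf box _ _ (flow_in H It))) // ler_wpM2r // ler_wpM2l //.
rewrite (le_trans (box_Qf_lip box _ _ (flow_in H' It) (flow_in H It))) //.
rewrite [leRHS](_ : _ = C * (2 * (`|x0 - x0'| + C * `|b - b'|)) * (2 * (`|e0'| + `|e'|)) * kappa); last by ring.
have HX := flow_X_dep It.
by rewrite !ler_pM ?mulr_ge0 // (flow_small H').
Qed.

End Dependence.

Lemma flow_unique b e x0 e0 X E X' E' s : local_flow b e x0 e0 X E -> local_flow b e x0 e0 X' E' ->
  I01 s -> X s = X' s /\ E s = E' s.
Proof.
move=> H H' Is; have := flow_X_dep H H' Is; have := flow_E_dep H H' Is.
rewrite !subrr normr0 !(mulr0, addr0) !normr_le0 !subr_eq0.
by move=> /eqP -> /eqP ->.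
Qed.

(** Time reversal, by which the opposite form retracts what a form has built up. *)
Lemma flow_reverse b e x0 e0 X E : local_flow b e x0 e0 X E ->
  local_flow (- b) (- e) (X 1) (E 1) (fun s => X (1 - s)) (fun s => E (1 - s)).
Proof.
move=> H.
have I1 (s : R) : I01 s -> I01 (1 - s) by move=> /andP[? ?]; apply/andP; split; lra.
have d1 (D : set R) s : deriv_in D (fun s => 1 - s) s (-1).
  by have := deriv_inB (@deriv_in_cst R _ D (1 : R) s) (@deriv_in_id R D s); rewrite sub0r.
split.
- by rewrite normrN; exact: flow_small H.
- by rewrite subr0.
- by rewrite subr0.
- by move=> s /I1; exact: (flow_in H).
- move=> s Is; have := deriv_in_comp I1 (d1 _ s) (flow_dX H (I1 s Is)).
  by rewrite -fAZ !scaleN1r.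
- move=> s Is; have := deriv_in_comp I1 (d1 _ s) (flow_dE H (I1 s Is)).
  rewrite scaleN1r opprD; congr deriv_in; congr (_ + _).
  by have := QfBr a (X (1 - s)) (E (1 - s)) 0 b; rewrite Qf0r !sub0r.
Qed.

(** The second equation is homogeneous in [(e, e0, E)]. Scaling by the derivative of a
    parametrization turns a flow that ends at [eta] into one that ends at the pulled-back [eta]. *)
Lemma flow_scale (k : R) b e x0 e0 X E : local_flow b e x0 e0 X E ->
  local_flow b (k *: e) x0 (k *: e0) X (fun s => k *: E s).
Proof.
move=> H; split.
- exact: flow_small H.
- exact: flow_X0 H.
- by rewrite (flow_E0 H).
- exact: flow_in H.
- exact: flow_dX H.
- by move=> s Is; rewrite QfZ -scalerDr; apply: deriv_inZ; exact: (flow_dE H).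
Qed.

Lemma flow_trivial x0 e0 : cball y0 rho x0 -> local_flow 0 0 x0 e0 (fun=> x0) (fun=> e0).
Proof.
move=> x0r; split=> // [|s _|s _]; first by rewrite normr0 ltW // (box_kappa box).
  by rewrite fA0; exact: deriv_in_cst.
by rewrite Qf0r addr0; exact: deriv_in_cst.
Qed.

(** The deviation [W] of [X] from its linearization along the constraint satisfies,
    by [tangency], a linear equation up to second-order terms. *)
Lemma flow_tangent (D : set R) (b e x0 e0 : R -> 'rV[R]_n) (X E : R -> R -> 'rV[R]_n) (u : R) :
  (exists2 d : R, 0 < d & forall v : R, D v -> `|v - u| < d -> local_flow (b v) (e v) (x0 v) (e0 v) (X v) (E v)) ->
  local_flow (b u) (e u) (x0 u) (e0 u) (X u) (E u) ->
  deriv_in D b u (e u) -> deriv_in D x0 u (fA a (x0 u) (e0 u)) ->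
  forall s : R, I01 s -> deriv_in D (fun v : R => X v s) u (fA a (X u s) (E u s)).
Proof.
move=> [d d0 dP] Hu db dx s Is eps eps0.
have C0 := box_C box; have k0 := ltW (box_kappa box); have C10 : 0 < 1 + C by rewrite ltr_wpDr.
have [d1 d10 d1P] := deriv_in_lip db.
have [d2 d20 d2P] := deriv_in_lip dx.
set lb := _ + 1 in d1P; set lx := _ + 1 in d2P.
(* Lipschitz constant at [u] of the points [X v t], common to all [t]. *)
pose K := 2 * (lx + C * lb).
have K0 : 0 <= K by rewrite mulr_ge0 // addr_ge0 ?mulr_ge0 // addr_ge0.
(* Coefficient of the errors quadratic in [v - u]: the variation of [fA] applied to [e u], and the
   Taylor remainder. *)
pose Q := C * K * `|e u| + C * K ^+ 2 * kappa.
have Q0 : 0 <= Q.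
  exact: (addr_ge0 (mulr_ge0 (mulr_ge0 C0 K0) (normr_ge0 _)) (mulr_ge0 (mulr_ge0 C0 (exprn_ge0 2 K0)) k0)).
(* The 4 is the factor 2 of [small_gronwall] times 2 for sharing [eps] with the quadratic errors;
   [1 + C] adds the contributions of [x0] and [b]. *)
pose delta := eps / (4 * (1 + C)).
have delta0 : 0 < delta by rewrite divr_gt0 // mulr_gt0.
have [d3 d30 d3P] := db _ delta0.
have [d4 d40 d4P] := dx _ delta0.
have d50 : 0 < eps / (4 * (Q + 1)) by rewrite divr_gt0 // mulr_gt0 // ltr_wpDl.
exists (Num.min (Num.min d (Num.min d1 d2)) (Num.min (Num.min d3 d4) (eps / (4 * (Q + 1))))).
  by rewrite !lt_min d0 d10 d20 d30 d40.
move=> v Dv; rewrite !lt_min => /andP[/andP[vd /andP[v1 v2]] /andP[/andP[v3 v4] v5]].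
have Hv := dP v Dv vd.
pose z := v - u.
have XK t : I01 t -> `|X v t - X u t| <= K * `|z|.
  move=> It; rewrite (le_trans (flow_X_dep Hv Hu It)) // /K -mulrA ler_wpM2l // mulrDl -mulrA lerD //.
    exact: d2P.
  by rewrite ler_wpM2l //; exact: d1P.
pose W t := X v t - X u t - z *: fA a (X u t) (E u t).
pose Wt t := fA a (X v t) (b v) - fA a (X u t) (b u) -
  z *: (dfA a (X u t) (fA a (X u t) (b u)) (E u t) + fA a (X u t) (e u + Qf a (X u t) (E u t) (b u))).
have subV : cball y0 rho `<=` chart_image a.
  by move=> y yr; apply: (box_sub box); apply: le_trans yr _; have := box_rho box; lra.
have dW t : I01 t -> deriv_in I01 W t (Wt t).
  move=> It; apply: deriv_inB; first by apply: deriv_inB; [exact: (flow_dX Hv)|exact: (flow_dX Hu)].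
  apply: deriv_inZ; apply: deriv_in_fA; [|exact: (flow_dX Hu)|exact: (flow_dE Hu)].
  exact: subV (flow_in Hu It).
pose err := C * (delta * `|z|) + Q * `|z| ^+ 2.
have err0 : 0 <= err.
  exact: (addr_ge0 (mulr_ge0 C0 (mulr_ge0 (ltW delta0) (normr_ge0 _))) (mulr_ge0 Q0 (exprn_ge0 2 (normr_ge0 _)))).
have Wbound t : I01 t -> `|Wt t| <= 2^-1 * `|W t| + err.
  move=> It; have Xu := flow_in Hu It; have Xv := flow_in Hv It.
  (* [tangency] absorbs the terms in [E]. A part linear in [W] is left, with three remainders:
     differentiability of [b], variation of [fA], and Taylor. *)
  have -> : Wt t = dfA a (X u t) (W t) (b u) + (fA a (X v t) (b v - b u - z *: e u) +
      (z *: (fA a (X v t) (e u) - fA a (X u t) (e u)) +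
       (fA a (X v t) (b u) - fA a (X u t) (b u) - dfA a (X u t) (X v t - X u t) (b u)))).
    rewrite /Wt /W !fAB fAZ !dfAB dfAZ.
    have -> : fA a (X u t) (e u + Qf a (X u t) (E u t) (b u)) = fA a (X u t) (e u) + fA a (X u t) (Qf a (X u t) (E u t) (b u)).
      by have := fA_linear_w alpha a (X u t) 1 (e u) (Qf a (X u t) (E u t) (b u)); rewrite !scale1r.
    rewrite -(tangency alpha (E u t) (b u) (subV _ Xu)).
    move: (dfA _ _ _ _) (dfA _ _ _ _) (dfA _ _ _ _) (dfA _ _ _ _) => p1 p2 p3 p4.
    move: (fA _ _ _) (fA _ _ _) (fA _ _ _) (fA _ _ _) (fA _ _ _) => q1 q2 q3 q4 q5.
    by apply/rowP => i; rewrite !mxE; ring.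
  rewrite (le_trans (ler_normD _ _)) // lerD //.
    rewrite (le_trans (box_dfA box _ _ Xu)) // mulrAC ler_wpM2r //.
    exact: C_small (flow_small Hu).
  rewrite (le_trans (ler_normD _ _)) // lerD //.
    by rewrite (le_trans (box_fA box _ Xv)) // ler_wpM2l //; exact: d3P.
  have zK := XK t It.
  rewrite (le_trans (ler_normD _ _)) // [leRHS](_ : _ = `|z| * (C * (K * `|z|) * `|e u|) + C * (K * `|z|) ^+ 2 * kappa); last first.
    by rewrite /Q; ring.
  rewrite lerD //.
    rewrite normrZ ler_wpM2l // (le_trans (box_fA_lip box _ Xu Xv)) // ler_wpM2r // ler_wpM2l //.
  rewrite (le_trans (box_taylor box _ Xu Xv)) // ler_pM ?mulr_ge0 ?exprn_ge0 ?(flow_small Hu) //.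
  by rewrite ler_wpM2l // lerXn2r // nnegrE // mulr_ge0.
have := small_gronwall err0 dW Wbound Is => /le_trans; apply.
have W0 : `|W 0| <= delta * `|z|.
  rewrite /W (flow_X0 Hv) (flow_X0 Hu) (flow_E0 Hu); exact: d4P.
have z5 : `|z| * (4 * (Q + 1)) <= eps by rewrite -ler_pdivlMr ?mulr_gt0 ?ltr_wpDl // ltW.
have dd : 4 * (delta * (1 + C)) = eps.
  by rewrite mulrCA divfK // gt_eqF // mulr_gt0.
have z0 := normr_ge0 z.
rewrite /err -/z; move: W0 z5 dd z0; move: (`|z|) (`|W 0|) => zz w0 W0 z5 dd z0.
have H1 : 4 * (delta * zz + C * (delta * zz)) = eps * zz by rewrite -dd; ring.
have H2 : Q * zz ^+ 2 * 4 <= eps * zz.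
  rewrite (le_trans _ (ler_wpM2r z0 z5)) //.
  have : 0 <= zz * zz by rewrite mulr_ge0.
  by have := mulr_ge0 Q0 (mulr_ge0 z0 z0); lra.
by lra.
Qed.

End Flow.

End FlowBox.

Section ConfigEquality.
Context {R : realType} {n : nat} {M : manifold R n} (alpha : poisson M).
Implicit Types (a : chart M) (c : config M).

Lemma config_ext c c' : (forall u, Xp c u = Xp c' u) -> (forall u, eta c u = eta c' u) -> c = c'.
Proof. by case: c c' => [X E] [X' E'] /= /funext -> /funext ->. Qed.

Lemma constraint_ext c c' : constraint alpha c -> constraint alpha c' ->
  (forall u, I01 u -> Xp c u = Xp c' u /\ eta c u = eta c' u) -> c = c'.
Proof.
move=> [cl _ _ _] [cl' _ _ _] H; apply: config_ext => u.
  by rewrite (cl u).1 (cl' u).1; have [] := H _ (clamp_I01 u).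
by rewrite (cl u).2 (cl' u).2; have [] := H _ (clamp_I01 u).
Qed.

Lemma solves_near c c' a u : (exists2 d : R, 0 < d & forall v, I01 v -> `|v - u| < d ->
    Xp c' v = Xp c v /\ eta c' v = eta c v) -> I01 u -> solves_at alpha c a u -> solves_at alpha c' a u.
Proof.
move=> [d d0 dP] Iu [[d' d'0 d'P] dX ce].
have [Eu Eu'] : Xp c' u = Xp c u /\ eta c' u = eta c u by apply: dP => //; rewrite subrr normr0.
split.
- exists (Num.min d d'); first by rewrite lt_min d0.
  by move=> v Iv; rewrite lt_min => /andP[/(dP v Iv)[-> _] /(d'P v Iv)].
- have -> : Xcoord c' a u = Xcoord c a u by rewrite /Xcoord Eu.
  rewrite Eu'; apply: deriv_in_near dX; last by rewrite /Xcoord Eu.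
  by exists d => // v Iv /(dP v Iv)[E _]; rewrite /Xcoord E.
- move=> e e0; have [d2 d20 d2P] := ce e e0.
  exists (Num.min d d2); first by rewrite lt_min d0.
  by move=> v Iv; rewrite lt_min => /andP[/(dP v Iv)[_ ->] /(d2P v Iv)]; rewrite Eu'.
Qed.

Lemma covector_from_eta a c u : constraint alpha c -> I01 u -> dom a (Xp c u) ->
  covector_from a (Xp c u) (eta c u a) = eta c u.
Proof.
move=> hc Iu au; apply: (covector_determined (covector_fromP _ _ _) (config_covector hc Iu) au).
exact: covector_from_id.
Qed.

End ConfigEquality.

(** * Flowing a whole configuration by a cut-off form *)

Section FlowStep.
Context {R : realType} {n : nat} {M : manifold R n} (alpha : poisson M).
Variables (a : chart M) (y0 : 'rV[R]_n) (rho C kappa : R).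
Hypothesis box : flow_box alpha a y0 rho C kappa.
Variable c : config M.
Hypothesis hc : constraint alpha c.
Variables (b b' : R -> 'rV[R]_n).
Hypotheses (db : forall u, I01 u -> deriv_in I01 b u (b' u))
  (cb' : forall u, I01 u -> cont_in I01 b' u)
  (bk : forall u, I01 u -> `|b u| <= kappa) (b0 : b 0 = 0) (b1 : b 1 = 0).
(** Both alternatives are open conditions in [u], so regularity near a parameter can be checked
    within one of them. *)
Hypothesis supp : forall u, I01 u ->
  (dom a (Xp c u) /\ `|Xcoord c a u - y0| < rho / 2) \/
  (exists2 d : R, 0 < d & forall v, I01 v -> `|v - u| < d -> b v = 0 /\ b' v = 0).

Let inbox u := dom a (Xp c u) /\ cball y0 (rho / 2) (Xcoord c a u).
Section Family.
Variables (X E : R -> R -> 'rV[R]_n).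
Hypothesis XE : forall u, I01 u -> inbox u ->
  local_flow alpha a y0 rho kappa (b u) (b' u) (Xcoord c a u) (eta c u a) (X u) (E u).

Let in_chart u s : I01 u -> inbox u -> I01 s -> chart_image a (X u s).
Proof.
move=> Iu iu Is; apply: (box_sub box); have := flow_in (XE Iu iu) Is.
by rewrite /cball /= => /le_trans; apply; have := box_rho box; lra.
Qed.

Let inbox_near u : I01 u -> dom a (Xp c u) -> `|Xcoord c a u - y0| < rho / 2 ->
  exists2 d : R, 0 < d & forall v, I01 v -> `|v - u| < d -> inbox v.
Proof.
move=> Iu au ur.
have [d d0 dP] := config_near hc Iu (@dom_open _ _ M a) au.
have g0 : 0 < rho / 2 - `|Xcoord c a u - y0| by rewrite subr_gt0.
have [d' d'0 d'P] := deriv_in_cont (config_deriv hc Iu au) g0.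
exists (Num.min d d'); first by rewrite lt_min d0.
move=> v Iv; rewrite lt_min => /andP[vd vd']; split; first exact: dP.
rewrite /cball /= -(subrKA (Xcoord c a u)) (le_trans (ler_normD _ _)) //.
by have := d'P v Iv vd'; rewrite -lerBrDr.
Qed.

(** [flow_X_dep] and [flow_E_dep] turn four moduli of continuity, of [X], [eta], [b] and [b'], into
    one that is uniform in the flow time; [T] collects the coefficients. *)
Let X_cont u : I01 u -> inbox u -> (exists2 d : R, 0 < d & forall v, I01 v -> `|v - u| < d -> inbox v) ->
  forall e : R, 0 < e -> exists2 d : R, 0 < d & forall v, I01 v -> `|v - u| < d -> forall s, I01 s ->
    `|X v s - X u s| <= e /\ `|E v s - E u s| <= e.
Proof.
move=> Iu iu [d1 d10 d1P] e e0; have C0 := box_C box; have k0 := box_kappa box.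
pose N := C * (2 * (`|eta c u a| + `|b' u|)).
have N0 : 0 <= N by rewrite mulr_ge0 // mulr_ge0 // addr_ge0.
pose T := 2 * (2 + C) + 2 * (2 + N * (1 + kappa * (2 * (1 + C)))).
have q0 : 0 <= N * (1 + kappa * (2 * (1 + C))).
  by rewrite mulr_ge0 // addr_ge0 // !mulr_ge0 // ?ltW // ltr_wpDr.
have T0 : 0 < T by rewrite /T; lra.
have dl0 : 0 < e / T by rewrite divr_gt0.
have [au _] := iu.
have [d2 d20 d2P] := deriv_in_cont (config_deriv hc Iu au) dl0.
have [d3 d30 d3P] := config_eta_cont hc Iu au dl0.
have [d4 d40 d4P] := deriv_in_cont (db Iu) dl0.
have [d5 d50 d5P] := cb' Iu dl0.
exists (Num.min (Num.min d1 d2) (Num.min d3 (Num.min d4 d5))); first by rewrite !lt_min d10 d20 d30 d40.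
move=> v Iv; rewrite !lt_min => /andP[/andP[v1 v2] /and3P[v3 v4 v5]] s Is.
have Hv := XE Iv (d1P v Iv v1); have Hu := XE Iu iu.
have h2 := d2P v Iv v2; have h3 := d3P v Iv v3; have h4 := d4P v Iv v4; have h5 := d5P v Iv v5.
have eT : e = e / T * T by rewrite divfK // gt_eqF.
have CT : C * `|b v - b u| <= C * (e / T) by rewrite ler_wpM2l.
have dl := ltW dl0.
have Cd : 0 <= C * (e / T) by rewrite mulr_ge0.
have NN : N * (`|b v - b u| + kappa * (2 * (`|Xcoord c a v - Xcoord c a u| + C * `|b v - b u|)))
     <= N * (1 + kappa * (2 * (1 + C))) * (e / T).
  rewrite -[leRHS]mulrA ler_wpM2l // [leRHS]mulrDl mul1r lerD // -[leRHS]mulrA ler_wpM2l //; first exact: ltW.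
  by rewrite -[leRHS]mulrA ler_wpM2l // [leRHS]mulrDl mul1r lerD.
have qd := mulr_ge0 q0 dl.
split.
  rewrite (le_trans (flow_X_dep box Hv Hu Is)) // [leRHS]eT /T.
  by move: h2 CT; move: (e / T) dl Cd qd => *; nra.
rewrite (le_trans (flow_E_dep box Hv Hu Is)) // [leRHS]eT /T.
by move: h3 h5 NN; rewrite /N; move: (e / T) dl Cd qd => *; nra.
Qed.

Let near_E u s : I01 u -> dom a (Xp c u) -> `|Xcoord c a u - y0| < rho / 2 -> I01 s ->
  deriv_in I01 (fun v => X v s) u (fA alpha a (X u s) (E u s)) /\ cont_in I01 (E^~ s) u.
Proof.
move=> Iu au ur Is; have [d d0 dP] := inbox_near Iu au ur.
have iu : inbox u by apply: dP => //; rewrite subrr normr0.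
split.
  apply: (flow_tangent box (b := b) (e := b') (x0 := Xcoord c a) (e0 := fun u => eta c u a)) => //.
  - by exists d => // v Iv vd; apply: XE => //; exact: dP.
  - exact: XE.
  - exact: db.
  - exact: (config_deriv hc).
move=> e e0; have [|d' d'0 d'P] := X_cont Iu iu _ e0; first by exists d.
by exists d' => // v Iv vd; have [] := d'P v Iv vd s Is.
Qed.

Section Regular.
Variables (gamma : R -> config M) (beta : R -> field_of_comps M).
Hypothesis gamma_in : forall u s, I01 u -> inbox u -> I01 s -> [/\ dom a (Xp (gamma s) u),
  Xcoord (gamma s) a u = X u s, eta (gamma s) u a = E u s & beta u (Xp (gamma s) u) a = b u].
Hypothesis gamma_out : forall u s, I01 u -> I01 s -> b u = 0 -> b' u = 0 ->
  Xp (gamma s) u = Xp c u /\ eta (gamma s) u = eta c u.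
Hypothesis betaE : forall u x, b u = 0 -> beta u x = fun=> 0.

Lemma regular_in s0 u0 : I01 s0 -> I01 u0 -> dom a (Xp c u0) -> `|Xcoord c a u0 - y0| < rho / 2 ->
  regular_at alpha beta gamma a s0 u0.
Proof.
move=> Is Iu au ur; have [d d0 dP] := inbox_near Iu au ur.
have iu : inbox u0 by apply: dP => //; rewrite subrr normr0.
have nin : \forall p \near near2 (s0, u0), [/\ I01 p.1, I01 p.2 & exists2 d : R, 0 < d &
    forall v, I01 v -> `|v - p.2| < d -> inbox v].
  apply/near2P; exists (d / 2); first by rewrite divr_gt0.
  move=> s u Is' Iu' sd ud /=; split=> //; exists (d / 2); first by rewrite divr_gt0.
  by move=> v Iv vd; apply: dP => //; have := ler_distD u v u0; lra.
have self u : I01 u -> (exists2 d : R, 0 < d & forall v, I01 v -> `|v - u| < d -> inbox v) -> inbox u.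
  by move=> Iu' [d' d'0]; apply=> //; rewrite subrr normr0.
have xiE s u : I01 s -> I01 u -> (exists2 d : R, 0 < d & forall v, I01 v -> `|v - u| < d -> inbox v) ->
    xi_eta alpha beta (gamma s) a u = b' u + Qf alpha a (X u s) (E u s) (b u).
  move=> Is' Iu' nu; have iu' := self u Iu' nu; have [d' d'0 d'P] := nu.
  rewrite xi_etaE; have [_ -> -> ->] := gamma_in Iu' iu' Is'; congr (_ + _).
  apply: (deriv_in_dI Iu' (deriv_in_near _ _ (db Iu'))).2.
    by exists d' => // v Iv vd; have [_ _ _] := gamma_in Iv (d'P v Iv vd) Is'.
  by have [_ _ _] := gamma_in Iu' iu' Is'.
(* Joint continuity from continuity in [s] at [u0] and continuity in [u] uniform over [s]. *)
have joint (Z : R -> R -> 'rV[R]_n) : (forall s, I01 s -> cont_in I01 (Z u0) s) ->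
   (forall e : R, 0 < e -> exists2 d : R, 0 < d & forall v, I01 v -> `|v - u0| < d -> forall s, I01 s ->
    `|Z v s - Z u0 s| <= e) -> (fun p : R * R => Z p.2 p.1) @ near2 (s0, u0) --> Z u0 s0.
  move=> c1 c2; apply/cvgrPdist_le => e e0.
  have e20 : 0 < e / 2 by rewrite divr_gt0.
  have [r1 r10 r1P] := c1 s0 Is _ e20; have [r2 r20 r2P] := c2 _ e20.
  apply/near2P; exists (Num.min r1 r2); first by rewrite lt_min r10.
  move=> s u Is' Iu' /=; rewrite !lt_min => /andP[s1 _] /andP[_ u2].
  have := r1P s Is' s1; have := r2P u Iu' u2 s Is'; have := ler_distD (Z u0 s) (Z u0 s0) (Z u s).
  rewrite (distrC (Z u s) (Z u0 s)) (distrC (Z u0 s) (Z u0 s0)); lra.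
have nu0 : exists2 d : R, 0 < d & forall v, I01 v -> `|v - u0| < d -> inbox v by exists d.
have H0 := XE Iu iu.
have cX : (fun p : R * R => X p.2 p.1) @ near2 (s0, u0) --> X u0 s0.
  apply: joint => [s Is'|e e0]; first exact: deriv_in_cont (flow_dX H0 Is').
  have [d' d'0 d'P] := X_cont Iu iu nu0 e0.
  by exists d' => // v Iv vd s Is'; have [] := d'P v Iv vd s Is'.
have cE : (fun p : R * R => E p.2 p.1) @ near2 (s0, u0) --> E u0 s0.
  apply: joint => [s Is'|e e0]; first exact: deriv_in_cont (flow_dE H0 Is').
  have [d' d'0 d'P] := X_cont Iu iu nu0 e0.
  by exists d' => // v Iv vd s Is'; have [] := d'P v Iv vd s Is'.
have cu (Z : R -> 'rV[R]_n) : cont_in I01 Z u0 -> (fun p : R * R => Z p.2) @ near2 (s0, u0) --> Z u0.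
  move=> cZ; apply: (joint (fun u _ => Z u)) => [s _ e e0|e e0].
    by exists 1 => // v _ _; rewrite subrr normr0 ltW.
  by have [d' d'0 d'P] := cZ e e0; exists d' => // v Iv vd s _; exact: d'P.
have cb := cu b (deriv_in_cont (db Iu)); have cbp := cu b' (cb' Iu).
have [_ EX EE EB] := gamma_in Iu iu Is.
split.
- by apply: filterS nin => p [I1 I2 /(self _ I2) ip]; have [] := gamma_in I2 ip I1.
- apply: filterS nin => p [I1 I2 /(self _ I2) ip]; have [_ -> _ ->] := gamma_in I2 ip I1.
  apply: deriv_in_ext (flow_dX (XE I2 ip) I1) => // s Is'.
  by have [_ -> _ _] := gamma_in I2 ip Is'.
- apply: filterS nin => p [I1 I2 np]; rewrite xiE //; have ip := self _ I2 np.
  apply: deriv_in_ext (flow_dE (XE I2 ip) I1) => // s Is'.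
  by have [_ _ -> _] := gamma_in I2 ip Is'.
- split.
  + rewrite EX; apply: cvg_trans cX; apply: near_eq_cvg.
    by apply: filterS nin => p [I1 I2 /(self _ I2) ip]; have [_ -> _ _] := gamma_in I2 ip I1.
  + rewrite EE; apply: cvg_trans cE; apply: near_eq_cvg.
    by apply: filterS nin => p [I1 I2 /(self _ I2) ip]; have [_ _ -> _] := gamma_in I2 ip I1.
  + rewrite EB; apply: cvg_trans cb; apply: near_eq_cvg.
    by apply: filterS nin => p [I1 I2 /(self _ I2) ip]; have [_ _ _ ->] := gamma_in I2 ip I1.
  + rewrite xiE //.
    have cxi : (fun p : R * R => b' p.2 + Qf alpha a (X p.2 p.1) (E p.2 p.1) (b p.2)) @ near2 (s0, u0) -->
        b' u0 + Qf alpha a (X u0 s0) (E u0 s0) (b u0).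
      exact: (cvgD cbp (cvg_Qf (in_chart Iu iu Is) cX cb cE)).
    apply: cvg_trans cxi; apply: near_eq_cvg.
    by apply: filterS nin => p [I1 I2 np]; rewrite xiE.
Qed.

(** Near such a parameter the curve is stationary, so any chart around the point serves. *)
Lemma regular_out s0 u0 d : I01 s0 -> I01 u0 -> 0 < d ->
  (forall v, I01 v -> `|v - u0| < d -> b v = 0 /\ b' v = 0) ->
  exists a', regular_at alpha beta gamma a' s0 u0.
Proof.
move=> Is Iu d0 dP; have [a' au] := charts_cover (Xp c u0); exists a'.
have [d1 d10 d1P] := config_near hc Iu (@dom_open _ _ M a') au.
have nin : \forall p \near near2 (s0, u0), [/\ I01 p.1, I01 p.2, dom a' (Xp c p.2) & exists2 d : R, 0 < d &
    forall v, I01 v -> `|v - p.2| < d -> b v = 0 /\ b' v = 0].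
  apply/near2P; exists (Num.min (d / 2) d1); first by rewrite lt_min divr_gt0.
  move=> s u Is' Iu'; rewrite !lt_min => /andP[sd _] /andP[ud ud1] /=; split=> //; first exact: d1P.
  exists (d / 2); first by rewrite divr_gt0.
  by move=> v Iv vd; apply: dP => //; have := ler_distD u v u0; lra.
have self u : I01 u -> (exists2 d : R, 0 < d & forall v, I01 v -> `|v - u| < d -> b v = 0 /\ b' v = 0) -> b u = 0 /\ b' u = 0.
  by move=> Iu' [d' d'0]; apply=> //; rewrite subrr normr0.
have xiE s u : I01 s -> I01 u -> (exists2 d : R, 0 < d & forall v, I01 v -> `|v - u| < d -> b v = 0 /\ b' v = 0) ->
    xi_eta alpha beta (gamma s) a' u = 0.
  move=> Is' Iu' nu; have [bu _] := self u Iu' nu; have [d' d'0 d'P] := nu.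
  rewrite xi_etaE betaE // Qf0r addr0.
  apply: (deriv_in_dI Iu' (deriv_in_near _ _ (@deriv_in_cst _ _ _ (0 : 'rV[R]_n) u))).2; last by rewrite betaE.
  by exists d' => // v Iv /(d'P v Iv)[bv _]; rewrite betaE.
have nu0 : exists2 d : R, 0 < d & forall v, I01 v -> `|v - u0| < d -> b v = 0 /\ b' v = 0 by exists d.
have [bu0 b'u0] := self u0 Iu nu0.
have c0 : (fun=> 0 : 'rV[R]_n) @ near2 (s0, u0) --> (0 : 'rV[R]_n) by exact: cvg_cst.
have [EX EE] := gamma_out Iu Is bu0 b'u0.
have cu (Z : R -> 'rV[R]_n) : cont_in I01 Z u0 -> (fun p : R * R => Z p.2) @ near2 (s0, u0) --> Z u0.
  move=> cZ; apply/cvgrPdist_le => e e0; have [r r0 rP] := cZ e e0.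
  by apply/near2P; exists r => // s u _ Iu' _ ur; rewrite distrC; exact: rP.
split.
- apply: filterS nin => p [I1 I2 ap np]; have [bp b'p] := self _ I2 np.
  by have [-> _] := gamma_out I2 I1 bp b'p.
- apply: filterS nin => p [I1 I2 ap np]; have [bp b'p] := self _ I2 np.
  rewrite betaE // fA0; apply: (deriv_in_ext _ I1 (@deriv_in_cst _ _ _ (Xcoord c a' p.2) _)) => s Is'.
  by rewrite /Xcoord; have [-> _] := gamma_out I2 Is' bp b'p.
- apply: filterS nin => p [I1 I2 ap np]; have [bp b'p] := self _ I2 np.
  rewrite xiE //; apply: (deriv_in_ext _ I1 (@deriv_in_cst _ _ _ (eta c p.2 a') _)) => s Is'.
  by have [_ ->] := gamma_out I2 Is' bp b'p.
- split.
  + have -> : Xcoord (gamma s0) a' u0 = Xcoord c a' u0 by rewrite /Xcoord EX.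
    apply: (cvg_trans _ (cu (Xcoord c a') (deriv_in_cont (config_deriv hc Iu au)))).
    apply: near_eq_cvg; apply: filterS nin => p [I1 I2 ap np]; have [bp b'p] := self _ I2 np.
    by rewrite /Xcoord; have [-> _] := gamma_out I2 I1 bp b'p.
  + rewrite EE; apply: (cvg_trans _ (cu (fun u => eta c u a') (config_eta_cont hc Iu au))).
    apply: near_eq_cvg; apply: filterS nin => p [I1 I2 ap np]; have [bp b'p] := self _ I2 np.
    by have [_ ->] := gamma_out I2 I1 bp b'p.
  + rewrite betaE //; apply: (cvg_trans _ c0).
    apply: near_eq_cvg; apply: filterS nin => p [I1 I2 ap np]; have [bp b'p] := self _ I2 np.
    by rewrite betaE.
  + rewrite xiE //; apply: (cvg_trans _ c0).
    by apply: near_eq_cvg; apply: filterS nin => p [I1 I2 ap np]; rewrite xiE.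
Qed.

End Regular.

Let beta := cutoff_form a y0 rho b.

(** Flowed in the chart, untouched elsewhere. The two prescriptions agree where [b] and [b'] vanish,
    by uniqueness against [flow_trivial] (see [gamma_out]). *)
Let gamma s := Config
  (fun u => if `[<inbox (clamp u)>] then chart_inv a (X (clamp u) s) else Xp c (clamp u))
  (fun u => if `[<inbox (clamp u)>] then covector_from a (chart_inv a (X (clamp u) s)) (E (clamp u) s)
            else eta c (clamp u)).

Let gamma_in u s : I01 u -> inbox u -> I01 s -> [/\ dom a (Xp (gamma s) u),
  Xcoord (gamma s) a u = X u s, eta (gamma s) u a = E u s & beta u (Xp (gamma s) u) a = b u].
Proof.
move=> Iu iu Is; have [ax xE] := chart_invP (in_chart Iu iu Is).
rewrite /Xcoord /= clamp_id // asboolT //; split=> //.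
  exact: covector_from_id.
apply: cutoff_form_near => //; rewrite xE; exact: (flow_in (XE Iu iu)).
Qed.

Let gamma_out u s : I01 u -> I01 s -> b u = 0 -> b' u = 0 ->
  Xp (gamma s) u = Xp c u /\ eta (gamma s) u = eta c u.
Proof.
move=> Iu Is bu b'u /=; rewrite clamp_id //.
have [iu|niu] := pselect (inbox u); last by rewrite asboolF.
rewrite asboolT //; have [au xr] := iu.
have xr' : cball y0 rho (Xcoord c a u).
  by move: xr; rewrite /cball /= => /le_trans; apply; have := box_rho box; lra.
have H := XE Iu iu; rewrite bu b'u in H.
have [-> ->] := flow_unique box H (flow_trivial box _ xr') Is.
by rewrite coordK // (covector_from_eta hc).
Qed.

Let gamma_constraint s : I01 s -> constraint alpha (gamma s).
Proof.
move=> Is; apply: constraint_intro => [u|u Iu|u Iu] /=.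
- by rewrite [clamp (clamp u)]clamp_id //; exact: clamp_I01.
- rewrite clamp_id //; case: asboolP => _; first exact: covector_fromP.
  exact: (config_covector hc).
- have [[au ur]|[d d0 dP]] := supp Iu; last first.
    have [a' au] := charts_cover (Xp c u); exists a'.
    apply: solves_near (constraint_solves hc Iu au) => //.
    by exists d => // v Iv vd; have [? ?] := dP v Iv vd; exact: gamma_out.
  have [dX cE] := near_E Iu au ur Is; have [d d0 dP] := inbox_near Iu au ur.
  have iu : inbox u by apply: dP => //; rewrite subrr normr0.
  exists a; split.
  + by exists d => // v Iv vd; have [] := gamma_in Iv (dP v Iv vd) Is.
  + have [_ -> -> _] := gamma_in Iu iu Is.
    apply: deriv_in_near dX; last by have [_ -> _ _] := gamma_in Iu iu Is.
    by exists d => // v Iv vd; have [_ -> _ _] := gamma_in Iv (dP v Iv vd) Is.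
  + move=> e e0; have [d' d'0 d'P] := cE e e0.
    exists (Num.min d d'); first by rewrite lt_min d0.
    move=> v Iv; rewrite lt_min => /andP[vd vd'].
    have [_ _ -> _] := gamma_in Iu iu Is; have [_ _ -> _] := gamma_in Iv (dP v Iv vd) Is.
    exact: d'P.
Qed.

Let beta_C1 : C1_forms beta.
Proof. exact: (C1_cutoff_form (box_rho box) (box_sub box) db cb'). Qed.

Lemma flow_family_step : [/\ flow_step alpha c (gamma 1),
  forall u, I01 u -> inbox u -> Xp (gamma 1) u = chart_inv a (X u 1) /\
    eta (gamma 1) u = covector_from a (chart_inv a (X u 1)) (E u 1) &
  forall u, I01 u -> b u = 0 -> b' u = 0 -> Xp (gamma 1) u = Xp c u /\ eta (gamma 1) u = eta c u].
Proof.
have I0 := @I01_0 R.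
have I1 := @I01_1 R.
split.
- exists beta, 1, gamma; split=> //.
  + exact: (P0_cutoff_form (box_rho box) (box_sub box) db cb').
  + rewrite (min_l ler01) (max_r ler01) => s Is; split; first exact: gamma_constraint.
    apply: regular_velocity => // u Iu.
    have [[au ur]|[d d0 dP]] := supp Iu; first by exists a; exact: (regular_in gamma_in).
    apply: (regular_out gamma_out _ Is Iu d0 dP) => v x; exact: cutoff_form0.
  + have [cl _ _ _] := hc.
    have E0 u : I01 u -> Xp (gamma 0) u = Xp c u /\ eta (gamma 0) u = eta c u.
      move=> Iu /=; rewrite clamp_id //; case: asboolP => // iu; have [au _] := iu.
      by rewrite (flow_X0 (XE Iu iu)) (flow_E0 (XE Iu iu)) coordK // (covector_from_eta hc).
    exact: (constraint_ext (gamma_constraint I0) hc E0).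
- by move=> u Iu iu /=; rewrite clamp_id // asboolT.
- by move=> u Iu; exact: gamma_out.
Qed.

End Family.

(** The new configuration is described through an arbitrary solution of the pointwise ODE, so that
    flows known from elsewhere can be inserted. *)
Lemma flow_lemma : exists c', [/\ flow_step alpha c c',
  forall u X E, I01 u -> dom a (Xp c u) -> cball y0 (rho / 2) (Xcoord c a u) ->
    local_flow alpha a y0 rho kappa (b u) (b' u) (Xcoord c a u) (eta c u a) X E ->
    Xp c' u = chart_inv a (X 1) /\ eta c' u = covector_from a (chart_inv a (X 1)) (E 1) &
  forall u, I01 u -> b u = 0 -> b' u = 0 -> Xp c' u = Xp c u /\ eta c' u = eta c u].
Proof.
have I1 := @I01_1 R.
have /choice[XE XEP] : forall u, exists XE : (R -> 'rV[R]_n) * (R -> 'rV[R]_n), I01 u -> inbox u ->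
    local_flow alpha a y0 rho kappa (b u) (b' u) (Xcoord c a u) (eta c u a) XE.1 XE.2.
  move=> u; have [[Iu [au xr]]|nu] := pselect (I01 u /\ inbox u); last first.
    by exists (fun=> 0, fun=> 0) => Iu iu; case: nu.
  by have [X [E H]] := flow_exists box (b' u) (eta c u a) (bk Iu) xr; exists (X, E).
have [H1 H2 H3] := @flow_family_step (fun u => (XE u).1) (fun u => (XE u).2) XEP.
eexists; split; [exact: H1| |exact: H3].
move=> u X E Iu au xr H.
have [-> ->] := H2 u Iu (conj au xr).
by have [-> ->] := flow_unique box (XEP u Iu (conj au xr)) H I1.
Qed.

End FlowStep.

(** * Developing a path *)

Section Primitive.
Context {R : realType} {m n : nat}.
Local Notation W := 'M[R]_(m, n).

(** A single operator for all continuous functions, needed to write the contraction as a map on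
    functions. *)
Lemma primitive_from (t0 : R) : exists P : (R -> W) -> R -> W, forall w, continuous w ->
  P w t0 = 0 /\ forall t, `|t - t0| < 2 -> deriv_in setT (P w) t (w t).
Proof.
have /choice[P HP] : forall w : R -> W, exists Q : R -> W, continuous w ->
    Q t0 = 0 /\ forall t, `|t - t0| < 2 -> deriv_in setT Q t (w t).
  move=> w; have [cw|ncw] := pselect (continuous w); last by exists w.
  have [Q HQ] := antiderivative (t0 - 2) (t0 + 2) cw.
  exists (fun t => Q t - Q t0) => _; split; first by rewrite subrr.
  move=> t; rewrite ltr_norml => /andP[t1 t2]; rewrite -[w t]subr0.
  apply: deriv_inB; last exact: deriv_in_cst.
  by apply: HQ; apply/andP; split; lra.
by exists P.
Qed.

Lemma primitive_bound (f f' : R -> W) (t0 K : R) : f t0 = 0 ->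
  (forall t, `|t - t0| < 2 -> deriv_in setT f t (f' t)) -> (forall t, `|f' t| <= K) ->
  forall t, `|t - t0| <= 1 -> `|f t| <= K * `|t - t0|.
Proof.
move=> f0 df fK t; rewrite ler_norml => /andP[t1 t2]; rewrite -[f t]subr0 -f0.
have [tt|tt] := leP t0 t.
  rewrite ger0_norm ?subr_ge0 //; apply: (@mean_value _ _ _ _ _ _ f f') => // u /andP[? ?].
  by apply: deriv_inS (df u _) => //; rewrite ltr_norml; apply/andP; split; lra.
rewrite distrC (distrC t) [`|t0 - t|]ger0_norm ?subr_ge0 ?(ltW tt) //.
apply: (@mean_value _ _ _ _ _ _ f f') => //; first exact: ltW.
move=> u /andP[? ?].
by apply: deriv_inS (df u _) => //; rewrite ltr_norml; apply/andP; split; lra.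
Qed.

End Primitive.

(** * Prescribing the end of the flow *)

Section Development.
Context {R : realType} {n : nat} {M : manifold R n} (alpha : poisson M).
Variables (a : chart M) (y0 : 'rV[R]_n) (rho C kappa : R).
Hypothesis box : flow_box alpha a y0 rho C kappa.
Local Notation flow := (local_flow alpha a y0 rho kappa).

Lemma flow_displacement b e x0 e0 X E s : flow b e x0 e0 X E -> I01 s -> `|X s - x0| <= C * kappa.
Proof.
move=> H Is; have I0 := @I01_0 R.
have Ck0 : 0 <= C * kappa by rewrite mulr_ge0 // ?(box_C box) // ltW // (box_kappa box).
rewrite -(flow_X0 H) (le_trans (mean_value_I01 I0 Is (flow_dX H) (K := C * kappa) _)) //.
  move=> t It; rewrite (le_trans (box_fA box _ (flow_in H It))) // ler_wpM2l ?(box_C box) //.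
  exact: flow_small H.
by rewrite ler_piMr // subr0; move: Is => /andP[? ?]; rewrite ger0_norm.
Qed.

(** Lowering [kappa] preserves all bounds and makes the displacement of every flow as small as
    desired. *)
Lemma flow_box_shrink k : 0 < k -> exists2 kappa', flow_box alpha a y0 rho C kappa' & C * kappa' <= k.
Proof.
move=> k0; have C0 := box_C box; have C1 : 0 < C + 1 by rewrite ltr_wpDl.
pose l := Num.min kappa (k / (C + 1)).
have l0 : 0 < l by rewrite lt_min (box_kappa box) divr_gt0.
have lk : C * l <= C * kappa by rewrite ler_wpM2l // ge_min lexx.
exists l.
  by case: box => *; split=> //; apply: le_trans lk _.
rewrite (le_trans (y := (C + 1) * l)) ?ler_wpM2r ?lerDl //; first exact: ltW.
by rewrite mulrC -ler_pdivlMr // ge_min lexx orbT.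
Qed.

(** Without the quadratic term [E 1] would be [w]. The defect [E 1 - w] integrates [Qf] against [b],
    which is of size [m * eps], so for small [eps] it is a contraction in [w]. With
    [p = C * m * eps] the two estimates need [8 p <= 1] and [14 p <= 1]; the factor 20 covers
    both. *)
Lemma flow_defect b w b' w' x0 X E X' E' (m eps delta : R) : 0 <= m -> 0 <= eps -> 0 <= delta ->
  20 * (C * m * eps) <= 1 -> flow b w x0 0 X E -> flow b' w' x0 0 X' E' ->
  `|b| <= m * eps -> `|w'| <= m -> `|b - b'| <= eps * delta -> `|w - w'| <= delta ->
  `|(E 1 - w) - (E' 1 - w')| <= delta / 2.
Proof.
move=> m0 eps0 delta0 small H H' bm w'm bb' ww'.
have C0 := box_C box; have k0 := ltW (box_kappa box); have Ck := box_half box.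
have I1 := @I01_1 R.
have I0 := @I01_0 R.
pose p := C * m * eps.
have p0 : 0 <= p by rewrite !mulr_ge0.
have dE s : I01 s -> `|E s - E' s| <= 3 * delta.
  move=> Is; rewrite (le_trans (flow_E_dep box H H' Is)) //.
  rewrite !subrr normr0 !add0r.
  have H1 : C * (2 * `|w'|) * (`|b - b'| + kappa * (2 * (C * `|b - b'|))) <=
      C * (2 * m) * (eps * delta + kappa * (2 * (C * (eps * delta)))).
    by rewrite ler_pM ?mulr_ge0 ?addr_ge0 ?mulr_ge0 // ?ler_wpM2l // lerD // ?ler_wpM2l.
  have H2 : C * (2 * m) * (eps * delta + kappa * (2 * (C * (eps * delta)))) = 2 * p * delta * (1 + 2 * (C * kappa)).
    by rewrite /p; ring.
  have pd0 : 0 <= p * delta by rewrite mulr_ge0.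
  have H3 : 2 * p * delta * (1 + 2 * (C * kappa)) <= 2 * p * delta * 2.
    by rewrite ler_wpM2l ?mulr_ge0 //; lra.
  have H4 : 20 * (p * delta) <= delta by have := ler_wpM2r delta0 small; rewrite /p; lra.
  by lra.
pose D s := (E s - s *: w) - (E' s - s *: w').
have dlin (v : 'rV[R]_n) s : deriv_in I01 (fun s => s *: v) s v.
  by have := deriv_in_scale (@deriv_in_id R I01 s) (@deriv_in_cst R _ I01 v s); rewrite scale1r scaler0 addr0.
have dD s : I01 s -> deriv_in I01 D s ((w + Qf alpha a (X s) (E s) b - w) - (w' + Qf alpha a (X' s) (E' s) b' - w')).
  move=> Is; apply: deriv_inB; apply: deriv_inB => //.
    exact: (flow_dE H).
  exact: (flow_dE H').
have -> : E 1 - w - (E' 1 - w') = D 1 - D 0.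
  by rewrite /D !scale1r !scale0r (flow_E0 H) (flow_E0 H') !subr0.
have : `|D 1 - D 0| <= delta / 2 * `|1 - 0|.
  apply: (mean_value_I01 I0 I1 dD) => s Is.
  have -> : (w + Qf alpha a (X s) (E s) b - w) - (w' + Qf alpha a (X' s) (E' s) b' - w') =
     Qf alpha a (X s) (E s - E' s) b + (Qf alpha a (X s) (E' s) (b - b') +
       (Qf alpha a (X s) (E' s) b' - Qf alpha a (X' s) (E' s) b')).
    rewrite QfB QfBr; move: (Qf _ _ _ _ _) (Qf _ _ _ _ _) (Qf _ _ _ _ _) (Qf _ _ _ _ _) => q1 q2 q3 q4.
    by apply/rowP => i; rewrite !mxE; ring.
  have E'm : `|E' s| <= 2 * m.
    by rewrite (le_trans (flow_E_bound box H' Is)) // normr0 add0r ler_wpM2l.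
  have XX : `|X s - X' s| <= 2 * (C * (eps * delta)).
    by rewrite (le_trans (flow_X_dep box H H' Is)) // subrr normr0 add0r ler_wpM2l // ler_wpM2l.
  have T1 : `|Qf alpha a (X s) (E s - E' s) b| <= C * (3 * delta) * (m * eps).
    by rewrite (le_trans (box_Qf box _ _ (flow_in H Is))) // ler_pM ?mulr_ge0 // ler_wpM2l // dE.
  have T2 : `|Qf alpha a (X s) (E' s) (b - b')| <= C * (2 * m) * (eps * delta).
    by rewrite (le_trans (box_Qf box _ _ (flow_in H Is))) // ler_pM ?mulr_ge0 // ler_wpM2l.
  have T3 : `|Qf alpha a (X s) (E' s) b' - Qf alpha a (X' s) (E' s) b'| <=
      C * (2 * (C * (eps * delta))) * (2 * m) * kappa.
    rewrite (le_trans (box_Qf_lip box _ _ (flow_in H' Is) (flow_in H Is))) //.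
    by rewrite !ler_pM ?mulr_ge0 // (flow_small H').
  rewrite (le_trans (ler_normD _ _)) //.
  rewrite (le_trans (lerD T1 (le_trans (ler_normD _ _) (lerD T2 T3)))) //.
  have -> : C * (3 * delta) * (m * eps) + (C * (2 * m) * (eps * delta) +
     C * (2 * (C * (eps * delta))) * (2 * m) * kappa) = p * delta * (5 + 4 * (C * kappa)) by rewrite /p; ring.
  have pd0 : 0 <= p * delta by rewrite mulr_ge0.
  have H3 : p * delta * (5 + 4 * (C * kappa)) <= p * delta * 7 by rewrite ler_wpM2l //; lra.
  have H4 : 20 * (p * delta) <= delta by have := ler_wpM2r delta0 small; rewrite /p; lra.
  by lra.
by rewrite subr0 normr1 mulr1.
Qed.

Lemma flow_E_cont x0 b' w' X' E' (e : R) : 0 < e -> flow b' w' x0 0 X' E' ->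
  exists2 d : R, 0 < d & forall b w X E, flow b w x0 0 X E -> `|b - b'| <= d -> `|w - w'| <= d ->
    `|E 1 - E' 1| <= e.
Proof.
move=> e0 H'; have C0 := box_C box; have k0 := ltW (box_kappa box).
have I1 := @I01_1 R.
pose N := C * (2 * `|w'|) * (1 + kappa * (2 * C)).
have N0 : 0 <= N by rewrite !mulr_ge0 // addr_ge0 // !mulr_ge0.
have T0 : 0 < 2 * (1 + N) by rewrite mulr_gt0 // ltr_wpDr.
exists (e / (2 * (1 + N))); first by rewrite divr_gt0.
move=> b w X E H bd wd; rewrite (le_trans (flow_E_dep box H H' I1)) //.
rewrite !subrr normr0 !add0r.
have -> : C * (2 * `|w'|) * (`|b - b'| + kappa * (2 * (C * `|b - b'|))) = N * `|b - b'| by rewrite /N; ring.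
have eT : e = e / (2 * (1 + N)) * (2 * (1 + N)) by rewrite divfK // gt_eqF.
rewrite [leRHS]eT; have := ler_wpM2l N0 bd.
by move: (e / _) wd => d wd; lra.
Qed.

(** The unknown is [w], and [B] is its primitive from [t0]; a fixed point of [w - (E 1 - e)] has
    [E 1 = e]. The bound [2 * (eps * (C * N)) <= 1] is recorded for the uniqueness argument in
    [development]. *)
Lemma prescribed_endpoint (N : R) : 0 <= N -> exists eps : R, [/\ 0 < eps, eps <= 1, 2 * (eps * (C * N)) <= 1 &
  forall (t0 : R) (e : R -> 'rV[R]_n) x0, continuous e -> (forall t, `|e t| <= N) -> cball y0 (rho / 2) x0 ->
  exists B w : R -> 'rV[R]_n, [/\ continuous w, B t0 = 0 &
    forall t, `|t - t0| <= eps -> [/\ deriv_in setT B t (w t), `|B t| <= kappa &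
      exists X E, flow (B t) (w t) x0 0 X E /\ E 1 = e t]]].
Proof.
move=> N0; have C0 := box_C box; have k0 := box_kappa box.
(* The defect of a function bounded by [m] is at most [m / 2], so [e] minus the defect is bounded by
   [N + m / 2 <= m]. *)
pose m := 2 * N + 1; have m0 : 0 < m by rewrite /m; lra.
have q0 : 0 < 20 * (C * m) + 1 by rewrite ltr_wpDl // !mulr_ge0 // ltW.
(* In this order: primitives are controlled up to distance 1 from [t0], forms stay below [kappa],
   and [flow_defect] applies. *)
pose eps := Num.min 1 (Num.min (kappa / m) (20 * (C * m) + 1)^-1).
have eps0 : 0 < eps by rewrite !lt_min ltr01 divr_gt0 //= invr_gt0.
have eps1 : eps <= 1 by rewrite ge_min lexx.
have epsk : m * eps <= kappa.
  by rewrite mulrC -ler_pdivlMr // !ge_min lexx orbT.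
have small : 20 * (C * m * eps) <= 1.
  rewrite mulrA (le_trans (y := (20 * (C * m) + 1) * eps)) //.
    by rewrite ler_wpM2r ?lerDl // ltW.
  by rewrite mulrC -ler_pdivlMr // div1r !ge_min lexx !orbT.
exists eps; split=> //.
  have : C * N * eps <= C * m * eps.
    by rewrite (ler_wpM2r (ltW eps0)) // ler_wpM2l // /m; lra.
  have : 0 <= C * m * eps by rewrite !mulr_ge0 // ltW.
  by rewrite (_ : eps * (C * N) = C * N * eps); [lra|ring].
move=> t0 e x0 ce eN x0r.
have [P HP] := @primitive_from R 1 n t0.
(* Freezing the argument outside the window makes all functions global, as [contraction_fixpoint]
   requires. *)
pose tau := window t0 eps.
have tau_in t : `|tau t - t0| <= eps := window_in t0 eps0 t.
have tau1 t : `|tau t - t0| <= 1 := le_trans (tau_in t) eps1.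
have /choice[fl flP] : forall bw : 'rV[R]_n * 'rV[R]_n, exists XE : (R -> 'rV[R]_n) * (R -> 'rV[R]_n),
    `|bw.1| <= kappa -> flow bw.1 bw.2 x0 0 XE.1 XE.2.
  move=> [b w] /=; have [bk|nbk] := pselect (`|b| <= kappa); last by exists (fun=> 0, fun=> 0).
  by have [X [E H]] := flow_exists box w 0 bk x0r; exists (X, E).
pose T w t := (fl (P w (tau t), w (tau t))).2 1.
pose K w t := w (tau t) - (T w t - e t).
have Pb w : continuous w -> (forall t, `|w t| <= m) -> forall t, `|P w (tau t)| <= m * eps.
  move=> cw wm t; have [P0 dP] := HP w cw.
  rewrite (le_trans (primitive_bound P0 dP wm (tau1 t))) // ler_wpM2l //.
  exact: ltW.
have flT w : continuous w -> (forall t, `|w t| <= m) -> forall t,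
    flow (P w (tau t)) (w (tau t)) x0 0 (fl (P w (tau t), w (tau t))).1 (fl (P w (tau t), w (tau t))).2.
  by move=> cw wm t; apply: (flP (_, _)); exact: le_trans (Pb w cw wm t) epsk.
have ctau : continuous tau := @window_continuous R t0 eps eps0.
have cP w : continuous w -> continuous (fun t => P w (tau t)).
  move=> cw t; apply/cvgrPdist_le => e1 e10; have [_ dP] := HP w cw.
  have tau2 : `|tau t - t0| < 2 by apply: le_lt_trans (tau1 t) _; lra.
  have [d d0 dP'] := deriv_in_cont (dP _ tau2) e10.
  apply/nbhs_ballP; exists d => //= v; rewrite /ball /= distrC => vd; rewrite distrC.
  by apply: dP' => //; apply: le_lt_trans vd; exact: window_lip.
have cwt (w : R -> 'rV[R]_n) : continuous w -> continuous (fun t => w (tau t)).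
  move=> cw t; apply/cvgrPdist_le => e1 e10.
  have /cvgrPdist_le /(_ e1 e10) /nbhs_ballP[d /= d0 dP'] := cw (tau t).
  apply/nbhs_ballP; exists d => //= v; rewrite /ball /= => vd.
  by apply: dP'; rewrite /ball /=; apply: le_lt_trans vd; exact: window_lip.
have diffT w w' d : continuous w -> continuous w' -> (forall t, `|w t| <= m) -> (forall t, `|w' t| <= m) ->
    (forall t, `|w t - w' t| <= d) -> forall t, `|(T w t - w (tau t)) - (T w' t - w' (tau t))| <= d / 2.
  move=> cw cw' wm wm' ww' t.
  have d0 : 0 <= d := le_trans (normr_ge0 _) (ww' t).
  apply: (flow_defect (ltW m0) (ltW eps0) d0 small (flT w cw wm t) (flT w' cw' wm' t)) => //; first exact: Pb.
  have [P0 dP] := HP w cw; have [P0' dP'] := HP w' cw'.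
  have dPP s : `|s - t0| < 2 -> deriv_in setT (fun s => P w s - P w' s) s (w s - w' s).
    by move=> s2; apply: deriv_inB; [exact: dP|exact: dP'].
  have PP0 : P w t0 - P w' t0 = 0 by rewrite P0 P0' subrr.
  rewrite (le_trans (primitive_bound PP0 dPP ww' (tau1 t))) // mulrC ler_wpM2r //.
have [w [cw wm Kw]] : exists w : R -> 'rV[R]_n, [/\ continuous w, forall t, `|w t - 0| <= m & K w = w].
  apply: (@contraction_fixpoint R 1 n K (fun=> 0) m); first exact: ltW.
  - by move=> t; exact: cvg_cst.
  - move=> w cw wm; have {}wm t : `|w t| <= m by have := wm t; rewrite subr0.
    split=> [t|t].
      have cT : {for t, continuous (T w)}.
        apply/cvgrPdist_le => e1 e10.
        have [d d0 dP] := flow_E_cont e10 (flT w cw wm t).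
        have H1 : \forall s \near t, `|P w (tau t) - P w (tau s)| <= d.
          by have /cvgrPdist_le := cP w cw t; apply.
        have H2 : \forall s \near t, `|w (tau t) - w (tau s)| <= d.
          by have /cvgrPdist_le := cwt w cw t; apply.
        near=> s; rewrite distrC; apply: (dP _ _ _ _ (flT w cw wm s)).
          by rewrite distrC; near: s.
        by rewrite distrC; near: s.
      by apply: (@continuousB _ _ _ (fun t => w (tau t)) (fun t => T w t - e t)); [exact: cwt|apply: continuousB => //; exact: ce].
    (* The zero function has zero defect; comparison with it bounds the defect of [w] by [m / 2]. *)
    pose z : R -> 'rV[R]_n := fun=> 0.
    have z0 (s : R) : `|z s| <= m by rewrite /z normr0 ltW.
    have cz : continuous z by move=> x; exact: cvg_cst.
    have wz s : `|w s - z s| <= m by rewrite /z subr0.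
    have := diffT w z m cw cz wm z0 wz t.
    have T0 : T z t = 0.
      have Pz : P z (tau t) = 0.
        have [P0 dP] := HP _ cz.
        apply/eqP; rewrite -normr_le0.
        have zz (s : R) : `|z s| <= 0 by rewrite /z normr0.
        by have := primitive_bound P0 dP zz (tau1 t); rewrite mul0r.
      have I1 := @I01_1 R.
      have x0r' : cball y0 rho x0.
        by move: x0r; rewrite /cball /= => /le_trans; apply; have := box_rho box; lra.
      have Hz := flT _ cz z0 t; rewrite Pz in Hz.
      by rewrite /T Pz; have [_ ->] := flow_unique box Hz (flow_trivial box 0 x0r') I1.
    rewrite T0 {1}/z !subr0 /K => H.
    have -> : w (tau t) - (T w t - e t) = e t - (T w t - w (tau t)).
      by apply/rowP => i; rewrite !mxE; ring.
    by rewrite (le_trans (ler_normB _ _)) //; have := eN t; rewrite /m in H *; lra.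
  - move=> w w' d cw cw' wm wm' ww' t.
    have {}wm s : `|w s| <= m by have := wm s; rewrite subr0.
    have {}wm' s : `|w' s| <= m by have := wm' s; rewrite subr0.
    rewrite -normrN; have -> : - (K w t - K w' t) = (T w t - w (tau t)) - (T w' t - w' (tau t)).
      by rewrite /K; apply/rowP => i; rewrite !mxE; ring.
    exact: diffT.
have {}wm t : `|w t| <= m by have := wm t; rewrite subr0.
have [P0 dP] := HP w cw.
exists (P w), w; split=> // t tt.
have tauE : tau t = t by exact: window_id.
split.
- by apply: dP; apply: le_lt_trans tt _; lra.
- by rewrite -tauE; exact: le_trans (Pb w cw wm t) epsk.
- have H := flT w cw wm t; rewrite tauE in H.
  exists (fl (P w t, w t)).1, (fl (P w t, w t)).2; split=> //.
  have /(congr1 (fun f => f t)) := Kw; rewrite /K /T tauE => /eqP.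
  by rewrite -subr_eq0 addrAC subrr sub0r oppr_eq0 subr_eq0 => /eqP.
Unshelve. all: by end_near. Qed.

End Development.

Section ConfigDevelopment.
Context {R : realType} {n : nat} {M : manifold R n} (alpha : poisson M).
Variables (a : chart M) (c : config M) (t1 : R).
Hypotheses (hc : constraint alpha c) (It1 : I01 t1) (at1 : dom a (Xp c t1)).
Variables (rho C kappa : R).
Hypothesis box : flow_box alpha a (Xcoord c a t1) rho C kappa.
Local Notation flow := (local_flow alpha a (Xcoord c a t1) rho kappa).

(** Once the flows end at the right [eta], their end points [Y] solve [Y' = fA Y eta] by
    [flow_tangent], because the constant start [(X t0, 0)] satisfies the constraint. [X] solves the
    same equation with the same value at [t0], so the two coincide. One [eps] works for all [t0]
    near [t1], which prepares a compactness argument. *)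
Lemma development : exists2 eps : R, 0 < eps & forall t0, I01 t0 -> `|t0 - t1| < eps ->
  exists B w : R -> 'rV[R]_n, [/\ continuous w, B t0 = 0 &
    forall t, I01 t -> `|t - t0| < eps ->
    [/\ deriv_in setT B t (w t), `|B t| <= kappa, dom a (Xp c t) /\ `|Xcoord c a t - Xcoord c a t1| < rho / 4 &
      exists X E, [/\ flow (B t) (w t) (Xcoord c a t0) 0 X E, X 1 = Xcoord c a t & E 1 = eta c t a]]].
Proof.
have C0 := box_C box; have rho0 := box_rho box.
have I1 := @I01_1 R.
have [d1 d10 d1P] := config_near hc It1 (@dom_open _ _ M a) at1.
have [d2 d20 d2P] := config_eta_cont hc It1 at1 ltr01.
have rho8 : 0 < rho / 8 by rewrite divr_gt0.
have [d3 d30 d3P] := deriv_in_cont (config_deriv hc It1 at1) rho8.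
pose r := Num.min (Num.min d1 d2) d3 / 2.
have r0 : 0 < r by rewrite divr_gt0 // !lt_min d10 d20.
have rd : r < Num.min (Num.min d1 d2) d3 by rewrite ltr_pdivrMr // ltr_pMr ?ltr1n // !lt_min d10 d20.
have good u : I01 u -> `|u - t1| <= r -> [/\ dom a (Xp c u), `|eta c u a - eta c t1 a| <= 1 &
    `|Xcoord c a u - Xcoord c a t1| < rho / 4].
  move=> Iu /le_lt_trans/(_ rd); rewrite !lt_min => /andP[/andP[u1 u2] u3]; split.
  - exact: d1P.
  - exact: d2P.
  - by apply: le_lt_trans (d3P u Iu u3) _; lra.
(* Truncation to the part of [0,1] within [r] of [t1], so that [e] is continuous on the whole
   line. *)
pose v t := clamp (window t1 r t).
have vI t : I01 (v t) := clamp_I01 _.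
have vr t : `|v t - t1| <= r.
  by rewrite /v -{2}(clamp_id It1) (le_trans (clamp_lip _ _)) // window_in.
have vlip t t' : `|v t - v t'| <= `|t - t'|.
  by rewrite (le_trans (clamp_lip _ _)) // window_lip.
have v_id t : I01 t -> `|t - t1| <= r -> v t = t.
  by move=> It tr; rewrite /v window_id // clamp_id.
pose e t := eta c (v t) a.
have ce : continuous e.
  move=> t; apply/cvgrPdist_le => e1 e10.
  have [at_ _ _] := good _ (vI t) (vr t).
  have [d d0 dP] := config_eta_cont hc (vI t) at_ e10.
  apply/nbhs_ballP; exists d => //= s; rewrite /ball /= distrC => sd; rewrite distrC.
  by apply: dP => //; apply: le_lt_trans sd.
pose N := `|eta c t1 a| + 1.
have N0 : 0 <= N by rewrite addr_ge0.
have eN t : `|e t| <= N.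
  have [_ H _] := good _ (vI t) (vr t).
  by rewrite -(subrK (eta c t1 a) (e t)) addrC (le_trans (ler_normD _ _)) // lerD2l.
have [eps [eps0 eps1 epsN Heps]] := prescribed_endpoint box N0.
exists (Num.min eps (r / 2)); first by rewrite lt_min eps0 divr_gt0.
move=> t0 It0; rewrite lt_min => /andP[_ t0r].
have t0r' : `|t0 - t1| <= r by apply: ltW; apply: lt_trans t0r _; lra.
have [at0 _ x0r] := good t0 It0 t0r'.
have x0r2 : cball (Xcoord c a t1) (rho / 2) (Xcoord c a t0).
  by rewrite /cball /=; apply: ltW; apply: lt_trans x0r _; lra.
have [B [w [cw B0 HB]]] := Heps t0 e (Xcoord c a t0) ce eN x0r2.
exists B, w; split=> // t It; rewrite lt_min => /andP[te tr].
have tr' s : `|s - t0| < r / 2 -> `|s - t1| <= r.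
  by move=> sr; have := ler_distD t0 s t1; lra.
have [dB Bk [X [E [H E1]]]] := HB t (ltW te).
have [at_ _ xr] := good t It (tr' t tr).
split=> //; exists X, E; split=> //; last by rewrite E1 /e v_id // tr'.
pose D := [set s | I01 s /\ (`|s - t0| <= `|t - t0|)].
have DP s : D s -> [/\ I01 s, `|s - t0| <= eps & `|s - t1| <= r].
  by move=> [Is st]; split=> //; [exact: le_trans (ltW te)|apply: tr'; exact: le_lt_trans tr].
have /choice[XE XEP] : forall s, exists XE : (R -> 'rV[R]_n) * (R -> 'rV[R]_n), `|s - t0| <= eps ->
    flow (B s) (w s) (Xcoord c a t0) 0 XE.1 XE.2 /\ XE.2 1 = e s.
  move=> s; have [se|nse] := pselect (`|s - t0| <= eps); last by exists (fun=> 0, fun=> 0).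
  by have [_ _ [X' [E' H']]] := HB s se; exists (X', E').
pose Y s := (XE s).1 1.
have dY s : D s -> deriv_in D Y s (fA alpha a (Y s) (eta c s a)).
  move=> Ds; have [Is se sr] := DP s Ds.
  have -> : eta c s a = (XE s).2 1 by rewrite (XEP s se).2 /e v_id.
  apply: (flow_tangent box (b := B) (e := w) (x0 := fun=> Xcoord c a t0) (e0 := fun=> 0)
    (X := fun s => (XE s).1) (E := fun s => (XE s).2)) => //.
  - by exists 1 => // s' /DP[_ se' _] _; exact: (XEP s' se').1.
  - exact: (XEP s se).1.
  - by have [dBs _ _] := HB s se; exact: deriv_inS dBs.
  - by rewrite fA0; exact: deriv_in_cst.
have dX s : D s -> deriv_in D (Xcoord c a) s (fA alpha a (Xcoord c a s) (eta c s a)).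
  move=> Ds; have [Is se sr] := DP s Ds; have [as_ _ _] := good s Is sr.
  by apply: deriv_inS (config_deriv hc Is as_) => s' /DP[].
(* The segment from [t0] to [t] rescaled to [0,1], where [small_gronwall] applies. *)
pose p (k : R) := t0 + k * (t - t0).
have pD k : I01 k -> D (p k).
  move=> /andP[k0 k1]; have /andP[? ?] := It; have /andP[? ?] := It0; split.
    by rewrite /p; apply/andP; split; nra.
  rewrite /p addrAC subrr add0r normrM ger0_norm //.
  by rewrite -[leRHS]mul1r ler_wpM2r.
have dp k : deriv_in I01 p k (t - t0).
  have := deriv_inD (@deriv_in_cst R _ I01 t0 k) (deriv_inM (@deriv_in_id R I01 k) (@deriv_in_cst R _ I01 (t - t0) k)).
  by rewrite add0r mul1r mulr0 addr0.
pose f k := Y (p k) - Xcoord c a (p k).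
have df k : I01 k -> deriv_in I01 f k ((t - t0) *: fA alpha a (Y (p k)) (eta c (p k) a)
    - (t - t0) *: fA alpha a (Xcoord c a (p k)) (eta c (p k) a)).
  move=> Ik; apply: deriv_inB.
    exact: (deriv_in_comp pD (dp k) (dY _ (pD k Ik))).
  exact: (deriv_in_comp pD (dp k) (dX _ (pD k Ik))).
have fb k : I01 k -> `|(t - t0) *: fA alpha a (Y (p k)) (eta c (p k) a)
    - (t - t0) *: fA alpha a (Xcoord c a (p k)) (eta c (p k) a)| <= 2^-1 * `|f k| + 0.
  move=> Ik; have [Ip pe pr] := DP _ (pD k Ik); have [ap _ xpr] := good _ Ip pr.
  have Yin : cball (Xcoord c a t1) rho (Y (p k)) := flow_in (XEP _ pe).1 I1.
  have Xin : cball (Xcoord c a t1) rho (Xcoord c a (p k)).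
    by rewrite /cball /=; apply: ltW; apply: lt_trans xpr _; lra.
  rewrite -scalerBr normrZ addr0 (le_trans (ler_wpM2l _ (box_fA_lip box _ Xin Yin))) //.
  have -> : `|t - t0| * (C * `|Y (p k) - Xcoord c a (p k)| * `|eta c (p k) a|) =
      `|t - t0| * (C * `|eta c (p k) a|) * `|f k| by rewrite /f; ring.
  rewrite ler_wpM2r // (le_trans (y := eps * (C * N))) //; last by lra.
  rewrite ler_pM ?mulr_ge0 //; first exact: ltW.
  by rewrite ler_wpM2l //; have := eN (p k); rewrite /e v_id.
have t0e : `|t0 - t0| <= eps by rewrite subrr normr0 ltW.
have f0 : f 0 = 0.
  rewrite /f /p mul0r addr0; apply/eqP; rewrite -normr_le0.
  have H0 := (XEP t0 t0e).1; rewrite B0 in H0.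
  have x0r' : cball (Xcoord c a t1) rho (Xcoord c a t0).
    by rewrite /cball /=; apply: ltW; apply: lt_trans x0r _; lra.
  have := flow_X_dep box H0 (flow_trivial box 0 x0r') I1.
  by rewrite !subrr normr0 mulr0 addr0 mulr0.
have := small_gronwall (lexx 0) df fb I1; rewrite f0 normr0 addr0 mulr0 normr_le0.
have -> : f 1 = Y t - Xcoord c a t by rewrite /f /p mul1r subrKC.
rewrite subr_eq0 => /eqP <-.
by have [] := flow_unique box H (XEP t (ltW te)).1 I1.
Qed.

End ConfigDevelopment.

(** * Pull-backs and concatenations *)

Section Smoothstep.
Context {R : realType}.
Implicit Types (x y u : R) (D : set R).

Lemma clamp_rev x : clamp (1 - x) = 1 - clamp x.
Proof. by case: (clamp_cases x) => -[x0 ->]; case: (clamp_cases (1 - x)) => -[x1 ->]; lra. Qed.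

(** The cubic [3 x^2 - 2 x^3] stopped at 0 and 1: its derivative vanishes at both ends, and C^1 is
    all that a parametrization needs. *)
Definition smoothstep x : R := 3 * clamp x ^+ 2 - 2 * clamp x ^+ 3.

Definition dsmoothstep x : R := 6 * clamp x * (1 - clamp x).

Lemma smoothstep_deriv D x : deriv_in D smoothstep x (dsmoothstep x).
Proof.
(* Nine cases by the positions of [x] and [y] relative to [0,1]. The constant 12 is generous; the
   products listed in each case are certificates for linear arithmetic. *)
have taylor y : `|smoothstep y - smoothstep x - (y - x) * dsmoothstep x| <= 12 * (y - x) ^+ 2.
  rewrite /smoothstep /dsmoothstep !expr2 !exprS expr0 !mulr1.
  have sq (t t' : R) : 0 <= t -> 0 <= t' -> 0 <= t * t' by exact: mulr_ge0.
  case: (clamp_cases y) => -[y0 ->]; case: (clamp_cases x) => -[x0 ->]; rewrite ler_norml.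
  - by have := sqr_ge0 (y - x); rewrite expr2 => ?; apply/andP; split; lra.
  - move: x0 => /andP[x0 x1].
    have y1 : 0 <= - y by lra.
    have x2 : 0 <= 1 - x by lra.
    have := sq _ _ x0 y1; have := sq _ _ (sq _ _ x0 x0) x2; have := sq _ _ (sq _ _ x0 y1) x2.
    have := sq _ _ (sq _ _ x0 y1) x0; have := sq _ _ y1 y1; have := sq _ _ x0 x0.
    by have := sq _ _ (sq _ _ x0 x0) x0; move=> *; apply/andP; split; lra.
  - have h : 0 <= x - 1 - y by lra.
    by have := sq _ _ h h; move=> *; apply/andP; split; lra.
  - move: y0 => /andP[y0 y1].
    have x2 : 0 <= - x by lra.
    have y2 : 0 <= 1 - y by lra.
    have := sq _ _ y0 x2; have := sq _ _ (sq _ _ y0 y0) y2; have := sq _ _ x2 x2.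
    by have := sq _ _ y0 y0; have := sq _ _ (sq _ _ y0 y0) y0; move=> *; apply/andP; split; lra.
  - move: y0 x0 => /andP[y0 y1] /andP[x0 x1].
    have -> : 3 * (y * y) - 2 * (y * (y * y)) - (3 * (x * x) - 2 * (x * (x * x))) - (y - x) * (6 * x * (1 - x)) =
      (y - x) * (y - x) * (3 - 2 * y - 4 * x) by ring.
    have d0 : 0 <= (y - x) * (y - x) by rewrite -expr2 sqr_ge0.
    have h1 : 0 <= 15 - 2 * y - 4 * x by lra.
    have h2 : 0 <= 9 + 2 * y + 4 * x by lra.
    by have := sq _ _ d0 h1; have := sq _ _ d0 h2; move=> *; apply/andP; split; lra.
  - move: y0 => /andP[y0 y1].
    have y2 : 0 <= 1 - y by lra.
    have x2 : 0 <= x - 1 by lra.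
    have := sq _ _ y2 x2; have := sq _ _ (sq _ _ y2 y2) y0; have := sq _ _ x2 x2.
    by have := sq _ _ y2 y2; have := sq _ _ (sq _ _ y2 y2) y2; move=> *; apply/andP; split; lra.
  - have h : 0 <= y - 1 - x by lra.
    by have := sq _ _ h h; move=> *; apply/andP; split; lra.
  - move: x0 => /andP[x0 x1].
    have y1 : 0 <= y - 1 by lra.
    have x2 : 0 <= 1 - x by lra.
    have := sq _ _ x2 y1; have := sq _ _ (sq _ _ x2 x2) x0; have := sq _ _ (sq _ _ x2 y1) x0.
    have := sq _ _ (sq _ _ x2 y1) x2; have := sq _ _ y1 y1; have := sq _ _ x2 x2.
    by have := sq _ _ (sq _ _ x2 x2) x2; move=> *; apply/andP; split; lra.
  - by have := sqr_ge0 (y - x); rewrite expr2 => ?; apply/andP; split; lra.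
move=> e e0; exists (e / 12); first by rewrite divr_gt0.
move=> y _; rewrite ltr_pdivlMr // => yx; rewrite (le_trans (taylor y)) //.
rewrite -real_normK ?num_real // expr2 mulrA ler_wpM2r //.
by rewrite mulrC ltW.
Qed.

Lemma dsmoothstep_lip x y : `|dsmoothstep x - dsmoothstep y| <= 6 * `|x - y|.
Proof.
have := clamp_lip x y; have /andP[] := clamp_I01 x; have /andP[] := clamp_I01 y; rewrite /dsmoothstep.
move: (clamp _) (clamp _) => k k' k0 k1 k0' k1' H; apply: le_trans (ler_wpM2l _ H) => //.
have -> : 6 * k * (1 - k) - 6 * k' * (1 - k') = 6 * ((k - k') * (1 - k - k')) by ring.
rewrite normrM (ger0_norm (x := 6)) // ler_wpM2l // normrM ler_piMr //.
by rewrite ler_norml; apply/andP; split; lra.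
Qed.

Lemma smoothstep_I01 x : I01 (smoothstep x).
Proof.
have /andP[] := clamp_I01 x; rewrite /smoothstep; move: (clamp _) => k k0 k1.
have h1 : 0 <= k * k * (3 - 2 * k) by rewrite !mulr_ge0 //; lra.
have h2 : 0 <= (1 - k) * (1 - k) * (1 + 2 * k) by rewrite !mulr_ge0 //; lra.
by rewrite !expr2 !exprS expr0 !mulr1; apply/andP; split; lra.
Qed.

Lemma smoothstep0 x : x <= 0 -> smoothstep x = 0 /\ dsmoothstep x = 0.
Proof.
rewrite /smoothstep /dsmoothstep => x0.
have -> : clamp x = 0 by case: (clamp_cases x) => -[x1 ->] //; lra.
by rewrite !expr0n /=; split; ring.
Qed.

Lemma smoothstep1 x : 1 <= x -> smoothstep x = 1 /\ dsmoothstep x = 0.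
Proof.
rewrite /smoothstep /dsmoothstep => x0.
have -> : clamp x = 1 by case: (clamp_cases x) => -[x1 ->] //; lra.
by rewrite !expr1n; split; ring.
Qed.

Lemma smoothstep_rev x : smoothstep (1 - x) = 1 - smoothstep x /\ dsmoothstep (1 - x) = dsmoothstep x.
Proof. by rewrite /smoothstep /dsmoothstep clamp_rev; split; ring. Qed.

End Smoothstep.

Section Reparametrizations.
Context {R : realType}.

(** The derivative is carried as data because the pull-back of [eta] contains it. *)
Record C1map (p p' : R -> R) : Prop := C1Map {
  map_I01 : forall u, I01 u -> I01 (p u);
  map_deriv : forall u, I01 u -> deriv_in I01 p u (p' u);
  map_cont : forall u, I01 u -> cont_in I01 p' u }.

Lemma cont_in_scale {W : normedModType R} (k : R -> R) (f : R -> W) (u : R) : I01 u ->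
  cont_in I01 k u -> cont_in I01 f u -> cont_in I01 (fun v => k v *: f v) u.
Proof.
move=> Iu /(cont_in_cvg _ Iu) ck /(cont_in_cvg _ Iu) cf; apply/(cont_in_cvg _ Iu).
exact: cvgZ.
Qed.

Lemma cont_in_add {W : normedModType R} (f g : R -> W) (u : R) : I01 u ->
  cont_in I01 f u -> cont_in I01 g u -> cont_in I01 (fun v => f v + g v) u.
Proof.
move=> Iu /(cont_in_cvg _ Iu) ck /(cont_in_cvg _ Iu) cf; apply/(cont_in_cvg _ Iu).
exact: cvgD.
Qed.

Lemma cont_in_comp {W : normedModType R} (D E : set R) (p : R -> R) (f : R -> W) u : (forall v, D v -> E (p v)) ->
  cont_in D p u -> cont_in E f (p u) -> cont_in D (f \o p) u.
Proof.
move=> DE cp cf e e0; have [d d0 dP] := cf e e0.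
have d20 : 0 < d / 2 by rewrite divr_gt0.
have [d' d'0 d'P] := cp _ d20; exists d' => // v Dv vd /=.
by apply: dP; [exact: DE|apply: le_lt_trans (d'P v Dv vd) _; lra].
Qed.

Lemma C1map_id : C1map id (fun=> 1).
Proof.
by split=> // u _; [exact: deriv_in_id|move=> e e0; exists 1 => // v _ _; rewrite subrr normr0 ltW].
Qed.

(** Runs from [k] to [k + l] with zero speed at both ends, so that pieces join to C^1 maps. *)
Definition step_map (k l : R) (u : R) : R := k + l * smoothstep u.

Lemma step_map_deriv D k l u : deriv_in D (step_map k l) u (l * dsmoothstep u).
Proof.
have := deriv_inD (@deriv_in_cst R _ D k u) (deriv_inZ l (@smoothstep_deriv R D u)).
by rewrite add0r.
Qed.

Lemma cont_in_dstep (D : set R) (l m0 m1 u : R) : cont_in D (fun v => l * dsmoothstep (m0 + m1 * v)) u.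
Proof.
have K0 : 0 < `|l| * (6 * `|m1|) + 1 by rewrite ltr_wpDl // !mulr_ge0.
move=> e e0; exists (e / (`|l| * (6 * `|m1|) + 1)); first by rewrite divr_gt0.
move=> v _; rewrite ltr_pdivlMr // => vu; rewrite -mulrBr normrM.
have := dsmoothstep_lip (m0 + m1 * v) (m0 + m1 * u).
have -> : m0 + m1 * v - (m0 + m1 * u) = m1 * (v - u) by ring.
rewrite normrM => /(ler_wpM2l (normr_ge0 l)) /le_trans; apply; apply: le_trans (ltW vu).
by have := normr_ge0 (v - u); lra.
Qed.

Lemma C1map_step k l : I01 k -> I01 (k + l) -> C1map (step_map k l) (fun u => l * dsmoothstep u).
Proof.
move=> /andP[k0 k1] /andP[kl0 kl1]; split=> [u _|u _|u _].
- have /andP[] := smoothstep_I01 u; rewrite /step_map; move: (smoothstep u) => s s0 s1.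
  by apply/andP; split; nra.
- exact: step_map_deriv.
- move=> e e0; have [d d0 dP] := @cont_in_dstep I01 l 0 1 u e e0; exists d => // v Iv vd.
  by have := dP v Iv vd; rewrite !add0r !mul1r.
Qed.

Definition catmap (f g : R -> R) (u : R) : R := if u <= 2^-1 then f (2 * u) else g (2 * u - 1).

Lemma affine_deriv (D : set R) (k l u : R) : deriv_in D (fun v => l * v + k) u l.
Proof.
have := deriv_inD (deriv_inZ l (@deriv_in_id R D u)) (@deriv_in_cst R _ D k u).
by rewrite addr0 [l *: 1]mulr1.
Qed.

Definition lower_half : set R := [set u | 0 <= u <= 2^-1].
Definition upper_half : set R := [set u | 2^-1 <= u <= 1].

Lemma halves : lower_half `|` upper_half = @I01 R.
Proof.
apply/seteqP; split=> u /=; first by case=> /andP[? ?]; apply/andP; split; lra.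
move=> /andP[u0 u1]; have [uh|uh] := leP u 2^-1; [left|right]; apply/andP; split; lra.
Qed.

Lemma half_cases (u : R) : I01 u -> lower_half u \/ upper_half u.
Proof. by rewrite -halves. Qed.

Lemma lower_I01 (u : R) : lower_half u -> I01 (2 * u).
Proof. by move=> /andP[? ?]; apply/andP; split; lra. Qed.

Lemma upper_I01 (u : R) : upper_half u -> I01 (2 * u - 1).
Proof. by move=> /andP[? ?]; apply/andP; split; lra. Qed.

(** Both halves contain 1/2, where both hypotheses apply and force the one-sided derivatives to
    match; [2^-1] undoes the doubled speed. *)
Lemma glue_deriv {W : normedModType R} (F f g : R -> W) u l : I01 u ->
  (forall v, lower_half v -> F v = f (2 * v)) -> (forall v, upper_half v -> F v = g (2 * v - 1)) ->
  (lower_half u -> deriv_in I01 f (2 * u) (2^-1 *: l)) ->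
  (upper_half u -> deriv_in I01 g (2 * u - 1) (2^-1 *: l)) -> deriv_in I01 F u l.
Proof.
move=> Iu Ff Fg df dg.
have two : (2 : R) *: (2^-1 *: l) = l by rewrite scalerA mulfV ?scale1r.
have far (D : set R) : (exists2 d : R, 0 < d & forall v, D v -> d <= `|v - u|) -> deriv_in D F u l.
  by move=> [d d0 dP] e e0; exists d => // v Dv; have := dP v Dv; rewrite leNgt => /negP H /H.
rewrite -halves; apply: deriv_inU.
- have [uh|uh] := leP u 2^-1; last first.
    apply: far; exists (u - 2^-1); first by rewrite subr_gt0.
    move=> v /andP[_ vh]; rewrite distrC (le_trans _ (ler_norm _)) // lerB //.
  have Lu : lower_half u by move/andP: Iu => [? ?]; apply/andP.
  apply: (deriv_in_ext Ff Lu); rewrite -two.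
  have d2 : deriv_in lower_half ( *%R 2) u 2.
    by have := deriv_inZ 2 (@deriv_in_id R lower_half u); rewrite [2 *: 1]mulr1.
  exact: (deriv_in_comp lower_I01 d2 (df Lu)).
- have [uh|uh] := leP 2^-1 u; last first.
    apply: far; exists (2^-1 - u); first by rewrite subr_gt0.
    move=> v /andP[vh _]; rewrite (le_trans _ (ler_norm _)) // lerB //.
  have Uu : upper_half u by move/andP: Iu => [? ?]; apply/andP.
  apply: (deriv_in_ext Fg Uu); rewrite -two.
  by apply: (deriv_in_comp upper_I01 (@affine_deriv upper_half (-1) 2 u)); exact: dg.
Qed.

Lemma glue_cont {W : normedModType R} (F f g : R -> W) u : I01 u ->
  (forall v, lower_half v -> F v = f (2 * v)) -> (forall v, upper_half v -> F v = g (2 * v - 1)) ->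
  (lower_half u -> cont_in I01 f (2 * u)) -> (upper_half u -> cont_in I01 g (2 * u - 1)) -> cont_in I01 F u.
Proof.
move=> Iu Ff Fg cf cg e e0.
have [d d0 dP] : exists2 d : R, 0 < d & forall v, lower_half v -> `|v - u| < d -> `|F v - F u| <= e.
  have [uh|uh] := leP u 2^-1; last first.
    exists (u - 2^-1); first by rewrite subr_gt0.
    by move=> v /andP[_ vh]; rewrite distrC ltNge => /negP[]; rewrite (le_trans _ (ler_norm _)) // lerB.
  have Lu : lower_half u by move/andP: Iu => [? ?]; apply/andP.
  have [d d0 dP] := cf Lu e e0; exists (d / 2); first by rewrite divr_gt0.
  move=> v Lv vd; rewrite !Ff //; apply: dP; first exact: lower_I01.
  by rewrite -mulrBr normrM ger0_norm // mulrC -ltr_pdivlMr.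
have [d' d'0 d'P] : exists2 d : R, 0 < d & forall v, upper_half v -> `|v - u| < d -> `|F v - F u| <= e.
  have [uh|uh] := leP 2^-1 u; last first.
    exists (2^-1 - u); first by rewrite subr_gt0.
    by move=> v /andP[vh _]; rewrite ltNge => /negP[]; rewrite (le_trans _ (ler_norm _)) // lerB.
  have Uu : upper_half u by move/andP: Iu => [? ?]; apply/andP.
  have [r r0 rP] := cg Uu e e0; exists (r / 2); first by rewrite divr_gt0.
  move=> v Uv vd; rewrite !Fg //; apply: rP; first exact: upper_I01.
  have -> : 2 * v - 1 - (2 * u - 1) = 2 * (v - u) by ring.
  by rewrite normrM ger0_norm // mulrC -ltr_pdivlMr.
exists (Num.min d d'); first by rewrite lt_min d0.
by move=> v /half_cases[Lv|Uv]; rewrite lt_min => /andP[? ?]; [exact: dP|exact: d'P].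
Qed.

Lemma C1map_cat f f' g g' : C1map f f' -> C1map g g' -> f 1 = g 0 -> f' 1 = g' 0 ->
  C1map (catmap f g) (fun u => 2 * catmap f' g' u).
Proof.
move=> Hf Hg fg fg'.
have upE (h k : R -> R) : h 1 = k 0 -> forall v, upper_half v -> catmap h k v = k (2 * v - 1).
  move=> hk v /andP[v0 _]; rewrite /catmap; have [vh|//] := leP v 2^-1.
  have -> : v = 2^-1 by apply/eqP; rewrite eq_le vh.
  by rewrite mulfV // subrr hk.
have loE (h k : R -> R) v : lower_half v -> catmap h k v = h (2 * v).
  by move=> /andP[_ vh]; rewrite /catmap vh.
have half (x : R) : 2^-1 *: (2 * x) = x by rewrite [LHS]mulrA mulVf // mul1r.
split=> u Iu.
- have [Lu|Uu] := half_cases Iu.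
    by rewrite loE //; apply: (map_I01 Hf); exact: lower_I01.
  by rewrite upE //; apply: (map_I01 Hg); exact: upper_I01.
- apply: (glue_deriv Iu (loE f g) (upE f g fg)) => H; rewrite half.
    by rewrite loE //; apply: (map_deriv Hf); exact: lower_I01.
  by rewrite upE //; apply: (map_deriv Hg); exact: upper_I01.
- have cc : cont_in I01 (catmap f' g') u.
    apply: (glue_cont Iu (loE f' g') (upE f' g' fg')) => H.
      by apply: (map_cont Hf); exact: lower_I01.
    by apply: (map_cont Hg); exact: upper_I01.
  apply: (cont_in_scale Iu _ cc) => e e0; by exists 1 => // v _ _; rewrite subrr normr0 ltW.
Qed.

End Reparametrizations.

(** * Sums and reparametrizations of families of forms *)

Section FormFamilies.
Context {R : realType} {n : nat} {M : manifold R n}.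
Implicit Types (a : chart M) (beta : R -> field_of_comps M) (w : field_of_comps M).

Lemma dpart0 {W : normedModType R} (s : seq 'I_n) (y : 'rV[R]_n) : dpart s (fun=> 0 : W) y = 0 :> W.
Proof.
elim: s y => [|i s IH] y //=.
have [|_ ->] := @derive_line_near R n W (dpart s (fun=> 0)) (fun=> 0) y (stdvec i) 0 _ (@deriv_in_cst _ _ _ _ _) => //.
by exists 1.
Qed.

Lemma one_form_lin (k : R) v w : one_form v -> one_form w -> one_form (fun x a => k *: v x a + w x a).
Proof.
move=> [cv sv] [cw sw]; split=> [x|a].
  have [v0 vE] := cv x; have [w0 wE] := cw x; split=> [a na|a b ax bx].
    by rewrite v0 // w0 // scaler0 addr0.
  by rewrite (vE a b) // (wE a b) // mulmxDl scalemxAl.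
exact: (smooth_on_lin k (@chart_image_open _ _ _ a) (sv a) (sw a)).1.
Qed.

Lemma one_form0 : one_form (fun (_ : M) _ => 0 : 'rV[R]_n).
Proof.
split=> [x|a]; last exact: smooth_on_cst.
by split=> // a b _ _; rewrite mul0mx.
Qed.

Lemma C1_forms0 : C1_forms (fun _ (_ : M) _ => 0 : 'rV[R]_n).
Proof.
split=> [u _|]; first exact: one_form0.
exists (fun _ _ _ => 0) => u Iu; split; first exact: one_form0.
- move=> a K s e _ _ e0; near=> h => y _.
  have -> : (fun z : 'rV[R]_n => diffq (fun=> 0 : 'rV[R]_n) u h - 0) = fun=> 0.
    by apply/funext => z; rewrite /diffq subrr scaler0 subr0.
  by rewrite dpart0 normr0.
- move=> a K s e _ _ e0; near=> h => y _.
  by under eq_fun do rewrite subrr; rewrite dpart0 normr0.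
Unshelve. all: by end_near. Qed.

Lemma P0_forms0 : P0_forms (fun _ (_ : M) _ => 0 : 'rV[R]_n).
Proof. by split=> //; exact: C1_forms0. Qed.

Lemma C1_forms_add beta1 beta2 : C1_forms beta1 -> C1_forms beta2 ->
  C1_forms (fun u x a => beta1 u x a + beta2 u x a).
Proof.
have oneD v w : one_form v -> one_form w -> one_form (fun x a => v x a + w x a).
  move=> ov ow; have := one_form_lin 1 ov ow; congr one_form.
  by apply/funext => x; apply/funext => a; rewrite scale1r.
case=> o1 [b1 H1]; case=> o2 [b2 H2]; split=> [u Iu|]; first by apply: oneD; [exact: o1|exact: o2].
exists (fun u x a => b1 u x a + b2 u x a) => u Iu.
have [ob1 c1 c1'] := H1 u Iu; have [ob2 c2 c2'] := H2 u Iu.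
have add (F : set_system R) (FF : Filter F) (w1 w2 : R -> field_of_comps M) l1 l2 :
    (\forall h \near F, one_form (w1 h) /\ one_form (w2 h)) -> one_form l1 -> one_form l2 ->
    cvg_form F w1 l1 -> cvg_form F w2 l2 ->
    cvg_form F (fun h x a => w1 h x a + w2 h x a) (fun x a => l1 x a + l2 x a).
  move=> ow ol1 ol2 cw1 cw2 a K s e cK KV e0.
  have e20 : 0 < e / 2 by rewrite divr_gt0.
  apply: filterS3 ow (cw1 a K s _ cK KV e20) (cw2 a K s _ cK KV e20) => h [ow1 ow2] h1 h2 y Ky.
  pose f1 z := w1 h (chart_inv a z) a - l1 (chart_inv a z) a.
  pose f2 z := w2 h (chart_inv a z) a - l2 (chart_inv a z) a.
  have sub v l : one_form v -> one_form l -> smooth_on (chart_image a) (fun z => v (chart_inv a z) a - l (chart_inv a z) a).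
    move=> ov ol; have [_ /(_ a)] := one_form_lin (-1) ol ov; congr smooth_on.
    by apply/funext => z; rewrite scaleN1r addrC.
  have -> : (fun z => w1 h (chart_inv a z) a + w2 h (chart_inv a z) a - (l1 (chart_inv a z) a + l2 (chart_inv a z) a)) =
      fun z => 1 *: f1 z + f2 z by apply/funext => z; rewrite scale1r /f1 /f2 opprD addrACA.
  rewrite (smooth_on_lin 1 (@chart_image_open _ _ _ a) (sub _ _ ow1 ol1) (sub _ _ ow2 ol2)).2; last exact: KV.
  rewrite scale1r (le_lt_trans (ler_normD _ _)) // [e]splitr ltrD //; [exact: h1|exact: h2].
have nI : \forall h \near increments I01 u, I01 (u + h).
  by rewrite /increments near_withinE; near=> h.
have odiff (b : R -> field_of_comps M) h : (forall u, I01 u -> one_form (b u)) -> I01 (u + h) ->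
    one_form (fun x a => diffq (fun v => b v x a) u h).
  move=> ob Ih; have := one_form_lin h^-1 (one_form_lin (-1) (ob u Iu) (ob _ Ih)) one_form0.
  by congr one_form; apply/funext => x; apply/funext => a; rewrite addr0 scaleN1r addrC.
split; first exact: oneD.
- have -> : (fun h x a => diffq (fun v => beta1 v x a + beta2 v x a) u h) =
      fun h x a => diffq (fun v => beta1 v x a) u h + diffq (fun v => beta2 v x a) u h.
    apply/funext => h; apply/funext => x; apply/funext => a.
    by rewrite /diffq -scalerDr opprD addrACA.
  apply: add => //.
  by apply: filterS nI => h Ih; split; exact: odiff.
- apply: add => //.
  have obb1 v : I01 v -> one_form (b1 v) by move=> /H1[].
  have obb2 v : I01 v -> one_form (b2 v) by move=> /H2[].
  by apply: filterS nI => h Ih; exact: (conj (obb1 _ Ih) (obb2 _ Ih)).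
Unshelve. all: by end_near. Qed.

(** Chain rule in the Frechet space: with [k = p (u + h) - p u], the difference quotient is [k / h]
    times that of [beta] at [p u] with increment [k]. *)
Lemma C1_forms_comp beta (p p' : R -> R) : C1_forms beta -> C1map p p' -> C1_forms (fun u => beta (p u)).
Proof.
move=> [ob [beta' Hb]] Hp.
split=> [u Iu|]; first exact: ob (map_I01 Hp Iu).
exists (fun u x a => p' u *: beta' (p u) x a) => u Iu.
have Ipu := map_I01 Hp Iu; have [ob' c1 c2] := Hb _ Ipu.
have osc (k : R) w : one_form w -> one_form (fun x a => k *: w x a).
  move=> ow; have := one_form_lin k ow one_form0; congr one_form.
  by apply/funext => x; apply/funext => a; rewrite addr0.
have osub v w : one_form v -> one_form w -> one_form (fun x a => v x a - w x a).
  move=> ov ow; have := one_form_lin (-1) ow ov; congr one_form.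
  by apply/funext => x; apply/funext => a; rewrite scaleN1r addrC.
split; first exact: osc.
- move=> a K s e cK KV e0.
  have [B B0 BP] := smooth_on_bounded s cK KV (ob'.2 a).
  pose L := `|p' u| + 1; have L0 : 0 < L by rewrite ltr_wpDl.
  have e10 : 0 < e / 2 / L by rewrite !divr_gt0.
  have B10 : 0 < B + 1 by rewrite ltr_wpDl.
  have e20 : 0 < e / 2 / (B + 1) by rewrite !divr_gt0.
  have := c1 a K s _ cK KV e10; rewrite /increments near_withinE => /nbhs_ballP[d1 /= d10 d1P].
  have [d2 d20 d2P] := map_deriv Hp Iu e20.
  have [d3 d30 d3P] := deriv_in_lip (map_deriv Hp Iu).
  rewrite near_withinE; apply/nbhs_ballP.
  exists (Num.min (Num.min d2 d3) (d1 / L)) => /=; first by rewrite !lt_min d20 d30 divr_gt0.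
  move=> h; rewrite /ball /= sub0r normrN !lt_min => /andP[/andP[h2 h3] h1] h0 Ih y Ky.
  pose k := p (u + h) - p u; have Ipk : I01 (p u + k) by rewrite /k subrKC; exact: (map_I01 Hp Ih).
  have uh : u + h - u = h by rewrite addrAC subrr add0r.
  have kL : `|k| <= L * `|h| by have := d3P _ Ih; rewrite uh; apply.
  have kp : `|h^-1 * k - p' u| <= e / 2 / (B + 1).
    have := d2P _ Ih; rewrite uh => /(_ h2) H.
    have -> : h^-1 * k - p' u = h^-1 * (k - h * p' u) by rewrite [RHS]mulrBr mulrA mulVf // mul1r.
    by rewrite normrM normfV mulrC ler_pdivrMr ?normr_gt0.
  pose G z := diffq (fun v => beta v (chart_inv a z) a) (p u) k - beta' (p u) (chart_inv a z) a.
  pose F z := beta' (p u) (chart_inv a z) a.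
  have sG : smooth_on (chart_image a) G.
    by have [_ /(_ a)] := osub _ _ (osc k^-1 _ (osub _ _ (ob _ Ipk) (ob _ Ipu))) ob'.
  have -> : (fun z => diffq (fun v => beta (p v) (chart_inv a z) a) u h - p' u *: beta' (p u) (chart_inv a z) a)
     = fun z => (h^-1 * k) *: G z + ((h^-1 * k - p' u) *: F z + 0).
    apply/funext => z; rewrite /G /F addr0 scalerBr scalerBl addrA subrK; congr (_ - _).
    rewrite /diffq; have -> : p u + k = p (u + h) by rewrite /k subrKC.
    (* If [k = 0] the inner quotient carries no information, but its factor [k / h] vanishes. *)
    have [k0|k0] := eqVneq k 0; last by rewrite !scalerA -mulrA mulfV // mulr1.
    have pE : p (u + h) = p u by apply/eqP; rewrite -subr_eq0 -/k k0.
    by rewrite pE subrr !scaler0.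
  have s0 := @smooth_on_cst R n _ (chart_image a) (0 : 'rV[R]_n).
  have sF := smooth_on_lin (h^-1 * k - p' u) (@chart_image_open _ _ _ a) (ob'.2 a) s0.
  rewrite (smooth_on_lin _ (@chart_image_open _ _ _ a) sG sF.1).2; last exact: KV.
  rewrite sF.2; last exact: KV.
  rewrite dpart0 addr0 (le_lt_trans (ler_normD _ _)) // [e]splitr ltr_leD //.
    rewrite normrZ; have [k0|k0] := eqVneq k 0; first by rewrite k0 mulr0 normr0 mul0r divr_gt0.
    have : `|dpart s G y| < e / 2 / L.
      apply: (d1P k) => //; rewrite /ball /= sub0r normrN.
      by rewrite (le_lt_trans kL) // mulrC -ltr_pdivlMr.
    rewrite ltr_pdivlMr // => H; apply: le_lt_trans H; rewrite mulrC ler_wpM2l //.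
    by rewrite normrM normfV mulrC ler_pdivrMr ?normr_gt0.
  rewrite normrZ (le_trans (ler_pM _ _ kp (BP y Ky))) //.
  by rewrite mulrAC ler_pdivrMr // ler_wpM2l ?lerDl // divr_ge0 // ltW.
- move=> a K s e cK KV e0.
  have [B B0 BP] := smooth_on_bounded s cK KV (ob'.2 a).
  pose L := `|p' u| + 1; have L0 : 0 < L by rewrite ltr_wpDl.
  have e10 : 0 < e / 2 / L by rewrite !divr_gt0.
  have B10 : 0 < B + 1 by rewrite ltr_wpDl.
  have e20 : 0 < e / 2 / (B + 1) by rewrite !divr_gt0.
  have := c2 a K s _ cK KV e10; rewrite /increments near_withinE => /nbhs_ballP[d1 /= d10 d1P].
  have [d2 d20 d2P] := map_cont Hp Iu e20.
  have [d4 d40 d4P] := map_cont Hp Iu ltr01.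
  have [d3 d30 d3P] := deriv_in_lip (map_deriv Hp Iu).
  rewrite near_withinE; apply/nbhs_ballP.
  exists (Num.min (Num.min d2 d3) (Num.min d4 (d1 / L))) => /=; first by rewrite !lt_min d20 d30 d40 divr_gt0.
  move=> h; rewrite /ball /= sub0r normrN !lt_min => /andP[/andP[h2 h3] /andP[h4 h1]] h0 Ih y Ky.
  pose k := p (u + h) - p u; have Ipk : I01 (p u + k) by rewrite /k subrKC; exact: (map_I01 Hp Ih).
  have uh : u + h - u = h by rewrite addrAC subrr add0r.
  have kL : `|k| <= L * `|h| by have := d3P _ Ih; rewrite uh; apply.
  have pk : p u + k = p (u + h) by rewrite /k subrKC.
  pose G z := beta' (p u + k) (chart_inv a z) a - beta' (p u) (chart_inv a z) a.
  pose F z := beta' (p u) (chart_inv a z) a.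
  have sG : smooth_on (chart_image a) G.
    by have [obk _ _] := Hb _ Ipk; have [_ /(_ a)] := osub _ _ obk ob'.
  have -> : (fun z => p' (u + h) *: beta' (p (u + h)) (chart_inv a z) a - p' u *: beta' (p u) (chart_inv a z) a)
     = fun z => p' (u + h) *: G z + ((p' (u + h) - p' u) *: F z + 0).
    by apply/funext => z; rewrite /G /F pk addr0 scalerBr scalerBl addrA subrK.
  have s0 := @smooth_on_cst R n _ (chart_image a) (0 : 'rV[R]_n).
  have sF := smooth_on_lin (p' (u + h) - p' u) (@chart_image_open _ _ _ a) (ob'.2 a) s0.
  rewrite (smooth_on_lin _ (@chart_image_open _ _ _ a) sG sF.1).2; last exact: KV.
  rewrite sF.2; last exact: KV.
  rewrite dpart0 addr0 (le_lt_trans (ler_normD _ _)) // [e]splitr ltr_leD //.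
    rewrite normrZ; have [k0|k0] := eqVneq k 0.
      have -> : G = fun=> 0 by apply/funext => z; rewrite /G k0 addr0 subrr.
      by rewrite dpart0 normr0 mulr0 divr_gt0.
    have : `|dpart s G y| < e / 2 / L.
      apply: (d1P k) => //; rewrite /ball /= sub0r normrN.
      by rewrite (le_lt_trans kL) // mulrC -ltr_pdivlMr.
    rewrite ltr_pdivlMr // => H; apply: le_lt_trans H; rewrite mulrC ler_wpM2l //.
    have := d4P _ Ih; rewrite uh => /(_ h4) H.
    by rewrite -(subrK (p' u) (p' (u + h))) (le_trans (ler_normD _ _)) // addrC lerD2l.
  have kp : `|p' (u + h) - p' u| <= e / 2 / (B + 1) by have := d2P _ Ih; rewrite uh; apply.
  rewrite normrZ (le_trans (ler_pM _ _ kp (BP y Ky))) //.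
  by rewrite mulrAC ler_pdivrMr // ler_wpM2l ?lerDl // divr_ge0 // ltW.
Qed.

End FormFamilies.

Section IntervalImage.
Context {R : realType}.

(** Velocity estimates are uniform over intervals, so transporting them along [p] requires intervals
    to be mapped onto intervals: extreme and intermediate value theorems. *)
Lemma C1map_image (p p' : R -> R) x y : C1map p p' -> 0 <= x -> x <= y -> y <= 1 ->
  exists lo hi : R, [/\ 0 <= lo, lo <= hi, hi <= 1, forall u, x <= u <= y -> lo <= p u <= hi &
    forall v, lo <= v <= hi -> exists2 u, x <= u <= y & p u = v].
Proof.
move=> Hp x0 xy y1.
have cp : continuous (p \o clamp).
  by apply: cont_in_clamp => u Iu; exact: deriv_in_cont (map_deriv Hp Iu).
have cps a b : {within `[a, b], continuous (p \o clamp)} by exact: continuous_subspaceT.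
have inI u : x <= u <= y -> I01 u by move=> /andP[? ?]; apply/andP; split; lra.
have [c1 c1i c1P] := EVT_min xy (cps x y); have [c2 c2i c2P] := EVT_max xy (cps x y).
move: c1i c2i; rewrite !in_itv /= => c1i c2i.
have I1 := inI _ c1i; have I2 := inI _ c2i.
exists (p c1), (p c2).
have bnd u : x <= u <= y -> p c1 <= p u <= p c2.
  move=> ui; have := c1P u; have := c2P u; rewrite !in_itv /= ui !clamp_id //; last exact: inI.
  by move=> -> // ->.
have /andP[lo0 _] := map_I01 Hp I1; have /andP[_ hi1] := map_I01 Hp I2.
split=> //; first by have /andP[] := bnd _ c1i => ? ?; have /andP[] := bnd _ c2i.
move=> v /andP[v1 v2].
have vmm a b : p a = p c1 /\ p b = p c2 \/ p a = p c2 /\ p b = p c1 -> Num.min (p a) (p b) <= v <= Num.max (p a) (p b).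
  by case=> -[-> ->]; rewrite ge_min le_max v1 v2 ?orbT.
have fin a b : a <= b -> x <= a -> b <= y ->
    p a = p c1 /\ p b = p c2 \/ p a = p c2 /\ p b = p c1 -> exists2 u, x <= u <= y & p u = v.
  move=> ab xa by_ H.
  have Ia : I01 a by apply: inI; apply/andP; split; lra.
  have Ib : I01 b by apply: inI; apply/andP; split; lra.
  have [|u] := IVT ab (cps a b) (v := v); first by rewrite /= !clamp_id //; exact: vmm.
  rewrite in_itv /= => /andP[ua ub] E.
  have uxy : x <= u <= y by apply/andP; split; lra.
  by exists u => //; rewrite -E clamp_id //; exact: inI.
move: c1i c2i => /andP[? ?] /andP[? ?].
by have [cc|/ltW cc] := leP c1 c2; [apply: (fin c1 c2) => //; left|apply: (fin c2 c1) => //; right].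
Qed.

(** This includes the ends of the subinterval: a derivative within [0,1] that is known to exist is
    determined by the values on one side. *)
Lemma dI_agree {W : normedModType R} (f g : R -> W) lo hi u : 0 <= lo -> lo < hi -> hi <= 1 ->
  (forall v, lo <= v <= hi -> f v = g v) -> lo <= u <= hi -> derivableI f u -> derivableI g u ->
  dI f u = dI g u.
Proof.
move=> lo0 lohi hi1 fg ui /derivableI_deriv_in df /derivableI_deriv_in dg.
pose D := [set v : R | lo <= v <= hi].
have DI : D `<=` I01 by move=> v /andP[? ?]; apply/andP; split; lra.
have acc : clusters D u.
  move=> d d0; move: ui => /andP[u1 u2].
  have [uh|uh] := ltP u hi.
    exists (u + Num.min (d / 2) (hi - u)).
    have m0 : 0 < Num.min (d / 2) (hi - u) by rewrite lt_min divr_gt0 //= subr_gt0.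
    split.
    - apply/andP; split; first by rewrite (le_trans u1) // lerDl ltW.
      by rewrite -lerBrDl ge_min lexx orbT.
    - by rewrite -subr_eq0 addrAC subrr add0r gt_eqF.
    - by rewrite addrAC subrr add0r gtr0_norm // gt_min ltr_pdivrMr // ltr_pMr // ltr1n.
  have uE : u = hi by apply/eqP; rewrite eq_le u2.
  exists (u - Num.min (d / 2) (hi - lo)).
  have m0 : 0 < Num.min (d / 2) (hi - lo) by rewrite lt_min divr_gt0 //= subr_gt0.
  split.
  - apply/andP; split; last by rewrite (le_trans _ u2) // gerBl ltW.
    by rewrite lerBrDr -lerBrDl uE ge_min lexx orbT.
  - by rewrite -subr_eq0 addrAC subrr add0r oppr_eq0 gt_eqF.
  - by rewrite addrAC subrr add0r normrN gtr0_norm // gt_min ltr_pdivrMr // ltr_pMr // ltr1n.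
apply: (deriv_in_uniq acc (deriv_inS DI df)).
by apply: (deriv_in_ext fg ui); exact: deriv_inS DI dg.
Qed.

(** Connectedness of the interval, from the mean value inequality for the indicator function of [P],
    whose derivative is 0. *)
Lemma locally_constant (lo hi : R) (P : R -> Prop) : lo <= hi ->
  (forall s, lo <= s <= hi -> exists2 d : R, 0 < d & forall t, lo <= t <= hi -> `|t - s| < d -> (P t <-> P s)) ->
  forall s t, lo <= s <= hi -> lo <= t <= hi -> P s -> P t.
Proof.
move=> lohi H s t si ti Ps.
pose f (x : R) : R := if pselect (P x) then 1 else 0.
have df x : lo <= x <= hi -> deriv_in [set y | lo <= y <= hi] f x 0.
  move=> xi; have [d d0 dP] := H x xi; apply: deriv_in_near (@deriv_in_cst _ _ _ (f x) x) => //.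
  exists d => // y yi yd; rewrite /f; have := dP y yi yd.
  by case: pselect => py; case: pselect => px // [h1 h2]; [case: px; exact: h1|case: py; exact: h2].
have const a b : lo <= a -> a <= b -> b <= hi -> f b = f a.
  move=> la ab bh; apply/eqP; rewrite -subr_eq0 -normr_le0.
  have := @mean_value_R R a b 0 f (fun=> 0) ab; rewrite mul0r; apply=> u /andP[? ?].
    apply: deriv_inS (df u _); first by move=> v /= /andP[? ?]; apply/andP; split; lra.
    by apply/andP; split; lra.
  by rewrite normr0.
have ff : f t = f s.
  move: si ti => /andP[? ?] /andP[? ?].
  by have [st|/ltW ts] := leP s t; [exact: const|apply/esym; exact: const].
move: ff; rewrite /f; case: pselect => // nPt; case: pselect => // _ /eqP.
by rewrite eq_sym oner_eq0.
Qed.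

End IntervalImage.

(** * Pull-backs of configurations and of integral curves *)

Section PullBack.
Context {R : realType} {n : nat} {M : manifold R n} (alpha : poisson M).
Implicit Types (a : chart M) (c : config M) (beta : R -> field_of_comps M) (gamma : R -> config M).

(** [clamp] supplies the constant extension outside [0,1] that [constraint] asks for. *)
Definition pull (p p' : R -> R) c : config M :=
  Config (fun u => Xp c (p (clamp u))) (fun u a => p' (clamp u) *: eta c (p (clamp u)) a).

Lemma pull_Xp p p' c u : I01 u -> Xp (pull p p' c) u = Xp c (p u).
Proof. by move=> Iu /=; rewrite clamp_id. Qed.

Lemma pull_eta p p' c u a : I01 u -> eta (pull p p' c) u a = p' u *: eta c (p u) a.
Proof. by move=> Iu /=; rewrite clamp_id. Qed.

Lemma covector_scale (x : M) (k : R) w : covector x w -> covector x (fun a => k *: w a).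
Proof.
move=> [w0 wE]; split=> [a /w0 ->|a b ax bx]; first by rewrite scaler0.
by rewrite (wE a b) // scalemxAl.
Qed.

Lemma pull_constraint p p' c : C1map p p' -> constraint alpha c -> constraint alpha (pull p p' c).
Proof.
move=> Hp hc; apply: constraint_intro => [u|u Iu|u Iu].
- by rewrite /= [clamp (clamp u)]clamp_id //; exact: clamp_I01.
- rewrite pull_Xp //; have := covector_scale (p' u) (config_covector hc (map_I01 Hp Iu)).
  by congr covector; apply/funext => a; rewrite pull_eta.
- have Ip := map_I01 Hp Iu; have [a ap] := charts_cover (Xp c (p u)).
  have [[d d0 dP] dX ce] := constraint_solves hc Ip ap.
  have cp := deriv_in_cont (map_deriv Hp Iu).
  exists a; split.
  + have d20 : 0 < d / 2 by rewrite divr_gt0.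
    have [d' d'0 d'P] := cp _ d20; exists d' => // v Iv vd; rewrite pull_Xp //.
    by apply: dP; [exact: (map_I01 Hp)|apply: le_lt_trans (d'P v Iv vd) _; lra].
  + have XE v : I01 v -> Xcoord (pull p p' c) a v = Xcoord c a (p v) by move=> Iv; rewrite /Xcoord pull_Xp.
    rewrite pull_eta // XE // fAZ; apply: (deriv_in_ext XE Iu).
    exact: (deriv_in_comp (fun v => @map_I01 _ _ _ Hp v) (map_deriv Hp Iu) dX).
  + have := cont_in_scale Iu (map_cont Hp Iu) (cont_in_comp (fun v => @map_I01 _ _ _ Hp v) cp ce).
    move=> K e e0; have [r r0 rP] := K e e0; exists r => // v Iv vr.
    by rewrite !pull_eta //; exact: rP.
Qed.

Lemma xi_X_deriv beta c a u : C1_forms beta -> constraint alpha c -> I01 u -> dom a (Xp c u) ->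
  deriv_in I01 (xi_X alpha beta c a) u (dI (xi_X alpha beta c a) u) /\ derivableI (xi_X alpha beta c a) u.
Proof.
move=> hb hc Iu au; have I0 := @I01_0 R.
have H := @deriv_xi_X R n M alpha beta (fun=> c) hb (fun _ _ => hc) a 0 u I0 Iu au.
by have [H1 ->] := deriv_in_dI Iu H.
Qed.

Definition velocity_est beta gamma s h (e : R) a u :=
  [/\ dom a (Xp (gamma (s + h)) u),
      `|diffq (fun t => Xcoord (gamma t) a u) s h - xi_X alpha beta (gamma s) a u| < e,
      `|diffq (fun t => dI (Xcoord (gamma t) a) u) s h - dI (xi_X alpha beta (gamma s) a) u| < e &
      `|diffq (fun t => eta (gamma t) u a) s h - xi_eta alpha beta (gamma s) a u| < e].

(** [has_velocity] confined to subintervals of [[lo, hi]], so that concatenations can be treated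
    half by half. *)
Definition velocity_on beta (J : set R) gamma s (lo hi : R) :=
  forall a (p q e : R), lo <= p -> p <= q -> q <= hi -> 0 < e ->
  (forall u, p <= u <= q -> dom a (Xp (gamma s) u)) ->
  \forall h \near increments J s, forall u, p <= u <= q -> velocity_est beta gamma s h e a u.

Lemma velocity_halves beta J gamma s m : velocity_on beta J gamma s 0 m -> velocity_on beta J gamma s m 1 ->
  has_velocity alpha beta J gamma s.
Proof.
move=> H1 H2 c a p q e p0 pq q1 e0 dpq.
have [qm|mq] := leP q m; first exact: H1.
have [mp|pm] := leP m p; first exact: H2.
have d1 u : p <= u <= m -> dom a (Xp (gamma s) u) by move=> /andP[? ?]; apply: dpq; apply/andP; split; lra.
have d2 u : m <= u <= q -> dom a (Xp (gamma s) u) by move=> /andP[? ?]; apply: dpq; apply/andP; split; lra.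
have h1 := H1 a p m e p0 (ltW pm) (lexx m) e0 d1.
have h2 := H2 a m q e (lexx m) (ltW mq) q1 e0 d2.
rewrite /increments in h1 h2 *.
apply: filterS2 h1 h2 => h h1 h2 u /andP[up uq].
by have [um|mu] := leP u m; [apply: h1|apply: h2]; apply/andP; split => //; exact: ltW.
Qed.

Lemma increments_in (J : set R) s : \forall h \near increments J s, J (s + h) /\ h != 0.
Proof.
rewrite /increments near_withinE; apply/nbhs_ballP; exists 1 => //= h _ h0 Jh; by split.
Qed.

Lemma diffq_scale {W : normedModType R} (f : R -> W) (k : R) s h :
  diffq (fun t => k *: f t) s h = k *: diffq f s h.
Proof. by rewrite /diffq -scalerBr !scalerA mulrC. Qed.

(** Reparametrization commutes with the flows: [dI X] and [eta] both acquire the factor [p' u],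
    whose bound [L] is built into the precision requested from the original curve. *)
Lemma velocity_pull beta (J : set R) gamma s p p' : C1map p p' -> C1_forms beta -> J s ->
  (forall t, J t -> constraint alpha (gamma t)) -> has_velocity alpha beta J gamma s ->
  has_velocity alpha (fun u => beta (p u)) J (fun t => pull p p' (gamma t)) s.
Proof.
move=> Hp hb Js hg H c a x y e x0 xy y1 e0 dxy.
have [lo [hi [lo0 lohi hi1 pin pim]]] := C1map_image Hp x0 xy y1.
have inI u : x <= u <= y -> I01 u by move=> /andP[? ?]; apply/andP; split; lra.
have [L L0 LP] := cont_in_bounded (map_cont Hp).
have L10 : 0 < L + 1 by rewrite ltr_wpDl.
have e10 : 0 < e / (L + 1) by rewrite divr_gt0.
have e1e : e / (L + 1) <= e by rewrite ler_pdivrMr // ler_peMr ?lerDr // ltW.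
have dlo v : lo <= v <= hi -> dom a (Xp (gamma s) v).
  by move=> /pim[u ui <-]; have := dxy u ui; rewrite /c pull_Xp //; exact: inI.
have hs := hg s Js.
apply: filterS2 (H a lo hi _ lo0 lohi hi1 e10 dlo) (increments_in J s) => h Hh [Jh h0] u ui.
have Iu := inI u ui; have Ip := map_I01 Hp Iu.
have [d1 d2 d3 d4] := Hh (p u) (pin u ui); have ds := dlo _ (pin u ui).
have small (W : normedModType R) (z : W) : `|z| < e / (L + 1) -> `|p' u *: z| < e.
  move=> zs; rewrite normrZ (le_lt_trans (y := L * `|z|)) ?ler_wpM2r ?LP //.
  rewrite (le_lt_trans (y := (L + 1) * `|z|)) ?ler_wpM2r ?lerDl //.
  by rewrite mulrC -ltr_pdivlMr.
have XE d v : I01 v -> Xcoord (pull p p' d) a v = Xcoord d a (p v) by move=> Iv; rewrite /Xcoord pull_Xp.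
have mI := fun v => @map_I01 _ _ _ Hp v.
split.
- by rewrite pull_Xp.
- rewrite (_ : diffq _ s h = diffq (fun t => Xcoord (gamma t) a (p u)) s h); last by rewrite /diffq !XE.
  rewrite (_ : xi_X _ _ _ _ _ = xi_X alpha beta (gamma s) a (p u)); first exact: lt_le_trans d2 e1e.
  by rewrite /xi_X pull_Xp.
- have dE d : constraint alpha d -> dom a (Xp d (p u)) -> dI (Xcoord (pull p p' d) a) u = p' u *: dI (Xcoord d a) (p u).
    move=> hd ad; rewrite (deriv_in_dI Ip (config_deriv hd Ip ad)).2 -fAZ.
    have hp := pull_constraint Hp hd.
    have := config_deriv hp Iu; rewrite pull_Xp // => /(_ _ ad) H1.
    by rewrite (deriv_in_dI Iu H1).2 XE // pull_eta.
  have -> : dI (xi_X alpha (fun u => beta (p u)) (pull p p' (gamma s)) a) u = p' u *: dI (xi_X alpha beta (gamma s) a) (p u).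
    have [dx _] := xi_X_deriv hb hs Ip ds.
    apply: (deriv_in_dI Iu (deriv_in_ext _ Iu (deriv_in_comp mI (map_deriv Hp Iu) dx))).2.
    by move=> v Iv; rewrite /xi_X /= clamp_id.
  rewrite (_ : diffq _ s h = p' u *: diffq (fun t => dI (Xcoord (gamma t) a) (p u)) s h); last first.
    by rewrite -diffq_scale /diffq !dE //; exact: hg.
  by rewrite -scalerBr; exact: small.
- have -> : xi_eta alpha (fun u => beta (p u)) (pull p p' (gamma s)) a u = p' u *: xi_eta alpha beta (gamma s) a (p u).
    rewrite !xi_etaE scalerDr XE // pull_eta // QfZ pull_Xp //; congr (_ + _).
    have df := derivableI_deriv_in (form_along hs hb Ip ds).
    apply: (deriv_in_dI Iu (deriv_in_ext _ Iu (deriv_in_comp mI (map_deriv Hp Iu) df))).2.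
    by move=> v Iv; rewrite /= clamp_id.
  rewrite (_ : diffq _ s h = p' u *: diffq (fun t => eta (gamma t) (p u) a) s h); last first.
    by rewrite -diffq_scale /diffq !pull_eta.
  by rewrite -scalerBr; exact: small.
Qed.

(** The velocity contains [u]-derivatives, which at [lo] and [hi] might see values outside the
    interval; [dI_agree] excludes this. *)
Lemma velocity_agree beta beta1 (J : set R) gamma gamma1 s lo hi : 0 <= lo -> lo < hi -> hi <= 1 ->
  C1_forms beta -> C1_forms beta1 -> J s ->
  (forall t, J t -> constraint alpha (gamma t)) -> (forall t, J t -> constraint alpha (gamma1 t)) ->
  (forall t u, J t -> lo <= u <= hi -> Xp (gamma t) u = Xp (gamma1 t) u /\ eta (gamma t) u = eta (gamma1 t) u) ->
  (forall u, lo <= u <= hi -> beta u = beta1 u) ->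
  has_velocity alpha beta1 J gamma1 s -> velocity_on beta J gamma s lo hi.
Proof.
move=> lo0 lohi hi1 hb hb1 Js hg hg1 gg bb H a p q e lop pq qhi e0 dpq.
have p0 : 0 <= p by lra.
have q1 : q <= 1 by lra.
have inh u : p <= u <= q -> lo <= u <= hi by move=> /andP[? ?]; apply/andP; split; lra.
have inI u : lo <= u <= hi -> I01 u by move=> /andP[? ?]; apply/andP; split; lra.
have dpq1 u : p <= u <= q -> dom a (Xp (gamma1 s) u).
  by move=> ui; have [<- _] := gg s u Js (inh u ui); exact: dpq.
have hs := hg s Js; have hs1 := hg1 s Js.
apply: filterS2 (H a p q e p0 pq q1 e0 dpq1) (increments_in J s) => h Hh [Jh h0] u ui.
have uh := inh u ui; have Iu := inI u uh.
have [d1 d2 d3 d4] := Hh u ui.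
have [Xs es] := gg s u Js uh; have [Xsh esh] := gg (s + h) u Jh uh.
have au := dpq u ui; have au1 := dpq1 u ui.
have XE t : J t -> Xcoord (gamma t) a u = Xcoord (gamma1 t) a u.
  by move=> Jt; rewrite /Xcoord (gg t u Jt uh).1.
split.
- by rewrite Xsh.
- rewrite (_ : diffq _ s h = diffq (fun t => Xcoord (gamma1 t) a u) s h); last by rewrite /diffq !XE.
  by rewrite (_ : xi_X _ _ _ _ _ = xi_X alpha beta1 (gamma1 s) a u) // /xi_X Xs bb.
- have dE t : J t -> dom a (Xp (gamma1 t) u) -> dI (Xcoord (gamma t) a) u = dI (Xcoord (gamma1 t) a) u.
    move=> Jt at1; have at_ : dom a (Xp (gamma t) u) by rewrite (gg t u Jt uh).1.
    rewrite (deriv_in_dI Iu (config_deriv (hg t Jt) Iu at_)).2 (deriv_in_dI Iu (config_deriv (hg1 t Jt) Iu at1)).2.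
    by rewrite XE // (gg t u Jt uh).2.
  rewrite (_ : diffq _ s h = diffq (fun t => dI (Xcoord (gamma1 t) a) u) s h); last by rewrite /diffq !dE.
  rewrite (dI_agree (g := xi_X alpha beta1 (gamma1 s) a) lo0 lohi hi1 _ uh) //.
  + by move=> v vh; rewrite /xi_X (gg s v Js vh).1 bb.
  + by have [] := xi_X_deriv hb hs Iu au.
  + by have [] := xi_X_deriv hb1 hs1 Iu au1.
- rewrite (_ : diffq _ s h = diffq (fun t => eta (gamma1 t) u a) s h); last by rewrite /diffq es esh.
  rewrite (_ : xi_eta _ _ _ _ _ = xi_eta alpha beta1 (gamma1 s) a u) //.
  rewrite !xi_etaE XE // es Xs bb //; congr (_ + _).
  apply: (dI_agree lo0 lohi hi1 _ uh).
  + by move=> v vh; rewrite (gg s v Js vh).1 bb.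
  + exact: (form_along hs hb Iu au).
  + exact: (form_along hs1 hb1 Iu au1).
Qed.

Lemma velocity_const c (J : set R) s : constraint alpha c ->
  has_velocity alpha (fun _ _ _ => 0) J (fun=> c) s.
Proof.
move=> hc d a p q e p0 pq q1 e0 dpq; near=> h => u ui.
have Iu : I01 u by move: ui => /andP[? ?]; apply/andP; split; lra.
have d0 (W : normedModType R) (w : W) : diffq (fun=> w) s h = 0 by rewrite /diffq subrr scaler0.
have xi0 : xi_X alpha (fun _ _ _ => 0) d a = fun=> 0.
  by apply/funext => v; rewrite /xi_X /sharp mul0mx oppr0.
rewrite !d0 xi0 xi_etaE Qf0r addr0 !dI_cst // subrr normr0; split => //; exact: dpq.
Unshelve. all: by end_near. Qed.

Lemma velocity_shift beta (J : set R) gamma s t : has_velocity alpha beta J gamma (t + s) ->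
  has_velocity alpha beta [set r | J (t + r)] (fun r => gamma (t + r)) s.
Proof.
move=> H c a p q e p0 pq q1 e0 dpq; have := H a p q e p0 pq q1 e0 dpq.
have E (W : normedModType R) (f : R -> W) h : diffq (fun r => f (t + r)) s h = diffq f (t + s) h.
  by rewrite /diffq addrA.
rewrite /increments !near_withinE; apply: filterS => h Hh h0 /=; rewrite addrA => Jh u ui.
have [h1 h2 h3 h4] := Hh h0 Jh u ui.
have E1 := E _ (fun r => Xcoord (gamma r) a u) h.
have E2 := E _ (fun r => dI (Xcoord (gamma r) a) u) h.
have E3 := E _ (fun r => eta (gamma r) u a) h.
by rewrite E1 E2 E3; split; [exact: h1|exact: h2|exact: h3|exact: h4].
Qed.

(** At 0 and 1 this makes [l] and [r] constant on orbits. The estimate on the degenerate interval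
    [[u, u]] gives zero coordinate velocity, and [locally_constant] passes from single charts to the
    whole curve. *)
Lemma velocity_endpoint beta lo hi gamma u : lo <= hi -> integral_curve alpha beta [set s | lo <= s <= hi] gamma ->
  I01 u -> (forall x a, beta u x a = 0) -> forall s t, lo <= s <= hi -> lo <= t <= hi ->
  Xp (gamma s) u = Xp (gamma t) u.
Proof.
move=> lohi H Iu b0 s t si ti.
apply: (@locally_constant R lo hi (fun r => Xp (gamma s) u = Xp (gamma r) u) lohi _ s t) => // r ri.
have [a ar] := charts_cover (Xp (gamma r) u).
set J := [set s | lo <= s <= hi] in H.
have loc v e : J v -> dom a (Xp (gamma v) u) -> 0 < e -> exists2 d : R, 0 < d & forall w, J w -> `|w - v| < d ->
    dom a (Xp (gamma w) u) /\ `|Xcoord (gamma w) a u - Xcoord (gamma v) a u| <= e * `|w - v|.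
  move=> Jv av e0; have [_ Hv] := H v Jv; move/andP: Iu => [u0 u1].
  have duu w : u <= w <= u -> dom a (Xp (gamma v) w) by rewrite -eq_le => /eqP <-.
  have := Hv a u u e u0 (lexx u) u1 e0 duu; rewrite /increments near_withinE => /nbhs_ballP[d /= d0 dP].
  exists d => // w Jw wd; have [->|wv] := eqVneq w v; first by rewrite !subrr !normr0 mulr0.
  have vw : v + (w - v) = w by rewrite subrKC.
  have wv0 : w - v != 0 by rewrite subr_eq0.
  have := dP (w - v); rewrite /ball /= sub0r normrN vw => /(_ wd wv0 Jw u).
  rewrite lexx => /(_ isT)[aw + _ _]; rewrite /xi_X b0 /sharp mul0mx oppr0 subr0 => /ltW.
  rewrite /diffq vw normrZ normfV mulrC ler_pdivrMr ?normr_gt0 // => ?; by split.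
have [d d0 dP] := loc r 1 ri ar ltr01.
exists d => // w wi wd; suff -> : Xp (gamma w) u = Xp (gamma r) u by [].
have [aw _] := dP w wi wd.
rewrite -(coordK aw) -(coordK ar); congr chart_inv; apply/eqP; rewrite -subr_eq0 -normr_le0.
have seg x y : J x -> J y -> x <= y -> (forall v, x <= v <= y -> `|v - r| < d) ->
    `|Xcoord (gamma y) a u - Xcoord (gamma x) a u| <= 0.
  move=> Jx Jy xy near; have {Jx Jy}Jxy v : x <= v <= y -> J v.
    by move: Jx Jy => /andP[? ?] /andP[? ?] /andP[? ?]; apply/andP; split; lra.
  have := @mean_value R 1 n x y 0 (fun v => Xcoord (gamma v) a u) (fun=> 0) xy; rewrite mul0r; apply => v vxy.
    have [av _] := dP v (Jxy v vxy) (near v vxy).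
    move=> e e0; have [d' d'0 d'P] := loc v e (Jxy v vxy) av e0.
    by exists d' => // z /Jxy Jz zd; rewrite scaler0 subr0; have [] := d'P z Jz zd.
  by rewrite normr0.
have [rw|/ltW wr] := leP r w.
  apply: seg => // v /andP[v1 v2]; apply: le_lt_trans wd.
  by rewrite !ger0_norm ?subr_ge0 // lerB.
rewrite distrC; apply: seg => // v /andP[v1 v2]; apply: le_lt_trans wd.
by rewrite !ler0_norm ?subr_le0 // lerN2 lerB.
Qed.

End PullBack.

(** * Concatenation, slowed paths and orbits *)

Section Concatenation.
Context {R : realType} {n : nat} {M : manifold R n} (alpha : poisson M).
Implicit Types (a : chart M) (c : config M) (beta : R -> field_of_comps M) (gamma : R -> config M).

(** At 1/2 [concat] uses the first formula; vanishing of [eta] at the junction makes the second one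
    valid there too ([concat_upper]). *)
Definition matched c1 c2 := [/\ constraint alpha c1, constraint alpha c2, Xp c1 1 = Xp c2 0 &
  forall a, eta c1 1 a = 0 /\ eta c2 0 a = 0].

Lemma concat_lower c1 c2 u : lower_half u ->
  Xp (concat c1 c2) u = Xp c1 (2 * u) /\ eta (concat c1 c2) u = fun a => 2 *: eta c1 (2 * u) a.
Proof. by move=> /andP[_ uh] /=; rewrite uh. Qed.

Lemma concat_upper c1 c2 u : matched c1 c2 -> upper_half u ->
  Xp (concat c1 c2) u = Xp c2 (2 * u - 1) /\ eta (concat c1 c2) u = fun a => 2 *: eta c2 (2 * u - 1) a.
Proof.
move=> [_ _ X12 E12] /andP[uh _] /=; have [u1|//] := leP u 2^-1.
have -> : u = 2^-1 by apply/eqP; rewrite eq_le u1.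
rewrite mulfV // subrr; split=> //; apply/funext => a.
by have [-> ->] := E12 a.
Qed.

Lemma glue_near (P P1 P2 : R -> Prop) u : I01 u ->
  (forall v, lower_half v -> P1 (2 * v) -> P v) -> (forall v, upper_half v -> P2 (2 * v - 1) -> P v) ->
  (lower_half u -> exists2 d : R, 0 < d & forall w, I01 w -> `|w - 2 * u| < d -> P1 w) ->
  (upper_half u -> exists2 d : R, 0 < d & forall w, I01 w -> `|w - (2 * u - 1)| < d -> P2 w) ->
  exists2 d : R, 0 < d & forall v, I01 v -> `|v - u| < d -> P v.
Proof.
move=> Iu PP1 PP2 H1 H2.
have [d d0 dP] : exists2 d : R, 0 < d & forall v, lower_half v -> `|v - u| < d -> P v.
  have [uh|uh] := leP u 2^-1; last first.
    exists (u - 2^-1); first by rewrite subr_gt0.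
    by move=> v /andP[_ vh]; rewrite distrC ltNge => /negP[]; rewrite (le_trans _ (ler_norm _)) // lerB.
  have Lu : lower_half u by move/andP: Iu => [? ?]; apply/andP.
  have [d d0 dP] := H1 Lu; exists (d / 2); first by rewrite divr_gt0.
  move=> v Lv vd; apply: PP1 => //; apply: dP; first exact: lower_I01.
  by rewrite -mulrBr normrM ger0_norm // mulrC -ltr_pdivlMr.
have [d' d'0 d'P] : exists2 d : R, 0 < d & forall v, upper_half v -> `|v - u| < d -> P v.
  have [uh|uh] := leP 2^-1 u; last first.
    exists (2^-1 - u); first by rewrite subr_gt0.
    by move=> v /andP[vh _]; rewrite ltNge => /negP[]; rewrite (le_trans _ (ler_norm _)) // lerB.
  have Uu : upper_half u by move/andP: Iu => [? ?]; apply/andP.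
  have [r r0 rP] := H2 Uu; exists (r / 2); first by rewrite divr_gt0.
  move=> v Uv vd; apply: PP2 => //; apply: rP; first exact: upper_I01.
  have -> : 2 * v - 1 - (2 * u - 1) = 2 * (v - u) by ring.
  by rewrite normrM ger0_norm // mulrC -ltr_pdivlMr.
exists (Num.min d d'); first by rewrite lt_min d0.
by move=> v /half_cases[Lv|Uv]; rewrite lt_min => /andP[? ?]; [exact: dP|exact: d'P].
Qed.

Lemma concat_constraint c1 c2 : matched c1 c2 -> constraint alpha (concat c1 c2).
Proof.
move=> m12; have [h1 h2 _ _] := m12.
have lo := @concat_lower c1 c2; have up := fun u => @concat_upper c1 c2 u m12.
have [cl1 _ _ _] := h1; have [cl2 _ _ _] := h2.
apply: constraint_intro => [u|u Iu|u Iu].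
- have E01 : ((1 : R) <= 2^-1) = false by apply/negP => ?; lra.
  have E00 : (0 : R) <= 2^-1 by rewrite invr_ge0.
  case: (clamp_cases u) => -[u0 cu]; rewrite cu //=.
    have u2 : u <= 2^-1 by lra.
    have c0 : clamp (2 * u) = 0 by case: (clamp_cases (2 * u)) => -[? ?] //; lra.
    by rewrite u2 E00 mulr0 (cl1 (2 * u)).1 (cl1 (2 * u)).2 c0.
  have u2 : (u <= 2^-1) = false by apply/negP => ?; lra.
  have c1' : clamp (2 * u - 1) = 1 by case: (clamp_cases (2 * u - 1)) => -[? ?] //; lra.
  have t1 : 2 * 1 - 1 = 1 :> R by lra.
  by rewrite u2 E01 t1 (cl2 (2 * u - 1)).1 (cl2 (2 * u - 1)).2 c1'.
- have [Lu|Uu] := half_cases Iu.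
    have [-> ->] := lo u Lu; apply: covector_scale.
    exact: (config_covector h1 (lower_I01 Lu)).
  have [-> ->] := up u Uu; apply: covector_scale.
  exact: (config_covector h2 (upper_I01 Uu)).
- have [a au] := charts_cover (Xp (concat c1 c2) u); exists a.
  have half (e : 'rV[R]_n) : 2^-1 *: (2 *: e) = e by rewrite scalerA mulVf // scale1r.
  have XL v : lower_half v -> Xcoord (concat c1 c2) a v = Xcoord c1 a (2 * v).
    by move=> /lo[E _]; rewrite /Xcoord E.
  have XU v : upper_half v -> Xcoord (concat c1 c2) a v = Xcoord c2 a (2 * v - 1).
    by move=> /up[E _]; rewrite /Xcoord E.
  split.
  + apply: (@glue_near _ (fun w => dom a (Xp c1 w)) (fun w => dom a (Xp c2 w))) => // [v /lo[-> _]|v /up[-> _]|Lu|Uu] //.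
      apply: (config_near h1 (lower_I01 Lu) (@dom_open _ _ M a)).
      by have [<- _] := lo u Lu.
    apply: (config_near h2 (upper_I01 Uu) (@dom_open _ _ M a)).
    by have [<- _] := up u Uu.
  + apply: (glue_deriv Iu XL XU) => [Lu|Uu].
      have [EX EE] := lo u Lu; rewrite EE -fAZ half XL //.
      by apply: (config_deriv h1 (lower_I01 Lu)); rewrite -EX.
    have [EX EE] := up u Uu; rewrite EE -fAZ half XU //.
    by apply: (config_deriv h2 (upper_I01 Uu)); rewrite -EX.
  + have two (v : R) : I01 v -> cont_in I01 (fun=> 2 : R) v.
      by move=> _ e e0; exists 1 => // w _ _; rewrite subrr normr0 ltW.
    apply: (glue_cont Iu (f := fun v => 2 *: eta c1 v a) (g := fun v => 2 *: eta c2 v a)).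
    * by move=> v /lo[_ ->].
    * by move=> v /up[_ ->].
    * move=> Lu; have I2 := lower_I01 Lu; apply: (cont_in_scale I2 (two _ I2)).
      by apply: (config_eta_cont h1 I2); have [<- _] := lo u Lu.
    * move=> Uu; have I2 := upper_I01 Uu; apply: (cont_in_scale I2 (two _ I2)).
      by apply: (config_eta_cont h2 I2); have [<- _] := up u Uu.
Qed.

(** Supplies representatives with [eta] zero at both ends. With both factors slowed, forms acting on
    them combine to a form that is C^1 across the junction, so moves of the factors become moves of
    the concatenation. *)
Definition slow c := pull smoothstep dsmoothstep c.

Lemma C1map_smoothstep : C1map (@smoothstep R) (@dsmoothstep R).
Proof.
have I0 := @I01_0 R.
have I1 : @I01 R (0 + 1) by rewrite add0r /I01 /= lexx ler01.
have [H1 H2 H3] := C1map_step I0 I1.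
split=> u Iu; first exact: smoothstep_I01.
- exact: smoothstep_deriv.
- by move=> e e0; have [d d0 dP] := H3 u Iu e e0; exists d => // v Iv vd; have := dP v Iv vd; rewrite !mul1r.
Qed.

Lemma slow_constraint c : constraint alpha c -> constraint alpha (slow c).
Proof. exact: (pull_constraint C1map_smoothstep). Qed.

Lemma slow_ends c : [/\ Xp (slow c) 0 = Xp c 0, Xp (slow c) 1 = Xp c 1 & vanishes_at_ends (slow c)].
Proof.
have I0 := @I01_0 R.
have I1 := @I01_1 R.
have [s0 d0] := smoothstep0 (lexx (0 : R)); have [s1 d1] := smoothstep1 (lexx (1 : R)).
split; rewrite /slow ?pull_Xp ?s0 ?s1 // => a.
by rewrite !pull_eta // d0 d1 !scale0r.
Qed.

Lemma slow_matched c1 c2 : constraint alpha c1 -> constraint alpha c2 -> Xp c1 1 = Xp c2 0 -> matched (slow c1) (slow c2).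
Proof.
move=> h1 h2 X12; have [_ E1 V1] := slow_ends c1; have [E2 _ V2] := slow_ends c2.
split; [exact: slow_constraint|exact: slow_constraint|by rewrite E1 E2|move=> a].
by have [_ ?] := V1 a; have [? _] := V2 a.
Qed.

Lemma C1map_lower : C1map (fun u : R => smoothstep (2 * u)) (fun u => 2 * dsmoothstep (2 * u)).
Proof.
split=> u Iu; first exact: smoothstep_I01.
- have d2 : deriv_in I01 ( *%R 2) u (2 : R).
    by have := deriv_inZ 2 (@deriv_in_id R I01 u); rewrite [2 *: 1]mulr1.
  exact: (deriv_in_comp (fun _ _ => I) d2 (@smoothstep_deriv R setT _)).
- move=> e e0; have [d d0 dP] := @cont_in_dstep R I01 2 0 2 u e e0.
  by exists d => // v Iv vd; have := dP v Iv vd; rewrite !add0r.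
Qed.

Lemma C1map_upper : C1map (fun u : R => smoothstep (2 * u - 1)) (fun u => 2 * dsmoothstep (2 * u - 1)).
Proof.
split=> u Iu; first exact: smoothstep_I01.
- exact: (deriv_in_comp (fun _ _ => I) (@affine_deriv R I01 (-1) 2 u) (@smoothstep_deriv R setT _)).
- move=> e e0; have [d d0 dP] := @cont_in_dstep R I01 2 (-1) 2 u e e0.
  by exists d => // v Iv vd; have := dP v Iv vd; rewrite ![-1 + _]addrC.
Qed.

(** [smoothstep] is constant outside [0,1], so on each half one summand is a form at an end of its
    interval, hence 0. The sum thus replaces a case distinction at 1/2. *)
Lemma P0_forms_concat beta1 beta2 : P0_forms beta1 -> P0_forms beta2 ->
  P0_forms (fun u x a => beta1 (smoothstep (2 * u)) x a + beta2 (smoothstep (2 * u - 1)) x a).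
Proof.
move=> [C1 z1] [C2 z2]; split.
  exact: (C1_forms_add (C1_forms_comp C1 C1map_lower) (C1_forms_comp C2 C1map_upper)).
have s0 x : x <= 0 -> @smoothstep R x = 0 by move=> /smoothstep0[].
have s1 x : 1 <= x -> @smoothstep R x = 1 by move=> /smoothstep1[].
have e00 : @smoothstep R (2 * 0) = 0 by apply: s0; lra.
have e01 : @smoothstep R (2 * 0 - 1) = 0 by apply: s0; lra.
have e10 : @smoothstep R (2 * 1) = 1 by apply: s1; lra.
have e11 : @smoothstep R (2 * 1 - 1) = 1 by apply: s1; lra.
move=> x a; rewrite e00 e01 e10 e11.
by rewrite (z1 x a).1 (z2 x a).1 (z1 x a).2 (z2 x a).2 addr0.
Qed.

Lemma integral_curve_concat beta1 beta2 (J : set R) gamma1 gamma2 : P0_forms beta1 -> P0_forms beta2 ->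
  integral_curve alpha beta1 J gamma1 -> integral_curve alpha beta2 J gamma2 ->
  (forall s, J s -> Xp (gamma1 s) 1 = Xp (gamma2 s) 0) ->
  integral_curve alpha (fun u x a => beta1 (smoothstep (2 * u)) x a + beta2 (smoothstep (2 * u - 1)) x a) J
    (fun s => concat (slow (gamma1 s)) (slow (gamma2 s))).
Proof.
move=> P1 P2 H1 H2 X12.
have m12 s : J s -> matched (slow (gamma1 s)) (slow (gamma2 s)).
  by move=> Js; apply: slow_matched; [exact: (H1 s Js).1|exact: (H2 s Js).1|exact: X12].
have hg s : J s -> constraint alpha (concat (slow (gamma1 s)) (slow (gamma2 s))).
  by move=> Js; apply: concat_constraint; exact: m12.
have [Cb _] := P0_forms_concat P1 P2; have [C1 z1] := P1; have [C2 z2] := P2.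
have h0 : (0 : R) < 2^-1 by rewrite invr_gt0.
have h1 : 2^-1 < (1 : R) by lra.
move=> s Js; split; first exact: hg.
have hl t : J t -> constraint alpha (pull (fun u : R => smoothstep (2 * u)) (fun u => 2 * dsmoothstep (2 * u)) (gamma1 t)).
  by move=> Jt; apply: (pull_constraint C1map_lower); exact: (H1 t Jt).1.
have hu t : J t -> constraint alpha (pull (fun u : R => smoothstep (2 * u - 1)) (fun u => 2 * dsmoothstep (2 * u - 1)) (gamma2 t)).
  by move=> Jt; apply: (pull_constraint C1map_upper); exact: (H2 t Jt).1.
have s0 x : x <= 0 -> @smoothstep R x = 0 by move=> /smoothstep0[].
have s1 x : 1 <= x -> @smoothstep R x = 1 by move=> /smoothstep1[].
apply: (velocity_halves (m := 2^-1)).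
- apply: (velocity_agree (lexx 0) h0 (ltW h1) Cb (C1_forms_comp C1 C1map_lower) Js hg hl).
  + move=> t u Jt Lu; have Iu : I01 u by move: Lu => /andP[? ?]; apply/andP; split; lra.
    have [-> ->] := concat_lower (slow (gamma1 t)) (slow (gamma2 t)) Lu; have I2 := lower_I01 Lu.
    rewrite /slow !pull_Xp //; split=> //; apply/funext => a.
    by rewrite !pull_eta // scalerA.
  + move=> u /andP[u0 u1]; apply/funext => x; apply/funext => a.
    by rewrite (s0 (2 * u - 1)) ?(z2 x a).1 ?addr0 //; lra.
  + apply: (velocity_pull C1map_lower C1 Js) => [t Jt|]; [exact: (H1 t Jt).1|exact: (H1 s Js).2].
- apply: (velocity_agree (ltW h0) h1 (lexx 1) Cb (C1_forms_comp C2 C1map_upper) Js hg hu).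
  + move=> t u Jt Uu; have Iu : I01 u by move: Uu => /andP[? ?]; apply/andP; split; lra.
    have [-> ->] := concat_upper (m12 t Jt) Uu; have I2 := upper_I01 Uu.
    rewrite /slow !pull_Xp //; split=> //; apply/funext => a.
    by rewrite !pull_eta // scalerA.
  + move=> u /andP[u0 u1]; apply/funext => x; apply/funext => a.
    by rewrite (s1 (2 * u)) ?(z1 x a).2 ?add0r //; lra.
  + apply: (velocity_pull C1map_upper C2 Js) => [t Jt|]; [exact: (H2 t Jt).1|exact: (H2 s Js).2].
Qed.

Lemma flow_step_constraint c c' : flow_step alpha c c' -> constraint alpha c /\ constraint alpha c'.
Proof.
move=> [beta [t [gamma [_ H <- <-]]]]; split; apply: (H _ _).1 => /=.
  by rewrite ge_min le_max lexx.
by rewrite ge_min le_max lexx !orbT.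
Qed.

(** The same curve, shifted in time so as to start where it ended. *)
Lemma flow_step_sym c c' : flow_step alpha c c' -> flow_step alpha c' c.
Proof.
move=> [beta [t [gamma [P0 H g0 gt]]]].
exists beta, (- t), (fun r => gamma (t + r)); split=> //; rewrite ?addr0 ?subrr //.
have JE : [set s | Num.min 0 (- t) <= s <= Num.max 0 (- t)] = [set r | [set s | Num.min 0 t <= s <= Num.max 0 t] (t + r)].
  apply/seteqP; split=> r /=; (have [t0|t0] := leP 0 t);
    (have [t1|t1] := leP 0 (- t)); move=> /andP[? ?]; apply/andP; split; lra.
rewrite JE => s Js; have [h v] := H (t + s) Js; split=> //; exact: velocity_shift.
Qed.

Lemma flow_step_ends c c' : flow_step alpha c c' -> Xp c 0 = Xp c' 0 /\ Xp c 1 = Xp c' 1.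
Proof.
move=> [beta [t [gamma [[_ z] H <- <-]]]].
have mm : Num.min 0 t <= Num.max 0 t by rewrite ge_min le_max lexx.
have J0 : Num.min 0 t <= 0 <= Num.max 0 t by rewrite ge_min le_max lexx.
have Jt : Num.min 0 t <= t <= Num.max 0 t by rewrite ge_min le_max lexx !orbT.
split; apply: (velocity_endpoint mm H) => //.
- by rewrite /I01 /= lexx ler01.
- by move=> x a; have [] := z x a.
- by rewrite /I01 /= lexx ler01.
- by move=> x a; have [] := z x a.
Qed.

(** The conditions on [p] make the pulled-back form vanish at the ends; they admit the reversal of
    paths. *)
Lemma flow_step_pull p p' c c' : C1map p p' -> p 0 = 0 \/ p 0 = 1 -> p 1 = 0 \/ p 1 = 1 ->
  flow_step alpha c c' -> flow_step alpha (pull p p' c) (pull p p' c').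
Proof.
move=> Hp p0 p1 [beta [t [gamma [[C1 z] H g0 gt]]]].
exists (fun u => beta (p u)), t, (fun s => pull p p' (gamma s)); split.
- split; first exact: C1_forms_comp Hp.
  by move=> x a; have [z0 z1] := z x a; split; [case: p0|case: p1] => ->.
- move=> s Js; split; first exact: (pull_constraint Hp (H s Js).1).
  by apply: (velocity_pull Hp C1 Js) => [r Jr|]; [exact: (H r Jr).1|exact: (H s Js).2].
- by rewrite g0.
- by rewrite gt.
Qed.

Lemma integral_curve_const c (J : set R) : constraint alpha c -> integral_curve alpha (fun _ _ _ => 0) J (fun=> c).
Proof. by move=> hc s _; split=> //; exact: velocity_const. Qed.

Lemma flow_step_concat_l c c' c2 : flow_step alpha c c' -> constraint alpha c2 -> Xp c 1 = Xp c2 0 ->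
  flow_step alpha (concat (slow c) (slow c2)) (concat (slow c') (slow c2)).
Proof.
move=> [beta [t [gamma [P0 H g0 gt]]]] h2 X12.
have mm : Num.min 0 t <= Num.max 0 t by rewrite ge_min le_max lexx.
have J0 : Num.min 0 t <= 0 <= Num.max 0 t by rewrite ge_min le_max lexx.
have I1 := @I01_1 R.
exists (fun u x a => beta (smoothstep (2 * u)) x a + 0), t, (fun s => concat (slow (gamma s)) (slow c2)).
split; [exact: (P0_forms_concat P0 P0_forms0)| |by rewrite g0|by rewrite gt].
have Hc := @integral_curve_const c2 [set s : R | Num.min 0 t <= s <= Num.max 0 t] h2.
apply: (integral_curve_concat P0 P0_forms0 H Hc) => s Js.
rewrite -X12 -g0; apply: (velocity_endpoint mm H I1) => // x a.
by have [_ ] := P0.2 x a.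
Qed.

Lemma flow_step_concat_r c1 c c' : flow_step alpha c c' -> constraint alpha c1 -> Xp c1 1 = Xp c 0 ->
  flow_step alpha (concat (slow c1) (slow c)) (concat (slow c1) (slow c')).
Proof.
move=> [beta [t [gamma [P0 H g0 gt]]]] h1 X12.
have mm : Num.min 0 t <= Num.max 0 t by rewrite ge_min le_max lexx.
have J0 : Num.min 0 t <= 0 <= Num.max 0 t by rewrite ge_min le_max lexx.
have I0 := @I01_0 R.
exists (fun u x a => 0 + beta (smoothstep (2 * u - 1)) x a), t, (fun s => concat (slow c1) (slow (gamma s))).
split; [exact: (P0_forms_concat P0_forms0 P0)| |by rewrite g0|by rewrite gt].
have Hc := @integral_curve_const c1 [set s : R | Num.min 0 t <= s <= Num.max 0 t] h1.
apply: (integral_curve_concat P0_forms0 P0 Hc H) => s Js.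
rewrite X12 -g0; apply: (velocity_endpoint mm H I0) => // x a.
by have [] := P0.2 x a.
Qed.

Local Notation orbit := (H_orbit alpha).

Lemma orbit_refl c : orbit c c.
Proof. exact: rt_refl. Qed.

Lemma orbit_trans c c' c'' : orbit c c' -> orbit c' c'' -> orbit c c''.
Proof. exact: rt_trans. Qed.

Lemma orbit_step c c' : flow_step alpha c c' -> orbit c c'.
Proof. exact: rt_step. Qed.

Lemma orbit_sym c c' : orbit c c' -> orbit c' c.
Proof.
elim=> [x y /flow_step_sym|x|x y z _ H1 _ H2]; [exact: orbit_step|exact: orbit_refl|].
exact: orbit_trans H2 H1.
Qed.

Lemma orbit_constraint c c' : orbit c c' -> constraint alpha c -> constraint alpha c'.
Proof.
by elim=> // [x y /flow_step_constraint[]|x y z _ H1 _ H2 /H1 /H2].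
Qed.

Lemma orbit_ends c c' : orbit c c' -> Xp c 0 = Xp c' 0 /\ Xp c 1 = Xp c' 1.
Proof.
by elim=> [x y /flow_step_ends|x|x y z _ [-> ->] _ [-> ->]].
Qed.

Lemma orbit_pull p p' c c' : C1map p p' -> p 0 = 0 \/ p 0 = 1 -> p 1 = 0 \/ p 1 = 1 ->
  orbit c c' -> orbit (pull p p' c) (pull p p' c').
Proof.
move=> Hp p0 p1; elim=> [x y /(flow_step_pull Hp p0 p1)|x|x y z _ H1 _ H2].
- exact: orbit_step.
- exact: orbit_refl.
- exact: orbit_trans H1 H2.
Qed.

(** One factor moves while the other carries the zero form. Orbits keep end points, so the factors
    remain composable at every step. *)
Lemma orbit_concat c1 c1' c2 c2' : constraint alpha c1 -> constraint alpha c2 -> Xp c1 1 = Xp c2 0 ->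
  orbit c1 c1' -> orbit c2 c2' -> orbit (concat (slow c1) (slow c2)) (concat (slow c1') (slow c2')).
Proof.
move=> h1 h2 X12 o1 o2.
have [_ X1] := orbit_ends o1; have h1' := orbit_constraint o1 h1.
apply: (@orbit_trans _ (concat (slow c1') (slow c2))).
  elim: o1 h1 X12 {X1 h1'} => [x y s _ X12|x _ _|x y z o1 H1 _ H2 hx X12].
  - by apply: orbit_step; exact: flow_step_concat_l.
  - exact: orbit_refl.
  - apply: orbit_trans (H1 hx X12) (H2 (orbit_constraint o1 hx) _).
    by have [_ <-] := orbit_ends o1.
rewrite X1 in X12.
elim: o2 h2 X12 => [x y s _ X12|x _ _|x y z o2 H1 _ H2 hx X12'].
- by apply: orbit_step; exact: flow_step_concat_r.
- exact: orbit_refl.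
- apply: orbit_trans (H1 hx X12') (H2 (orbit_constraint o2 hx) _).
  by have [<- _] := orbit_ends o2.
Qed.

End Concatenation.

(** * Invariance under reparametrization *)

Section LocalReparametrization.
Context {R : realType} {n : nat} {M : manifold R n} (alpha : poisson M).
Implicit Types (a : chart M) (c : config M).

(** The outcome of [development] with the box hidden, leaving only [eps] to be made uniform. The
    displacement [rho / 8] added to [rho / 4] stays below [rho / 2], so a second flow can start
    where the first one ends. *)
Definition developable c (eps t0 : R) := exists a y0 rho C kappa (B w : R -> 'rV[R]_n),
  [/\ flow_box alpha a y0 rho C kappa, C * kappa <= rho / 8, continuous w, B t0 = 0 &
    forall t, I01 t -> `|t - t0| < eps ->
    [/\ deriv_in setT B t (w t), `|B t| <= kappa, dom a (Xp c t) /\ `|Xcoord c a t - y0| < rho / 4 &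
      exists X E, [/\ local_flow alpha a y0 rho kappa (B t) (w t) (Xcoord c a t0) 0 X E,
        X 1 = Xcoord c a t & E 1 = eta c t a]]].

Lemma uniformly_developable c : constraint alpha c ->
  exists2 eps : R, 0 < eps & forall t0, I01 t0 -> developable c eps t0.
Proof.
move=> hc; apply: (@segment_uniform R 0 1 (fun eps t0 => developable c eps t0)).
  move=> d d' u d'0 dd' [a [y0 [rho [C [kappa [B [w [H1 H2 H3 H4 H5]]]]]]]].
  exists a, y0, rho, C, kappa, B, w; split=> // t It td; apply: H5 => //.
  exact: lt_le_trans dd'.
move=> t1 It1; have [a at1] := charts_cover (Xp c t1).
have [rho [C [kappa0 box0]]] := flow_box_exists alpha (chart_map_image at1).
have rho8 : 0 < rho / 8 by rewrite divr_gt0 // (box_rho box0).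
have [kappa box small] := flow_box_shrink box0 rho8.
have [eps eps0 H] := development hc It1 at1 box; exists eps => // t0 It0 t01.
have [B [w [cw B0 HB]]] := H t0 It0 t01.
by exists a, (Xcoord c a t1), rho, C, kappa, B, w.
Qed.

Section Local.
Variables (c : config M) (a : chart M) (y0 : 'rV[R]_n) (rho C kappa : R) (B w : R -> 'rV[R]_n) (eps t0 : R).
Hypothesis hc : constraint alpha c.
Hypotheses (box : flow_box alpha a y0 rho C kappa) (small : C * kappa <= rho / 8) (cw : continuous w) (B0 : B t0 = 0).
Hypothesis dev : forall t, I01 t -> `|t - t0| < eps ->
    [/\ deriv_in setT B t (w t), `|B t| <= kappa, dom a (Xp c t) /\ `|Xcoord c a t - y0| < rho / 4 &
      exists X E, [/\ local_flow alpha a y0 rho kappa (B t) (w t) (Xcoord c a t0) 0 X E,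
        X 1 = Xcoord c a t & E 1 = eta c t a]].
Variables (chi chi' : R -> R).
Hypothesis hchi : C1map chi chi'.

Let far (u : R) := exists2 d : R, 0 < d & forall v, I01 v -> `|v - u| < d -> chi v = 0 /\ chi' v = 0.

(** [k = -1] retracts and [k = 1] expands. *)
Let cutoff (k : R) (p : R -> R) (u : R) := (k * chi u) *: B (p u).
Let dcutoff (k : R) (p p' : R -> R) (u : R) := (k * chi' u) *: B (p u) + (k * chi u) *: (p' u *: w (p u)).

Let cutoff_far k p p' u : I01 u -> far u ->
  exists2 d : R, 0 < d & forall v, I01 v -> `|v - u| < d -> cutoff k p v = 0 /\ dcutoff k p p' v = 0.
Proof.
move=> Iu [d d0 dP]; exists d => // v Iv vd; have [E E'] := dP v Iv vd.
by rewrite /cutoff /dcutoff E E' mulr0 !scale0r addr0.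
Qed.

Let cutoff_data k p p' : `|k| <= 1 -> C1map p p' -> (forall u, I01 u -> `|p u - t0| < eps \/ far u) ->
  chi 0 = 0 \/ p 0 = t0 -> chi 1 = 0 \/ p 1 = t0 ->
  [/\ forall u, I01 u -> deriv_in I01 (cutoff k p) u (dcutoff k p p' u),
      forall u, I01 u -> cont_in I01 (dcutoff k p p') u,
      forall u, I01 u -> `|cutoff k p u| <= kappa, cutoff k p 0 = 0 & cutoff k p 1 = 0].
Proof.
move=> k1 Hp near e0 e1.
have zero u : chi u = 0 \/ p u = t0 -> cutoff k p u = 0.
  by rewrite /cutoff; case=> ->; rewrite ?mulr0 ?scale0r // B0 scaler0.
have kc (f : R -> R) u : I01 u -> cont_in I01 f u -> cont_in I01 (fun v => k * f v) u.
  move=> Iu /(cont_in_cvg _ Iu) cf; apply/(cont_in_cvg _ Iu); exact: cvgM (cvg_cst _) cf.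
split; [move=> u Iu|move=> u Iu|move=> u Iu|exact: zero|exact: zero].
- have [pu|fu] := near u Iu; last first.
    have [d d0 dP] := cutoff_far k p p' Iu fu.
    have [c0 ->] : cutoff k p u = 0 /\ dcutoff k p p' u = 0 by apply: dP => //; rewrite subrr normr0.
    apply: deriv_in_near (@deriv_in_cst _ _ _ (0 : 'rV[R]_n) u) => //.
    by exists d => // v Iv vd; have [] := dP v Iv vd.
  have [dB _ _ _] := dev (map_I01 Hp Iu) pu.
  exact: (deriv_in_scale (deriv_inZ k (map_deriv hchi Iu)) (deriv_in_comp (fun _ _ => I) (map_deriv Hp Iu) dB)).
- have [pu|fu] := near u Iu; last first.
    have [d d0 dP] := cutoff_far k p p' Iu fu.
    have [_ c0] : cutoff k p u = 0 /\ dcutoff k p p' u = 0 by apply: dP => //; rewrite subrr normr0.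
    move=> e e0'; exists d => // v Iv vd; have [_ ->] := dP v Iv vd.
    by rewrite c0 subrr normr0 ltW.
  have [dB _ _ _] := dev (map_I01 Hp Iu) pu.
  have cp := deriv_in_cont (map_deriv Hp Iu).
  have cB : cont_in I01 (B \o p) u by exact: (cont_in_comp (fun _ _ => I) cp (deriv_in_cont dB)).
  have cwp : cont_in I01 (w \o p) u.
    apply: (cont_in_comp (E := setT) (fun _ _ => I) cp) => e /= e0'.
    have /cvgrPdist_le /(_ e e0') /nbhs_ballP[d /= d0 dP] := @cw (p u).
    by exists d => // v _ vd; rewrite distrC; apply: dP; rewrite /ball /= distrC.
  apply: (cont_in_add Iu).
    by apply: (cont_in_scale Iu _ cB); apply: kc => //; exact: (map_cont hchi).
  apply: (cont_in_scale Iu); first by apply: kc => //; exact: deriv_in_cont (map_deriv hchi Iu).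
  exact: (cont_in_scale Iu (map_cont Hp Iu) cwp).
- have [pu|fu] := near u Iu; last first.
    have [d d0 dP] := cutoff_far k p p' Iu fu.
    have [-> _] : cutoff k p u = 0 /\ dcutoff k p p' u = 0 by apply: dP => //; rewrite subrr normr0.
    by rewrite normr0 ltW // (box_kappa box).
  have [_ Bk _ _] := dev (map_I01 Hp Iu) pu.
  have /andP[x0 x1] := map_I01 hchi Iu.
  rewrite /cutoff normrZ normrM (ger0_norm x0) (le_trans _ Bk) // ler_piMl //.
  by rewrite mulr_ile1.
Qed.

(** Step 1 retracts the piece of the path on which [chi = 1] to the constant path
    at [t0]; step 2 expands it again along the other parametrization. *)
Lemma local_reparam_aux p0 p0' p1 p1' : C1map p0 p0' -> C1map p1 p1' ->
  (forall u, I01 u -> (`|p0 u - t0| < eps /\ `|p1 u - t0| < eps) \/ far u) ->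
  (forall u, I01 u -> (chi u = 1 /\ chi' u = 0) \/ (p0 u = p1 u /\ p0' u = p1' u)) ->
  chi 0 = 0 \/ (p0 0 = t0 /\ p1 0 = t0) -> chi 1 = 0 \/ (p0 1 = t0 /\ p1 1 = t0) ->
  H_orbit alpha (pull p0 p0' c) (pull p1 p1' c).
Proof.
move=> H0 H1 near same e0 e1.
have rho0 := box_rho box.
have I1 := @I01_1 R.
have near0 u : I01 u -> `|p0 u - t0| < eps \/ far u by move=> /near[[? ?]|?]; [left|right].
have near1 u : I01 u -> `|p1 u - t0| < eps \/ far u by move=> /near[[? ?]|?]; [left|right].
have kN : `|-1 : R| <= 1 by rewrite normrN normr1.
have k1 : `|1 : R| <= 1 by rewrite normr1.
have e00 : chi 0 = 0 \/ p0 0 = t0 by case: e0 => [?|[? ?]]; [left|right].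
have e01 : chi 1 = 0 \/ p0 1 = t0 by case: e1 => [?|[? ?]]; [left|right].
have e10 : chi 0 = 0 \/ p1 0 = t0 by case: e0 => [?|[? ?]]; [left|right].
have e11 : chi 1 = 0 \/ p1 1 = t0 by case: e1 => [?|[? ?]]; [left|right].
have [db1 cb1 bk1 b10 b11] := cutoff_data kN H0 near0 e00 e01.
have [db2 cb2 bk2 b20 b21] := cutoff_data k1 H1 near1 e10 e11.
set b1 := cutoff (-1) p0 in db1 bk1 b10 b11; set b1' := dcutoff (-1) p0 p0' in db1 cb1.
set b2 := cutoff 1 p1 in db2 bk2 b20 b21; set b2' := dcutoff 1 p1 p1' in db2 cb2.
pose c0 := pull p0 p0' c; have hc0 : constraint alpha c0 := pull_constraint H0 hc.
pose c1 := pull p1 p1' c; have hc1 : constraint alpha c1 := pull_constraint H1 hc.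
have c0in u : I01 u -> `|p0 u - t0| < eps -> dom a (Xp c0 u) /\ `|Xcoord c0 a u - y0| < rho / 4.
  by move=> Iu pu; rewrite /Xcoord /c0 pull_Xp //; have [_ _ ? _] := dev (map_I01 H0 Iu) pu.
have supp1 u : I01 u -> (dom a (Xp c0 u) /\ `|Xcoord c0 a u - y0| < rho / 2) \/
    (exists2 d : R, 0 < d & forall v, I01 v -> `|v - u| < d -> b1 v = 0 /\ b1' v = 0).
  move=> Iu; have [pu|fu] := near0 u Iu; [left|right; exact: cutoff_far].
  by have [? ur] := c0in u Iu pu; split=> //; apply: lt_trans ur _; lra.
have [cm [step1 cmE cm0]] := flow_lemma box hc0 db1 cb1 bk1 b10 b11 supp1.
have [_ hcm] := flow_step_constraint step1.
have flow1 u : I01 u -> `|p0 u - t0| < eps -> exists X E,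
    [/\ local_flow alpha a y0 rho kappa (b1 u) (b1' u) (Xcoord c0 a u) (eta c0 u a) X E,
      dom a (Xp cm u), Xcoord cm a u = X 1, eta cm u a = E 1 & cball y0 (rho / 2) (X 1)].
  move=> Iu pu; have [au ur] := c0in u Iu pu.
  have ur2 : cball y0 (rho / 2) (Xcoord c0 a u) by rewrite /cball /=; lra.
  have [X [E H]] := flow_exists box (b1' u) (eta c0 u a) (bk1 u Iu) ur2.
  have [EX EE] := cmE u X E Iu au ur2 H.
  have dX := flow_displacement box H I1.
  have Xin : cball y0 (rho / 2) (X 1).
    rewrite /cball /= -(subrKA (Xcoord c0 a u)) (le_trans (ler_normD _ _)) //.
    by apply: le_trans (lerD (le_trans dX small) (ltW ur)) _; lra.
  have [aX mX] : dom a (chart_inv a (X 1)) /\ chart_map a (chart_inv a (X 1)) = X 1.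
    by apply: chart_invP; apply: (box_sub box); move: Xin; rewrite /cball /=; lra.
  exists X, E; split=> //; first by rewrite EX.
    by rewrite /Xcoord EX.
  by rewrite EE covector_from_id.
have strict u : I01 u -> `|p0 u - t0| < eps -> `|Xcoord cm a u - y0| < rho / 2.
  move=> Iu pu; have [X [E [H _ -> _ _]]] := flow1 u Iu pu.
  have [_ ur] := c0in u Iu pu; have dX := flow_displacement box H I1.
  rewrite -(subrKA (Xcoord c0 a u)) (le_lt_trans (ler_normD _ _)) //.
  by apply: le_lt_trans (lerD (le_trans dX small) (ltW ur)) _; lra.
have supp2 u : I01 u -> (dom a (Xp cm u) /\ `|Xcoord cm a u - y0| < rho / 2) \/
    (exists2 d : R, 0 < d & forall v, I01 v -> `|v - u| < d -> b2 v = 0 /\ b2' v = 0).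
  move=> Iu; have [[pu _]|fu] := near u Iu; [left|right; exact: cutoff_far].
  split; last exact: strict.
  by have [X [E [_ ? _ _ _]]] := flow1 u Iu pu.
have [c2 [step2 c2E c20]] := flow_lemma box hcm db2 cb2 bk2 b20 b21 supp2.
have [_ hc2] := flow_step_constraint step2.
suff -> : pull p1 p1' c = c2 by apply: (orbit_trans (orbit_step step1)); exact: orbit_step step2.
apply: (constraint_ext hc1 hc2) => u Iu.
(* Three kinds of parameters: off the support nothing moves; where the parametrizations agree the
   second flow reverses the first; where [chi = 1] the path is retracted and expanded anew. *)
have [[pu0 pu1]|fu] := near u Iu; last first.
  have [d d0 dP] := fu; have [x0 x0'] : chi u = 0 /\ chi' u = 0 by apply: dP => //; rewrite subrr normr0.
  have [|[pE pE']] := same u Iu; first by rewrite x0 => -[/eqP]; rewrite eq_sym oner_eq0.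
  have z1 : b1 u = 0 /\ b1' u = 0 by rewrite /b1 /b1' /cutoff /dcutoff x0 x0' mulr0 !scale0r addr0.
  have z2 : b2 u = 0 /\ b2' u = 0 by rewrite /b2 /b2' /cutoff /dcutoff x0 x0' mulr0 !scale0r addr0.
  have [-> ->] := c20 u Iu z2.1 z2.2; have [-> ->] := cm0 u Iu z1.1 z1.2.
  rewrite /c0 !pull_Xp // pE; split=> //; apply/funext => a'.
  by rewrite !pull_eta // pE pE'.
have [X [E [HXE acm Xcm Ecm Xin]]] := flow1 u Iu pu0.
have cmr : cball y0 (rho / 2) (Xcoord cm a u) by rewrite Xcm.
have [ac0 _] := c0in u Iu pu0.
have [[x1 x1']|[pE pE']] := same u Iu; last first.
  have bN : b2 u = - b1 u by rewrite /b1 /b2 /cutoff pE mul1r mulN1r scaleNr opprK.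
  have bN' : b2' u = - b1' u.
    by rewrite /b1' /b2' /dcutoff pE pE' !mul1r !mulN1r !scaleNr opprD !opprK.
  have Hr := flow_reverse HXE; rewrite -bN -bN' -Xcm -Ecm in Hr.
  have [-> ->] := c2E u _ _ Iu acm cmr Hr.
  rewrite subrr (flow_X0 HXE) (flow_E0 HXE) coordK // (covector_from_eta hc0) //.
  rewrite /c0 !pull_Xp // pE; split=> //; apply/funext => a'.
  by rewrite !pull_eta // pE pE'.
have b1E : b1 u = - B (p0 u) by rewrite /b1 /cutoff x1 mulr1 scaleN1r.
have b1E' : b1' u = - (p0' u *: w (p0 u)).
  by rewrite /b1' /dcutoff x1 x1' mulr0 scale0r add0r mulr1 scaleN1r.
have b2E : b2 u = B (p1 u) by rewrite /b2 /cutoff x1 mulr1 scale1r.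
have b2E' : b2' u = p1' u *: w (p1 u).
  by rewrite /b2' /dcutoff x1 x1' mulr0 scale0r add0r mulr1 scale1r.
have [_ _ _ [X0 [E0 [F0 X01 E01]]]] := dev (map_I01 H0 Iu) pu0.
have [_ _ [ap1 _] [X1 [E1 [F1 X11 E11]]]] := dev (map_I01 H1 Iu) pu1.
(* The first flow reverses the development scaled by [p0' u], so it ends at [X t0] with [eta = 0].
   This intermediate state no longer depends on [p0], and the development scaled by [p1' u] can
   start from it. *)
have Hr := flow_reverse (flow_scale (p0' u) F0).
have hx : Xcoord c0 a u = X0 1 by rewrite /Xcoord /c0 pull_Xp.
have he : eta c0 u a = p0' u *: E0 1 by rewrite /c0 pull_eta // E01.
rewrite -b1E -b1E' -hx -he in Hr.
have [XX EE] := flow_unique box HXE Hr I1.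
rewrite subrr (flow_X0 F0) in XX; rewrite subrr (flow_E0 F0) scaler0 in EE.
have F1s := flow_scale (p1' u) F1.
rewrite scaler0 -b2E -b2E' -EE -XX -Xcm -Ecm in F1s.
have [-> ->] := c2E u _ _ Iu acm cmr F1s.
rewrite X11 E11; have ac1 : dom a (Xp c1 u) by rewrite /c1 pull_Xp.
have XE : chart_inv a (Xcoord c a (p1 u)) = Xp c1 u by rewrite /Xcoord coordK // /c1 pull_Xp.
have EE1 : p1' u *: eta c (p1 u) a = eta c1 u a by rewrite /c1 pull_eta.
by rewrite XE EE1 (covector_from_eta hc1).
Qed.

End Local.

Lemma local_reparam c (eps t0 : R) chi chi' p0 p0' p1 p1' : constraint alpha c ->
  developable c eps t0 -> C1map chi chi' -> C1map p0 p0' -> C1map p1 p1' ->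
  (forall u, I01 u -> (`|p0 u - t0| < eps /\ `|p1 u - t0| < eps) \/
    exists2 d : R, 0 < d & forall v, I01 v -> `|v - u| < d -> chi v = 0 /\ chi' v = 0) ->
  (forall u, I01 u -> (chi u = 1 /\ chi' u = 0) \/ (p0 u = p1 u /\ p0' u = p1' u)) ->
  chi 0 = 0 \/ (p0 0 = t0 /\ p1 0 = t0) -> chi 1 = 0 \/ (p0 1 = t0 /\ p1 1 = t0) ->
  H_orbit alpha (pull p0 p0' c) (pull p1 p1' c).
Proof.
move=> hc [a [y0 [rho [C [kappa [B [w [H1 H2 H3 H4 H5]]]]]]]].
move=> hchi C0 C1 near same e0 e1.
exact: (local_reparam_aux hc H1 H2 H3 H4 H5 hchi C0 C1 near same e0 e1).
Qed.

End LocalReparametrization.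

Section MixedMaps.
Context {R : realType}.

Lemma cont_in_mul (f g : R -> R) (u : R) : I01 u ->
  cont_in I01 f u -> cont_in I01 g u -> cont_in I01 (fun v => f v * g v) u.
Proof.
move=> Iu /(cont_in_cvg _ Iu) cf /(cont_in_cvg _ Iu) cg; apply/(cont_in_cvg _ Iu).
exact: cvgM.
Qed.

Lemma cont_in_sub (f g : R -> R) (u : R) : I01 u ->
  cont_in I01 f u -> cont_in I01 g u -> cont_in I01 (fun v => f v - g v) u.
Proof.
move=> Iu /(cont_in_cvg _ Iu) cf /(cont_in_cvg _ Iu) cg; apply/(cont_in_cvg _ Iu).
exact: cvgB.
Qed.

(** Homotopies of parametrizations use the convexity of [0,1]; a weight that varies with [u]
    localizes the change. *)
Definition mix (t p q : R -> R) (u : R) : R := p u + t u * (q u - p u).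
Definition dmix (t t' p p' q q' : R -> R) (u : R) : R := p' u + (t' u * (q u - p u) + t u * (q' u - p' u)).

Lemma C1map_mix t t' p p' q q' : C1map t t' -> C1map p p' -> C1map q q' ->
  C1map (mix t p q) (dmix t t' p p' q q').
Proof.
move=> Ht Hp Hq; split=> u Iu.
- have /andP[] := map_I01 Ht Iu; have /andP[] := map_I01 Hp Iu; have /andP[] := map_I01 Hq Iu.
  rewrite /mix; move: (t u) (p u) (q u) => k x y x0 x1 y0 y1 k0 k1.
  have -> : x + k * (y - x) = (1 - k) * x + k * y by ring.
  have k2 : 0 <= 1 - k by lra.
  have h1 := mulr_ge0 k2 y0; have h2 := mulr_ge0 k0 x0.
  have := ler_wpM2l k2 y1; have := ler_wpM2l k0 x1; rewrite !mulr1 => h3 h4.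
  by apply/andP; split; lra.
- apply: deriv_inD; first exact: (map_deriv Hp).
  by apply: deriv_inM; [exact: (map_deriv Ht)|apply: deriv_inB; [exact: (map_deriv Hq)|exact: (map_deriv Hp)]].
- have cp := deriv_in_cont (map_deriv Hp Iu); have cq := deriv_in_cont (map_deriv Hq Iu).
  have ct := deriv_in_cont (map_deriv Ht Iu).
  apply: (cont_in_add Iu (map_cont Hp Iu)); apply: (cont_in_add Iu).
    by apply: (cont_in_mul Iu (map_cont Ht Iu)); exact: cont_in_sub.
  by apply: (cont_in_mul Iu ct); apply: cont_in_sub => //; [exact: (map_cont Hq)|exact: (map_cont Hp)].
Qed.

Lemma C1map_mul (p p' q q' : R -> R) : C1map p p' -> C1map q q' ->
  C1map (fun u => p u * q u) (fun u => p' u * q u + p u * q' u).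
Proof.
move=> Hp Hq; split=> u Iu.
- have /andP[p0 p1] := map_I01 Hp Iu; have /andP[q0 q1] := map_I01 Hq Iu.
  by apply/andP; split; [exact: mulr_ge0|rewrite mulr_ile1].
- by apply: deriv_inM; [exact: (map_deriv Hp)|exact: (map_deriv Hq)].
- have cp := deriv_in_cont (map_deriv Hp Iu); have cq := deriv_in_cont (map_deriv Hq Iu).
  apply: (cont_in_add Iu); first exact: (cont_in_mul Iu (map_cont Hp Iu)).
  exact: (cont_in_mul Iu cp (map_cont Hq Iu)).
Qed.

Lemma C1map_cst (k : R) : I01 k -> C1map (fun=> k) (fun=> 0).
Proof.
move=> Ik; split=> // u _; first exact: deriv_in_cst.
by move=> e e0; exists 1 => // v _ _; rewrite subrr normr0 ltW.
Qed.

Lemma C1map_ramp (k m : R) : C1map (fun u => smoothstep (k + m * u)) (fun u => m * dsmoothstep (k + m * u)).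
Proof.
split=> u _; first exact: smoothstep_I01.
- have d2 : deriv_in I01 (fun v => k + m * v) u m.
    have := deriv_inD (@deriv_in_cst R _ I01 k u) (deriv_inZ m (@deriv_in_id R I01 u)).
    by rewrite add0r [m *: 1]mulr1.
  exact: (deriv_in_comp (fun _ _ => I) d2 (@smoothstep_deriv R setT _)).
- exact: cont_in_dstep.
Qed.

Lemma C1map_lipschitz p p' : C1map p p' -> exists2 K : R, 0 <= K &
  forall u v, I01 u -> I01 v -> `|p u - p v| <= K * `|u - v|.
Proof.
move=> Hp; have [K K0 KP] := cont_in_bounded (map_cont Hp); exists K => //.
have ord u v : I01 u -> I01 v -> u <= v -> `|p v - p u| <= K * (v - u).
  move=> /andP[? ?] /andP[? ?] uv.
  have inI w : u <= w <= v -> I01 w by move=> /andP[? ?]; apply/andP; split; lra.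
  apply: (@mean_value_R R u v K p p') => // w wi; last by apply: KP; exact: inI.
  apply: deriv_inS (map_deriv Hp (inI w wi)) => x; exact: inI.
move=> u v Iu Iv; have [uv|/ltW vu] := leP u v.
  by rewrite distrC (distrC u) (ger0_norm (x := v - u)) ?subr_ge0 //; exact: ord.
by rewrite (ger0_norm (x := u - v)) ?subr_ge0 //; exact: ord.
Qed.

End MixedMaps.

Section Reparametrization.
Context {R : realType} {n : nat} {M : manifold R n} (alpha : poisson M).
Variable c : config M.
Hypothesis hc : constraint alpha c.

Lemma pull_ext p p' q q' : (forall u, I01 u -> p u = q u /\ p' u = q' u) -> pull p p' c = pull q q' c.
Proof.
by move=> H; apply: config_ext => u /=; have [E E'] := H _ (clamp_I01 u); rewrite ?E'  E.
Qed.

Section Close.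
Variables (eps : R) (p p' q q' : R -> R).
Hypotheses (eps0 : 0 < eps) (dev : forall t0, I01 t0 -> developable alpha c eps t0).
Hypotheses (Hp : C1map p p') (Hq : C1map q q') (pq0 : p 0 = q 0) (pq1 : p 1 = q 1).
Hypothesis close : forall u, I01 u -> `|q u - p u| <= eps / 2.

(** The weight is 1 for [m u <= j - 1] and 0 for [m u >= j]: stage [j] follows [q] before the ramp
    and [p] after it, so consecutive stages differ only for [j - 1 < m u < j + 1]. *)
Let ramp (m j : nat) (u : R) := smoothstep (j%:R + - m%:R * u).
Let dramp (m j : nat) (u : R) := - m%:R * dsmoothstep (j%:R + - m%:R * u).
Let stage m j := mix (ramp m j) p q.
Let dstage m j := dmix (ramp m j) (dramp m j) p p' q q'.

Let stage_C1 m j : C1map (stage m j) (dstage m j).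
Proof. exact: C1map_mix (C1map_ramp _ _) Hp Hq. Qed.

Let stage_end m j u : p u = q u -> stage m j u = p u.
Proof. by move=> E; rewrite /stage /mix E subrr mulr0 addr0. Qed.

Let stage_close m j u : I01 u -> `|stage m j u - p u| <= eps / 2.
Proof.
move=> Iu; rewrite /stage /mix addrAC subrr add0r normrM.
have /andP[s0 s1] := smoothstep_I01 (j%:R + - m%:R * u).
by rewrite (ger0_norm s0) (le_trans _ (close Iu)) // ler_piMl.
Qed.

Let stage_early m j u : m%:R * u >= j%:R -> stage m j u = p u /\ dstage m j u = p' u.
Proof.
move=> uj; have [|s0 d0] := @smoothstep0 R (j%:R + - m%:R * u); first by lra.
by rewrite /stage /dstage /mix /dmix /ramp /dramp s0 d0 mulr0 !mul0r !addr0.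
Qed.

Let stage_late m j u : m%:R * u <= j%:R - 1 -> stage m j u = q u /\ dstage m j u = q' u.
Proof.
move=> uj; have [|s0 d0] := @smoothstep1 R (j%:R + - m%:R * u); first by lra.
by rewrite /stage /dstage /mix /dmix /ramp /dramp s0 d0 mulr0 mul0r !mul1r add0r !subrKC.
Qed.

Let stage_step m j (K : R) : (4 <= m)%N -> (j <= m)%N -> 0 <= K ->
  (forall u v, I01 u -> I01 v -> `|p u - p v| <= K * `|u - v|) -> 4 * K / m%:R <= eps / 4 ->
  H_orbit alpha (pull (stage m j) (dstage m j) c) (pull (stage m j.+1) (dstage m j.+1) c).
Proof.
move=> m4 jm K0 pK Km.
have m4r : (4 : R) <= m%:R by rewrite ler_nat.
have m0 : 0 < m%:R :> R by lra.
have jmr : j%:R <= m%:R :> R by rewrite ler_nat.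
have j0 : 0 <= j%:R :> R by [].
have jS : j.+1%:R = j%:R + 1 :> R by rewrite -natr1.
(* Centre of the move. If the window reaches an end of [0,1], the centre is that end: there both
   stages pass through [t0 = p u0], so the form vanishes although [chi] does not. [4 <= m] excludes
   that both ends are reached. *)
pose u0 : R := if (j <= 1)%N then 0 else if (m <= j.+1)%N then 1 else j%:R / m%:R.
have I0 := @I01_0 R.
have I1 := @I01_1 R.
have Iu0 : I01 u0.
  rewrite /u0; case: ifP => // _; case: ifP => // _.
  by apply/andP; split; [rewrite divr_ge0|rewrite ler_pdivrMr // mul1r].
have mu0 : m%:R * (j%:R / m%:R) = j%:R :> R by rewrite mulrC divfK // gt_eqF.
have near_u0 u : I01 u -> j%:R - 2 <= m%:R * u -> m%:R * u <= j%:R + 2 -> `|u - u0| <= 4 / m%:R.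
  move=> /andP[ua ub] u1 u2; rewrite ler_pdivlMr // -[X in _ * X](gtr0_norm m0) -normrM mulrBl.
  rewrite ler_norml /u0 [u * _]mulrC; have mu1 : m%:R * u <= m%:R by rewrite ler_piMr // ltW.
  have mu2 : 0 <= m%:R * u by rewrite mulr_ge0 // ltW.
  case: ifP => j1.
    have : j%:R <= 1 :> R by rewrite (ler_nat R j 1).
    by move=> ?; apply/andP; split; lra.
  case: ifP => mj.
    have : m%:R <= j%:R + 1 :> R by rewrite -jS ler_nat.
    by move=> ?; apply/andP; split; lra.
  by rewrite [_ / _ * _]mulrC mu0; apply/andP; split; lra.
(* Equal to 1 for [j - 1 <= m u <= j + 1], where the stages may differ, and 0 outside
   [j - 2 < m u < j + 2]. *)
pose chi u : R := smoothstep (j%:R + 2 + - m%:R * u) * smoothstep (2 - j%:R + m%:R * u).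
pose chi' u : R := (- m%:R * dsmoothstep (j%:R + 2 + - m%:R * u)) * smoothstep (2 - j%:R + m%:R * u)
  + smoothstep (j%:R + 2 + - m%:R * u) * (m%:R * dsmoothstep (2 - j%:R + m%:R * u)).
have Hchi : C1map chi chi' by exact: (C1map_mul (C1map_ramp _ _) (C1map_ramp _ _)).
have chi_high u : j%:R + 2 <= m%:R * u -> chi u = 0 /\ chi' u = 0.
  move=> uj; have [|s0 d0] := @smoothstep0 R (j%:R + 2 + - m%:R * u); first by lra.
  by rewrite /chi /chi' s0 d0 mulr0 !mul0r addr0.
have chi_low u : m%:R * u <= j%:R - 2 -> chi u = 0 /\ chi' u = 0.
  move=> uj; have [|s0 d0] := @smoothstep0 R (2 - j%:R + m%:R * u); first by lra.
  by rewrite /chi /chi' s0 d0 !mulr0 addr0.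
apply: (local_reparam (t0 := p u0) hc (dev (map_I01 Hp Iu0)) Hchi (stage_C1 m j) (stage_C1 m j.+1)).
- move=> u Iu; have [uh|uh] := ltP (j%:R + 2) (m%:R * u).
    right; exists ((m%:R * u - (j%:R + 2)) / m%:R); first by rewrite divr_gt0 // subr_gt0.
    move=> v Iv; rewrite ltr_pdivlMr // => vu; apply: chi_high.
    have := ler_norm (u - v); rewrite distrC => /(ler_wpM2r (ltW m0)); lra.
  have [ul|ul] := ltP (m%:R * u) (j%:R - 2).
    right; exists ((j%:R - 2 - m%:R * u) / m%:R); first by rewrite divr_gt0 // subr_gt0.
    move=> v Iv; rewrite ltr_pdivlMr // => vu; apply: chi_low.
    have := ler_norm (v - u) => /(ler_wpM2r (ltW m0)); lra.
  left; have pu : `|p u - p u0| <= eps / 4.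
    rewrite (le_trans (pK u u0 Iu Iu0)) // (le_trans _ Km) //.
    by have := ler_wpM2l K0 (near_u0 u Iu ul uh); lra.
  have fin k : `|stage m k u - p u0| < eps.
    have := ler_distD (p u) (stage m k u) (p u0); have := stage_close m k Iu.
    by move: eps0 => e0; lra.
  by split; exact: fin.
- move=> u Iu; have [uh|uh] := ltP (j%:R + 1) (m%:R * u).
    right; have [|-> ->] := @stage_early m j u; first by lra.
    by have [|-> ->] := @stage_early m j.+1 u; first by rewrite jS ltW.
  have [ul|ul] := ltP (m%:R * u) (j%:R - 1).
    right; have [|-> ->] := @stage_late m j u; first exact: ltW.
    by have [|-> ->] := @stage_late m j.+1 u; first by rewrite jS; lra.
  left; have [|s1 d1] := @smoothstep1 R (j%:R + 2 + - m%:R * u); first by lra.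
  have [|s2 d2] := @smoothstep1 R (2 - j%:R + m%:R * u); first by lra.
  by rewrite /chi /chi' s1 s2 d1 d2 !mulr0 mul0r addr0 mulr1.
- rewrite !stage_end //; have [j1|j1] := leqP j 1; [right|left].
    by rewrite /u0 j1.
  have : 2 <= j%:R :> R by rewrite (ler_nat R 2 j).
  move=> j2; have l0 : m%:R * 0 <= j%:R - 2 :> R by rewrite mulr0; lra.
  by have [-> _] := chi_low 0 l0.
- rewrite !stage_end //; have [mj|mj] := leqP m j.+1; [right|left].
    have j1 : (j <= 1)%N = false by apply/negP => j1; have := leq_trans m4 mj; rewrite ltnS => /leq_trans /(_ j1).
    by rewrite /u0 j1 mj.
  have : j%:R + 2 <= m%:R :> R by rewrite -(natrD R j 2) ler_nat addn2.
  rewrite -[m%:R]mulr1 => j2; by have [-> _] := chi_high 1 j2.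
Qed.

Lemma close_reparam : H_orbit alpha (pull p p' c) (pull q q' c).
Proof.
have [K K0 pK] := C1map_lipschitz Hp.
(* The grid is so fine that [p] stays within [eps / 4] of its value at the centre of a window; with
   [eps / 2] for the distance of the stages from [p] the total stays below [eps]. *)
have [m m4 mK] : exists2 m : nat, (4 <= m)%N & 4 * K / m%:R <= eps / 4.
  have [k kP] : exists k : nat, 16 * K / eps < k%:R.
    by exists (Num.bound (16 * K / eps)); apply: archi_boundP; rewrite divr_ge0 ?mulr_ge0 // ltW.
  exists (k + 4)%N; first exact: leq_addl.
  have k4 : 0 < (k + 4)%:R :> R by rewrite ltr0n addn4.
  rewrite ler_pdivrMr //; move: kP; rewrite ltr_pdivrMr // => kP.
  rewrite natrD mulrDr; have := ltW eps0; lra.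
have H j : (j <= m.+1)%N -> H_orbit alpha (pull (stage m 0) (dstage m 0) c) (pull (stage m j) (dstage m j) c).
  elim: j => [|j IH] jm; first exact: orbit_refl.
  by apply: orbit_trans (IH (ltnW jm)) _; apply: (stage_step m4 _ K0 pK mK).
have := H m.+1 (leqnn _).
have -> : pull (stage m 0) (dstage m 0) c = pull p p' c.
  apply: pull_ext => u /andP[u0 _]; apply: stage_early.
  by rewrite mulr_ge0.
have -> // : pull (stage m m.+1) (dstage m m.+1) c = pull q q' c.
apply: pull_ext => u /andP[_ u1]; apply: stage_late.
by rewrite -natr1 addrK ler_piMr.
Qed.

End Close.

(** The straight homotopy from [p] to [q] is cut into [N] steps of size at most [eps / 2], where
    [eps] depends on the path only. *)
Lemma reparametrization p p' q q' : C1map p p' -> C1map q q' -> p 0 = q 0 -> p 1 = q 1 ->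
  H_orbit alpha (pull p p' c) (pull q q' c).
Proof.
move=> Hp Hq pq0 pq1; have [eps eps0 dev] := uniformly_developable hc.
have [N N0 NP] : exists2 N : nat, (0 < N)%N & 1 <= N%:R * (eps / 2).
  have [k kP] : exists k : nat, 2 / eps < k%:R.
    by exists (Num.bound (2 / eps)); apply: archi_boundP; rewrite divr_ge0 // ltW.
  exists k; first by rewrite -(ltr_nat R); apply: le_lt_trans kP; rewrite divr_ge0 // ltW.
  by move: kP; rewrite ltr_pdivrMr //; lra.
have N0r : 0 < N%:R :> R by rewrite ltr0n.
pose st j := mix (fun=> (j%:R / N%:R : R)) p q.
pose dst j := dmix (fun=> (j%:R / N%:R : R)) (fun=> 0) p p' q q'.
have IN j : (j <= N)%N -> I01 (j%:R / N%:R : R).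
  move=> jN; apply/andP; split; first by rewrite divr_ge0.
  by rewrite ler_pdivrMr // mul1r ler_nat.
have stC j : (j <= N)%N -> C1map (st j) (dst j).
  by move=> jN; exact: C1map_mix (C1map_cst (IN j jN)) Hp Hq.
have ends j u : p u = q u -> st j u = p u by move=> E; rewrite /st /mix E subrr mulr0 addr0.
have H j : (j <= N)%N -> H_orbit alpha (pull (st 0%N) (dst 0%N) c) (pull (st j) (dst j) c).
  elim: j => [|j IH] jN; first exact: orbit_refl.
  apply: orbit_trans (IH (ltnW jN)) _.
  apply: (close_reparam eps0 dev (stC j (ltnW jN)) (stC j.+1 jN)); rewrite ?ends //.
  move=> u Iu; have -> : st j.+1 u - st j u = (q u - p u) / N%:R.
    by rewrite /st /mix -natr1 mulrDl; ring.
  rewrite normrM normfV (gtr0_norm N0r) ler_pdivrMr // mulrC (le_trans _ NP) //.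
  have /andP[? ?] := map_I01 Hp Iu; have /andP[? ?] := map_I01 Hq Iu.
  by rewrite ler_norml; apply/andP; split; lra.
have := H N (leqnn N).
have -> : pull (st 0%N) (dst 0%N) c = pull p p' c.
  by apply: pull_ext => u _; rewrite /st /dst /mix /dmix !mul0r !addr0.
have -> // : pull (st N) (dst N) c = pull q q' c.
apply: pull_ext => u _; rewrite /st /dst /mix /dmix divff ?gt_eqF //.
by rewrite mul0r !mul1r add0r !subrKC.
Qed.

End Reparametrization.

(** * The groupoid *)

Section Groupoid.
Context {R : realType} {n : nat} {M : manifold R n} (alpha : poisson M).
Implicit Types (a : chart M) (c d : config M) (g h k : phase_space alpha) (x y : M).
Local Notation orbit := (H_orbit alpha).

Let I0 : @I01 R 0 := @I01_0 R.
Let I1 : @I01 R 1 := @I01_1 R.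
Let S0 : @smoothstep R 0 = 0. Proof. by have [] := smoothstep0 (lexx (0 : R)). Qed.
Let S1 : @smoothstep R 1 = 1. Proof. by have [] := smoothstep1 (lexx (1 : R)). Qed.
Let dS0 : @dsmoothstep R 0 = 0. Proof. by have [] := smoothstep0 (lexx (0 : R)). Qed.
Let dS1 : @dsmoothstep R 1 = 0. Proof. by have [] := smoothstep1 (lexx (1 : R)). Qed.

Lemma reparam_id p p' c : constraint alpha c -> C1map p p' -> p 0 = 0 -> p 1 = 1 -> orbit c (pull p p' c).
Proof.
move=> hc Hp p0 p1.
have {1}-> : c = pull id (fun=> 1) c.
  apply: (constraint_ext hc (pull_constraint C1map_id hc)) => u Iu.
  by rewrite pull_Xp //; split=> //; apply/funext => a; rewrite pull_eta // scale1r.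
exact: (reparametrization hc C1map_id Hp).
Qed.

Lemma slow_orbit c : constraint alpha c -> orbit c (slow c).
Proof. by move=> hc; apply: (reparam_id hc C1map_smoothstep). Qed.

Lemma catmap_ends (f q : R -> R) : catmap f q 0 = f 0 /\ catmap f q 1 = q 1.
Proof.
rewrite /catmap invr_ge0 ler0n mulr0; split=> //.
have -> : ((1 : R) <= 2^-1) = false by apply/negP => ?; lra.
by congr q; lra.
Qed.

Lemma concat_ends c1 c2 : Xp (concat c1 c2) 0 = Xp c1 0 /\ Xp (concat c1 c2) 1 = Xp c2 1.
Proof.
rewrite /= invr_ge0 ler0n mulr0; split=> //.
have -> : ((1 : R) <= 2^-1) = false by apply/negP => ?; lra.
by congr (Xp c2); lra.
Qed.

Lemma concat_vanishes c1 c2 : vanishes_at_ends c1 -> vanishes_at_ends c2 -> vanishes_at_ends (concat c1 c2).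
Proof.
move=> v1 v2 a; rewrite /= invr_ge0 ler0n mulr0 (v1 a).1 scaler0; split=> //.
have -> : ((1 : R) <= 2^-1) = false by apply/negP => ?; lra.
have -> : 2 * 1 - 1 = 1 :> R by lra.
by rewrite (v2 a).2 scaler0.
Qed.

(** Turns the unit and inverse laws into statements about maps of [0,1]. *)
Lemma concat_pull c p p' q q' : constraint alpha c -> C1map p p' -> C1map q q' ->
  p 1 = q 0 -> p' 1 = 0 -> q' 0 = 0 ->
  concat (pull p p' c) (pull q q' c) = pull (catmap p q) (fun u => 2 * catmap p' q' u) c /\
  C1map (catmap p q) (fun u => 2 * catmap p' q' u).
Proof.
move=> hc Hp Hq pq p1 q0.
have Hpq : C1map (catmap p q) (fun u => 2 * catmap p' q' u).
  by apply: C1map_cat => //; rewrite p1 q0.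
split=> //; have m : matched alpha (pull p p' c) (pull q q' c).
  split; [exact: pull_constraint|exact: pull_constraint|by rewrite !pull_Xp // pq|].
  by move=> a; rewrite !pull_eta // p1 q0 !scale0r.
apply: (constraint_ext (concat_constraint m) (pull_constraint Hpq hc)) => u Iu.
have [uh|uh] := leP u 2^-1.
  have Lu : lower_half u by case/andP: Iu => ? ?; apply/andP; split.
  have [-> ->] := concat_lower (pull p p' c) (pull q q' c) Lu; have I2 := lower_I01 Lu.
  have cE (f f' : R -> R) : catmap f f' u = f (2 * u) by rewrite /catmap uh.
  rewrite !pull_Xp // cE; split=> //; apply/funext => a.
  by rewrite !pull_eta // !cE scalerA.
have Uu : upper_half u by case/andP: Iu => ? ?; apply/andP; split=> //; exact: ltW.
have [-> ->] := concat_upper m Uu; have I2 := upper_I01 Uu.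
have cE (f f' : R -> R) : catmap f f' u = f' (2 * u - 1) by rewrite /catmap leNgt uh.
rewrite !pull_Xp // cE; split=> //; apply/funext => a.
by rewrite !pull_eta // !cE scalerA.
Qed.

Let half0 : @I01 R 2^-1. Proof. by apply/andP; split; lra. Qed.

(** Slowing both factors amounts to pulling back the whole concatenation by a map that halts at 0,
    1/2 and 1. *)
Lemma concat_slow c1 c2 : matched alpha c1 c2 -> orbit (concat c1 c2) (concat (slow c1) (slow c2)).
Proof.
move=> m; have [h1 h2 X12 _] := m; have hcc := concat_constraint m.
have Hp : C1map (step_map 0 2^-1) (fun u : R => 2^-1 * dsmoothstep u).
  by apply: C1map_step; rewrite ?add0r.
have Hq : C1map (step_map 2^-1 2^-1) (fun u : R => 2^-1 * dsmoothstep u).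
  by apply: C1map_step => //; apply/andP; split; lra.
have Hpq : C1map (catmap (step_map 0 2^-1) (step_map 2^-1 2^-1))
    (fun u : R => 2 * catmap (fun u => 2^-1 * dsmoothstep u) (fun u => 2^-1 * dsmoothstep u) u).
  by apply: C1map_cat => //; rewrite /step_map ?S1 ?S0 ?dS0 ?dS1 //; lra.
have := reparam_id hcc Hpq; rewrite !(catmap_ends _ _).1 !(catmap_ends _ _).2 /step_map S0 S1.
have e0 : 0 + 2^-1 * 0 = 0 :> R by lra.
have e1 : 2^-1 + 2^-1 * 1 = 1 :> R by lra.
move=> /(_ e0 e1).
set L := pull _ _ _; suff -> : L = concat (slow c1) (slow c2) by [].
have ms := slow_matched h1 h2 X12.
apply: (constraint_ext (pull_constraint Hpq hcc) (concat_constraint ms)) => u Iu.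
have half (e : 'rV[R]_n) (k : R) : (2 * (2^-1 * k)) *: (2 *: e) = 2 *: (k *: e).
  by rewrite !scalerA; congr (_ *: _); by field.
have [uh|uh] := leP u 2^-1.
  have Lu : lower_half u by case/andP: Iu => ? ?; apply/andP; split.
  have cE (f f' : R -> R) : catmap f f' u = f (2 * u) by rewrite /catmap uh.
  have [-> ->] := concat_lower (slow c1) (slow c2) Lu; have I2 := lower_I01 Lu.
  have /andP[s0 s1] := smoothstep_I01 (2 * u).
  have Lv : lower_half (0 + 2^-1 * smoothstep (2 * u)) by apply/andP; split; lra.
  have [EX EE] := concat_lower c1 c2 Lv.
  have vE : 2 * (0 + 2^-1 * smoothstep (2 * u)) = smoothstep (2 * u) by field.
  rewrite /L pull_Xp // cE EX vE /slow pull_Xp //; split=> //; apply/funext => a.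
  by rewrite !pull_eta // !cE EE vE half.
have Uu : upper_half u by case/andP: Iu => ? ?; apply/andP; split=> //; exact: ltW.
have cE (f f' : R -> R) : catmap f f' u = f' (2 * u - 1) by rewrite /catmap leNgt uh.
have [-> ->] := concat_upper ms Uu; have I2 := upper_I01 Uu.
have /andP[s0 s1] := smoothstep_I01 (2 * u - 1).
have Uv : upper_half (2^-1 + 2^-1 * smoothstep (2 * u - 1)) by apply/andP; split; lra.
have [EX EE] := concat_upper m Uv.
have vE : 2 * (2^-1 + 2^-1 * smoothstep (2 * u - 1)) - 1 = smoothstep (2 * u - 1) by field.
rewrite /L pull_Xp // cE EX vE /slow pull_Xp //; split=> //; apply/funext => a.
by rewrite !pull_eta // !cE EE vE half.
Qed.

(** The map takes [0,1/4], [1/4,1/2], [1/2,1] to [0,1/2], [1/2,3/4], [3/4,1], which matches the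
    break points of the two bracketings. Each piece runs through [smoothstep] to be C^1 at the
    joints, hence the slowed factors on the right. *)
Lemma concat_assoc c1 c2 c3 : constraint alpha c1 -> constraint alpha c2 -> constraint alpha c3 ->
  Xp c1 1 = Xp c2 0 -> Xp c2 1 = Xp c3 0 ->
  vanishes_at_ends c1 -> vanishes_at_ends c2 -> vanishes_at_ends c3 ->
  orbit (concat c1 (concat c2 c3)) (concat (concat (slow c1) (slow c2)) (slow c3)).
Proof.
move=> h1 h2 h3 X12 X23 v1 v2 v3.
have m23 : matched alpha c2 c3 by split=> // a; rewrite (v2 a).2 (v3 a).1.
have h23 := concat_constraint m23.
have m1 : matched alpha c1 (concat c2 c3).
  split=> //; first by rewrite (concat_ends c2 c3).1.
  by move=> a; rewrite (v1 a).2 (concat_vanishes v2 v3 a).1.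
have hF := concat_constraint m1.
have ms12 := slow_matched h1 h2 X12; have hs12 := concat_constraint ms12.
have [s20 s21 vs2] := slow_ends c2; have [s30 s31 vs3] := slow_ends c3.
have [s10 s11 vs1] := slow_ends c1.
have mL : matched alpha (concat (slow c1) (slow c2)) (slow c3).
  split=> //; first exact: slow_constraint.
    by rewrite (concat_ends _ _).2 s21 s30.
  by move=> a; rewrite (concat_vanishes vs1 vs2 a).2 (vs3 a).1.
have Hp : C1map (step_map 0 2^-1) (fun u : R => 2^-1 * dsmoothstep u).
  by apply: C1map_step; rewrite ?add0r.
have Hq : C1map (step_map 2^-1 4^-1) (fun u : R => 4^-1 * dsmoothstep u).
  by apply: C1map_step => //; apply/andP; split; lra.
have Hr : C1map (step_map (3 / 4) 4^-1) (fun u : R => 4^-1 * dsmoothstep u).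
  by apply: C1map_step; apply/andP; split; lra.
have Hpq : C1map (catmap (step_map 0 2^-1) (step_map 2^-1 4^-1))
    (fun u : R => 2 * catmap (fun u => 2^-1 * dsmoothstep u) (fun u => 4^-1 * dsmoothstep u) u).
  by apply: C1map_cat => //; rewrite /step_map ?S1 ?S0 ?dS0 ?dS1 //; lra.
have Hall := C1map_cat Hpq Hr.
rewrite !(catmap_ends _ _).2 /step_map S0 S1 dS0 dS1 in Hall.
have e0' : 2^-1 + 4^-1 * 1 = 3 / 4 + 4^-1 * 0 :> R by lra.
have e1' : 2 * (4^-1 * 0) = 4^-1 * 0 :> R by lra.
have {e0' e1'}Hall := Hall e0' e1'.
have := reparam_id hF Hall; rewrite !(catmap_ends _ _).1 !(catmap_ends _ _).2 S0 S1.
have e0 : 0 + 2^-1 * 0 = 0 :> R by lra.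
have e1 : 3 / 4 + 4^-1 * 1 = 1 :> R by lra.
move=> /(_ e0 e1).
set L := pull _ _ _; suff -> : L = concat (concat (slow c1) (slow c2)) (slow c3) by [].
apply: (constraint_ext (pull_constraint Hall hF) (concat_constraint mL)) => u Iu.
have [uh|uh] := leP u 2^-1; last first.
  have Uu : upper_half u by case/andP: Iu => ? ?; apply/andP; split=> //; exact: ltW.
  have cE (f f' : R -> R) : catmap f f' u = f' (2 * u - 1) by rewrite /catmap leNgt uh.
  have [-> ->] := concat_upper mL Uu; have I2 := upper_I01 Uu.
  have /andP[t0 t1] := smoothstep_I01 (2 * u - 1).
  have Uv : upper_half (3 / 4 + 4^-1 * smoothstep (2 * u - 1)) by apply/andP; split; lra.
  have [EX EE] := concat_upper m1 Uv.
  have Uv' : upper_half (2 * (3 / 4 + 4^-1 * smoothstep (2 * u - 1)) - 1) by apply/andP; split; lra.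
  have [EX' EE'] := concat_upper m23 Uv'.
  have vE : 2 * (2 * (3 / 4 + 4^-1 * smoothstep (2 * u - 1)) - 1) - 1 = smoothstep (2 * u - 1) by field.
  rewrite /L pull_Xp // cE EX EX' vE /slow pull_Xp //; split=> //; apply/funext => a.
  rewrite !pull_eta // !cE EE EE' vE !scalerA; congr (_ *: _); by field.
have Lu : lower_half u by case/andP: Iu => ? ?; apply/andP; split.
have cE (f f' : R -> R) : catmap f f' u = f (2 * u) by rewrite /catmap uh.
have [-> ->] := concat_lower (concat (slow c1) (slow c2)) (slow c3) Lu; have I2 := lower_I01 Lu.
have [uq|uq] := leP (2 * u) 2^-1; last first.
  have Uu : upper_half (2 * u) by case/andP: I2 => ? ?; apply/andP; split=> //; exact: ltW.
  have cE' (f f' : R -> R) : catmap f f' (2 * u) = f' (2 * (2 * u) - 1) by rewrite /catmap leNgt uq.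
  have [-> ->] := concat_upper ms12 Uu; have I3 := upper_I01 Uu.
  have /andP[t0 t1] := smoothstep_I01 (2 * (2 * u) - 1).
  have Uv : upper_half (2^-1 + 4^-1 * smoothstep (2 * (2 * u) - 1)) by apply/andP; split; lra.
  have [EX EE] := concat_upper m1 Uv.
  have Lv' : lower_half (2 * (2^-1 + 4^-1 * smoothstep (2 * (2 * u) - 1)) - 1) by apply/andP; split; lra.
  have [EX' EE'] := concat_lower c2 c3 Lv'.
  have vE : 2 * (2 * (2^-1 + 4^-1 * smoothstep (2 * (2 * u) - 1)) - 1) = smoothstep (2 * (2 * u) - 1) by field.
  rewrite /L pull_Xp // cE cE' EX EX' vE /slow pull_Xp //; split=> //; apply/funext => a.
  rewrite !pull_eta // !cE !cE' EE EE' vE !scalerA; congr (_ *: _); by field.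
have Lu' : lower_half (2 * u) by case/andP: I2 => ? ?; apply/andP; split.
have cE' (f f' : R -> R) : catmap f f' (2 * u) = f (2 * (2 * u)) by rewrite /catmap uq.
have [-> ->] := concat_lower (slow c1) (slow c2) Lu'; have I3 := lower_I01 Lu'.
have /andP[t0 t1] := smoothstep_I01 (2 * (2 * u)).
have Lv : lower_half (0 + 2^-1 * smoothstep (2 * (2 * u))) by apply/andP; split; lra.
have [EX EE] := concat_lower c1 (concat c2 c3) Lv.
have vE : 2 * (0 + 2^-1 * smoothstep (2 * (2 * u))) = smoothstep (2 * (2 * u)) by field.
rewrite /L pull_Xp // cE cE' EX vE /slow pull_Xp //; split=> //; apply/funext => a.
rewrite !pull_eta // !cE !cE' EE vE !scalerA; congr (_ *: _); by field.
Qed.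

(** Brings units within the scope of [reparametrization]. *)
Lemma const_pull c (k : R) : const_config (Xp c k) = pull (fun=> k) (fun=> 0) c.
Proof. by apply: config_ext => u //=; apply/funext => a; rewrite scale0r. Qed.

Lemma concat_const_l c : constraint alpha c -> orbit c (concat (const_config (Xp c 0)) (slow c)).
Proof.
move=> hc; rewrite const_pull; have [|||-> Hpq] := concat_pull hc (C1map_cst I0) C1map_smoothstep => //.
by apply: (reparam_id hc Hpq); rewrite ?(catmap_ends _ _).1 ?(catmap_ends _ _).2.
Qed.

Lemma concat_const_r c : constraint alpha c -> orbit c (concat (slow c) (const_config (Xp c 1))).
Proof.
move=> hc; rewrite const_pull; have [|||-> Hpq] := concat_pull hc C1map_smoothstep (C1map_cst I1) => //.
by apply: (reparam_id hc Hpq); rewrite ?(catmap_ends _ _).1 ?(catmap_ends _ _).2.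
Qed.

Let C1map_rev : C1map (fun u : R => 1 - u) (fun=> -1).
Proof.
split=> u Iu.
- by case/andP: Iu => ? ?; apply/andP; split; lra.
- by have := deriv_inB (@deriv_in_cst R _ I01 (1 : R) u) (@deriv_in_id R I01 u); rewrite sub0r.
- by move=> e e0; exists 1 => // v _ _; rewrite subrr normr0 ltW.
Qed.

Lemma reverse_pull c : constraint alpha c -> reverse c = pull (fun u => 1 - u) (fun=> -1) c.
Proof.
move=> [cl _ _ _]; apply: config_ext => u /=; rewrite -clamp_rev; first by rewrite -(cl _).1.
by apply/funext => a; rewrite scaleN1r -(cl _).2.
Qed.

Lemma reverse_constraint c : constraint alpha c -> constraint alpha (reverse c).
Proof. by move=> hc; rewrite reverse_pull //; exact: pull_constraint C1map_rev hc. Qed.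

Lemma orbit_reverse c d : constraint alpha c -> orbit c d -> orbit (reverse c) (reverse d).
Proof.
move=> hc cd; rewrite !reverse_pull //; last exact: orbit_constraint cd hc.
by apply: (orbit_pull C1map_rev) => //; [right|left]; rewrite ?subr0 ?subrr.
Qed.

Lemma concat_reverse c : constraint alpha c -> orbit (const_config (Xp c 0)) (concat (slow c) (reverse (slow c))).
Proof.
move=> hc; have Hr : C1map (step_map 1 (-1)) (fun u : R => -1 * dsmoothstep u).
  by apply: C1map_step; rewrite ?subrr.
have -> : reverse (slow c) = pull (step_map 1 (-1)) (fun u : R => -1 * dsmoothstep u) c.
  apply: (constraint_ext (reverse_constraint (slow_constraint hc)) (pull_constraint Hr hc)) => u Iu.
  have Iu' := map_I01 C1map_rev Iu; have [sE dE] := smoothstep_rev u.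
  have vE : step_map 1 (-1) u = 1 - smoothstep u by rewrite /step_map mulN1r.
  rewrite /reverse /= !clamp_id // sE dE vE; split=> //; apply/funext => a.
  by rewrite mulN1r scaleNr.
have [|||-> Hpq] := concat_pull hc C1map_smoothstep Hr => //; rewrite /step_map ?S0 ?S1 ?dS0 ?mulr0 ?addr0 //.
rewrite const_pull; apply: (reparametrization hc (C1map_cst I0) Hpq); rewrite ?(catmap_ends _ _).1 ?(catmap_ends _ _).2 /step_map ?S0 ?S1 //.
by rewrite mulr1 subrr.
Qed.

(** Orbits are equivalence classes, so a common member suffices; the proof stored in a class is
    irrelevant. *)
Lemma class_eq g k c : members g c -> members k c -> g = k.
Proof.
move=> gc kc; have E : members g = members k.
  have [c0 _ E0] := membersP g; have [c1 _ E1] := membersP k.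
  rewrite E0 E1; rewrite E0 in gc; rewrite E1 in kc.
  apply/seteqP; split=> d od.
    by apply: (orbit_trans kc); apply: (orbit_trans (orbit_sym gc)).
  by apply: (orbit_trans gc); apply: (orbit_trans (orbit_sym kc)).
case: g k E {gc kc} => mg pg [mk pk] /= E; case: _ / E pk => pk.
by congr PhaseSpace; exact: Prop_irrelevance.
Qed.

Lemma members_representative g : members g (representative g).
Proof.
rewrite /representative; have := s2valP' (cid2 (membersP g)) => /= {1}->.
exact: orbit_refl.
Qed.

Lemma members_orbit g c d : members g c -> orbit c d -> members g d.
Proof.
by have [c0 _ ->] := membersP g; exact: orbit_trans.
Qed.

Lemma members_related g c d : members g c -> members g d -> orbit c d.
Proof.
have [c0 _ ->] := membersP g => /orbit_sym; exact: orbit_trans.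
Qed.

Lemma members_constraint g c : members g c -> constraint alpha c.
Proof.
by have [c0 h0 ->] := membersP g => /orbit_constraint; apply.
Qed.

Lemma members_ends g c : members g c -> Xp c 0 = lmap g /\ Xp c 1 = rmap g.
Proof.
move=> gc; have := members_related gc (members_representative g).
exact: orbit_ends.
Qed.

Lemma members_class c (hc : constraint alpha c) : members (class_of hc) c.
Proof. exact: orbit_refl. Qed.

Lemma members_slow g c : members g c -> members g (slow c).
Proof. by move=> gc; apply: (members_orbit gc); apply: slow_orbit; exact: members_constraint gc. Qed.

(** Independence of representatives: both concatenations are moved to slowed ones, which respect
    orbits by [orbit_concat]. *)
Lemma composite_unique g h k k' : is_composite g h k -> is_composite g h k' -> k = k'.
Proof.
move=> [c1 [c2 [gc1 hc2 [v1 v2] X12 kc]]] [d1 [d2 [gd1 hd2 [w1 w2] Y12 kd]]].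
have mt c c' : constraint alpha c -> constraint alpha c' -> Xp c 1 = Xp c' 0 ->
    vanishes_at_ends c -> vanishes_at_ends c' -> matched alpha c c'.
  by move=> ? ? ? vc vc'; split=> // a; rewrite (vc a).2 (vc' a).1.
have C1 := members_constraint gc1; have C2 := members_constraint hc2.
have D1 := members_constraint gd1; have D2 := members_constraint hd2.
apply: (class_eq (members_orbit kc _) kd).
apply: (orbit_trans (concat_slow (mt _ _ C1 C2 X12 v1 v2))).
apply: orbit_trans (orbit_sym (concat_slow (mt _ _ D1 D2 Y12 w1 w2))).
exact: (orbit_concat C1 C2 X12 (members_related gc1 gd1) (members_related hc2 hd2)).
Qed.

Lemma gcompE g h k : is_composite g h k -> gcomp g h = k.
Proof.
by move=> H; apply: (composite_unique _ H); apply: epsilon_spec; exists k.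
Qed.

Lemma gcomp_members g h c1 c2 : members g c1 -> members h c2 -> vanishes_at_ends c1 -> vanishes_at_ends c2 ->
  Xp c1 1 = Xp c2 0 -> members (gcomp g h) (concat c1 c2).
Proof.
move=> gc hc v1 v2 X12; have C1 := members_constraint gc; have C2 := members_constraint hc.
have m : matched alpha c1 c2 by split=> // a; rewrite (v1 a).2 (v2 a).1.
rewrite (@gcompE g h (class_of (concat_constraint m))); first exact: members_class.
by exists c1, c2; split=> //; exact: members_class.
Qed.

Lemma ginv_members g c : members g c -> members (ginv g) (reverse c).
Proof.
move=> gc; have hc := members_constraint gc.
have [d gd kd] : is_inverse g (ginv g).
  apply: epsilon_spec; exists (class_of (reverse_constraint hc)).
  by exists c => //; exact: members_class.
by apply: (members_orbit kd); apply: (orbit_reverse (members_constraint gd)); exact: members_related gc.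
Qed.

Lemma jmap_ends x : lmap (jmap alpha x) = x /\ rmap (jmap alpha x) = x.
Proof.
by have [<- <-] := members_ends (members_class (constraint_cst alpha x)).
Qed.

Lemma gcomp_ends g h : rmap g = lmap h -> lmap (gcomp g h) = lmap g /\ rmap (gcomp g h) = rmap h.
Proof.
move=> gh; pose c1 := representative g; pose c2 := representative h.
have g1 : members g c1 := members_representative g; have h2 : members h c2 := members_representative h.
have [l1 r1 v1] := slow_ends c1; have [l2 r2 v2] := slow_ends c2.
have X12 : Xp (slow c1) 1 = Xp (slow c2) 0 by rewrite r1 l2.
have [<- <-] := members_ends (gcomp_members (members_slow g1) (members_slow h2) v1 v2 X12).
have [-> ->] := concat_ends (slow c1) (slow c2).
by rewrite l1 r2.
Qed.

Lemma gcomp_jmap_l g : gcomp (jmap alpha (lmap g)) g = g.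
Proof.
pose c := representative g; have gc : members g c := members_representative g.
have [l1 r1 v1] := slow_ends c.
apply: (class_eq (c := concat (const_config (lmap g)) (slow c))).
  apply: gcomp_members => //; first exact: members_class.
  exact: members_slow.
by apply: (members_orbit gc); exact: (concat_const_l (members_constraint gc)).
Qed.

Lemma gcomp_jmap_r g : gcomp g (jmap alpha (rmap g)) = g.
Proof.
pose c := representative g; have gc : members g c := members_representative g.
have [l1 r1 v1] := slow_ends c.
apply: (class_eq (c := concat (slow c) (const_config (rmap g)))).
  apply: gcomp_members => //; first exact: members_slow.
  exact: members_class.
by apply: (members_orbit gc); exact: (concat_const_r (members_constraint gc)).
Qed.

Lemma ginv_ends g : lmap (ginv g) = rmap g /\ rmap (ginv g) = lmap g.
Proof.
have [<- <-] := members_ends (ginv_members (members_representative g)).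
by rewrite /= subr0 subrr.
Qed.

Lemma gcomp_ginv g : gcomp g (ginv g) = jmap alpha (lmap g).
Proof.
pose c := representative g; have gc : members g c := members_representative g.
have [l1 r1 v1] := slow_ends c; have gs := members_slow gc.
apply: (class_eq (c := concat (slow c) (reverse (slow c)))).
  apply: gcomp_members => //; first exact: ginv_members.
    move=> a; have -> : eta (reverse (slow c)) 0 a = - eta (slow c) 1 a by rewrite /= subr0.
    have -> : eta (reverse (slow c)) 1 a = - eta (slow c) 0 a by rewrite /= subrr.
    by rewrite (v1 a).1 (v1 a).2 oppr0.
  by rewrite /= subr0.
apply: (members_orbit (members_class (constraint_cst alpha (lmap g)))).
exact: (concat_reverse (members_constraint gc)).
Qed.

Lemma gcomp_assoc g h k : rmap g = lmap h -> rmap h = lmap k ->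
  gcomp (gcomp g h) k = gcomp g (gcomp h k).
Proof.
move=> gh hk; pose c1 := slow (representative g); pose c2 := slow (representative h).
pose c3 := slow (representative k).
have [l1 r1 v1] := slow_ends (representative g); have [l2 r2 v2] := slow_ends (representative h).
have [l3 r3 v3] := slow_ends (representative k).
have m1 : members g c1 := members_slow (members_representative g).
have m2 : members h c2 := members_slow (members_representative h).
have m3 : members k c3 := members_slow (members_representative k).
have X12 : Xp c1 1 = Xp c2 0 by rewrite r1 l2.
have X23 : Xp c2 1 = Xp c3 0 by rewrite r2 l3.
(* [concat_assoc] wants vanishing ends on one side and slows the factors on the other, so the slowed
   representatives are slowed once more. *)
have [l1' r1' v1'] := slow_ends c1; have [l2' r2' v2'] := slow_ends c2; have [l3' r3' v3'] := slow_ends c3.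
have H1 := members_constraint m1; have H2 := members_constraint m2; have H3 := members_constraint m3.
apply: (class_eq (c := concat (concat (slow c1) (slow c2)) (slow c3))).
  apply: gcomp_members; [|exact: members_slow|exact: concat_vanishes|exact: v3'|].
    by apply: gcomp_members; [exact: members_slow|exact: members_slow|exact: v1'|exact: v2'|rewrite r1' l2'].
  by rewrite (concat_ends _ _).2 r2' l3'.
apply: members_orbit (concat_assoc H1 H2 H3 X12 X23 v1 v2 v3).
apply: gcomp_members => //; [exact: gcomp_members|exact: concat_vanishes|].
by rewrite (concat_ends _ _).1.
Qed.

End Groupoid.

Theorem theorem4p3 (R : realType) (n : nat) (M : manifold R n)
    (alpha : poisson M) :
  [/\ (@lmap R n M alpha \o @jmap R n M alpha = id /\
       @rmap R n M alpha \o @jmap R n M alpha = id),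
      (forall (x y z : M) (g h : phase_space alpha),
         arrows x y g -> arrows y z h -> arrows x z (gcomp g h)),
      (forall (x y : M) (g : phase_space alpha), arrows x y g ->
         gcomp (jmap alpha x) g = g /\ gcomp g (jmap alpha y) = g),
      (forall (x y : M) (g : phase_space alpha), arrows x y g ->
         arrows y x (ginv g) /\ gcomp g (ginv g) = jmap alpha x) &
      (forall g h k : phase_space alpha, rmap g = lmap h -> rmap h = lmap k ->
         gcomp (gcomp g h) k = gcomp g (gcomp h k))].
Proof.
split.
- by split; apply/funext => x /=; have [] := jmap_ends alpha x.
- move=> x y z g h [/= <- gy] [/= hy <-].
  by apply: gcomp_ends; rewrite gy hy.
- by move=> x y g [/= <- <-]; split; [exact: gcomp_jmap_l|exact: gcomp_jmap_r].
- move=> x y g [/= <- <-]; split; last exact: gcomp_ginv.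
  exact: ginv_ends.
- exact: gcomp_assoc.
Qed.
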